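(* Let $q\ge 0$, $\gamma\ge 0$, and $h(x)=e^{-\gamma x}x^{-q}$ with $E[h(\tilde\mu(\mathbb X))]<\infty$, where $\tilde\mu$ is a completely random measure with intensity $\nu(dx,ds)=\eta(dx)\rho_x(ds)$. Let $\tilde\mu_t$ be the tilted completely random measure with parameters $\nu$ and $h$, and $\tilde G_t=\tilde\mu_t/\tilde\mu_t(\mathbb X)$. Let $n\ge1$ and let $\mathbf X_n=\{X_1,\dots,X_n\}=\{Y_1,\dots,Y_{\aleph(\mathbf p_n)},\mathbf p_n\}$ be, conditionally on $\tilde G_t$, i.i.d. with distribution $\tilde G_t$, with cluster sizes $n_1,\dots,n_{\aleph(\mathbf p_n)}$, and let $U_n$ be the augmenting variable defined in the context. Then the conditional distribution of $\tilde G_t$ given $U_n$ and $\mathbf X_n$ is the distribution of a normalized completely random measure $\tilde G_t^{(U_n,\mathbf X_n)}$ such that $$\tilde G_t^{(U_n,\mathbf X_n)}\overset{d}{=}\tilde\mu^{(U_n,\mathbf X_n)}/\tilde\mu^{(U_n,\mathbf X_n)}(\mathbb X),$$ where: 1. $\tilde\mu^{(U_n,\mathbf X_n)}$ is a completely random measure with the same law as $$\tilde\mu^{(U_n)}+\sum_{k=1}^{\aleph(\mathbf p_n)}J_k^{(U_n,\mathbf X_n)}\delta_{Y_k},$$ where $\tilde\mu^{(U_n)}$ is a completely random measure with intensity $\eta(dx)\,e^{-s(\gamma+U_n)}\rho_x(ds)$, $Y_1,\dots,Y_{\aleph(\mathbf p_n)}$ are fixed points of discontinuity, and $J_1^{(U_n,\mathbf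 X_n)},\dots,J_{\aleph(\mathbf p_n)}^{(U_n,\mathbf X_n)}$ are the corresponding jumps. 2. Conditional on $U_n$ and $\mathbf X_n$, each jump has the distribution $$\mathbb P(J_k^{(U_n,\mathbf X_n)}\in ds)=\frac{s^{n_k}e^{-s(\gamma+U_n)}\rho_{Y_k}(ds)}{\int_{(0,\infty)}s^{n_k}e^{-s(\gamma+U_n)}\rho_{Y_k}(ds)},\qquad k=1,\dots,\aleph(\mathbf p_n).$$ 3. Conditional on $U_n$ and $\mathbf X_n$, $\tilde\mu^{(U_n)},J_1^{(U_n,\mathbf X_n)},\dots,J_{\aleph(\mathbf p_n)}^{(U_n,\mathbf X_n)}$ are independent. 4. Conditional on $\mathbf X_n$, $U_n$ has the density $$f_{U_n|\mathbf X_n}(u)=\frac{e^{-\psi_0(\gamma+u)}\prod_{k=1}^{\aleph(\mathbf p_n)}\tau_{n_k,Y_k}(\gamma+u)\,u^{n+q-1}}{\int_0^\infty e^{-\psi_0(\gamma+u)}\prod_{k'=1}^{\aleph(\mathbf p_n)}\tau_{n_{k'},Y_{k'}}(\gamma+u)\,u^{n+q-1}\,du},\qquad u>0,$$ where $\tau_{m,z}(a)=\int_{(0,\infty)}s^m e^{-sa}\rho_z(ds)$ and $\psi_a(b)=\int_{\mathbb X}\int_{(0,\infty)}(1-e^{-bs})e^{-as}\rho_x(ds)\,\eta(dx)$.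
   Context: Let $\mathbb X$ be a Polish space with Borel $\sigma$-field $\mathcal B(\mathbb X)$, and let $\mathcal M_{\mathbb X}$ be the space of boundedly finite measures on $\mathbb X$ (finite on bounded Borel sets), with the Borel $\sigma$-field $\mathcal B(\mathcal M_{\mathbb X})$ of its weak convergence topology. A random measure $\mu$ is a completely random measure if $\mu(A_1),\dots,\mu(A_k)$ are mutually independent for all finite families of pairwise disjoint bounded Borel sets $A_1,\dots,A_k$; a normalized completely random measure is a completely random measure divided by its total mass. Intensity: $\eta$ is a non-atomic probability measure on $\mathbb X$, $x\mapsto\rho_x$ is a measurable family of $\sigma$-finite measures on $(0,\infty)$, and $\nu(dx,ds)=\eta(dx)\rho_x(ds)$ satisfies $\int_{(0,\infty)}\min\{y,s\}\,\nu(A,dy)<\infty$ for every bounded $A\in\mathcal B(\mathbb X)$ and $s>0$, and $\nu(\{x\},(0,\infty))=0$ for all $x$. The completely random measure $\tilde\mu$ with intensity (parameter measure) $\nu$ is $\tilde\mu(A)=\int_{(0,\infty)}y\,N(A,dy)$, where $N$ is a Poisson random measure on $\mathbb X\times(0,\infty)$ with intensity $\nu$; its law on $\mathcal M_{\mathbb X}$ is $\mathcal P_{\tilde\mu}$. Standing assumption: $0<\tilde\mu(\mathbb X)<\infty$ almost surely. Tilting: for a positive Borel function $h$ with $E[h(\tilde\mu(\mathbb X))]<\infty$, the tilted completely random measure $\tilde\mu_t$ with parameters $\nu,h$ is a random measure with law $$\mathcal P_{\tilde\mu_t}(A)=\frac{1}{E[h(\tilde\mu(\mathbb X))]}\int_A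 h(\mu(\mathbb X))\,\mathcal P_{\tilde\mu}(d\mu),\quad A\in\mathcal B(\mathcal M_{\mathbb X}),$$ and $\tilde G_t(\cdot)=\tilde\mu_t(\cdot)/\tilde\mu_t(\mathbb X)$. Augmenting variable: $U_n$ is a positive random variable which, conditionally on $\tilde\mu_t$, is independent of $\mathbf X_n$ and has the gamma distribution with shape $n+q$ and rate $\tilde T_t:=\tilde\mu_t(\mathbb X)$; that is, if $\tilde T_t$ has density $f_{\tilde T_t}$, then $(\tilde T_t,U_n)$ has joint density $\frac{u^{n+q-1}e^{-uy}y^{n+q}}{\Gamma(n+q)}f_{\tilde T_t}(y)$ for $u,y>0$. Partition notation: $Y_1,\dots,Y_{\aleph(\mathbf p_n)}$ are the distinct values among $X_1,\dots,X_n$, $\mathbf p_n=\{C_1,\dots,C_{\aleph(\mathbf p_n)}\}$ is the partition of $\{1,\dots,n\}$ with $C_k=\{i: X_i=Y_k\}$, $\aleph(\mathbf p_n)$ is its number of cells, and $n_k$ is the number of elements of $C_k$. $\delta_a$ is the Dirac measure at $a$. Conditional statements hold almost surely. *)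

(* Defs.v *)
From HB Require Import structures.
From mathcomp Require Import all_boot all_order all_algebra.
From mathcomp Require Import all_classical all_reals all_analysis.
From mathcomp Require Import metric_structure measurable_realfun.

Set Implicit Arguments.
Unset Strict Implicit.
Unset Printing Implicit Defensive.

Import Order.TTheory GRing.Theory Num.Theory.
Import numFieldNormedType.Exports.

Local Open Scope classical_set_scope.
Local Open Scope ring_scope.
Local Open Scope ereal_scope.

(* A Polish space is given with a complete metric, which is the one that
   defines the bounded sets; separability is a separate predicate. *)
#[short(type="completeMetricType")]
HB.structure Definition CompleteMetric (K : numDomainType) :=
  {T of Complete T & Metric K T}.

Definition separable (T : topologicalType) : Prop :=
  exists2 D : set T, countable D & dense D.

Definition borel (T : ptopologicalType) : Type :=
  g_sigma_algebraType (@open T).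

HB.instance Definition _ (T : ptopologicalType) := Pointed.on (borel T).
HB.instance Definition _ (T : ptopologicalType) :=
  Measurable.on (borel T).

Section boundedly_finite_measures.
Context {R : realType} (X : completeMetricType R).

Definition metric_bounded (A : set X) : Prop :=
  exists M : R, forall x y, A x -> A y -> (mdist x y <= M)%R.

Record bfmeasure := BFMeasure {
  bf_measure :> {measure set (borel X) -> \bar R} ;
  bf_finite : forall A : set (borel X),
    measurable A -> metric_bounded A -> bf_measure A < +oo }.

HB.instance Definition _ := gen_eqMixin bfmeasure.
HB.instance Definition _ := gen_choiceMixin bfmeasure.

Let mzero_finite (A : set (borel X)) : measurable A -> metric_bounded A ->
  (mzero : {measure set (borel X) -> \bar R}) A < +oo.
Proof. by move=> _ _; rewrite ltry. Qed.

HB.instance Definition _ :=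
  isPointed.Build bfmeasure (BFMeasure mzero_finite).

Record testfun := TestFun {
  testfun_fun :> X -> R ;
  testfun_continuous : continuous testfun_fun ;
  testfun_bounded : exists M : R, forall x, (`|testfun_fun x| <= M)%R ;
  testfun_support : exists2 B : set X,
    metric_bounded B & forall x, ~ B x -> testfun_fun x = 0%R }.

(* The weak topology on boundedly finite measures is the coarsest one for
   which every m |-> \int f dm is continuous, f bounded continuous and
   vanishing outside a bounded set. *)
Definition bf_pairing (m : bfmeasure) : {ptws testfun -> R} :=
  fun f => (\int[m]_x f x)%R.

Definition MX : Type := borel (initial_topology bf_pairing).

HB.instance Definition _ := Pointed.on MX.
HB.instance Definition _ :=
  Measurable.on MX.

Definition bf_of_MX (m : MX) : bfmeasure := m.
Coercion bf_of_MX : MX >-> bfmeasure.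

Definition total_mass (m : bfmeasure) : R := fine (m setT).

Fact inv_total_mass_ge0 (m : bfmeasure) : (0 <= (total_mass m)^-1)%R.
Proof. by rewrite invr_ge0 fine_ge0. Qed.

Let normalize_finite (m : bfmeasure) (A : set (borel X)) :
  measurable A -> metric_bounded A ->
  (mscale (NngNum (inv_total_mass_ge0 m)) m
    : {measure set (borel X) -> \bar R}) A < +oo.
Proof.
by move=> mA bA; apply: lte_mul_pinfty => //; exact: bf_finite.
Qed.

(* m / m(X); this is the zero measure when m(X) is 0 or +oo. *)
Definition normalize (m : MX) : MX := BFMeasure (@normalize_finite m).

End boundedly_finite_measures.

Section conditioning.
Context {R : realType}.

Definition mutually_independent d (Om : measurableType d)
    (P : probability Om R) (I : finType) (F : I -> set_system Om) : Prop :=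
  forall E : I -> set Om, (forall i, F i (E i)) ->
    P (\bigcap_(i in [set: I]) E i) = \prod_(i : I) P (E i).

Definition sigma_of d d' (Om : measurableType d) (T : measurableType d')
    (Z : Om -> T) : set_system Om :=
  preimage_set_system setT Z measurable.

(* K is a regular version of the conditional distribution of Z given Y. *)
Definition is_cond_law d d1 d2 (Om : measurableType d)
    (T1 : measurableType d1) (T2 : measurableType d2) (P : probability Om R)
    (Y : Om -> T1) (Z : Om -> T2) (K : R.-pker T1 ~> T2) : Prop :=
  forall (A : set T1) (B : set T2), measurable A -> measurable B ->
    P (Y @^-1` A `&` Z @^-1` B) = \int[P]_(w in Y @^-1` A) K (Y w) B.

End conditioning.

Section completely_random_measures.
Context {R : realType} (X : completeMetricType R).
Context d (Om : measurableType d) (P : probability Om R).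

Definition is_CRM (mu : {RV P >-> MX X}) : Prop :=
  forall (k : nat) (A : 'I_k -> set (borel X)),
    (forall i, measurable (A i)) -> (forall i, metric_bounded (A i)) ->
    trivIset setT A ->
    mutually_independent P (fun i => sigma_of (fun w => mu w (A i))).

(* The space X x (0, +oo) is represented by X x R; intensities will not charge
   X x (-oo, 0].  The last argument 0 of poisson_prob is a dummy. *)
Definition is_poisson_random_measure
    (N : R.-ker Om ~> (borel X * R)%type)
    (nu : {measure set (borel X * R) -> \bar R}) : Prop :=
  [/\ forall C, measurable C -> nu C < +oo -> forall k : nat,
        P [set w | N w C = k%:R%:E] = poisson_prob (fine (nu C)) 0%N [set k],
      forall C, measurable C -> nu C = +oo -> P [set w | N w C = +oo] = 1
    & forall (k : nat) (C : 'I_k -> set (borel X * R)),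
        (forall i, measurable (C i)) -> trivIset setT C ->
        mutually_independent P (fun i => sigma_of (fun w => N w (C i)))].

Definition is_CRM_with_intensity (mu : {RV P >-> MX X})
    (nu : {measure set (borel X * R) -> \bar R}) : Prop :=
  exists N : R.-ker Om ~> (borel X * R)%type,
    is_poisson_random_measure N nu /\
    {ae P, forall w, forall A : set (borel X), measurable A ->
      mu w A = \int[N w]_(z in A `*` `]0%R, +oo[) (z.2)%:E}.

End completely_random_measures.

Section intensity.
Context {R : realType} (X : completeMetricType R).
Implicit Types (eta : probability (borel X) R)
  (rho : borel X -> set R -> \bar R)
  (nu : {measure set (borel X * R) -> \bar R}).

(* nu(dx, ds) = eta(dx) rho_x(ds) *)
Definition disintegrates nu eta rho : Prop :=
  forall (A : set (borel X)) (B : set R), measurable A -> measurable B ->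
    nu (A `*` B) = \int[eta]_(x in A) rho x B.

Definition is_tilted d0 (Om0 : measurableType d0) (P0 : probability Om0 R)
    (mu : {RV P0 >-> MX X}) (h : R -> R)
    d (Om : measurableType d) (P : probability Om R)
    (mut : {RV P >-> MX X}) : Prop :=
  forall A : set (MX X), measurable A ->
    P (mut @^-1` A) =
    ('E_P0[fun w => h (total_mass (mu w))])^-1 *
    \int[distribution P0 mu]_(m in A) (h (total_mass m))%:E.

(* exp (- b s) rho_x(ds) *)
Definition exp_tilt (rho : borel X -> {measure set R -> \bar R}) (b : R)
    (x : borel X) (B : set R) : \bar R :=
  \int[rho x]_(s in B) (expR (- (b * s)))%:E.

Definition tau (rho : borel X -> {measure set R -> \bar R})
    (m : nat) (z : borel X) (a : R) : \bar R :=
  \int[rho z]_(s in `]0%R, +oo[) (s ^+ m * expR (- (s * a)))%:E.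

Definition psi eta (rho : borel X -> {measure set R -> \bar R})
    (a b : R) : \bar R :=
  \int[eta]_x \int[rho x]_(s in `]0%R, +oo[)
    ((1 - expR (- (b * s))) * expR (- (a * s)))%:E.

End intensity.

Section gamma_distribution.
Context {R : realType}.

Definition Gamma (a : R) : R :=
  (\int[lebesgue_measure]_(t in `]0%R, +oo[) (t `^ (a - 1) * expR (- t)))%R.

Definition gamma_law (shape rate : R) (C : set R) : \bar R :=
  \int[lebesgue_measure]_(u in C `&` `]0%R, +oo[)
    (u `^ (shape - 1) * expR (- (u * rate)) * rate `^ shape / Gamma shape)%:E.

End gamma_distribution.

Section partition.
Context {T : eqType} {n : nat} (x : n.-tuple T).

(* The distinct values are listed without repetition, in the order of undup. *)
Definition ncells : nat := size (undup x).

Definition cell_value (k : 'I_ncells) : T := tnth (in_tuple (undup x)) k.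

Definition cell (k : 'I_ncells) : {set 'I_n} :=
  [set i | tnth x i == cell_value k]%SET.

Definition cell_size (k : 'I_ncells) : nat := #|cell k|.

End partition.

Section sampling.
Context {R : realType} (X : completeMetricType R).
Context d (Om : measurableType d) (P : probability Om R).

(* Given V, the X_i are i.i.d. with distribution G. *)
Definition cond_iid d' (T : measurableType d') (V : Om -> T) (G : Om -> MX X)
    (n : nat) (Xs : Om -> n.-tuple (borel X)) : Prop :=
  forall (A : set T) (B : 'I_n -> set (borel X)),
    measurable A -> (forall i, measurable (B i)) ->
    P (V @^-1` A `&` [set w | forall i, B i (tnth (Xs w) i)]) =
    \int[P]_(w in V @^-1` A) \prod_(i < n) G w (B i).

(* Given mut, the variables X_1, ..., X_n, U are independent, each X_i with
   distribution mut / mut(X) and U with the gamma distribution of the given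
   shape and of rate mut(X). *)
Definition augmented_sample (mut : Om -> MX X) (n : nat)
    (Xs : Om -> n.-tuple (borel X)) (U : Om -> R) (shape : R) : Prop :=
  forall (A : set (MX X)) (B : 'I_n -> set (borel X)) (C : set R),
    measurable A -> (forall i, measurable (B i)) -> measurable C ->
    P (mut @^-1` A `&` [set w | forall i, B i (tnth (Xs w) i)]
         `&` U @^-1` C) =
    \int[P]_(w in mut @^-1` A)
      ((\prod_(i < n) normalize (mut w) (B i)) *
       gamma_law shape (total_mass (mut w)) C).

End sampling.

Section posterior.
Context {R : realType} (X : completeMetricType R).
Variables (eta : probability (borel X) R)
  (rho : borel X -> {measure set R -> \bar R}) (gamma q : R) (n : nat).

(* P(J_k in ds), with Y_k = cell_value k and n_k = cell_size k *)
Definition jump_law (u : R) (x : n.-tuple (borel X)) (k : 'I_(ncells x))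
    (B : set R) : \bar R :=
  (\int[rho (cell_value k)]_(s in B `&` `]0%R, +oo[)
     (s ^+ cell_size k * expR (- (s * (gamma + u))))%:E) /
  (\int[rho (cell_value k)]_(s in `]0%R, +oo[)
     (s ^+ cell_size k * expR (- (s * (gamma + u))))%:E).

(* Q is the law of mux / mux(X) for a completely random measure mux with the
   same law as mus = muu + \sum_k J_k delta_{Y_k}, where muu has intensity
   eta(dx) exp(- s (gamma + u)) rho_x(ds) and is independent of the jumps.
   The values u of U_n and x of X_n are fixed here. *)
Definition normalized_posterior_CRM (u : R) (x : n.-tuple (borel X))
    (Q : set (MX X) -> \bar R) : Prop :=
  exists (d : measure_display) (Om : measurableType d) (P : probability Om R)
    (mux mus muu : {RV P >-> MX X}) (J : 'I_(ncells x) -> {RV P >-> R})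
    (nuu : {measure set (borel X * R) -> \bar R}),
  (forall A : set (MX X), measurable A ->
     Q A = P [set w | A (normalize (mux w))]) /\
  [/\ is_CRM mux,
      forall A : set (MX X), measurable A ->
        P (mux @^-1` A) = P (mus @^-1` A),
      {ae P, forall w, forall A : set (borel X), measurable A ->
        mus w A = muu w A + \sum_(k < ncells x)
                    (J k w)%:E * \d_(cell_value k) A},
      disintegrates nuu eta (exp_tilt rho (gamma + u))
    & is_CRM_with_intensity muu nuu] /\
  (forall (k : 'I_(ncells x)) (B : set R), measurable B ->
     P (J k @^-1` B) = jump_law u k B) /\
  mutually_independent P (fun i : option 'I_(ncells x) =>
    if i is Some k then sigma_of (J k) else sigma_of muu).

Definition latent_kernel (x : n.-tuple (borel X)) (u : R) : \bar R :=
  expeR (- psi eta rho 0 (gamma + u)) *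
  (\prod_(k < ncells x) tau rho (cell_size k) (cell_value k) (gamma + u)) *
  (u `^ (n%:R + q - 1))%:E.

Definition latent_density (x : n.-tuple (borel X)) (u : R) : \bar R :=
  latent_kernel x u /
  \int[lebesgue_measure]_(v in `]0%R, +oo[) latent_kernel x v.

End posterior.

(* Main.v *)
Require Import Defs.
From HB Require Import structures.
From mathcomp Require Import all_boot all_order all_algebra.
From mathcomp Require Import all_classical all_reals all_analysis.
From mathcomp Require Import metric_structure measurable_realfun finmap.
From mathcomp Require Import lra ring.

(** Conditionally on the tilted measure [m], the observations have the density
    [m(dx_1) ... m(dx_n) / m(X)^n] and the latent variable has the density
    [u^(n+q-1) exp (- u m(X)) m(X)^(n+q) / Gamma (n+q)], while the tilting
    contributes [exp (- gamma m(X)) m(X)^(-q)]. The powers of [m(X)] cancel,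
    which is the purpose of the latent variable, and the joint law is, up to a
    constant,

      [u^(n+q-1) exp (- (gamma+u) m(X)) m(dx_1) ... m(dx_n) law(mu)(dm) du].

    The factor [exp (- (gamma+u) m(X))] turns [mu] into a completely random
    measure with damped intensity ([tilted_poisson]), and each factor
    [m(dx_i)] is absorbed by Mecke's formula ([crm_mecke]): biasing the law of
    [mu] by [m(dx)] amounts to adding an independent atom at [x] whose size [s]
    follows [s rho_x(ds)]. For a diffuse intensity, an observation that
    repeats the value [y] multiplies the density by the size of the atom
    already added at [y]. After [n] observations the atom at a value
    observed [k] times therefore has the density [s^k exp (- (gamma+u) s)]
    with respect to [rho_y], and the atoms are independent of each other and
    of the rest ([iterated_mecke], [palm_eval]). The total mass of the
    resulting measure, as a function of [u], is
    [u^(n+q-1) exp (- psi(gamma+u)) prod_k tau_k], the density of the latent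
    variable given the observations up to normalisation. Bayes' rule
    ([bayes]) turns these two facts into the two conditional laws
    ([conditional_laws]).

    Two devices organise the argument. Measures, kernels and conditional laws
    are obtained from functionals on nonnegative measurable functions that
    satisfy monotone convergence ([integral_functional]); mixtures, densities
    and images are then compositions of functionals. Laws of random measures
    are identified by Laplace transforms: the functional
    [E exp (- N f) = exp (- nu (1 - exp (- f)))] characterises the Poisson
    random measure with intensity [nu] ([prm_laplace], [prm_of_laplace]),
    tilting and Mecke's formula follow from it by algebra and differentiation,
    and equality of Laplace transforms is equality of laws because the Borel
    sets of the weak topology are generated by the evaluations [m |-> m A]
    ([MX_measurableE]). *)

Set Implicit Arguments.
Unset Strict Implicit.
Unset Printing Implicit Defensive.

Import Order.TTheory GRing.Theory Num.Theory.
Import numFieldNormedType.Exports.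

Local Open Scope classical_set_scope.
Local Open Scope ring_scope.
Local Open Scope ereal_scope.


(** * Integration as a monotone linear functional *)

(** Monotonicity and the convention [0 * +oo = 0] make the rule hold for an
    infinite factor as well. *)
Lemma ge0_nondecreasing_limeMl (R : realType) (y : \bar R)
    (f : nat -> \bar R) : 0 <= y -> (forall n, 0 <= f n) ->
  nondecreasing_seq f -> limn (fun n => y * f n) = y * limn f.
Proof.
move=> y0 f0 nd; have cvf : cvgn f by exact: ereal_nondecreasing_is_cvgn.
case: y y0 => [y y0|_|]; [by rewrite limeMl| |by []].
have [n0|/existsNP[n /eqP fn]] := pselect (forall n, f n = 0).
  have -> : f = (fun=> 0) by apply/funext => n; rewrite n0.
  by under eq_fun do rewrite mule0; rewrite !lim_cst// mule0.
have fn0 : 0 < f n by rewrite lt_neqAle eq_sym fn f0.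
have -> : +oo * limn f = +oo.
  rewrite gt0_mulye//; apply: (lt_le_trans fn0).
  by rewrite (cvg_lim _ (ereal_nondecreasing_cvgn nd))//; apply: ereal_sup_ubound; exists n.
apply/cvg_lim => //; apply: cvg_near_cst; near=> m.
rewrite gt0_mulye//; apply: (lt_le_trans fn0); apply: nd.
by near: m; exists n.
Unshelve. all: by end_near. Qed.

Section integral_functional.
Context d (T : measurableType d) (R : realType).
Implicit Types f g : T -> \bar R.

Definition nnmeas f := (forall x, 0 <= f x) /\ measurable_fun setT f.

(** The functionals [f |-> \int[m]_x f x], characterised without mention of
    the measure [m]; [ifun_measure] recovers it. *)
Record integral_functional (L : (T -> \bar R) -> \bar R) : Prop := {
  ifun_ge0 : forall f, nnmeas f -> 0 <= L f ;
  ifun_le : forall f g, nnmeas f -> nnmeas g -> (forall x, f x <= g x) ->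
    L f <= L g ;
  ifunD : forall f g, nnmeas f -> nnmeas g ->
    L (fun x => f x + g x) = L f + L g ;
  ifunZ : forall (c : R) f, (0 <= c)%R -> nnmeas f ->
    L (fun x => c%:E * f x) = c%:E * L f ;
  ifun_lim : forall (f_ : nat -> T -> \bar R), (forall n, nnmeas (f_ n)) ->
    (forall x, nondecreasing_seq (f_ ^~ x)) ->
    L (fun x => limn (f_ ^~ x)) = limn (fun n => L (f_ n)) }.

Lemma nnmeasD f g : nnmeas f -> nnmeas g -> nnmeas (fun x => f x + g x).
Proof.
move=> [f0 mf] [g0 mg]; split; first by move=> x; rewrite adde_ge0.
exact: emeasurable_funD.
Qed.

Lemma nnmeasM f g : nnmeas f -> nnmeas g -> nnmeas (fun x => f x * g x).
Proof.
move=> [f0 mf] [g0 mg]; split; first by move=> x; rewrite mule_ge0.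
exact: emeasurable_funM.
Qed.

Lemma nnmeas_cst (c : \bar R) : 0 <= c -> nnmeas (fun=> c).
Proof. by move=> c0; split. Qed.

Lemma nnmeas_indic (A : set T) : measurable A ->
  nnmeas (fun x => (\1_A x)%:E).
Proof.
move=> mA; split; first by move=> x; rewrite lee_fin indicE.
exact/measurable_EFinP/measurable_indic.
Qed.

Lemma nnmeas_sum I (s : seq I) (f_ : I -> T -> \bar R) :
  (forall i, nnmeas (f_ i)) -> nnmeas (fun x => \sum_(i <- s) f_ i x).
Proof.
move=> h; split; first by move=> x; apply: sume_ge0 => i _; case: (h i).
by apply: emeasurable_sum => i; case: (h i).
Qed.

Lemma nnmeas_prod (I : eqType) (s : seq I) (f_ : I -> T -> \bar R) :
  (forall i, nnmeas (f_ i)) -> nnmeas (fun x => \prod_(i <- s) f_ i x).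
Proof.
move=> h; elim: s => [|i s ih].
  by under [X in nnmeas X]eq_fun do rewrite big_nil; exact: nnmeas_cst.
by under [X in nnmeas X]eq_fun do rewrite big_cons; exact: nnmeasM.
Qed.

Lemma nnmeas_lim (f_ : nat -> T -> \bar R) : (forall n, nnmeas (f_ n)) ->
    (forall x, nondecreasing_seq (f_ ^~ x)) ->
  nnmeas (fun x => limn (f_ ^~ x)).
Proof.
move=> h nd; have cvf x : cvgn (f_ ^~ x) by exact: ereal_nondecreasing_is_cvgn.
split => [x|]; first by apply: lime_ge => //; apply: nearW => n; case: (h n).
by apply: (emeasurable_fun_cvg f_) => // n; case: (h n).
Qed.

Section functional.
Variable L : (T -> \bar R) -> \bar R.
Hypothesis hL : integral_functional L.

Lemma ifun0 : L (fun=> 0) = 0.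
Proof.
have h := @ifunZ _ hL 0%R (fun=> 0) (lexx _) (nnmeas_cst (lexx _)).
apply: etrans (etrans h _); last by rewrite mul0e.
by congr L; apply/funext => x; rewrite mule0.
Qed.

Lemma ifun_sum I (s : seq I) (f_ : I -> T -> \bar R) :
  (forall i, nnmeas (f_ i)) ->
  L (fun x => \sum_(i <- s) f_ i x) = \sum_(i <- s) L (f_ i).
Proof.
move=> h; elim: s => [|i s ih].
  by rewrite big_nil -[RHS]ifun0; congr L; apply/funext => x; rewrite big_nil.
rewrite big_cons -ih -(ifunD hL (h i) (nnmeas_sum s h)).
by congr L; apply/funext => x; rewrite big_cons.
Qed.

Lemma ifun_series (f_ : nat -> T -> \bar R) : (forall n, nnmeas (f_ n)) ->
  L (fun x => \sum_(n <oo) f_ n x) = \sum_(n <oo) L (f_ n).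
Proof.
move=> h.
rewrite (@ifun_lim _ hL (fun n x => \sum_(0 <= i < n) f_ i x)).
- by congr (limn _); apply/funext => n; rewrite ifun_sum.
- by move=> n; exact: nnmeas_sum.
- by move=> x m n mn; apply: lee_sum_nneg_natr => // k _ _; case: (h k).
Qed.

End functional.

Import HBNNSimple.

(** Linearity and monotone convergence pass from indicators through simple
    functions to every nonnegative measurable function. *)
Lemma ifun_unique L1 L2 :
  integral_functional L1 -> integral_functional L2 ->
  (forall A, measurable A ->
    L1 (fun x => (\1_A x)%:E) = L2 (fun x => (\1_A x)%:E)) ->
  forall f, nnmeas f -> L1 f = L2 f.
Proof.
move=> h1 h2 h12 f [f0 mf].
pose f_ n x := (nnsfun_approx measurableT mf n x)%:E.
have fE : f = (fun x => limn (f_ ^~ x)).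
  apply/funext => x; apply/esym/cvg_lim => //.
  exact: cvg_nnsfun_approx.
have nf n : nnmeas (f_ n).
  by split; [move=> x; rewrite lee_fin | exact/measurable_EFinP].
have nd x : nondecreasing_seq (f_ ^~ x).
  by move=> m n mn; rewrite lee_fin; exact/lefP/nd_nnsfun_approx.
rewrite fE !ifun_lim//; congr (limn _); apply/funext => n.
rewrite /f_; move: (nnsfun_approx _ _ n) => g.
pose s := enum_fset (fset_set (range g)).
pose h (i : 'I_(size s)) x : \bar R := (\1_(g @^-1` [set (nth 0%R s i)]) x)%:E.
have mh i : nnmeas (h i) by exact: nnmeas_indic.
pose c (i : 'I_(size s)) : R := (nth 0%R s i).
have c0 i : (0 <= c i)%R.
  have : (nth 0%R s i) \in fset_set (range g) by apply: mem_nth; rewrite ltn_ord.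
  by rewrite in_fset_set// => /set_mem[x _ ci]; rewrite /c -ci.
have gE : (fun x => (g x)%:E) = (fun x => \sum_i (c i)%:E * h i x).
  apply/funext => x; rewrite fimfunEord -sumEFin.
  by apply: eq_bigr => i _; rewrite EFinM.
have mch i : nnmeas (fun x => (c i)%:E * h i x).
  by apply: nnmeasM => //; apply: nnmeas_cst; rewrite lee_fin.
rewrite gE !ifun_sum//; apply: eq_bigr => i _.
by rewrite !ifunZ// h12.
Qed.

Lemma ifun_integral (m : {measure set T -> \bar R}) :
  integral_functional (fun f => \int[m]_x f x).
Proof.
split.
- by move=> f [f0 _]; exact: integral_ge0.
- by move=> f g [f0 mf] [g0 mg] fg; exact: ge0_le_integral.
- by move=> f g [f0 mf] [g0 mg]; exact: ge0_integralD.
- by move=> c f c0 [f0 mf]; rewrite ge0_integralZl_EFin.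
- move=> f_ hf nd; rewrite monotone_convergence//.
  + by move=> n; case: (hf n).
  + by move=> n x _; case: (hf n) => [].
Qed.

(** The set function [A |-> L (\1_A)] is countably additive by monotone
    convergence. *)
Lemma ifun_measure L : integral_functional L ->
  exists m : {measure set T -> \bar R},
    forall f, nnmeas f -> \int[m]_x f x = L f.
Proof.
move=> hL; pose m A := L (fun x => (\1_(A `&` setT) x)%:E) .
pose m' A := if pselect (measurable A) then m A else 0.
have m0 : m' set0 = 0.
  rewrite /m'; case: pselect => [?|//]; rewrite /m set0I -[RHS](ifun0 hL).
  by congr L; apply/funext => x; rewrite indic0.
have mge0 A : 0 <= m' A.
  rewrite /m'; case: pselect => [mA|//]; rewrite /m setIT; apply: ifun_ge0 => //.
  exact: nnmeas_indic.
have mE A : measurable A -> m' A = L (fun x => (\1_A x)%:E).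
  by move=> mA; rewrite /m'; case: pselect => [?|//]; rewrite /m setIT.
have msigma : semi_sigma_additive m'.
  move=> F mF tF mUF; rewrite (mE _ mUF).
  have -> : (fun x => (\1_(\bigcup_n F n) x)%:E : \bar R) =
            (fun x => \sum_(n <oo) (\1_(F n) x)%:E).
    apply/funext => x; rewrite indicE.
    case: (boolP (x \in _)) => [/set_mem [k _ Fkx]|].
      rewrite (@nneseriesD1 _ _ k)//=.
      rewrite [in RHS]indicE mem_set// eseries0 ?adde0// => i _ ik.
      rewrite indicE memNset// => Fix; move/eqP: ik; apply.
      by apply: (tF i k) => //; exists x.
    move=> xF; rewrite eseries0// => i _ _; rewrite indicE memNset// => Fix.
    by move/negP : xF; apply; apply/mem_set; exists i.
  have h n : nnmeas (fun x => (\1_(F n) x)%:E) by exact: nnmeas_indic.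
  rewrite (ifun_series hL h).
  have -> : (fun n => \sum_(0 <= i < n) m' (F i)) =
            (fun n => \sum_(0 <= i < n) L (fun x => (\1_(F i) x)%:E)).
    by apply/funext => n; apply: eq_bigr => i _; rewrite mE.
  apply: is_cvg_nneseries => n _ _; exact: (ifun_ge0 hL).
pose M := isMeasure.Build _ _ _ m' m0 mge0 msigma.
pose m2 : {measure set T -> \bar R} := HB.pack m' M.
exists m2; apply: ifun_unique => //; first exact: ifun_integral.
by move=> A mA; rewrite integral_indic// setIT /m2 /= mE.
Qed.

Lemma ifun_density L (w : T -> \bar R) : integral_functional L -> nnmeas w ->
  integral_functional (fun f => L (fun x => f x * w x)).
Proof.
move=> hL hw; split.
- by move=> f hf; apply: (ifun_ge0 hL); exact: nnmeasM.
- move=> f g hf hg fg; apply: (ifun_le hL); do ?exact: nnmeasM.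
  by move=> x; apply: lee_wpmul2r => //; case: hw.
- move=> f g hf hg; rewrite -(ifunD hL); do ?exact: nnmeasM.
  congr L; apply/funext => x; rewrite ge0_muleDl//.
    by case: hf.
  by case: hg.
- move=> c f c0 hf; rewrite -(ifunZ hL)//; last exact: nnmeasM.
  by congr L; apply/funext => x; rewrite muleA.
- move=> f_ hf nd; rewrite -(ifun_lim hL).
  + congr L; apply/funext => x; apply/esym.
    have -> : limn ((fun n x => f_ n x * w x) ^~ x) = limn (fun n => w x * f_ n x).
      by congr (limn _); apply/funext => n; rewrite muleC.
    rewrite [RHS]muleC ge0_nondecreasing_limeMl//; first by case: hw.
    by move=> n; case: (hf n).
  + by move=> n; exact: nnmeasM.
  + by move=> x m n mn; apply: lee_wpmul2r; [case: hw|exact: nd].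
Qed.

End integral_functional.

Section functional_tools.
Context (R : realType).

Lemma ifun_bind d1 d2 (T1 : measurableType d1) (T2 : measurableType d2)
    (L1 : (T1 -> \bar R) -> \bar R) (L2 : T1 -> (T2 -> \bar R) -> \bar R) :
  integral_functional L1 -> (forall x, integral_functional (L2 x)) ->
  (forall f, nnmeas f -> measurable_fun setT (fun x => L2 x f)) ->
  integral_functional (fun f => L1 (fun x => L2 x f)).
Proof.
move=> h1 h2 m2.
have n2 f : nnmeas f -> nnmeas (fun x => L2 x f).
  by move=> hf; split; [move=> x; exact: (ifun_ge0 (h2 x))|exact: m2].
split.
- by move=> f hf; apply: (ifun_ge0 h1); exact: n2.
- move=> f g hf hg fg; apply: (ifun_le h1); do ?exact: n2.
  by move=> x; exact: (ifun_le (h2 x)).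
- move=> f g hf hg; rewrite -(ifunD h1); do ?exact: n2.
  by congr L1; apply/funext => x; exact: (ifunD (h2 x)).
- move=> c f c0 hf; rewrite -(ifunZ h1)//; last exact: n2.
  by congr L1; apply/funext => x; exact: (ifunZ (h2 x)).
- move=> f_ hf nd; rewrite -(ifun_lim h1).
  + by congr L1; apply/funext => x; exact: (ifun_lim (h2 x)).
  + by move=> n; exact: n2.
  + move=> x m n mn; apply: (ifun_le (h2 x)) => // y; exact: nd.
Qed.

Lemma ifun_comp d1 d2 (T1 : measurableType d1) (T2 : measurableType d2)
    (L : (T1 -> \bar R) -> \bar R) (phi : T1 -> T2) :
  integral_functional L -> measurable_fun setT phi ->
  integral_functional (fun f => L (fun x => f (phi x))).
Proof.
move=> hL mphi.
have n1 (f : T2 -> \bar R) : nnmeas f -> nnmeas (fun x => f (phi x)).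
  by move=> [f0 mf]; split => //; exact: measurableT_comp.
split.
- by move=> f hf; apply: (ifun_ge0 hL); exact: n1.
- by move=> f g hf hg fg; apply: (ifun_le hL); do ?exact: n1.
- by move=> f g hf hg; rewrite -(ifunD hL); do ?exact: n1.
- by move=> c f c0 hf; rewrite -(ifunZ hL)//; exact: n1.
- move=> f_ hf nd; rewrite -(ifun_lim hL)//.
  by move=> n; exact: n1.
Qed.

Lemma ifunC d (T : measurableType d) (L : (T -> \bar R) -> \bar R) (c : \bar R) :
  integral_functional L -> 0 <= c -> integral_functional (fun f => c * L f).
Proof.
move=> hL c0; split.
- by move=> f hf; rewrite mule_ge0//; exact: (ifun_ge0 hL).
- by move=> f g hf hg fg; apply: lee_wpmul2l => //; exact: (ifun_le hL).
- move=> f g hf hg; rewrite (ifunD hL)// ge0_muleDr//; exact: (ifun_ge0 hL).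
- by move=> k f k0 hf; rewrite (ifunZ hL)// muleCA.
- move=> f_ hf nd; rewrite (ifun_lim hL)// ge0_nondecreasing_limeMl//.
    by move=> n; exact: (ifun_ge0 hL).
  by move=> m n mn; apply: (ifun_le hL) => // x; exact: nd.
Qed.

Lemma ifun_eval d (T : measurableType d) (x : T) :
  integral_functional (fun f : T -> \bar R => f x).
Proof. by split => //; move=> f []. Qed.

Lemma ifun_add d (T : measurableType d) (L1 L2 : (T -> \bar R) -> \bar R) :
  integral_functional L1 -> integral_functional L2 ->
  integral_functional (fun f => L1 f + L2 f).
Proof.
move=> h1 h2; split.
- by move=> f hf; rewrite adde_ge0//; [exact: (ifun_ge0 h1)|exact: (ifun_ge0 h2)].
- by move=> f g hf hg fg; apply: leeD; [exact: (ifun_le h1)|exact: (ifun_le h2)].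
- by move=> f g hf hg; rewrite (ifunD h1)// (ifunD h2)// addeACA.
- move=> k f k0 hf; rewrite (ifunZ h1)// (ifunZ h2)// ge0_muleDr//.
    exact: (ifun_ge0 h1).
  exact: (ifun_ge0 h2).
- move=> f_ hf nd; rewrite (ifun_lim h1)// (ifun_lim h2)//.
  have nd1 : nondecreasing_seq (fun n => L1 (f_ n)).
    by move=> m n mn; apply: (ifun_le h1) => // x; exact: nd.
  have nd2 : nondecreasing_seq (fun n => L2 (f_ n)).
    by move=> m n mn; apply: (ifun_le h2) => // x; exact: nd.
  rewrite limeD//; do ?exact: ereal_nondecreasing_is_cvgn.
  apply: ge0_adde_def; rewrite inE; apply: lime_ge;
    do ?exact: ereal_nondecreasing_is_cvgn.
    by apply: nearW => n; exact: (ifun_ge0 h1).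
  by apply: nearW => n; exact: (ifun_ge0 h2).
Qed.

(** Uniqueness of sigma-finite measures on a pi-system, in the language of
    functionals. *)
Lemma ifun_unique_pi d (T : measurableType d) (G : set (set T))
    (g : (set T)^nat) (L1 L2 : (T -> \bar R) -> \bar R) :
  measurable = <<s G >> -> setI_closed G -> (forall i, G (g i)) ->
  \bigcup_k (g k) = setT ->
  integral_functional L1 -> integral_functional L2 ->
  (forall A, G A -> L1 (fun x => (\1_A x)%:E) = L2 (fun x => (\1_A x)%:E)) ->
  (forall k, L1 (fun x => (\1_(g k) x)%:E) < +oo) ->
  forall f, nnmeas f -> L1 f = L2 f.
Proof.
move=> GE GI Gg gT h1 h2 h12 goo.
have [m1 m1E] := ifun_measure h1.
have [m2 m2E] := ifun_measure h2.
have mG A : G A -> measurable A by move=> GA; rewrite GE; exact: sub_sigma_algebra.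
have mE A : measurable A -> m1 A = L1 (fun x => (\1_A x)%:E).
  by move=> mA; rewrite -m1E ?integral_indic ?setIT//; exact: nnmeas_indic.
have mE2 A : measurable A -> m2 A = L2 (fun x => (\1_A x)%:E).
  by move=> mA; rewrite -m2E ?integral_indic ?setIT//; exact: nnmeas_indic.
apply: ifun_unique => // A mA; rewrite -mE// -mE2//.
apply: (measure_unique G g) => //.
- by move=> B GB; rewrite mE ?mE2; [exact: h12|exact: mG|exact: mG].
- by move=> k; rewrite mE; [exact: goo|exact: mG].
Qed.

Lemma finite_measure_unique d (T : measurableType d) (G : set (set T))
    (m1 m2 : {measure set T -> \bar R}) :
  measurable = <<s G >> -> setI_closed G -> m1 setT < +oo ->
  m1 setT = m2 setT -> (forall A, G A -> m1 A = m2 A) ->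
  forall A, measurable A -> m1 A = m2 A.
Proof.
move=> GE GI m1oo m12 h A mA.
have mG B : G B -> measurable B by move=> GB; rewrite GE; exact: sub_sigma_algebra.
apply: (measure_unique (G `|` [set setT]) (fun=> setT)) => //.
- apply/seteqP; split.
    rewrite GE; apply: smallest_sub; first exact: smallest_sigma_algebra.
    by move=> B GB; apply: sub_sigma_algebra; left.
  apply: smallest_sub; first exact: sigma_algebra_measurable.
  by move=> B [/mG//|->].
- move=> B C [GB|->] [GC|->]; rewrite ?setIT ?setTI; [left|left|left|right] => //.
  exact: GI.
- by move=> i; right.
- by rewrite bigcup_const.
- by move=> B [GB|->]//; exact: h.
Qed.

Lemma ge0_integral_unique d (T : measurableType d)
    (m1 m2 : {measure set T -> \bar R}) :
  (forall A, measurable A -> m1 A = m2 A) ->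
  forall f, \int[m1]_x f x = \int[m2]_x f x.
Proof. by move=> h f; apply: eq_measure_integral => A mA _; exact: h. Qed.

Lemma density_measure d (T : measurableType d) (m : {measure set T -> \bar R})
    (w : T -> \bar R) : nnmeas w ->
  exists m' : {measure set T -> \bar R},
    (forall f, nnmeas f -> \int[m']_x f x = \int[m]_x (f x * w x)) /\
    (forall A, measurable A -> m' A = \int[m]_(x in A) w x).
Proof.
move=> hw; have [m' m'E] := ifun_measure (ifun_density (ifun_integral m) hw).
exists m'; split => // A mA.
have <- : \int[m']_x (\1_A x)%:E = m' A by rewrite integral_indic// setIT.
rewrite m'E; last exact: nnmeas_indic.
rewrite [RHS]integral_mkcond; apply: eq_integral => x _.
by rewrite patchE indicE; case: ifPn; rewrite ?mul1e ?mul0e.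
Qed.

(** It suffices to compare the two sides on indicators. *)
Lemma integral_density d (T : measurableType d)
    (m m' : {measure set T -> \bar R}) (w : T -> \bar R) : nnmeas w ->
  (forall A, measurable A -> m' A = \int[m]_(x in A) w x) ->
  forall f, nnmeas f -> \int[m']_x f x = \int[m]_x (f x * w x).
Proof.
move=> hw h f hf; have [m2 [m2I m2E]] := density_measure m hw.
rewrite -m2I//; apply: ge0_integral_unique => A mA.
by rewrite h// m2E.
Qed.

Lemma integral_indicM d (T : measurableType d) (m : {measure set T -> \bar R})
    (A : set T) (f : T -> \bar R) : measurable A ->
  \int[m]_x ((\1_A x)%:E * f x) = \int[m]_(x in A) f x.
Proof.
move=> mA; rewrite [RHS]integral_mkcond; apply: eq_integral => x _.
by rewrite patchE indicE; case: ifPn; rewrite ?mul1e ?mul0e.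
Qed.

Lemma integral_indicT d (T : measurableType d) (m : {measure set T -> \bar R})
    (A : set T) : measurable A -> \int[m]_x (\1_A x)%:E = m A.
Proof. by move=> mA; rewrite integral_indic// setIT. Qed.

Lemma integral_prob_cst d (T : measurableType d) (P : probability T R)
    (c : \bar R) : \int[P]_w c = c.
Proof.
rewrite integral_cst//; transitivity (c * 1); last by rewrite mule1.
by congr (_ * _); exact: probability_setT.
Qed.

Lemma image_measure d1 d2 (T1 : measurableType d1) (T2 : measurableType d2)
    (m : {measure set T1 -> \bar R}) (phi : T1 -> T2) :
  measurable_fun setT phi ->
  exists m' : {measure set T2 -> \bar R},
    (forall f, nnmeas f -> \int[m']_y f y = \int[m]_x f (phi x)) /\
    (forall B, measurable B -> m' B = m (phi @^-1` B)).
Proof.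
move=> mphi; have [m' m'E] := ifun_measure (ifun_comp (ifun_integral m) mphi).
exists m'; split => // B mB.
rewrite -integral_indicT// m'E; last exact: nnmeas_indic.
rewrite -integral_indicT//.
by rewrite -[X in measurable X]setTI; exact: mphi.
Qed.

End functional_tools.

(** * The Borel sets of the space of boundedly finite measures *)

Lemma cvg_initial (S : choiceType) (T : topologicalType) (f : S -> T)
    (F : set_system S) (s : S) : Filter F ->
  F --> (s : initial_topology f) <-> f @ F --> f s.
Proof.
move=> FF; split=> [Fs|Fs].
  by move=> A nA; apply: Fs; exact: (@initial_continuous _ _ f s A nA).
move=> A; rewrite nbhsE => -[B [[C oC <-] Cfs] BA].
apply: filterS BA _; apply: (Fs C); exact: open_nbhs_nbhs.
Qed.

Lemma cvg_ptws (I : Type) (V : topologicalType) (F : set_system (I -> V))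
    (g : I -> V) : Filter F ->
  F --> (g : {ptws I -> V}) <-> forall i, (fun f => f i) @ F --> g i.
Proof.
move=> FF; split.
  by move=> /cvg_sup h i; move/(_ i) : h => /cvg_initial.
by move=> h; apply/cvg_sup => i; apply/cvg_initial.
Qed.

Lemma ptws_eval_continuous (I : Type) (V : topologicalType) (i : I) :
  continuous (fun g : {ptws I -> V} => g i).
Proof.
move=> g; have FF : Filter (nbhs g) by exact: nbhs_filter.
have [h _] := @cvg_ptws I V (nbhs g) g FF.
exact: h.
Qed.

Section evaluations.
Context (R : realType) (X : completeMetricType R).

Lemma borel_open (O : set X) : open O -> measurable (O : set (borel X)).
Proof. by move=> oO; apply: sub_sigma_algebra. Qed.

Lemma borel_lsc (f : X -> R) : (forall t, open [set x | (t < f x)%R]) ->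
  measurable_fun (setT : set (borel X)) f.
Proof.
move=> h; apply: (measurability _ (RGenOInfty.measurableE R)).
move=> _ [_ [x ->] <-]; rewrite setTI; apply: borel_open.
rewrite [X in open X](_ : _ = [set y | (x < f y)%R])//.
by apply/seteqP; split => y /=; rewrite in_itv/= andbT.
Qed.

Lemma borel_continuous (f : X -> R) : continuous f ->
  measurable_fun (setT : set (borel X)) f.
Proof.
move=> /continuousP cf; apply: borel_lsc => t.
exact: (cf [set y | (t < y)%R] (@open_gt R t)).
Qed.

Lemma measurable_pairing (f : testfun X) :
  measurable_fun (setT : set (MX X)) (fun m : MX X => (\int[m]_x f x)%R).
Proof.
apply: (measurability _ (RGenOpens.measurableE R)).
move=> _ [U oU <-]; rewrite setTI; apply: sub_sigma_algebra.
have oV : open ((fun g : {ptws testfun X -> R} => g f) @^-1` U).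
  have c : continuous (fun g : {ptws testfun X -> R} => g f).
    exact: ptws_eval_continuous.
  move/continuousP : c; apply; case: oU => [a [b ->]]; exact: interval_open.
by move/continuousP : (@initial_continuous _ _ (@bf_pairing R X)) => /(_ _ oV).
Qed.

(** The distance to the complement of [O], cut at 1. *)
Definition codist (O : set X) (x : X) : R :=
  inf ([set 1%R] `|` [set mdist x y | y in ~` O]).

Lemma codist_has_inf O (x : X) : has_inf ([set 1%R] `|` [set mdist x y | y in ~` O]).
Proof.
split; first by exists 1%R; left.
by exists 0%R => _ [->//|[y _ <-]]; exact: mdist_ge0.
Qed.

Lemma codist_ge0 O x : (0 <= codist O x)%R.
Proof.
apply: lb_le_inf; first by exists 1%R; left.
by move=> _ [->//|[y _ <-]]; exact: mdist_ge0.
Qed.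

Lemma codist_out O x : ~ O x -> codist O x = 0%R.
Proof.
move=> nOx; apply/eqP; rewrite eq_le codist_ge0 andbT.
apply: ge_inf; first by case: (codist_has_inf O x).
by right; exists x => //; rewrite mdistxx.
Qed.

Lemma codist_gt0 O x : open O -> O x -> (0 < codist O x)%R.
Proof.
move=> oO Ox; have /nbhs_ballP[e e0 eO] : nbhs x O by exact: open_nbhs_nbhs.
have e0' : (0 < Num.min 1 e)%R by rewrite lt_min ltr01.
apply: (lt_le_trans e0'); apply: lb_le_inf; first by exists 1%R; left.
move=> _ [->|[y nOy <-]]; first by rewrite ge_min lexx.
rewrite ge_min; apply/orP; right; rewrite leNgt; apply/negP => ye.
by apply: nOy; apply: eO; rewrite ballEmdist.
Qed.

Lemma codist_lip O x y : (codist O x <= codist O y + mdist x y)%R.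
Proof.
rewrite -lerBlDr; apply: lb_le_inf; first by exists 1%R; left.
have lb z : has_lbound ([set 1%R] `|` [set mdist z y | y in ~` O]).
  by case: (codist_has_inf O z).
move=> _ [->|[z nOz <-]]; rewrite lerBlDr.
  apply: (@le_trans _ _ 1%R); last by rewrite lerDl mdist_ge0.
  by apply: ge_inf => //; left.
apply: (@le_trans _ _ (mdist x z)); first by apply: ge_inf => //; right; exists z.
by rewrite addrC; exact: metric_triangle.
Qed.

Lemma lip_continuous (f : X -> R) (k : R) :
  (forall x y, (f x <= f y + k * mdist x y)%R) -> continuous f.
Proof.
move=> h x; apply/cvgrPdist_lt => e e0; apply/nbhs_ballP.
exists (e / (`|k| + 1))%R => /=.
  by rewrite divr_gt0// ltr_wpDl.
move=> y; rewrite ballEmdist/= ltr_pdivlMr ?ltr_wpDl// => hy.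
have kd : (k * mdist x y < e)%R.
  apply: le_lt_trans hy; rewrite mulrC; apply: ler_wpM2l; first exact: mdist_ge0.
  by rewrite (le_trans (ler_norm _))// lerDl.
rewrite ltr_norml; apply/andP; split.
  rewrite ltrNl opprB ltrBlDr; apply: (le_lt_trans (h y x)).
  by rewrite metric_sym addrC ltrD2r.
by rewrite ltrBlDr; apply: (le_lt_trans (h x y)); rewrite addrC ltrD2r.
Qed.

(** Lipschitz functions that vanish outside the open set [O] and increase to
    its indicator. *)
Definition bump (O : set X) (n : nat) (x : X) : R :=
  Num.min 1%R (n%:R * codist O x)%R.

Lemma bump_ge0 O n x : (0 <= bump O n x)%R.
Proof. by rewrite /bump le_min ler01 mulr_ge0// codist_ge0. Qed.

Lemma bump_continuous O n : continuous (bump O n).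
Proof.
apply: (@lip_continuous _ n%:R) => x y; rewrite /bump.
have nd : (0 <= n%:R * mdist x y)%R by rewrite mulr_ge0 ?mdist_ge0.
rewrite addr_minl; rewrite le_min; apply/andP; split.
  by rewrite ge_min lerDl nd.
rewrite ge_min; apply/orP; right.
by rewrite -mulrDr ler_wpM2l// codist_lip.
Qed.

Lemma bump_bounded O n : exists M : R, forall x, (`|bump O n x| <= M)%R.
Proof. by exists 1%R => x; rewrite ger0_norm ?bump_ge0// /bump ge_min lexx. Qed.

Lemma bump_support (O : set X) n : metric_bounded O ->
  exists2 B : set X, metric_bounded B & forall x, ~ B x -> bump O n x = 0%R.
Proof.
move=> bO; exists O => // x nOx.
by rewrite /bump codist_out// mulr0 min_r.
Qed.

Lemma bump_cvg (O : set X) x : open O ->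
  (bump O n x)%:E @[n --> \oo] --> (\1_O x)%:E.
Proof.
move=> oO; rewrite indicE; apply: cvg_EFin; first exact: nearW.
have [/set_mem Ox|/negP nOx] := boolP (x \in O); last first.
  rewrite (_ : _ \o _ = fun=> 0%R); first exact: cvg_cst.
  by apply/funext => n /=; rewrite /bump codist_out ?mulr0 ?min_r// => /mem_set.
have c0 := codist_gt0 oO Ox.
apply: cvg_near_cst; near=> n; rewrite /= /bump min_l// -ler_pdivrMr//.
by near: n; exact: nbhs_infty_ger.
Unshelve. all: by end_near. Qed.

Lemma bump_nd (O : set X) x : nondecreasing_seq (fun n => (bump O n x)%:E).
Proof.
move=> m n mn; rewrite lee_fin /bump le_min ge_min lexx/= ge_min.
by rewrite ler_wpM2r ?orbT// ?codist_ge0// ler_nat.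
Qed.

(** The mass of a bounded open set is the monotone limit of the pairings with
    the test functions [bump O n]. *)
Lemma measurable_eval_open (O : set X) : open O -> metric_bounded O ->
  measurable_fun (setT : set (MX X)) (fun m : MX X => m (O : set (borel X))).
Proof.
move=> oO bO.
pose t n := TestFun (@bump_continuous O n) (bump_bounded O n) (bump_support n bO).
have mb n : measurable_fun (setT : set (borel X)) (fun x => (bump O n x)%:E).
  by apply/measurable_EFinP; apply: borel_continuous; exact: bump_continuous.
have tE n (m : MX X) : \int[m]_x (bump O n x)%:E = (\int[m]_x t n x)%R%:E.
  rewrite /Rintegral fineK// ge0_fin_numE; last first.
    by apply: integral_ge0 => x _; rewrite lee_fin bump_ge0.
  apply: (@le_lt_trans _ _ (\int[m]_x (\1_O x)%:E)).
    apply: ge0_le_integral => //.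
    - by move=> x _; rewrite lee_fin bump_ge0.
    - exact: mb.
    - by apply/measurable_EFinP; apply: measurable_indic; exact: borel_open.
    - move=> x _; rewrite lee_fin indicE /bump.
      have [_|/negP nOx] := boolP (x \in O); first by rewrite ge_min lexx.
      by rewrite /= /bump codist_out ?mulr0 ?ge_min ?lexx ?orbT// => /mem_set.
  rewrite integral_indic ?setIT//; last exact: borel_open.
  by apply: bf_finite => //; exact: borel_open.
have mE (m : MX X) : m (O : set (borel X)) = limn (fun n => (\int[m]_x t n x)%R%:E).
  have <- : \int[m]_x (\1_O x)%:E = m (O : set (borel X)).
    by rewrite integral_indic ?setIT//; exact: borel_open.
  rewrite (_ : (fun n => _) = (fun n => \int[m]_x (bump O n x)%:E)); last first.
    by apply/funext => n; rewrite tE.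
  rewrite -monotone_convergence//.
  - by apply: eq_integral => x _; apply/esym/cvg_lim => //; exact: bump_cvg.
  - by move=> n x _; rewrite lee_fin bump_ge0.
  - by move=> x _; exact: bump_nd.
rewrite (_ : (fun m : MX X => m O) =
    (fun m : MX X => limn (fun n => (\int[m]_x t n x)%R%:E))); last first.
  by apply/funext => m; exact: mE.
apply: (emeasurable_fun_cvg (fun n (m : MX X) => (\int[m]_x t n x)%R%:E)).
  by move=> n; apply/measurable_EFinP; exact: measurable_pairing.
move=> m _; apply: ereal_nondecreasing_is_cvgn => i j ij.
rewrite -!tE; apply: ge0_le_integral => //.
  by move=> x _; rewrite lee_fin bump_ge0.
by move=> x _; exact: bump_nd.
Qed.

Definition origin_ball (k : nat) : set (borel X) := ball (point : X) k.+1%:R.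

Lemma origin_ball_open k : open (origin_ball k : set X).
Proof.
rewrite openE => x xb; apply/nbhs_ballP; move: xb; rewrite /origin_ball ballEmdist/= => xb.
exists (k.+1%:R - mdist point x)%R => /=; first by rewrite subr_gt0.
move=> y; rewrite /origin_ball !ballEmdist/= ltrBrDl => xy.
exact: le_lt_trans (@metric_triangle _ _ point x y) _.
Qed.

Lemma origin_ball_measurable k : measurable (origin_ball k).
Proof. exact: borel_open (origin_ball_open k). Qed.

Lemma origin_ball_bounded k : metric_bounded (origin_ball k : set X).
Proof.
exists (k.+1%:R + k.+1%:R)%R => x y; rewrite /origin_ball ballEmdist/= => hx hy.
apply: (le_trans (@metric_triangle _ _ x point y)); rewrite lerD//; last exact: ltW.
by rewrite metric_sym ltW.
Qed.

Lemma origin_ball_nd : nondecreasing_seq origin_ball.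
Proof.
move=> m n mn; apply/subsetPset => x; rewrite /origin_ball ballEmdist/= => hx.
by rewrite ballEmdist/=; apply: (lt_le_trans hx); rewrite ler_nat.
Qed.

Lemma origin_ball_cover : \bigcup_k origin_ball k = setT.
Proof.
apply/seteqP; split => // x _.
have := truncnS_gt (mdist point x).
by set k := Num.truncn _ => h; exists k => //; rewrite /origin_ball ballEmdist.
Qed.

(** Inside a ball around the origin all masses are finite, so the sets with
    measurable evaluation form a Dynkin class that contains the open sets. *)
Lemma measurable_eval (A : set (borel X)) : measurable A ->
  measurable_fun (setT : set (MX X)) (fun m : MX X => m A).
Proof.
move=> mA.
have step k : measurable_fun (setT : set (MX X))
    (fun m : MX X => m (A `&` origin_ball k)).
  pose PP (B : set (borel X)) := measurable_fun (setT : set (MX X))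
    (fun m : MX X => m (B `&` origin_ball k)).
  have fin (m : MX X) B : measurable B -> m (B `&` origin_ball k) < +oo.
    move=> mB; apply: (le_lt_trans (le_measure m _ _ (@subIsetr _ B _))).
    - by apply/mem_set; apply: measurableI => //; exact: origin_ball_measurable.
    - by apply/mem_set; exact: origin_ball_measurable.
    - by apply: bf_finite; [exact: origin_ball_measurable|exact: origin_ball_bounded].
  have PT : PP setT.
    rewrite /PP.
    have -> : (fun m : MX X => m (setT `&` origin_ball k)) =
              (fun m : MX X => m (origin_ball k)).
      by apply/funext => m; rewrite setTI.
    by apply: measurable_eval_open; [exact: origin_ball_open|exact: origin_ball_bounded].
  apply: (@dynkin_induction _ (borel X) (@open X) PP) => //.
  - by move=> B C oB oC; exact: openI.
  - move=> B oB; apply: measurable_eval_open.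
      by apply: openI => //; exact: origin_ball_open.
    have [M hM] := origin_ball_bounded k.
    by exists M => x y [_ ?] [_ ?]; exact: hM.
  - move=> B mB PB; rewrite /PP.
    rewrite (_ : (fun _ => _) = (fun m : MX X =>
        m (setT `&` origin_ball k) - m (B `&` origin_ball k))).
      exact: emeasurable_funB.
    apply/funext => m; rewrite setTI (setIC B) -measureD.
    + by rewrite setDE setIC.
    + exact: origin_ball_measurable.
    + exact: mB.
    + by move: (fin m setT measurableT); rewrite setTI.
  - move=> F mF tF PF; rewrite /PP.
    rewrite (_ : (fun _ => _) = (fun m : MX X =>
        \sum_(n <oo) m (F n `&` origin_ball k))).
      by apply: ge0_emeasurable_sum => // n _; exact: PF.
    apply/funext => m; rewrite setI_bigcupl measure_semi_bigcup//.
    + by move=> n; apply: measurableI => //; exact: origin_ball_measurable.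
    + exact: trivIset_setIr.
    + apply: bigcup_measurable => n _; apply: measurableI => //.
      exact: origin_ball_measurable.
apply: (emeasurable_fun_cvg (fun n (m : MX X) => m (A `&` origin_ball n))) => //.
move=> m _.
rewrite [X in _ --> m X](_ : A = \bigcup_n (A `&` origin_ball n)).
  apply: nondecreasing_cvg_mu.
  - by move=> n; apply: measurableI => //; exact: origin_ball_measurable.
  - apply: bigcup_measurable => n _; apply: measurableI => //.
    exact: origin_ball_measurable.
  - move=> i j ij; apply/subsetPset; apply: setIS; apply/subsetPset.
    exact: origin_ball_nd.
by rewrite -setI_bigcupr origin_ball_cover setIT.
Qed.

End evaluations.

Section generated_by_evaluations.
Context (R : realType) (X : completeMetricType R).
Hypothesis sepX : separable X.

Definition evaluation_sets : set (set (MX X)) :=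
  [set V | exists2 A : set (borel X), measurable A &
    exists2 B : set (\bar R), measurable B &
      V = (fun m : MX X => m A) @^-1` B].

Lemma ballX_open (x : X) r : open (ball x r).
Proof.
rewrite openE => y; rewrite ballEmdist/= => xy; apply/nbhs_ballP.
exists (r - mdist x y)%R => /=; first by rewrite subr_gt0.
move=> z; rewrite !ballEmdist/= ltrBrDl => yz.
exact: le_lt_trans (metric_triangle x y z) yz.
Qed.

Lemma dense_sequence : exists e : nat -> X,
  forall (x : X) (r : R), (0 < r)%R -> exists i, ball (e i) r x.
Proof.
have [D cD dD] := sepX.
have [d0 [_ Dd0]] : [set: X] `&` D !=set0.
  by apply: dD; [exists point|exact: openT].
have [e De] : exists e : nat -> X, D `<=` range e.
  have /pfcard_geP[D0|[f]] := cD; first by move: Dd0; rewrite D0.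
  exists f => x Dx; have [n _ <-] := @surj _ _ _ _ f x Dx.
  by exists n.
exists e => x r r0.
have [|y [By /De[i _ eiy]]] := dD _ _ (@ballX_open x r).
  by exists x; exact: ballxx.
by exists i; rewrite eiy; exact: ball_sym.
Qed.

(** A rational multiple of the indicator of a ball around a point of the dense
    sequence [e]; the index [i] encodes the centre, the radius and the factor,
    and indices that encode nothing give [0]. *)
Definition scaled_ball (e : nat -> X) (i : nat) (x : X) : R :=
  if @choice.unpickle (nat * nat * rat)%type i is Some (j, k, v)
  then (@ratr R v * \1_(ball (e j) (k.+1%:R^-1)%R) x)%R else 0%R.

Definition ball_max e (F : seq nat) (x : X) : R :=
  (\big[Num.max/0]_(i <- F) scaled_ball e i x)%R.

Lemma ball_max_ge0 e F x : (0 <= ball_max e F x)%R.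
Proof. exact: bigmax_ge_id. Qed.

Lemma measurable_ball_max e F :
  measurable_fun (setT : set (borel X)) (ball_max e F).
Proof.
elim: F => [|i F ih].
  rewrite (_ : ball_max e [::] = fun=> 0%R)//.
  by apply/funext => x; rewrite /ball_max big_nil.
rewrite (_ : ball_max e (i :: F) = (scaled_ball e i) \max (ball_max e F)); last first.
  by apply/funext => x; rewrite /ball_max big_cons.
apply: measurable_maxr => //.
rewrite /scaled_ball; case: choice.unpickle => [[[j k] v]|]; last exact: measurable_cst.
apply: measurable_funM => //; apply: measurable_indic.
by apply: borel_open; exact: ballX_open.
Qed.

(** A lower semicontinuous function is the supremum of the countably many
    rational multiples of indicators of small balls below it. *)
Lemma lsc_approx e (g : X -> R) (m : {measure set (borel X) -> \bar R}) (t : R) :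
  (forall (x : X) (r : R), (0 < r)%R -> exists i, ball (e i) r x) ->
  (forall x, (0 <= g x)%R) ->
  (forall c, open [set x | (c < g x)%R]) ->
  t%:E < \int[m]_x (g x)%:E ->
  exists F, (forall x, (ball_max e F x <= g x)%R) /\
    t%:E < \int[m]_x (ball_max e F x)%:E.
Proof.
move=> he g0 og tg.
pose P i := `[< forall x, (scaled_ball e i x <= g x)%R >].
pose F N := [seq i <- iota 0 N | P i].
have Fg N x : (ball_max e (F N) x <= g x)%R.
  by rewrite /ball_max big_filter; apply: bigmax_le => // i /asboolP.
have nd x : nondecreasing_seq (fun N => (ball_max e (F N) x)%:E).
  move=> a b ab; rewrite lee_fin /ball_max !big_filter.
  by have := @le_bigmax_nat _ R 0%R 0%N a 0%N b P (fun i => scaled_ball e i x) (leqnn _) ab;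
    rewrite /index_iota !subn0.
have lim x : limn (fun N => (ball_max e (F N) x)%:E) = (g x)%:E.
  rewrite (cvg_lim _ (ereal_nondecreasing_cvgn (nd x)))//.
  apply/eqP; rewrite eq_le; apply/andP; split.
    by apply: ge_ereal_sup => _ [N _ <-]; rewrite lee_fin.
  rewrite leNgt; apply/negP => sg.
  set s := ereal_sup _ in sg.
  have s0 : 0 <= s.
    by apply: (@le_trans _ _ (ball_max e (F 0%N) x)%:E);
      [rewrite lee_fin ball_max_ge0|apply: ereal_sup_ubound; exists 0%N].
  have sfin : s \is a fin_num by rewrite ge0_fin_numE// (lt_trans sg)// ltry.
  move: sg; rewrite -(fineK sfin) lte_fin => /rat_in_itvoo[c].
  rewrite in_itv/= => /andP[sc cg].
  have /nbhs_ballP[r /= r0 rg] : nbhs x [set y | (ratr c < g y)%R].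
    by apply: open_nbhs_nbhs; split => //; exact: og.
  have [k hk] : exists k, (k.+1%:R^-1 + k.+1%:R^-1 < r)%R.
    exists (Num.truncn (2 / r)%R).
    rewrite [ltRHS]splitr ltrD// invf_plt ?posrE ?divr_gt0// invf_div;
      exact: truncnS_gt.
  have [j xj] := he x (k.+1%:R^-1)%R (ltac:(by rewrite invr_gt0)).
  have bg y : ball (e j) (k.+1%:R^-1)%R y -> (ratr c < g y)%R.
    move=> yj; apply: rg; apply: (le_ball (ltW hk)).
    apply: (@ball_triangle _ _ (e j)) => //; exact: ball_sym.
  pose i := choice.pickle (j, k, c).
  have ti y : scaled_ball e i y = (ratr c * \1_(ball (e j) (k.+1%:R^-1)%R) y)%R.
    by rewrite /scaled_ball /i choice.pickleK.
  have Pi : P i.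
    apply/asboolP => y; rewrite ti indicE.
    have [/set_mem yb|_] := boolP (y \in _); last by rewrite mulr0.
    by rewrite mulr1 ltW// bg.
  have : (ball_max e (F i.+1) x)%:E <= s by apply: ereal_sup_ubound; exists i.+1.
  rewrite -(fineK sfin) lee_fin leNgt => /negP; apply.
  apply: (lt_le_trans sc); rewrite /ball_max big_filter.
  apply: (@bigmax_sup_seq _ _ _ _ _ i) => //.
    by rewrite mem_iota/= add0n.
  by rewrite ti indicE mem_set// mulr1.
have : t%:E < limn (fun N => \int[m]_x (ball_max e (F N) x)%:E).
  rewrite -monotone_convergence//.
  - by under eq_integral do rewrite lim.
  - by move=> N; apply/measurable_EFinP; exact: measurable_ball_max.
  - by move=> N x _; rewrite lee_fin ball_max_ge0.
have ndi : nondecreasing_seq (fun N => \int[m]_x (ball_max e (F N) x)%:E).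
  move=> a b ab; apply: ge0_le_integral => //.
  - by move=> x _; rewrite lee_fin ball_max_ge0.
  - by apply/measurable_EFinP; exact: measurable_ball_max.
  - by apply/measurable_EFinP; exact: measurable_ball_max.
  - by move=> x _; exact: nd.
rewrite (cvg_lim _ (ereal_nondecreasing_cvgn ndi))//.
move=> /ereal_sup_gt[_ [N _ <-] tN].
by exists (F N).
Qed.

(** Codes of the sets from which neighbourhoods in the weak topology are
    built: a lower bound on the integral of a [ball_max], or an upper bound on
    the mass of a ball around the origin. *)
Definition nbhs_code : Type := (seq nat * rat + nat * rat)%type.

Definition basic (e : nat -> X) (p : nbhs_code) : set (MX X) :=
  match p with
  | inl (F, a) => [set m : MX X | (ratr a)%:E < \int[m]_x (ball_max e F x)%:E]
  | inr (j, b) => [set m : MX X | m (origin_ball j) < (ratr b)%:E]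
  end.

Fixpoint basics e (c : seq nbhs_code) : set (MX X) :=
  if c is p :: c' then basic e p `&` basics e c' else setT.

Lemma basics_cat e c c' : basics e (c ++ c') = basics e c `&` basics e c'.
Proof. by elim: c => [|p c ih] /=; rewrite ?setTI// ih setIA. Qed.

Lemma ratr_between (x y : R) : (x < y)%R -> exists q : rat, (x < ratr q < y)%R.
Proof. by move=> /rat_in_itvoo[q]; rewrite in_itv/= => h; exists q. Qed.

(** The integral of a lower semicontinuous function is a lower semicontinuous
    function of the measure, already for the topology generated by the coded
    sets. *)
Lemma lower_code e (g : X -> R) (m0 : MX X) (eps : R) :
  (forall (x : X) (r : R), (0 < r)%R -> exists i, ball (e i) r x) ->
  (forall x, (0 <= g x)%R) ->
  (forall c, open [set x | (c < g x)%R]) -> (0 < eps)%R ->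
  (forall m : MX X, \int[m]_x (g x)%:E < +oo) ->
  exists p, basic e p m0 /\ forall m : MX X, basic e p m ->
    (fine (\int[m0]_x (g x)%:E) - eps < fine (\int[m]_x (g x)%:E))%R.
Proof.
move=> he g0 og eps0 gfin.
have mg : measurable_fun (setT : set (borel X)) g by exact: borel_lsc.
have gf (m : MX X) : \int[m]_x (g x)%:E \is a fin_num.
  by rewrite ge0_fin_numE//; apply: integral_ge0 => x _; rewrite lee_fin.
have [F [Fg tF]] := @lsc_approx e g m0 (fine (\int[m0]_x (g x)%:E) - eps)%R
  he g0 og (ltac:(by rewrite -[ltRHS]fineK// lte_fin ltrBlDr ltrDl)).
have sg (m : MX X) : \int[m]_x (ball_max e F x)%:E <= \int[m]_x (g x)%:E.
  apply: ge0_le_integral => //.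
  - by move=> x _; rewrite lee_fin ball_max_ge0.
  - by apply/measurable_EFinP; exact: measurable_ball_max.
  - exact/measurable_EFinP.
  - by move=> x _; rewrite lee_fin.
have sf (m : MX X) : \int[m]_x (ball_max e F x)%:E \is a fin_num.
  rewrite ge0_fin_numE ?(le_lt_trans (sg m))//.
  by apply: integral_ge0 => x _; rewrite lee_fin ball_max_ge0.
move: tF; rewrite -(fineK (sf m0)) lte_fin => /ratr_between[a /andP[ta aF]].
exists (inl (F, a)); split; first by rewrite /= -(fineK (sf m0)) lte_fin.
move=> m /= am; apply: (lt_trans ta).
by rewrite -lte_fin fineK//; apply: (lt_le_trans am).
Qed.

Lemma metric_bounded_origin (B : set X) : metric_bounded B ->
  exists j, B `<=` (origin_ball j : set X).
Proof.
move=> [M hM]; have [[b Bb]|nB] := pselect (exists b, B b); last first.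
  by exists 0%N => x Bx; exfalso; apply: nB; exists x.
have := truncnS_gt (mdist point b + M)%R.
set k := Num.truncn _ => h; exists k => x Bx.
rewrite /origin_ball ballEmdist/=; apply: le_lt_trans h.
by apply: (le_trans (metric_triangle point b x)); rewrite lerD// hM.
Qed.

(** If [f] vanishes outside the ball [O] and is bounded by [M], then [M \1_O +
    f] and [M \1_O - f] are nonnegative and lower semicontinuous. Lower bounds
    on their integrals, with an upper bound on the mass of [O], confine the
    integral of [f]. *)
Lemma pairing_code e (f : testfun X) (m0 : MX X) (eps : R) :
  (forall (x : X) (r : R), (0 < r)%R -> exists i, ball (e i) r x) ->
  (0 < eps)%R ->
  exists c, basics e c m0 /\ forall m : MX X, basics e c m ->
    (`| bf_pairing m0 f - bf_pairing m f | < eps)%R.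
Proof.
move=> he eps0; have [M0 hM0] := testfun_bounded f.
pose M := (`|M0| + 1)%R.
have M_gt0 : (0 < M)%R by rewrite ltr_wpDl.
have hM x : (`|f x| <= M)%R.
  by rewrite (le_trans (hM0 x))// /M (le_trans (ler_norm _))// lerDl.
have [B bB fB] := testfun_support f.
have [j Bj] := metric_bounded_origin bB.
pose O : set (borel X) := origin_ball j.
have mO : measurable O by exact: origin_ball_measurable.
have fO x : ~ O x -> f x = 0%R by move=> nOx; apply: fB => /Bj.
have mf : measurable_fun (setT : set (borel X)) f.
  by apply: borel_continuous; exact: testfun_continuous.
have Ofin (m : MX X) : m O < +oo.
  by apply: bf_finite => //; exact: origin_ball_bounded.
have iOE (m : MX X) : \int[m]_x (M * \1_O x)%:E = (M * fine (m O))%:E.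
  under eq_integral do rewrite EFinM.
  have mind : measurable_fun (setT : set (borel X)) (fun x => (\1_O x)%:E : \bar R).
    by apply/measurable_EFinP; exact: measurable_indic.
  have M_ge0 := ltW M_gt0.
  rewrite (ge0_integralZl_EFin _ measurableT _ mind M_ge0)//.
  by rewrite integral_indic ?setIT// EFinM fineK// ge0_fin_numE// Ofin.
have iO (m : MX X) : m.-integrable setT (fun x => (M * \1_O x)%:E).
  apply/integrableP; split.
    apply/measurable_EFinP; apply: measurable_funM => //; exact: measurable_indic.
  under eq_integral do rewrite gee0_abs ?lee_fin ?mulr_ge0 ?(ltW M_gt0)//.
  by rewrite iOE ltry.
have if_ (m : MX X) : m.-integrable setT (fun x => (f x)%:E).
  apply: le_integrable (iO m) => //; first exact/measurable_EFinP.
  move=> x _; rewrite /= lee_fin indicE.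
  have [_|/negP nOx] := boolP (x \in O); first by rewrite mulr1 (ger0_norm (ltW M_gt0)).
  by rewrite fO ?normr0// => /mem_set.
have ifE (m : MX X) : \int[m]_x (f x)%:E = (bf_pairing m f)%:E.
  have h : \int[m]_x (f x)%:E \is a fin_num by apply: integrable_fin_num => //; exact: if_.
  by apply/esym; rewrite /bf_pairing /Rintegral; exact: fineK.
pose g1 x := (f x + M * \1_O x)%R.
pose g2 x := (M * \1_O x - f x)%R.
have ig1 (m : MX X) : \int[m]_x (g1 x)%:E = (bf_pairing m f + M * fine (m O))%:E.
  under eq_integral do rewrite EFinD.
  by rewrite integralD// ifE iOE.
have ig2 (m : MX X) : \int[m]_x (g2 x)%:E = (M * fine (m O) - bf_pairing m f)%:E.
  under eq_integral do rewrite EFinB.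
  by rewrite integralB// ifE iOE.
have g1_ge0 x : (0 <= g1 x)%R.
  rewrite /g1 indicE; have [_|/negP nOx] := boolP (x \in O).
    by rewrite mulr1 -lerBlDr sub0r; have := hM x; rewrite ler_norml => /andP[].
  by rewrite fO ?mulr0 ?addr0// => /mem_set.
have g2_ge0 x : (0 <= g2 x)%R.
  rewrite /g2 indicE; have [_|/negP nOx] := boolP (x \in O).
    by rewrite mulr1 subr_ge0; have := hM x; rewrite ler_norml => /andP[].
  by rewrite fO ?mulr0 ?subr0// => /mem_set.
have oO : open (O : set X) by exact: origin_ball_open.
have lsc (g h : X -> R) : continuous h -> (forall x, O x -> g x = h x) ->
    (forall x, ~ O x -> g x = 0%R) -> (forall x, (0 <= g x)%R) ->
    forall c, open [set x | (c < g x)%R].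
  move=> ch gO gnO g0 c; have [c0|c0] := ltP c 0%R.
    rewrite (_ : [set _ | _] = setT); first exact: openT.
    by apply/seteqP; split => // x _ /=; rewrite (lt_le_trans c0).
  rewrite (_ : [set _ | _] = O `&` h @^-1` [set y | (c < y)%R]).
    by apply: openI => //; move/continuousP : ch; apply; exact: open_gt.
  apply/seteqP; split => x /=.
    have [Ox|nOx] := pselect (O x); first by rewrite gO.
    by rewrite gnO// ltNge c0.
  by move=> [Ox]; rewrite gO.
have cf : continuous f by exact: testfun_continuous.
have lsc1 : forall c, open [set x | (c < g1 x)%R].
  apply: (lsc _ (fun x => f x + M)%R) => //.
  - move=> x; apply: cvgD; [exact: cf|exact: cvg_cst].
  - by move=> x Ox; rewrite /g1 indicE mem_set// mulr1.
  - by move=> x nOx; rewrite /g1 fO// indicE memNset// mulr0 addr0.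
have lsc2 : forall c, open [set x | (c < g2 x)%R].
  apply: (lsc _ (fun x => M - f x)%R) => //.
  - move=> x; apply: cvgB; [exact: cvg_cst|exact: cf].
  - by move=> x Ox; rewrite /g2 indicE mem_set// mulr1.
  - by move=> x nOx; rewrite /g2 fO// indicE memNset// mulr0 subr0.
pose d : R := (eps / (1 + M))%R.
have d0 : (0 < d)%R by rewrite divr_gt0// addr_gt0.
have [p1 [p10 hp1]] := @lower_code e g1 m0 d he g1_ge0 lsc1 d0
  (fun m => ltac:(by rewrite ig1 ltry)).
have [p2 [p20 hp2]] := @lower_code e g2 m0 d he g2_ge0 lsc2 d0
  (fun m => ltac:(by rewrite ig2 ltry)).
have [b /andP[ob bo]] : exists q : rat, (fine (m0 O) < ratr q < fine (m0 O) + d)%R.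
  by apply: ratr_between; rewrite ltrDl.
exists [:: p1; p2; inr (j, b)]; split.
  split => //; split => //; split => //=.
  by rewrite -/O -[ltLHS]fineK ?lte_fin// ge0_fin_numE// Ofin.
move=> m [/hp1 h1 [/hp2 h2 [/= h3 _]]].
have {h3} h3 : (fine (m O) < fine (m0 O) + d)%R.
  apply: lt_trans bo; rewrite -lte_fin fineK// ge0_fin_numE// Ofin//.
move: h1 h2; rewrite !ig1 !ig2 /= => h1 h2.
have Mh : (M * fine (m O) < M * fine (m0 O) + M * d)%R.
  by rewrite -mulrDr ltr_pM2l.
have dE : (d + M * d = eps)%R.
  rewrite -{1}(mul1r d) -mulrDl /d mulrC divfK// gt_eqF// addr_gt0//.
by rewrite ltr_norml; apply/andP; split; lra.
Qed.

(** The coded sets are countably many, and between a point and any weak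
    neighbourhood of it lies a finite intersection of them; hence a weakly
    open set is a countable union of such intersections. *)
Lemma open_evaluation (W : set (initial_topology (@bf_pairing R X))) :
  open W -> <<s evaluation_sets >> (W : set (MX X)).
Proof.
move=> oW; have [e he] := dense_sequence.
pose B n : set (MX X) := if @choice.unpickle (seq nbhs_code) n is Some c then
  if `[< basics e c `<=` W >] then basics e c else set0 else set0.
have -> : (W : set (MX X)) = \bigcup_n B n.
  apply/seteqP; split; last first.
    move=> m [n _]; rewrite /B; case: choice.unpickle => [c|//].
    by case: ifPn => [/asboolP + |//]; apply.
  move=> m0 Wm0.
  pose F := filter_from [set c | basics e c m0] (basics e).
  have FF : Filter F.
    apply: filter_from_filter; first by exists [::].
    move=> c c' hc hc'; exists (c ++ c'); last by rewrite basics_cat.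
    by rewrite /= basics_cat.
  have : F --> (m0 : initial_topology (@bf_pairing R X)).
    apply/cvg_initial; apply/(@cvg_ptws (testfun X) R) => f.
    apply/cvgrPdist_lt => eps eps0.
    have [c [c0 hc]] := pairing_code f m0 he eps0.
    by exists c => // m /hc.
  move=> /(_ W); case; first exact: open_nbhs_nbhs.
  move=> c hc cW; exists (choice.pickle c) => //.
  by rewrite /B choice.pickleK asboolT.
pose ME := g_sigma_algebraType evaluation_sets.
have mev (A : set (borel X)) : measurable A ->
    measurable_fun (setT : set ME) (fun m : ME => (m : bfmeasure X) A).
  move=> mA _ C mC; rewrite setTI; apply: sub_sigma_algebra.
  by exists A => //; exists C.
have mint (s : borel X -> \bar R) : nnmeas s ->
    measurable_fun (setT : set ME) (fun m : ME => \int[(m : bfmeasure X)]_x s x).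
  move=> [s0 ms].
  exact: (@measurable_fun_integral_kernel _ _ ME (borel X) R
    (fun m : ME => bf_measure (m : bfmeasure X)) mev s s0 ms).
have mbasic p : measurable (basic e p : set ME).
  case: p => [[F a]|[j b]].
  - have hs : nnmeas (fun x : borel X => (ball_max e F x)%:E).
      split; first by move=> x; rewrite lee_fin ball_max_ge0.
      by apply/measurable_EFinP; exact: measurable_ball_max.
    have := emeasurable_fun_o_infty measurableT (mint _ hs) (ratr a)%:E.
    by rewrite setTI.
  - have := emeasurable_fun_infty_o measurableT (mev _ (@origin_ball_measurable R X j)) (ratr b)%:E.
    by rewrite setTI.
have mbasics c : measurable (basics e c : set ME).
  elim: c => [|p c ih]; first exact: measurableT.
  exact: measurableI.
apply: (@bigcupT_measurable _ ME) => n.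
rewrite /B; case: choice.unpickle => [c|]; last exact: measurable0.
by case: ifPn => _; [exact: mbasics|exact: measurable0].
Qed.

(** Measurability of a random measure can be checked on the evaluations [m |->
    m A]. *)
Lemma MX_measurableE : (@measurable _ (MX X)) = <<s evaluation_sets >>.
Proof.
apply/seteqP; split.
  apply: smallest_sub; first exact: smallest_sigma_algebra.
  by move=> W oW; exact: open_evaluation.
apply: smallest_sub; first exact: sigma_algebra_measurable.
move=> _ [A mA [B mB ->]].
by have := measurable_eval mA measurableT mB; rewrite setTI.
Qed.

Lemma measurable_to_MX d (T : measurableType d) (f : T -> MX X) :
  (forall A : set (borel X), measurable A ->
    measurable_fun setT (fun t => f t A)) ->
  measurable_fun setT f.
Proof.
move=> h; apply: (measurability _ MX_measurableE).
move=> _ [_ [A mA [B mB ->]] <-].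
exact: (h A mA measurableT B mB).
Qed.

End generated_by_evaluations.

(** * Laplace transforms, independence and uniqueness *)

Section negative_exponential.
Context (R : realType).
Implicit Types x y : \bar R.

Definition enexp x : \bar R := expeR (- x).

Lemma enexp_ge0 x : 0 <= enexp x. Proof. exact: expeR_ge0. Qed.

Lemma enexp0 : enexp 0 = 1. Proof. by rewrite /enexp oppe0 expeR0. Qed.

Lemma enexp_le1 x : 0 <= x -> enexp x <= 1.
Proof. by move=> x0; rewrite /enexp -expeR0 lee_expeR leeNl oppe0. Qed.

Lemma enexp_fin x : 0 <= x -> enexp x \is a fin_num.
Proof.
by move=> /enexp_le1 h; rewrite ge0_fin_numE ?enexp_ge0// (le_lt_trans h)// ltry.
Qed.

Lemma enexpD x y : 0 <= x -> 0 <= y -> enexp (x + y) = enexp x * enexp y.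
Proof.
move=> x0 y0; rewrite /enexp oppeD ?expeRD//.
by apply: ge0_adde_def; rewrite inE.
Qed.

Lemma enexp_le x y : x <= y -> enexp y <= enexp x.
Proof. by move=> xy; rewrite /enexp lee_expeR leeN2. Qed.

Lemma enexp_EFin (r : R) : enexp r%:E = (expR (- r))%:E.
Proof. by []. Qed.

Lemma enexp_gt0 x : x < +oo -> 0 < enexp x.
Proof. by move=> xoo; apply: expeR_gt0; rewrite lteNr. Qed.

Lemma enexp_sum I (s : seq I) (f : I -> \bar R) : (forall i, 0 <= f i) ->
  enexp (\sum_(i <- s) f i) = \prod_(i <- s) enexp (f i).
Proof.
move=> f0; elim: s => [|i s ih]; first by rewrite !big_nil enexp0.
by rewrite !big_cons enexpD ?ih//; exact: sume_ge0.
Qed.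

Lemma measurable_enexp : measurable_fun setT enexp.
Proof.
apply: (measurability _ (ErealGenOInfty.measurableE R)).
move=> _ [_ [r ->] <-]; rewrite setTI.
have [r0|r0] := ltP r 0%R.
  rewrite (_ : _ @^-1` _ = setT); first exact: measurableT.
  apply/seteqP; split => // x _ /=; rewrite in_itv/= andbT.
  by rewrite (lt_le_trans _ (enexp_ge0 x)).
have [->|rn0] := eqVneq r 0%R.
  rewrite (_ : _ @^-1` _ = [set x | x < +oo]).
    by have := emeasurable_fun_infty_o measurableT (@measurable_id _ (\bar R) setT) +oo;
      rewrite setTI.
  apply/seteqP; split => x /=; rewrite in_itv/= andbT.
    by rewrite ltey; apply: contraPneq => ->; rewrite /enexp/= ltxx.
  exact: enexp_gt0.
have r_gt0 : (0 < r)%R by rewrite lt_neqAle eq_sym rn0.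
rewrite (_ : _ @^-1` _ = [set x | x < (- ln r)%:E]).
  by have := emeasurable_fun_infty_o measurableT (@measurable_id _ (\bar R) setT) (- ln r)%:E;
      rewrite setTI.
have rE : r%:E = expeR (ln r)%:E by rewrite /= lnK.
by apply/seteqP; split => x /=; rewrite in_itv/= andbT rE lte_expeR lteNr.
Qed.

Lemma nnmeas_enexp d (T : measurableType d) (f : T -> \bar R) :
  measurable_fun setT f -> nnmeas (fun x : T => enexp (f x)).
Proof.
by move=> mf; split; [move=> x; exact: enexp_ge0|exact: measurableT_comp measurable_enexp mf].
Qed.

End negative_exponential.

Section laplace_uniqueness.
Context (R : realType).

Lemma bernoulli_ge (y : R) (n : nat) : (0 <= y)%R ->
  (1 + n%:R * y <= (1 + y) ^+ n)%R.
Proof.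
move=> y0; elim: n => [|n ih]; first by rewrite mul0r addr0 expr0.
rewrite exprS; apply: (@le_trans _ _ ((1 + y) * (1 + n%:R * y))%R).
  rewrite -natr1 mulrDl mul1r mulrDl mulrDr mulr1 mul1r.
  have : (0 <= y * (n%:R * y))%R by rewrite !mulr_ge0.
  by lra.
by rewrite ler_wpM2l// addr_ge0.
Qed.

Lemma bernoulli_le (y : R) (n : nat) : (0 <= y <= 1)%R ->
  (1 - n%:R * y <= (1 - y) ^+ n)%R.
Proof.
move=> /andP[y0 y1]; elim: n => [|n ih]; first by rewrite mul0r subr0 expr0.
rewrite exprS; apply: (@le_trans _ _ ((1 - y) * (1 - n%:R * y))%R).
  rewrite -natr1 mulrDl mul1r mulrBl mulrBr mulr1 mul1r.
  have : (0 <= y * (n%:R * y))%R by rewrite !mulr_ge0.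
  by lra.
by rewrite ler_wpM2l// subr_ge0.
Qed.

Lemma natr_expr_cvg0 (y : R) : (0 <= y < 1)%R ->
  (n%:R * y ^+ n)%R @[n --> \oo] --> (0 : R)%R.
Proof.
move=> /andP[y0 y1].
have [->|yn0] := eqVneq y 0%R.
  apply: cvg_near_cst; near=> n.
  by rewrite expr0n gt_eqF ?mulr0//; near: n; exists 1%N.
pose s := Num.sqrt y.
have s0 : (0 < s)%R by rewrite sqrtr_gt0 lt_neqAle eq_sym yn0.
have s1 : (s < 1)%R by rewrite -sqrtr1 ltr_sqrt.
have ys : y = (s * s)%R by rewrite -expr2 sqr_sqrtr.
pose c := (s^-1 - 1)%R.
have c0 : (0 < c)%R by rewrite subr_gt0 invf_gt1.
have bnd n : (n%:R * s ^+ n <= c^-1)%R.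
  have := @bernoulli_ge c n (ltW c0).
  have -> : (1 + c = s^-1)%R by rewrite /c addrC subrK.
  move=> h.
  rewrite -(ler_pM2r c0) mulVf ?gt_eqF// mulrAC.
  apply: (@le_trans _ _ ((s^-1 ^+ n) * s ^+ n)%R).
    rewrite ler_wpM2r ?exprn_ge0 ?(ltW s0)//; apply: le_trans h.
    by rewrite lerDr.
  by rewrite -exprMn mulVf ?gt_eqF// expr1n.
apply: (@squeeze_cvgr _ _ _ _ (fun=> 0%R) (fun n => c^-1 * s ^+ n)%R).
- apply: nearW => n; rewrite mulr_ge0 ?exprn_ge0//=.
  by rewrite ys exprMn mulrA ler_wpM2r// exprn_ge0// ltW.
- exact: cvg_cst.
- rewrite -[X in _ --> X](mulr0 (c^-1)%R); apply: cvgM; first exact: cvg_cst.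
  by apply: cvg_expr; rewrite ger0_norm// ltW.
Unshelve. all: by end_near. Qed.

(** The powers [(1 - x^N)^(N 2^N)] separate [x < 1/2] from [1/2 <= x], by
    Bernoulli's inequality. *)
Lemma step_cvg (x : R) : (0 <= x <= 1)%R ->
  ((1 - x ^+ N) ^+ (N * 2 ^ N))%R @[N --> \oo] -->
  (if (2 * x < 1)%R then 1%R else 0%R : R).
Proof.
move=> /andP[x0 x1].
have xN N : (0 <= x ^+ N <= 1)%R by rewrite exprn_ge0//= exprn_ile1.
have natE N : ((N * 2 ^ N)%:R * x ^+ N = N%:R * (2 * x) ^+ N :> R)%R.
  by rewrite natrM natrX exprMn mulrA.
case: ltP => hx.
  apply: (@squeeze_cvgr _ _ _ _ (fun N => 1 - N%:R * (2 * x) ^+ N)%R (fun=> 1%R)).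
  - apply: nearW => N; rewrite -natE bernoulli_le//=.
    have /andP[a b] := xN N; rewrite exprn_ile1// ?subr_ge0//.
    by rewrite lerBlDr lerDl.
  - rewrite -[X in _ --> X]subr0; apply: cvgB; first exact: cvg_cst.
    by apply: natr_expr_cvg0; rewrite mulr_ge0.
  - exact: cvg_cst.
apply: (@squeeze_cvgr _ _ _ _ (fun=> 0%R) (fun N => (N%:R + 1)^-1)%R).
- apply: nearW => N; have /andP[a b] := xN N.
  rewrite exprn_ge0 ?subr_ge0//=.
  have h1 : (N%:R + 1 <= (1 + x ^+ N) ^+ (N * 2 ^ N))%R.
    apply: le_trans (bernoulli_ge _ a); rewrite natE addrC lerD2l.
    by rewrite ler_peMr// exprn_ege1.
  rewrite -[leRHS]mul1r ler_pdivlMr; last by rewrite ltr_wpDl.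
  apply: (@le_trans _ _ ((1 - x ^+ N) ^+ (N * 2 ^ N) * (1 + x ^+ N) ^+ (N * 2 ^ N))%R).
    by rewrite ler_wpM2l// exprn_ge0// subr_ge0.
  rewrite -exprMn exprn_ile1//.
    by rewrite mulr_ge0 ?subr_ge0// addr_ge0.
  rewrite -subr_sqr expr1n lerBlDr lerDl exprn_ge0//.
- exact: cvg_cst.
- apply/cvgrPdist_lt => e e0; near=> N.
  rewrite sub0r normrN ger0_norm ?invr_ge0 ?addr_ge0//.
  have N1 : (0 < N%:R + 1 :> R)%R by rewrite ltr_wpDl.
  rewrite invf_plt ?posrE//.
  apply: (@le_lt_trans _ _ N%:R); first by near: N; exact: nbhs_infty_ger.
  by rewrite ltrDl.
Unshelve. all: by end_near. Qed.

Lemma bounded_integral_eq_lim d (T : measurableType d)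
    (m1 m2 : {measure set T -> \bar R}) (f_ : nat -> T -> R) (f : T -> R) :
  m1 setT < +oo -> m2 setT < +oo ->
  (forall n, measurable_fun setT (f_ n)) ->
  (forall n x, (`|f_ n x| <= 1)%R) ->
  (forall x, f_ ^~ x @ \oo --> f x) ->
  (forall n, \int[m1]_x (f_ n x)%:E = \int[m2]_x (f_ n x)%:E) ->
  \int[m1]_x (f x)%:E = \int[m2]_x (f x)%:E.
Proof.
move=> m1oo m2oo mf bf cf h.
have mlim : measurable_fun setT f by apply: (measurable_fun_cvg (h := f_)) => // x _; exact: cf.
have key (m : {measure set T -> \bar R}) : m setT < +oo ->
    (fun n => \int[m]_x (f_ n x)%:E) @ \oo --> \int[m]_x (f x)%:E.
  move=> moo.
  have H1 n : measurable_fun setT (fun x => (f_ n x)%:E) by exact/measurable_EFinP.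
  have H2 : measurable_fun setT (fun x => (f x)%:E) by exact/measurable_EFinP.
  have H3 : {ae m, forall x, setT x ->
      (fun n => (f_ n x)%:E) @ \oo --> (f x)%:E}.
    by apply: aeW => x _; apply: cvg_EFin; [exact: nearW|exact: cf].
  have H4 : m.-integrable setT (cst 1).
    apply/integrableP; split => //; under eq_integral do rewrite abse1.
    by rewrite integral_cst// mul1e.
  have H5 : {ae m, forall x n, setT x -> `|(f_ n x)%:E| <= cst 1 x}.
    by apply: aeW => x n _; rewrite lee_fin.
  by have [_ _] := dominated_convergence measurableT H1 H2 H3 H4 H5.
have /cvg_lim <- // := key m1 m1oo.
have /cvg_lim <- // := key m2 m2oo.
by congr (limn _); apply/funext => n; exact: h.
Qed.

Lemma poly_integral_eq d (T : measurableType d)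
    (m1 m2 : {measure set T -> \bar R}) (phi : T -> R) (p : {poly R}) :
  m1 setT < +oo -> m2 setT < +oo ->
  measurable_fun setT phi -> (forall x, (0 <= phi x <= 1)%R) ->
  (forall n, \int[m1]_x (phi x ^+ n)%:E = \int[m2]_x (phi x ^+ n)%:E) ->
  \int[m1]_x (p.[phi x])%:E = \int[m2]_x (p.[phi x])%:E.
Proof.
move=> m1oo m2oo mphi phi01 h.
have int (m : {measure set T -> \bar R}) n (c : R) : m setT < +oo ->
    m.-integrable setT (fun x => (c * phi x ^+ n)%:E).
  move=> moo; apply: measurable_bounded_integrable => //.
    by apply: measurable_funM => //; exact: measurable_funX.
  exists `|c|%R; split; first exact: num_real.
  move=> M cM x _ /=; rewrite normrM; apply: le_trans (ltW cM).
  have /andP[a b] := phi01 x.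
  by rewrite ler_piMr// ger0_norm ?exprn_ge0// exprn_ile1.
have key (m : {measure set T -> \bar R}) : m setT < +oo ->
    \int[m]_x (p.[phi x])%:E =
    \sum_(i < size p) (p`_i)%:E * \int[m]_x (phi x ^+ i)%:E.
  move=> moo; under eq_integral do rewrite horner_coef -sumEFin.
  rewrite (@integral_sum _ _ _ m setT measurableT _
    (fun (i : 'I_(size p)) x => (p`_i * phi x ^+ i)%:E)); last by move=> i; exact: int.
  apply: eq_bigr => i _; under eq_integral do rewrite EFinM.
  rewrite integralZl//; have := int m i 1%R moo.
  by under eq_fun do rewrite mul1r.
by rewrite !key//; apply: eq_bigr => i _; rewrite h.
Qed.

(** A finite measure is determined on the sigma-algebra of [Z] by its Laplace
    transform: the powers of [exp (- t Z)] are again of this form, and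
    polynomials in it approximate the indicator of [Z > c]. *)
Lemma laplace_unique d (T : measurableType d)
    (m1 m2 : {measure set T -> \bar R}) (Z : T -> \bar R) :
  m1 setT < +oo -> m2 setT < +oo -> nnmeas Z ->
  (forall t : R, (0 <= t)%R ->
    \int[m1]_x enexp (t%:E * Z x) = \int[m2]_x enexp (t%:E * Z x)) ->
  forall B, measurable B -> m1 (Z @^-1` B) = m2 (Z @^-1` B).
Proof.
move=> m1oo m2oo [Z0 mZ] h.
have mass : m1 setT = m2 setT.
  have := h 0%R (lexx _); under eq_integral do rewrite mul0e enexp0.
  under [in RHS]eq_integral do rewrite mul0e enexp0.
  by rewrite !integral_cst// !mul1e.
have mZP B : measurable B -> measurable (Z @^-1` B).
  by move=> mB; rewrite -[X in measurable X]setTI; exact: mZ.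
have above (c : R) : (0 < c)%R -> m1 [set x | c%:E < Z x] = m2 [set x | c%:E < Z x].
  move=> c0; pose t : R := (ln 2 / c)%R.
  have ln2 : (0 < ln 2 :> R)%R by rewrite ln_gt0// ltr1n.
  have t0 : (0 < t)%R by rewrite divr_gt0.
  have tc : (t * c = ln 2)%R by rewrite /t divfK// gt_eqF.
  clearbody t.
  have tZ0 x : 0 <= t%:E * Z x by rewrite mule_ge0 ?lee_fin ?(ltW t0).
  pose phi x : R := fine (enexp (t%:E * Z x)).
  have phiE x : (phi x)%:E = enexp (t%:E * Z x).
    by rewrite /phi fineK//; exact: enexp_fin.
  have mphi : measurable_fun setT phi.
    apply/measurable_EFinP; rewrite (_ : _ \o _ = fun x => enexp (t%:E * Z x)).
      by apply: (nnmeas_enexp _).2; exact: measurable_funeM.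
    by apply/funext => x; rewrite /= phiE.
  have phi01 x : (0 <= phi x <= 1)%R.
    by rewrite -!lee_fin phiE enexp_ge0 enexp_le1.
  have hphi n : \int[m1]_x (phi x ^+ n)%:E = \int[m2]_x (phi x ^+ n)%:E.
    have E x : (phi x ^+ n)%:E = enexp ((n%:R * t)%:E * Z x).
      elim: n => [|n ih]; first by rewrite expr0 mul0r mul0e enexp0.
      rewrite exprS EFinM ih phiE -natr1 mulrDl mul1r addrC EFinD.
      rewrite ge0_muleDl ?lee_fin ?mulr_ge0 ?(ltW t0)//.
      by rewrite enexpD// mule_ge0// lee_fin mulr_ge0// ltW.
    under eq_integral do rewrite E; under [in RHS]eq_integral do rewrite E.
    by apply: h; rewrite mulr_ge0// ltW.
  have stepE x : (if (2 * phi x < 1)%R then 1%R else 0%R : R) =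
                 \1_[set y | c%:E < Z y] x.
    rewrite indicE; suff -> : (2 * phi x < 1)%R = (x \in [set y | c%:E < Z y]).
      by case: (_ \in _).
    have -> : (2 * phi x < 1)%R = (phi x < expR (- ln 2))%R.
      by rewrite expRN lnK ?posrE// -ltr_pdivlMl// mulr1.
    rewrite -lte_fin phiE (_ : (expR (- ln 2))%:E = enexp (ln 2)%:E)//.
    rewrite /enexp lte_expeR lteN2.
    rewrite -tc EFinM lte_pmul2l ?lte_fin//.
    by apply/idP/idP => [l|/set_mem//]; exact/mem_set.
  have mS : measurable [set x | c%:E < Z x].
    by have := emeasurable_fun_o_infty measurableT mZ c%:E; rewrite setTI.
  pose S : set T := [set x | c%:E < Z x].
  have : \int[m1]_x (\1_S x)%:E = \int[m2]_x (\1_S x)%:E.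
    apply: (@bounded_integral_eq_lim _ _ m1 m2
      (fun N x => ((1 - phi x ^+ N) ^+ (N * 2 ^ N))%R)) => //.
    - move=> N; apply: measurable_funX; apply: measurable_funB => //.
      exact: measurable_funX.
    - move=> N x; have /andP[a b] := phi01 x.
      have ? : (0 <= 1 - phi x ^+ N)%R by rewrite subr_ge0 exprn_ile1.
      rewrite ger0_norm ?exprn_ge0// exprn_ile1//.
      by rewrite lerBlDr lerDl exprn_ge0.
    - by move=> x; rewrite /S -stepE; exact: step_cvg.
    - move=> N; pose p : {poly R} := ((1 - 'X^N) ^+ (N * 2 ^ N))%R.
      have pE x : (((1 - phi x ^+ N) ^+ (N * 2 ^ N))%R = p.[phi x])%R.
        by rewrite /p horner_exp !hornerE.
      under eq_integral do rewrite pE; under [in RHS]eq_integral do rewrite pE.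
      exact: poly_integral_eq.
  by rewrite !integral_indic// !setIT.
move=> B mB.
have [n1 [_ n1P]] := image_measure m1 mZ.
have [n2 [_ n2P]] := image_measure m2 mZ.
rewrite -n1P// -n2P//.
apply: (finite_measure_unique (ErealGenOInfty.measurableE R)) => //.
- move=> _ _ [r ->] [s ->]; exists (Num.max r s).
  by apply/seteqP; split => x /=; rewrite !in_itv/= !andbT EFin_max gt_max => /andP.
- by rewrite n1P// preimage_setT.
- by rewrite n1P// n2P// preimage_setT.
move=> _ [r ->].
have mr : measurable (`]r%:E, +oo[%classic : set (\bar R)).
  exact: emeasurable_itv.
rewrite n1P// n2P//.
have pE (s : R) : Z @^-1` `]s%:E, +oo[%classic = [set x | s%:E < Z x].
  by apply/seteqP; split => x /=; rewrite in_itv/= andbT.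
rewrite pE; have [r0|r0|r0] := ltgtP r 0%R.
- rewrite (_ : [set _ | _] = setT)//; apply/seteqP; split => // x _ /=.
  by rewrite (lt_le_trans _ (Z0 x))// lte_fin.
- exact: above.
rewrite r0.
have U : [set x | 0%:E < Z x] = \bigcup_n [set x | (n.+1%:R^-1 : R)%:E < Z x].
  apply/seteqP; split => x /=; last first.
    by move=> [n _ /=]; apply: lt_trans; rewrite lte_fin invr_gt0.
  move=> Zx; have [Zy|Zoo] := eqVneq (Z x) +oo; first by exists 0%N => //=; rewrite Zy ltry.
  have Zf : Z x \is a fin_num by rewrite ge0_fin_numE// ltey.
  move: Zx; rewrite -(fineK Zf) lte_fin => Zx.
  exists (Num.truncn (fine (Z x))^-1) => //=.
  rewrite -(fineK Zf) lte_fin invf_plt ?posrE//; exact: truncnS_gt.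
have nd : nondecreasing_seq (fun n => [set x | (n.+1%:R^-1 : R)%:E < Z x]).
  move=> i j ij; apply/subsetPset => x /=; apply: le_lt_trans.
  by rewrite lee_fin lef_pV2 ?posrE// ler_nat.
have mS n : measurable [set x | (n.+1%:R^-1 : R)%:E < Z x].
  by have := emeasurable_fun_o_infty measurableT mZ (n.+1%:R^-1 : R)%:E; rewrite setTI.
rewrite U.
have /cvg_lim <- // := @nondecreasing_cvg_mu _ _ _ m1 _ mS (bigcupT_measurable _ mS) nd.
have /cvg_lim <- // := @nondecreasing_cvg_mu _ _ _ m2 _ mS (bigcupT_measurable _ mS) nd.
by congr (limn _); apply/funext => n /=; apply: above; rewrite invr_gt0.
Qed.

End laplace_uniqueness.

Section independence.
Context (R : realType) d (Om : measurableType d) (P : probability Om R).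
Implicit Types f Y : Om -> \bar R.

Definition unit_fun f := nnmeas f /\ forall w, f w <= 1.

Lemma prode_le1 (I : Type) (s : seq I) (A : pred I) (f : I -> \bar R) :
  (forall i, 0 <= f i <= 1) -> 0 <= \prod_(i <- s | A i) f i <= 1.
Proof.
move=> h; elim/big_rec : _ => [|i x _ /andP[x0 x1]]; first by rewrite lee01 lexx.
have /andP[f0 f1] := h i; rewrite mule_ge0//=.
by rewrite -[leRHS]mule1; apply: lee_pmul.
Qed.

Lemma unit_fun_prod (I : finType) (A : pred I) (f : I -> Om -> \bar R) :
  (forall i, unit_fun (f i)) -> unit_fun (fun w => \prod_(i | A i) f i w).
Proof.
move=> h; split; last first.
  move=> w; have /andP[//] := @prode_le1 I (index_enum I) A (f ^~ w)
    (fun i => ltac:(by have [[h0 _] h1] := h i; rewrite h0 h1)).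
under eq_fun do rewrite -big_filter.
by apply: nnmeas_prod => i; case: (h i).
Qed.

Lemma unit_fun_integral f : unit_fun f -> 0 <= \int[P]_w f w <= 1.
Proof.
move=> [[f0 mf] f1]; rewrite integral_ge0//=.
rewrite -[leRHS](@probability_setT _ _ _ P) -[leRHS]mul1e -integral_cst//.
by apply: ge0_le_integral.
Qed.

(** A product formula valid on classes [C0 i] of functions extends to classes
    [C1 i] one coordinate at a time, the other coordinates being kept as a
    weight [Y]. *)
Lemma coordinatewise (I : finType) (C0 C1 : I -> (Om -> \bar R) -> Prop) :
  (forall i f, C0 i f -> unit_fun f) -> (forall i f, C1 i f -> unit_fun f) ->
  (forall i Y (c : \bar R), unit_fun Y -> 0 <= c <= 1 ->
    (forall f, C0 i f -> \int[P]_w (f w * Y w) = (\int[P]_w f w) * c) ->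
    forall f, C1 i f -> \int[P]_w (f w * Y w) = (\int[P]_w f w) * c) ->
  (forall phi : I -> Om -> \bar R, (forall i, C0 i (phi i)) ->
    \int[P]_w \prod_i phi i w = \prod_i \int[P]_w phi i w) ->
  forall phi : I -> Om -> \bar R, (forall i, C1 i (phi i)) ->
    \int[P]_w \prod_i phi i w = \prod_i \int[P]_w phi i w.
Proof.
move=> u0 u1 step base.
have S (s : seq I) (phi : I -> Om -> \bar R) :
    (forall i, (if i \in s then C1 i else C0 i) (phi i)) ->
    \int[P]_w \prod_i phi i w = \prod_i \int[P]_w phi i w.
  elim: s phi => [|i s ih] phi h; first exact: base.
  have [si|si] := boolP (i \in s).
    apply: ih => j; have := h j; rewrite inE.
    by case: eqVneq => // ->; rewrite si.
  have u j : unit_fun (phi j).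
    by have := h j; case: ifP => _; [exact: u1|exact: u0].
  pose Y w := \prod_(j | j != i) phi j w.
  pose c := \prod_(j | j != i) \int[P]_w phi j w.
  have c01 : 0 <= c <= 1.
    by apply: prode_le1 => j; exact: unit_fun_integral.
  under eq_integral do rewrite (bigD1 i)//=.
  rewrite (bigD1 i)//=; apply: (step i Y c) => //; first exact: unit_fun_prod.
    move=> f Cf; pose phi' j := if j == i then f else phi j.
    have hphi' j : (if j \in s then C1 j else C0 j) (phi' j).
      rewrite /phi'; case: eqVneq => [->|ji]; first by rewrite (negPf si).
      by have := h j; rewrite inE (negPf ji).
    have LE w : \prod_j phi' j w = f w * Y w.
      rewrite (bigD1 i)//= {1}/phi' eqxx; congr (_ * _).
      by apply: eq_bigr => j /negPf ji; rewrite /phi' ji.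
    have RE : \prod_j \int[P]_w phi' j w = \int[P]_w f w * c.
      rewrite (bigD1 i)//= {1}/phi' eqxx; congr (_ * _).
      by apply: eq_bigr => j /negPf ji; rewrite /phi' ji.
    rewrite -RE -(ih _ hphi'); apply: eq_integral => w _.
    by rewrite LE.
  by have := h i; rewrite inE eqxx.
move=> phi h; apply: (S (enum I)) => i.
by rewrite mem_enum.
Qed.

Lemma nnmeas_preimage (Z : Om -> \bar R) B : measurable_fun setT Z ->
  measurable B -> measurable (Z @^-1` B).
Proof. by move=> mZ mB; rewrite -[X in measurable X]setTI; exact: mZ. Qed.

Lemma unit_fun_indic (A : set Om) : measurable A ->
  unit_fun (fun w => (\1_A w)%:E).
Proof.
move=> mA; split; first exact: nnmeas_indic.
by move=> w; rewrite lee_fin indicE; case: (_ \in _).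
Qed.

Lemma unit_fun_enexp (Z : Om -> \bar R) (t : R) : nnmeas Z -> (0 <= t)%R ->
  unit_fun (fun w => enexp (t%:E * Z w)).
Proof.
move=> [Z0 mZ] t0; split; last by move=> w; rewrite enexp_le1// mule_ge0.
by apply: nnmeas_enexp; exact: measurable_funeM.
Qed.

Lemma indic_bigcap (I : finType) (E : I -> set Om) w :
  (\1_(\bigcap_(i in [set: I]) E i) w)%:E = \prod_i (\1_(E i) w)%:E :> \bar R.
Proof.
rewrite prodEFin; congr EFin; rewrite indicE.
have [/set_mem h|/negP h] := boolP (w \in _).
  by rewrite big1// => i _; rewrite indicE mem_set//; exact: h.
have [i nEi] : exists i, ~ E i w.
  by apply/existsNP => k; apply: h; apply/mem_set => i _; exact: k.
by rewrite (bigD1 i)//= indicE memNset// mul0r.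
Qed.

(** The exponentials are replaced by indicators one coordinate at a time: with
    the other coordinates as a density, [laplace_unique] applies. *)
Lemma indep_of_laplace (I : finType) (Z : I -> Om -> \bar R) :
  (forall i, nnmeas (Z i)) ->
  (forall t : I -> R, (forall i, (0 <= t i)%R) ->
    \int[P]_w \prod_i enexp ((t i)%:E * Z i w) =
    \prod_i \int[P]_w enexp ((t i)%:E * Z i w)) ->
  mutually_independent P (fun i => sigma_of (Z i)).
Proof.
move=> nZ h E FE.
have mE i : measurable (E i).
  by have [B mB <-] := FE i; rewrite setTI; apply: nnmeas_preimage => //; case: (nZ i).
pose C0 i f := exists2 t : R, (0 <= t)%R & f = (fun w => enexp (t%:E * Z i w)).
pose C1 i f := exists2 B, measurable B & f = (fun w => (\1_(Z i @^-1` B) w)%:E).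
have := @coordinatewise I C0 C1 _ _ _ _ (fun i w => (\1_(E i) w)%:E) _.
under eq_integral do rewrite -indic_bigcap.
rewrite integral_indicT; last first.
  by apply: fin_bigcap_measurable => // i _; exact: mE.
under [in X in _ -> X]eq_bigr do idtac.
move=> -> //.
- by apply: eq_bigr => i _; rewrite integral_indicT.
- by move=> i f [t t0 ->]; exact: unit_fun_enexp.
- move=> i f [B mB ->]; apply: unit_fun_indic; apply: nnmeas_preimage => //.
  by case: (nZ i).
- move=> i Y c [hY Y1] /andP[c0 c1] hC0 f [B mB ->].
  have mZB : measurable (Z i @^-1` B) by apply: nnmeas_preimage => //; case: (nZ i).
  have [m1 [m1I m1E]] := density_measure P hY.
  have [m2 [m2I m2E]] := density_measure P (@nnmeas_cst _ Om R c c0).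
  have -> : \int[P]_w ((\1_(Z i @^-1` B) w)%:E * Y w) = m1 (Z i @^-1` B).
    by rewrite integral_indicM// m1E.
  have -> : \int[P]_w ((\1_(Z i @^-1` B) w)%:E) * c = m2 (Z i @^-1` B).
    by rewrite m2E// integral_cst// integral_indicT// muleC.
  apply: laplace_unique => //.
  + rewrite m1E//; apply: (@le_lt_trans _ _ 1); last by rewrite ltry.
    by have /andP[] := unit_fun_integral (conj hY Y1).
  + rewrite m2E//; apply: (@le_lt_trans _ _ 1); last by rewrite ltry.
    have uc : unit_fun (fun=> c) by split; [exact: nnmeas_cst|move=> w; exact: c1].
    by have /andP[] := unit_fun_integral uc.
  + move=> t t0; have [hu _] := unit_fun_enexp (nZ i) t0.
    rewrite m1I// m2I// hC0; last by exists t.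
    by rewrite ge0_integralZr//; case: hu.
- move=> phi hphi.
  have /choice[t tP] : forall i, exists t : R, (0 <= t)%R /\
      phi i = (fun w => enexp (t%:E * Z i w)).
    by move=> i; have [t t0 ->] := hphi i; exists t.
  under eq_integral do under eq_bigr do rewrite (tP _).2.
  by rewrite h; [apply: eq_bigr => i _; rewrite (tP _).2|move=> i; case: (tP i)].
- by move=> i; have [B mB <-] := FE i; exists B => //; rewrite setTI.
Qed.

(** Indicators are replaced by the functions [g i] one coordinate at a time,
    by uniqueness of functionals. *)
Lemma indep_integral (I : finType) (Z : I -> Om -> \bar R)
    (g : I -> \bar R -> \bar R) :
  (forall i, measurable_fun setT (Z i)) ->
  mutually_independent P (fun i => sigma_of (Z i)) ->
  (forall i, nnmeas (g i)) -> (forall i x, g i x <= 1) ->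
  \int[P]_w \prod_i g i (Z i w) = \prod_i \int[P]_w g i (Z i w).
Proof.
move=> mZ hind ng g1.
pose C0 i f := exists2 B, measurable B & f = (fun w => (\1_(Z i @^-1` B) w)%:E).
pose C1 i f := exists2 k : \bar R -> \bar R, nnmeas k /\ (forall x, k x <= 1) &
  f = (fun w => k (Z i w)).
apply: (@coordinatewise I C0 C1 _ _ _ _ (fun i w => g i (Z i w))).
- by move=> i f [B mB ->]; apply: unit_fun_indic; exact: nnmeas_preimage.
- move=> i f [k [[k0 mk] k1] ->]; split => //; split => //.
  exact: measurableT_comp.
- move=> i Y c [hY Y1] /andP[c0 c1] hC0 f [k [hk k1] ->].
  have h1 := ifun_comp (ifun_density (ifun_integral P) hY) (mZ i).
  have h2 := ifunC (ifun_comp (ifun_integral P) (mZ i)) c0.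
  rewrite [RHS]muleC; apply: (ifun_unique h1 h2) => // A mA.
  by rewrite [RHS]muleC; apply: hC0; exists A.
- move=> phi hphi.
  have /choice[B BP] : forall i, exists B : set (\bar R), measurable B /\
      phi i = (fun w => (\1_(Z i @^-1` B) w)%:E).
    by move=> i; have [B mB ->] := hphi i; exists B.
  under eq_integral do under eq_bigr do rewrite (BP _).2.
  under eq_integral do rewrite -indic_bigcap.
  have mZB i : measurable (Z i @^-1` B i).
    by apply: nnmeas_preimage => //; case: (BP i).
  rewrite integral_indicT; last exact: fin_bigcap_measurable.
  apply: (etrans (hind (fun i => Z i @^-1` B i) _)).
    by move=> i; exists (B i); [case: (BP i)|rewrite setTI].
  by apply: eq_bigr => i _; rewrite (BP i).2 integral_indicT.
- by move=> i; exists (g i).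
Qed.

End independence.

Section laplace_family.
Context (R : realType) d (T : measurableType d) (I : Type)
  (e : I -> T -> \bar R).
Hypothesis ne : forall a, nnmeas (e a).
Hypothesis TE : (@measurable _ T) = <<s [set V | exists a,
  exists2 B : set (\bar R), measurable B & V = e a @^-1` B] >>.

Definition lin (s : seq (R * I)) (x : T) : \bar R :=
  \sum_(p <- s) p.1%:E * e p.2 x.

Definition nneg_coefs (s : seq (R * I)) := forall p, List.In p s -> (0 <= p.1)%R.

Lemma lin_ge0 s x : nneg_coefs s -> 0 <= lin s x.
Proof.
rewrite /lin; elim: s => [|p s ih] h; first by rewrite big_nil.
rewrite big_cons adde_ge0//.
  by rewrite mule_ge0 ?lee_fin//; [apply: h; left|case: (ne p.2)].
by apply: ih => q qs; apply: h; right.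
Qed.

Lemma measurable_lin s : measurable_fun setT (lin s).
Proof.
by apply: emeasurable_sum => p; apply: measurable_funeM; case: (ne p.2).
Qed.

(** By [laplace_unique], applied to one evaluation at a time with the
    remaining indicators and exponentials as a density, the two measures agree
    on finite intersections of sets of the form [e a @^-1` B]. *)
Lemma laplace_family_unique (m1 m2 : {measure set T -> \bar R}) :
  m1 setT < +oo -> m2 setT < +oo ->
  (forall s, nneg_coefs s ->
    \int[m1]_x enexp (lin s x) = \int[m2]_x enexp (lin s x)) ->
  forall A, measurable A -> m1 A = m2 A.
Proof.
move=> m1oo m2oo h.
pose ind (l : seq (I * set (\bar R))) (x : T) : \bar R :=
  \prod_(p <- l) (\1_(e p.1 @^-1` p.2) x)%:E.
pose good (l : seq (I * set (\bar R))) := forall p, List.In p l -> measurable p.2.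
have mpre a B : measurable B -> measurable (e a @^-1` B).
  by move=> mB; rewrite -[X in measurable X]setTI; apply: (ne a).2.
have nind l : good l -> nnmeas (ind l).
  rewrite /ind; elim: l => [|p l ih] gl.
    by under [X in nnmeas X]eq_fun do rewrite big_nil; exact: nnmeas_cst.
  under [X in nnmeas X]eq_fun do rewrite big_cons.
  apply: nnmeasM; last by apply: ih => q ql; apply: gl; right.
  by apply: nnmeas_indic; apply: mpre; apply: gl; left.
have ind1 l x : ind l x <= 1.
  have h01 (p : I * set (\bar R)) : 0 <= (\1_(e p.1 @^-1` p.2) x : R)%:E <= 1.
    by apply/andP; split; rewrite lee_fin indicE//; case: (_ \in _).
  by have /andP[_] := prode_le1 l xpredT h01.
have nexp s : nneg_coefs s -> nnmeas (fun x => enexp (lin s x)).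
  by move=> hs; apply: nnmeas_enexp; exact: measurable_lin.
have key l : good l -> forall s, nneg_coefs s ->
    \int[m1]_x (ind l x * enexp (lin s x)) =
    \int[m2]_x (ind l x * enexp (lin s x)).
  elim: l => [|[a B] l ih] gl s hs.
    rewrite /ind; under eq_integral do rewrite big_nil mul1e.
    by under [in RHS]eq_integral do rewrite big_nil mul1e; exact: h.
  have gl' : good l by move=> q ql; apply: gl; right.
  have mB : measurable B by apply: (gl (a, B)); left.
  have nw : nnmeas (fun x => ind l x * enexp (lin s x)).
    by apply: nnmeasM; [exact: nind|exact: nexp].
  have [k1 [k1I k1E]] := density_measure m1 nw.
  have [k2 [k2I k2E]] := density_measure m2 nw.
  have kfin (m k : {measure set T -> \bar R}) : m setT < +oo ->
      k setT = \int[m]_x (ind l x * enexp (lin s x)) -> k setT < +oo.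
    move=> moo ->; apply: (@le_lt_trans _ _ (\int[m]_x 1)).
      apply: ge0_le_integral => //; [by move=> x _; case: nw|by case: nw|].
      move=> x _; rewrite -[leRHS]mule1; apply: lee_pmul => //.
      - by case: (nind _ gl').
      - exact: enexp_ge0.
      - by rewrite enexp_le1// lin_ge0.
    by rewrite integral_cst// mul1e.
  have E (m k : {measure set T -> \bar R}) :
      (forall A, measurable A -> k A = \int[m]_(x in A) (ind l x * enexp (lin s x))) ->
      \int[m]_x (ind ((a, B) :: l) x * enexp (lin s x)) = k (e a @^-1` B).
    move=> kE; rewrite kE; last exact: mpre.
    rewrite -(integral_indicM m _ (mpre a B mB)).
    by apply: eq_integral => x _; rewrite /ind big_cons muleA.
  rewrite (E m1 k1)// (E m2 k2)//.
  apply: laplace_unique => //.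
  - by apply: (kfin m1) => //; rewrite k1E.
  - by apply: (kfin m2) => //; rewrite k2E.
  - move=> t t0.
    have nt : nnmeas (fun x => enexp (t%:E * e a x)).
      by apply: nnmeas_enexp; apply: measurable_funeM; case: (ne a).
    have E2 x : enexp (t%:E * e a x) * (ind l x * enexp (lin s x)) =
        ind l x * enexp (lin ((t, a) :: s) x).
      rewrite {2}/lin big_cons enexpD ?lin_ge0//; last first.
        by rewrite mule_ge0 ?lee_fin//; case: (ne a).
      by rewrite muleCA.
    rewrite k1I// k2I//.
    under eq_integral do rewrite E2; under [in RHS]eq_integral do rewrite E2.
    by apply: ih => // p [<-//|]; exact: hs.
pose G : set (set T) := [set A | exists2 l, good l &
  forall x, (\1_A x)%:E = ind l x].
have GI : setI_closed G.
  move=> A B [l gl hl] [l' gl' hl']; exists (l ++ l').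
    by move=> p pl; case: (List.in_app_or _ _ _ pl); [exact: gl|exact: gl'].
  by move=> x; rewrite indicI/= EFinM hl hl' /ind big_cat.
have Gm A : G A -> measurable A.
  move=> [l gl hl]; rewrite (_ : A = (ind l) @^-1` [set 1]).
    by rewrite -[X in measurable X]setTI; apply: (nind l gl).2.
  apply/seteqP; split => x; rewrite /preimage/= -hl indicE.
    by move=> Ax; rewrite mem_set.
  have [/set_mem//|_ /eqP] := boolP (x \in A).
  by rewrite eqe eq_sym oner_eq0.
have GE : measurable = <<s G >>.
  apply/seteqP; split; last first.
    by apply: smallest_sub => //; exact: sigma_algebra_measurable.
  rewrite TE; apply: smallest_sub; first exact: smallest_sigma_algebra.
  move=> _ [a [B mB ->]]; apply: sub_sigma_algebra.
  exists [:: (a, B)]; first by move=> p [<-|].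
  by move=> x; rewrite /ind big_seq1.
apply: (finite_measure_unique GE) => //.
  rewrite -!integral_indicT//.
  have := key [::] _ [::] _; rewrite /ind /lin.
  under eq_integral do rewrite !big_nil enexp0 mule1.
  under [in X in _ = X]eq_integral do rewrite !big_nil enexp0 mule1.
  move=> k; rewrite !integral_cst// !mul1e in k.
  by rewrite !integral_indicT//; apply: k.
move=> A GA; have mA := Gm A GA; have [l gl hl] := GA.
rewrite -!integral_indicT//; have := key l gl [::] _.
rewrite /lin; under eq_integral do rewrite big_nil enexp0 mule1 -hl.
under [in X in _ = X]eq_integral do rewrite big_nil enexp0 mule1 -hl.
by apply.
Qed.

End laplace_family.

(** * Poisson variables and Poisson random measures *)

Section poisson_laplace.
Context (R : realType).

Lemma measurable_fun_from_nat d (T : measurableType d) (f : nat -> T) :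
  measurable_fun setT f.
Proof. by []. Qed.

Lemma nat_integral (m : {measure set nat -> \bar R}) (g : nat -> \bar R) :
  (forall k, 0 <= g k) -> \int[m]_k g k = \sum_(k <oo) g k * m [set k].
Proof.
move=> g0; have U : [set: nat] = \bigcup_k [set k].
  by apply/seteqP; split => // k _; exists k.
rewrite U (@ge0_integral_bigcup _ _ _ m (fun k => [set k]))//.
- apply: eq_eseriesr => k _; rewrite -integral_cst//.
  by apply: eq_integral => j /set_mem ->.
- by move=> i j _ _ [k [-> ->]].
Qed.

Lemma poisson_probE (lam : R) k :
  poisson_prob lam 0%N [set k] =
  if (0 < lam)%R then (poisson_pmf lam k)%:E else (k == 0%N)%:R%:E.
Proof.
rewrite /poisson_prob; case: ifPn => l0.
  by rewrite esum_set1// lee_fin poisson_pmf_ge0.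
rewrite diracE; case: eqVneq => [->|k0]; first by rewrite mem_set.
by rewrite memNset// => /= /esym/eqP; rewrite (negPf k0).
Qed.

Lemma poisson_exp_sum (lam t : R) : (0 <= lam)%R -> (0 <= t)%R ->
  \sum_(k <oo) enexp (t%:E * k%:R%:E) * poisson_prob lam 0%N [set k] =
  enexp ((1 - expR (- t)) * lam)%:E.
Proof.
move=> lam0 t0.
have [l0|l0] := ltP 0%R lam; last first.
  have -> : lam = 0%R by apply/eqP; rewrite eq_le lam0 l0.
  under eq_eseriesr do rewrite poisson_probE ltxx.
  rewrite (@nneseriesD1 _ _ 0%N)//=.
    rewrite mule0 enexp0 mule1 eseries0 ?adde0 ?mulr0 ?enexp0// => k _ /negPf ->.
    by rewrite mule0.
  by move=> k _; rewrite mule_ge0 ?enexp_ge0// lee_fin.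
pose l' := (lam * expR (- t))%R.
have l'0 : (0 < l')%R by rewrite mulr_gt0// expR_gt0.
have E k : enexp (t%:E * k%:R%:E) * poisson_prob lam 0%N [set k] =
    (expR (l' - lam))%:E * poisson_prob l' 0%N [set k].
  have -> : enexp (t%:E * k%:R%:E) = (expR (- (t * k%:R)))%:E by [].
  rewrite !poisson_probE l0 l'0 -!EFinM; congr EFin.
  rewrite /poisson_pmf l0 l'0 /l' exprMn -expRM_natl.
  have -> : (k%:R * - t = - (t * k%:R))%R by ring.
  rewrite expRD.
  have e2 : (expR (lam * expR (- t)) * expR (- (lam * expR (- t))) = 1)%R.
    by rewrite -expRD subrr expR0.
  transitivity ((expR (lam * expR (- t)) * expR (- (lam * expR (- t)))) *
    (expR (- (t * k%:R)) * (lam ^+ k / k`!%:R * expR (- lam))))%R.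
    by rewrite e2 mul1r.
  by ring.
under eq_eseriesr do rewrite E.
rewrite nneseriesZl; last by move=> k _; exact: measure_ge0.
have -> : \sum_(k <oo) poisson_prob l' 0%N [set k] = 1.
  rewrite -(@probability_setT _ _ _ (poisson_prob l' 0%N)).
  rewrite -[RHS](@integral_indicT)// nat_integral; last by move=> k; rewrite lee_fin indicE.
  by apply: eq_eseriesr => k _; rewrite indicE mem_set// mul1e.
rewrite mule1 enexp_EFin; congr ((expR _)%:E).
by rewrite /l'; ring.
Qed.

Section variable.
Context d (Om : measurableType d) (P : probability Om R).

(** The values at the naturals bound [P (Z \in B)] from below by the Poisson
    probability; applied to the complement of [B], this bound gives equality. *)
Lemma poisson_law (Z : Om -> \bar R) (lam : R) : measurable_fun setT Z ->
  (forall k : nat, P [set w | Z w = k%:R%:E] = poisson_prob lam 0%N [set k]) ->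
  forall B, measurable B -> P (Z @^-1` B) = poisson_prob lam 0%N [set k | B k%:R%:E].
Proof.
move=> mZ h.
have mk (k : nat) : measurable [set w | Z w = k%:R%:E].
  exact: (nnmeas_preimage mZ (B := [set k%:R%:E])).
have ge B : measurable B -> poisson_prob lam 0%N [set k | B k%:R%:E] <= P (Z @^-1` B).
  move=> mB; set K := [set k | _].
  have -> : K = \bigcup_(k in K) [set k].
    by apply/seteqP; split => [k Kk|k [j Kj ->]]//; exists k.
  have mZB : measurable (Z @^-1` B) by exact: nnmeas_preimage.
  have tr (D : set nat) : trivIset D (fun k : nat => [set w | Z w = k%:R%:E]).
    move=> i j _ _ [w [/= -> [/eqP]]]; rewrite eqr_nat => /eqP.
    by [].
  rewrite measure_bigcup//; last by move=> i j _ _ [k [-> ->]].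
  apply: (@le_trans _ _ (P (\bigcup_(k in K) [set w | Z w = k%:R%:E]))).
    rewrite measure_bigcup//.
    by rewrite (eq_eseriesr (fun k _ => esym (h k))).
  apply: le_measure; [|exact/mem_set|].
    by apply/mem_set; apply: bigcup_measurable => k _; exact: mk.
  by move=> w [k Kk /= Zw]; rewrite /preimage/= Zw.
move=> B mB; apply/eqP; rewrite eq_le ge// andbT.
have mZB : measurable (Z @^-1` B) by exact: nnmeas_preimage.
have E1 : P (Z @^-1` (~` B)) = 1 - P (Z @^-1` B).
  by rewrite -probability_setC.
have E2 : poisson_prob lam 0%N [set k | (~` B) k%:R%:E] =
    1 - poisson_prob lam 0%N [set k | B k%:R%:E].
  by rewrite -(@probability_setC _ _ _ (poisson_prob lam 0%N)).
have := ge (~` B) (measurableC mB); rewrite E1 E2.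
have f1 : P (Z @^-1` B) \is a fin_num by exact: fin_num_measure.
have f2 : poisson_prob lam 0%N [set k | B k%:R%:E] \is a fin_num.
  by apply: (@fin_num_measure _ _ _ (poisson_prob lam 0%N)).
rewrite -(fineK f1) -(fineK f2) -!EFinB !lee_fin.
by rewrite lerD2l lerN2.
Qed.

Lemma poisson_laplace_var (Z : Om -> \bar R) (lam t : R) : nnmeas Z ->
  (0 <= lam)%R -> (0 <= t)%R ->
  (forall k : nat, P [set w | Z w = k%:R%:E] = poisson_prob lam 0%N [set k]) ->
  \int[P]_w enexp (t%:E * Z w) = enexp ((1 - expR (- t)) * lam)%:E.
Proof.
move=> [Z0 mZ] lam0 t0 h.
rewrite -poisson_exp_sum// -(@nat_integral (poisson_prob lam 0%N) (fun k => enexp (t%:E * k%:R%:E))); last first.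
  by move=> k; exact: enexp_ge0.
have nexp : nnmeas (fun x : \bar R => enexp (t%:E * x)).
  by apply: nnmeas_enexp; exact: measurable_funeM.
have [m1 [m1I m1E]] := image_measure P mZ.
have [m2 [m2I m2E]] := image_measure (poisson_prob lam 0%N)
  (@measurable_fun_from_nat _ (\bar R) (fun k : nat => k%:R%:E)).
rewrite -(m1I _ nexp) -(m2I _ nexp); apply: ge0_integral_unique => B mB.
by rewrite (m1E _ mB) (m2E _ mB); exact: poisson_law.
Qed.

(** By [laplace_unique] on the extended line. The absolute value makes the
    identity nonnegative there, and changes neither of the two laws. *)
Lemma poisson_of_laplace (Z : Om -> \bar R) (lam : R) : nnmeas Z ->
  (0 <= lam)%R ->
  (forall t : R, (0 <= t)%R ->
    \int[P]_w enexp (t%:E * Z w) = enexp ((1 - expR (- t)) * lam)%:E) ->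
  forall k : nat, P [set w | Z w = k%:R%:E] = poisson_prob lam 0%N [set k].
Proof.
move=> [Z0 mZ] lam0 h k.
have [m1 [m1I m1E]] := image_measure P mZ.
have [m2 [m2I m2E]] := image_measure (poisson_prob lam 0%N)
  (@measurable_fun_from_nat _ (\bar R) (fun k : nat => k%:R%:E)).
have abs_ge0 : nnmeas (fun x : \bar R => `|x|).
  by split; [move=> x; exact: abse_ge0|exact: measurableT_comp].
have absE t : (0 <= t)%R -> nnmeas (fun x : \bar R => enexp (t%:E * `|x|)).
  by move=> t0; apply: nnmeas_enexp; apply: measurable_funeM; case: abs_ge0.
have mk : measurable (abse @^-1` [set k%:R%:E] : set (\bar R)).
  by rewrite -[X in measurable X]setTI; exact: (abs_ge0.2 measurableT).
have m1T : m1 setT = 1 by rewrite m1E//; exact: probability_setT.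
have m2T : m2 setT = 1.
  by rewrite m2E//; exact: (@probability_setT _ _ _ (poisson_prob lam 0%N)).
have key : m1 (abse @^-1` [set k%:R%:E]) = m2 (abse @^-1` [set k%:R%:E]).
  apply: (laplace_unique (Z := fun x : \bar R => `|x|)) => //.
  - by rewrite m1T ltry.
  - by rewrite m2T ltry.
  - move=> t t0; rewrite (m1I _ (absE _ t0)) (m2I _ (absE _ t0)).
    under eq_integral do rewrite gee0_abs//.
    rewrite h// nat_integral; last by move=> j; exact: enexp_ge0.
    rewrite -poisson_exp_sum//; apply: eq_eseriesr => j _.
    by rewrite gee0_abs.
have e1 : Z @^-1` (abse @^-1` [set k%:R%:E]) = [set w | Z w = k%:R%:E].
  by apply/seteqP; split => w; rewrite /preimage/= gee0_abs.
have e2 : (fun j : nat => j%:R%:E : \bar R) @^-1` (abse @^-1` [set k%:R%:E]) = [set k].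
  apply/seteqP; split => j; rewrite /preimage/=; last by move=> ->; rewrite ger0_norm.
  by rewrite ger0_norm// => -[/eqP]; rewrite eqr_nat => /eqP.
by rewrite -e1 -e2 -m1E// key m2E.
Qed.

End variable.

End poisson_laplace.

Section enexp_limits.
Context (R : realType).

Lemma enexp_lim (u : nat -> \bar R) : (forall n, 0 <= u n) ->
  nondecreasing_seq u -> (fun n => enexp (u n)) @ \oo --> enexp (limn u).
Proof.
move=> u0 nd.
have cu : u @ \oo --> ereal_sup (range u) by exact: ereal_nondecreasing_cvgn.
rewrite (cvg_lim _ cu)//; set s := ereal_sup _.
have ni : nonincreasing_seq (fun n => enexp (u n)).
  by move=> m n mn; apply: enexp_le; exact: nd.
have := ereal_nonincreasing_cvgn ni.
suff -> : ereal_inf (range (fun n => enexp (u n))) = enexp s by [].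
apply/eqP; rewrite eq_le; apply/andP; split; last first.
  apply: le_ereal_inf_tmp => _ [n _ <-]; apply: enexp_le.
  by apply: ereal_sup_ubound; exists n.
have s0 : 0 <= s by apply: (le_trans (u0 0%N)); apply: ereal_sup_ubound; exists 0%N.
have es0 := enexp_ge0 s.
rewrite leNgt; apply/negP => h.
set i := ereal_inf _ in h.
have i1 : i <= 1.
  apply: (@le_trans _ _ (enexp (u 0%N))); last exact: enexp_le1.
  by apply: ereal_inf_lbound; exists 0%N.
have [r ir] : exists r, i = r%:E.
  exists (fine i); rewrite fineK// ge0_fin_numE ?(le_lt_trans i1) ?ltry//.
  exact: (le_trans es0 (ltW h)).
have r0 : (0 < r)%R by rewrite -lte_fin -ir (le_lt_trans es0 h).
have le n : u n <= (- ln r)%:E.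
  have : i <= enexp (u n) by apply: ereal_inf_lbound; exists n.
  rewrite ir -{1}(lnK r0) (_ : (expR (ln r))%:E = expeR (ln r)%:E)//.
  by rewrite /enexp lee_expeR leeNr.
have : s <= (- ln r)%:E by apply: ge_ereal_sup => _ [n _ <-].
move=> /enexp_le; rewrite enexp_EFin opprK lnK// -ir.
by rewrite leNgt h.
Qed.

End enexp_limits.

Section laplace_functional.
Context (R : realType) (X : completeMetricType R).
Context d (Om : measurableType d).
Local Notation E := (borel X * R)%type.

Lemma sube_enexp_ge0 (x : \bar R) : 0 <= x -> 0 <= 1 - enexp x.
Proof. by move=> x0; rewrite sube_ge0 ?enexp_le1// enexp_fin. Qed.

Lemma nnmeas_1enexp d' (T : measurableType d') (f : T -> \bar R) :
  nnmeas f -> nnmeas (fun z => 1 - enexp (f z)).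
Proof.
move=> [f0 mf]; split; first by move=> z; exact: sube_enexp_ge0.
by apply: emeasurable_funB => //; case: (nnmeas_enexp mf).
Qed.

(** At most one term of each sum is nonzero. *)
Lemma disjoint_exponent (T : Type) (k : nat) (C : 'I_k -> set T) (t : 'I_k -> R) z :
  trivIset setT C ->
  1 - enexp (\sum_i (t i)%:E * (\1_(C i) z)%:E) =
  \sum_i (1 - expR (- t i))%:E * (\1_(C i) z)%:E.
Proof.
move=> tC; have [[i Ci]|nC] := pselect (exists i, C i z); last first.
  rewrite big1 ?enexp0 ?subee//; last first.
    move=> i _; rewrite indicE memNset ?mule0// => Ci; apply: nC; by exists i.
  by rewrite big1// => i _; rewrite indicE memNset ?mule0// => Ci; apply: nC; exists i.
have nCj j : j != i -> \1_(C j) z = 0%R :> R.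
  move=> ji; rewrite indicE memNset// => Cj; move/negP : ji; apply; apply/eqP.
  by apply: tC => //; exists z.
have S (u : 'I_k -> R) : \sum_j (u j)%:E * (\1_(C j) z)%:E = (u i)%:E.
  rewrite (bigD1 i)//= indicE mem_set// mule1 big1 ?adde0// => j ji.
  by rewrite nCj// mule0.
by rewrite !S enexp_EFin -EFinB.
Qed.

Section from_poisson.
Variables (P : probability Om R) (N : R.-ker Om ~> E)
  (nu : {measure set E -> \bar R}).
Hypothesis hN : is_poisson_random_measure P N nu.

Lemma ae_of_prob1 (A : set Om) : measurable A -> P A = 1 -> {ae P, forall w, A w}.
Proof.
move=> mA PA; exists (~` A); split => //; first exact: measurableC.
by rewrite probability_setC// PA subee.
Qed.

Lemma nnmeas_count C : measurable C -> nnmeas (fun w => N w C).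
Proof. by move=> mC; split => //; exact: measurable_kernel. Qed.

Lemma nnmeas_kernel_integral (f : E -> \bar R) : nnmeas f ->
  nnmeas (fun w => \int[N w]_z f z).
Proof.
move=> [f0 mf]; split; first by move=> w; exact: integral_ge0.
by apply: measurable_fun_integral_kernel => // U mU; exact: measurable_kernel.
Qed.

(** A set of infinite intensity almost surely has infinitely many points, so
    both sides vanish for [0 < t]. *)
Lemma prm_count_laplace C (t : R) : measurable C -> (0 <= t)%R ->
  \int[P]_w enexp (t%:E * N w C) = enexp ((1 - expR (- t))%:E * nu C).
Proof.
move=> mC t0; have [h1 h2 _] := hN; have nC := nnmeas_count mC.
have [t_eq0|tn0] := eqVneq t 0%R.
  rewrite t_eq0 oppr0 expR0 subrr mul0e enexp0.
  under eq_integral do rewrite mul0e enexp0.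
  by rewrite integral_prob_cst.
have t_gt0 : (0 < t)%R by rewrite lt_neqAle eq_sym tn0.
have := leey (nu C); rewrite le_eqVlt => /predU1P[nuoo|nufin].
  have e0 : enexp ((1 - expR (- t))%:E * nu C) = 0.
    rewrite nuoo gt0_muley ?lte_fin ?subr_gt0 ?expR_lt1 ?oppr_lt0//.
  rewrite e0 -(integral0 P setT).
  have nexp : nnmeas (fun w => enexp (t%:E * N w C)).
    by apply: nnmeas_enexp; apply: measurable_funeM; case: nC.
  apply: ge0_ae_eq_integral => //; [by case: nexp|by move=> w _; case: nexp|].
  have mS : measurable [set w | N w C = +oo].
    exact: (nnmeas_preimage nC.2 (B := [set +oo])).
  have := ae_of_prob1 mS (h2 C mC nuoo).
  apply: filterS => w /= Nw _; rewrite Nw gt0_muley//.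
have nuf : nu C \is a fin_num by rewrite ge0_fin_numE.
rewrite (@poisson_laplace_var _ _ _ P (fun w => N w C) (fine (nu C)))//.
- by rewrite EFinM fineK.
- by move=> k; exact: h1.
Qed.

Import HBNNSimple.

(** The level sets of a simple function are disjoint, so their counts are
    independent Poisson variables. *)
Lemma prm_laplace_simple (g : {nnsfun E >-> R}) :
  \int[P]_w enexp (\int[N w]_z (g z)%:E) =
  enexp (\int[nu]_z (1 - enexp (g z)%:E)).
Proof.
have [_ _ h3] := hN.
pose s := enum_fset (fset_set (range g)).
pose C (i : 'I_(size s)) : set E := g @^-1` [set (nth 0%R s i)].
pose c (i : 'I_(size s)) : R := nth 0%R s i.
have c0 i : (0 <= c i)%R.
  have : (nth 0%R s i) \in fset_set (range g) by apply: mem_nth; rewrite ltn_ord.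
  by rewrite in_fset_set// => /set_mem[x _ ci]; rewrite /c -ci.
have mC i : measurable (C i) by rewrite /C -[X in measurable X]setTI; exact: measurable_funP.
have tC : trivIset setT C.
  move=> i j _ _ [z [/= zi zj]]; apply/val_inj => /=; apply/eqP.
  rewrite -(nth_uniq 0%R (ltn_ord i) (ltn_ord j) (fset_uniq _)).
  by apply/eqP; rewrite -zi -zj.
have gE z : (g z)%:E = \sum_i (c i)%:E * (\1_(C i) z)%:E.
  by rewrite fimfunEord -sumEFin; apply: eq_bigr => i _; rewrite EFinM.
have nCi (k : 'I_(size s) -> R) i : (0 <= k i)%R ->
    nnmeas (fun z => (k i)%:E * (\1_(C i) z)%:E).
  by move=> k0; apply: nnmeasM; [exact: nnmeas_cst|exact: nnmeas_indic].
have Ngl w : \int[N w]_z (g z)%:E = \sum_i (c i)%:E * N w (C i).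
  under eq_integral do rewrite gE.
  rewrite (ifun_sum (ifun_integral (N w)))//; last by move=> i; exact: nCi.
  by apply: eq_bigr => i _; rewrite (ifunZ (ifun_integral _))// ?integral_indicT//; exact: nnmeas_indic.
have RE : \int[nu]_z (1 - enexp (g z)%:E) =
    \sum_i (1 - expR (- c i))%:E * nu (C i).
  have e0 i : (0 <= 1 - expR (- c i))%R by rewrite subr_ge0 expR_le1 oppr_le0.
  under eq_integral do rewrite gE disjoint_exponent//.
  rewrite (ifun_sum (ifun_integral nu))//; last by move=> i; exact: (nCi (fun i => 1 - expR (- c i))%R).
  by apply: eq_bigr => i _; rewrite (ifunZ (ifun_integral _))// ?integral_indicT//; exact: nnmeas_indic.
rewrite RE enexp_sum; last first.
  by move=> i; rewrite mule_ge0// lee_fin subr_ge0 expR_le1 oppr_le0.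
have cN0 i w : 0 <= (c i)%:E * N w (C i) by rewrite mule_ge0 ?lee_fin.
have LE w : enexp (\int[N w]_z (g z)%:E) = \prod_i enexp ((c i)%:E * N w (C i)).
  by rewrite Ngl enexp_sum.
under eq_integral do rewrite LE.
under [RHS]eq_bigr do rewrite -prm_count_laplace//.
have absE w i : N w (C i) = `|N w (C i)| by rewrite gee0_abs.
under eq_integral do under eq_bigr do rewrite absE.
rewrite (@indep_integral _ _ _ P _ (fun i w => N w (C i)) (fun i x => enexp ((c i)%:E * `|x|)))//.
- apply: eq_bigr => i _; apply: eq_integral => w _; by rewrite -absE.
- by move=> i; case: (nnmeas_count (mC i)).
- exact: h3.
- move=> i; apply: nnmeas_enexp; apply: measurable_funeM.
  exact: abse_measurable.
- by move=> i x; rewrite enexp_le1// mule_ge0// lee_fin.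
Qed.

Lemma prm_laplace (f : E -> \bar R) : nnmeas f ->
  \int[P]_w enexp (\int[N w]_z f z) = enexp (\int[nu]_z (1 - enexp (f z))).
Proof.
move=> [f0 mf].
pose g n := nnsfun_approx measurableT mf n.
have ng n : nnmeas (fun z => (g n z)%:E).
  by split; [move=> z; rewrite lee_fin|exact/measurable_EFinP].
have nd z : nondecreasing_seq (fun n => (g n z)%:E).
  by move=> m n mn; rewrite lee_fin; exact/lefP/nd_nnsfun_approx.
have fE : f = (fun z => limn (fun n => (g n z)%:E)).
  apply/funext => z; apply/esym/cvg_lim => //; exact: cvg_nnsfun_approx.
have ndi (m : {measure set E -> \bar R}) :
    nondecreasing_seq (fun n => \int[m]_z (g n z)%:E).
  by move=> i j ij; apply: (ifun_le (ifun_integral m)) => // z; exact: nd.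
have ige0 (m : {measure set E -> \bar R}) n : 0 <= \int[m]_z (g n z)%:E.
  by apply: (ifun_ge0 (ifun_integral m)).
have L1 w : (fun n => enexp (\int[N w]_z (g n z)%:E)) @ \oo -->
    enexp (\int[N w]_z f z).
  rewrite [in X in _ --> X]fE (ifun_lim (ifun_integral (N w)))//.
  exact: enexp_lim.
have mexp (h : E -> \bar R) : nnmeas h ->
    nnmeas (fun w => enexp (\int[N w]_z h z)).
  by move=> nh; apply: nnmeas_enexp; case: (nnmeas_kernel_integral nh).
have LHS_cvg : (fun n => \int[P]_w enexp (\int[N w]_z (g n z)%:E)) @ \oo -->
    \int[P]_w enexp (\int[N w]_z f z).
  have H1 n : measurable_fun setT (fun w => enexp (\int[N w]_z (g n z)%:E)).
    by case: (mexp _ (ng n)).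
  have H2 : measurable_fun setT (fun w => enexp (\int[N w]_z f z)).
    by case: (mexp f).
  have H3 : {ae P, forall w, setT w ->
      (fun n => enexp (\int[N w]_z (g n z)%:E)) @ \oo --> enexp (\int[N w]_z f z)}.
    by apply: aeW.
  have H4 : P.-integrable setT (cst 1).
    apply/integrableP; split => //; under eq_integral do rewrite abse1.
    by rewrite integral_prob_cst ltry.
  have H5 : {ae P, forall w n, setT w -> `|enexp (\int[N w]_z (g n z)%:E)| <= cst 1 w}.
    by apply: aeW => w n _; rewrite gee0_abs ?enexp_ge0// enexp_le1.
  by have [_ _] := dominated_convergence measurableT H1 H2 H3 H4 H5.
have RHS_cvg : (fun n => enexp (\int[nu]_z (1 - enexp (g n z)%:E))) @ \oo -->
    enexp (\int[nu]_z (1 - enexp (f z))).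
  have nd1 z : nondecreasing_seq (fun n => 1 - enexp (g n z)%:E).
    by move=> i j ij; apply: leeB => //; apply: enexp_le; exact: nd.
  have n1 n := nnmeas_1enexp (ng n).
  have -> : (fun z => 1 - enexp (f z)) = (fun z => limn (fun n => 1 - enexp (g n z)%:E)).
    apply/funext => z; apply/esym/cvg_lim => //; rewrite fE.
    have cl : (fun n => enexp (g n z)%:E) @ \oo --> enexp (limn (fun n => (g n z)%:E)).
      by apply: enexp_lim => //= n; rewrite lee_fin.
    apply: cvgeB => //; last exact: cvg_cst.
  rewrite (ifun_lim (ifun_integral nu))//.
  apply: enexp_lim; first by move=> n; apply: (ifun_ge0 (ifun_integral nu)).
  by move=> i j ij; apply: (ifun_le (ifun_integral nu)) => // z; exact: nd1.
have E : (fun n => \int[P]_w enexp (\int[N w]_z (g n z)%:E)) =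
         (fun n => enexp (\int[nu]_z (1 - enexp (g n z)%:E))).
  by apply/funext => n; exact: prm_laplace_simple.
rewrite -(cvg_lim _ LHS_cvg)// -(cvg_lim _ RHS_cvg)//.
by rewrite E.
Qed.

End from_poisson.

(** On combinations of indicators of disjoint sets, the Laplace functional is
    the joint Laplace transform of the counts: it determines their laws, and
    factorises, which gives independence. *)
Lemma prm_of_laplace (P : probability Om R) (N : R.-ker Om ~> E)
    (nu : {measure set E -> \bar R}) :
  (forall f, nnmeas f ->
    \int[P]_w enexp (\int[N w]_z f z) = enexp (\int[nu]_z (1 - enexp (f z)))) ->
  is_poisson_random_measure P N nu.
Proof.
move=> h.
have e0 (t : R) : (0 <= t)%R -> 0 <= (1 - expR (- t))%:E :> \bar R.
  by move=> t0; rewrite lee_fin subr_ge0 expR_le1 oppr_le0.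
have one C (t : R) : measurable C -> (0 <= t)%R ->
    \int[P]_w enexp (t%:E * N w C) = enexp ((1 - expR (- t))%:E * nu C).
  move=> mC t0; have := h (fun z => t%:E * (\1_C z)%:E) _.
  have hN' (m : {measure set E -> \bar R}) : \int[m]_z (t%:E * (\1_C z)%:E) = t%:E * m C.
    by rewrite (ifunZ (ifun_integral m))// ?integral_indicT//; exact: nnmeas_indic.
  under eq_integral do rewrite hN'.
  move=> ->; last by apply: nnmeasM; [exact: nnmeas_cst|exact: nnmeas_indic].
  congr enexp; rewrite -integral_indicT//.
  rewrite -(ifunZ (ifun_integral nu)); [|by rewrite -lee_fin e0|exact: nnmeas_indic].
  apply: eq_integral => z _; rewrite indicE; case: (z \in C).
    by rewrite !mule1 enexp_EFin -EFinB.
  by rewrite !mule0 enexp0 subee.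
split.
- move=> C mC Cfin k.
  apply: (@poisson_of_laplace _ _ _ P (fun w => N w C)).
  + exact: nnmeas_count.
  + by rewrite fine_ge0.
  + by move=> t t0; rewrite one// EFinM fineK// ge0_fin_numE.
- move=> C mC Coo.
  have nC := nnmeas_count N mC.
  have := one C 1%R mC ler01.
  rewrite Coo gt0_muley ?lte_fin ?subr_gt0 ?expR_lt1 ?oppr_lt0// => h0.
  have nexp : nnmeas (fun w => enexp (1%:E * N w C)).
    by apply: nnmeas_enexp; apply: measurable_funeM; case: nC.
  have /ae_eq_integral_abs : measurable_fun setT (fun w => enexp (1%:E * N w C)).
    by case: nexp.
  move=> /(_ P measurableT)[+ _].
  under eq_integral do rewrite gee0_abs ?enexp_ge0//.
  move=> /(_ h0) h1.
  have mS : measurable [set w | N w C = +oo].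
    exact: (nnmeas_preimage nC.2 (B := [set +oo])).
  have [S [mS' S0 hS]] := h1.
  have PC : P (~` [set w | N w C = +oo]) = 0.
    apply/eqP; rewrite eq_le measure_ge0 andbT -S0; apply: le_measure.
    - by apply/mem_set; exact: measurableC.
    - exact/mem_set.
    - move=> w nw; apply: hS => /= /(_ I)/eqP; rewrite mul1e /enexp expeR_eq0.
      by move=> /eqP e; apply: nw => /=; rewrite -[N w C]oppeK e.
  have := @probability_setC _ _ _ P _ (measurableC mS).
  by rewrite setCK PC sube0.
- move=> k C mC tC; apply: indep_of_laplace.
    by move=> i; exact: nnmeas_count.
  move=> t t0.
  have nC i : nnmeas (fun z => (t i)%:E * (\1_(C i) z)%:E).
    by apply: nnmeasM; [apply: nnmeas_cst; rewrite lee_fin|exact: nnmeas_indic].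
  have e1 w : \prod_i enexp ((t i)%:E * N w (C i)) =
      enexp (\int[N w]_z \sum_i (t i)%:E * (\1_(C i) z)%:E).
    rewrite (ifun_sum (ifun_integral (N w)))// enexp_sum.
      apply: eq_bigr => i _.
      by rewrite (ifunZ (ifun_integral _))// ?integral_indicT//; exact: nnmeas_indic.
    by move=> i; apply: (ifun_ge0 (ifun_integral (N w))).
  under eq_integral do rewrite e1.
  rewrite h; last exact: nnmeas_sum.
  under eq_integral do rewrite disjoint_exponent//.
  have nC' i : nnmeas (fun z => (1 - expR (- t i))%:E * (\1_(C i) z)%:E).
    by apply: nnmeasM; [apply: nnmeas_cst; exact: e0|exact: nnmeas_indic].
  rewrite (ifun_sum (ifun_integral nu))// enexp_sum; last first.
    by move=> i; apply: (ifun_ge0 (ifun_integral nu)).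
  apply: eq_bigr => i _; rewrite one//.
  rewrite (ifunZ (ifun_integral _)) ?integral_indicT//; last exact: nnmeas_indic.
  by rewrite -lee_fin e0.
Qed.

End laplace_functional.

(** * Laplace functional and tilting of completely random measures *)

Section crm.
Context (R : realType) (X : completeMetricType R).
Local Notation E := (borel X * R)%type.

Definition msets : Type := {A : set (borel X) | measurable A}.

Definition ev (a : msets) (m : MX X) : \bar R := m (sval a).

(** The intensity lives on positive sizes; reading negative ones as [0] makes
    every point of the product space an atom. *)
Definition jump (z : E) : \bar R := (Num.max z.2 0)%:E.

(** The function on the points that corresponds to the combination [lin ev s]
    of masses: for [m] the sum of [t delta_x] over the points [(x, t)], [lin
    ev s m] is the sum of [linf s x * t]. *)
Definition linf (s : seq (R * msets)) (x : borel X) : \bar R :=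
  \sum_(p <- s) p.1%:E * (\1_(sval p.2) x)%:E.

Lemma nnmeas_ev a : nnmeas (ev a).
Proof. by case: a => A mA; split => //; exact: measurable_eval. Qed.

Lemma jump_ge0 z : 0 <= jump z.
Proof. by rewrite lee_fin le_max lexx orbT. Qed.

Lemma nnmeas_jump : nnmeas jump.
Proof.
split; first exact: jump_ge0.
apply/measurable_EFinP; apply: measurable_maxr => //; exact: measurable_snd.
Qed.

Lemma nnmeas_jumpB (B : set (borel X)) : measurable B ->
  nnmeas (fun z : E => (\1_B z.1)%:E * jump z).
Proof.
move=> mB; apply: nnmeasM; last exact: nnmeas_jump.
split; first by move=> z; rewrite lee_fin indicE.
by apply/measurable_EFinP; apply: measurableT_comp => //; exact: measurable_indic.
Qed.

Lemma jump_integral (m : {measure set E -> \bar R}) (B : set (borel X)) :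
  measurable B ->
  \int[m]_(z in B `*` `]0%R, +oo[) (z.2)%:E = \int[m]_z ((\1_B z.1)%:E * jump z).
Proof.
move=> mB; rewrite integral_mkcond; apply: eq_integral => z _.
rewrite patchE indicE /jump.
have [/set_mem[Bz /=]|/negP nz] := boolP (z \in _).
  by rewrite in_itv/= andbT => z0; rewrite mem_set// mul1e max_l// ltW.
have [/set_mem Bz|_] := boolP (z.1 \in B); last by rewrite mul0e.
rewrite mul1e max_r// leNgt; apply/negP => z0; apply: nz; apply/mem_set.
by split => //=; rewrite in_itv/= andbT.
Qed.

Lemma nnmeas_linf s : nneg_coefs s -> nnmeas (linf s).
Proof.
rewrite /linf; elim: s => [|p s ih] h.
  by under [X in nnmeas X]eq_fun do rewrite big_nil; exact: nnmeas_cst.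
under [X in nnmeas X]eq_fun do rewrite big_cons.
apply: nnmeasD; last by apply: ih => q qs; apply: h; right.
apply: nnmeasM; first by apply: nnmeas_cst; rewrite lee_fin; apply: h; left.
by apply: nnmeas_indic; case: (p.2).
Qed.

Lemma nnmeas_linf_jump s : nneg_coefs s ->
  nnmeas (fun z : E => linf s z.1 * jump z).
Proof.
move=> hs; have [h0 h1] := nnmeas_linf hs.
apply: nnmeasM; last exact: nnmeas_jump.
by split => //; exact: measurableT_comp.
Qed.

Section atoms.
Hypothesis sepX : separable X.

Lemma MX_evE : (@measurable _ (MX X)) = <<s [set V | exists a : msets,
  exists2 B : set (\bar R), measurable B & V = ev a @^-1` B] >>.
Proof.
rewrite (MX_measurableE sepX); congr (<<s _ >>); apply/seteqP; split => V.
  by move=> [A mA [B mB ->]]; exists (exist _ A mA), B.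
by move=> [[A mA] [B mB ->]]; exists A => //; exists B.
Qed.

Fact max0_ge0 (s : R) : (0 <= Num.max s 0)%R.
Proof. by rewrite le_max lexx orbT. Qed.

Fact add_atom_finite (m : MX X) (x : borel X) (s : R) (A : set (borel X)) :
  measurable A -> metric_bounded A ->
  (measure_add m (mscale (NngNum (max0_ge0 s)) (@dirac _ _ x R))
    : {measure set (borel X) -> \bar R}) A < +oo.
Proof.
move=> mA bA.
suff : m A + mscale (NngNum (max0_ge0 s)) (@dirac _ _ x R) A < +oo.
  by apply: le_lt_trans; rewrite -(measure_addE m (mscale _ _)).
apply: lte_add_pinfty; first exact: bf_finite.
rewrite /mscale/= lte_mul_pinfty ?lee_fin ?max0_ge0//.
by rewrite diracE; case: (_ \in _); rewrite ltry.
Qed.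

(** The measure [m + s delta_x], negative [s] being read as 0. *)
Definition add_atom (m : MX X) (x : borel X) (s : R) : MX X :=
  BFMeasure (@add_atom_finite m x s).

Lemma add_atomE (m : MX X) x s (A : set (borel X)) :
  add_atom m x s A = m A + (\1_A x)%:E * jump (x, s).
Proof.
transitivity (m A + mscale (NngNum (max0_ge0 s)) (@dirac _ _ x R) A).
  exact: measure_addE.
by rewrite /mscale/= diracE indicE muleC.
Qed.

Lemma measurable_add_atom :
  measurable_fun setT (fun p : MX X * E => add_atom p.1 p.2.1 p.2.2).
Proof.
apply: (measurable_to_MX sepX) => A mA.
have -> : (fun p : MX X * E => add_atom p.1 p.2.1 p.2.2 A) =
    (fun p : MX X * E => p.1 A + (\1_A p.2.1)%:E * jump p.2).
  by apply/funext => -[m [x s]]; rewrite add_atomE.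
apply: emeasurable_funD.
  exact: (measurableT_comp (measurable_eval mA) measurable_fst).
exact: (measurableT_comp (nnmeas_jumpB mA).2 measurable_snd).
Qed.

Lemma lin_add_atom s (m : MX X) x t : nneg_coefs s ->
  lin ev s (add_atom m x t) = lin ev s m + linf s x * jump (x, t).
Proof.
rewrite /lin /linf; elim: s => [|p s ih] h.
  by rewrite !big_nil mul0e adde0.
have p0 : 0 <= p.1%:E by rewrite lee_fin; apply: h; left.
have hs : nneg_coefs s by move=> q qs; apply: h; right.
have [l0 _] := nnmeas_linf hs.
rewrite !big_cons ih// /ev add_atomE.
rewrite ge0_muleDr//; last by rewrite mule_ge0 ?jump_ge0// lee_fin indicE.
rewrite ge0_muleDl//; last 2 first.
- by rewrite mule_ge0// lee_fin indicE.
- exact: l0.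
by rewrite muleA addeACA.
Qed.

End atoms.

Section laplace.
Context d (Om : measurableType d) (P : probability Om R).
Variables (mu : Om -> MX X) (N : R.-ker Om ~> E) (nu : {measure set E -> \bar R}).
Hypothesis mmu : measurable_fun setT mu.
Hypothesis hN : is_poisson_random_measure P N nu.
Hypothesis hmu : {ae P, forall w, forall A : set (borel X), measurable A ->
  mu w A = \int[N w]_(z in A `*` `]0%R, +oo[) (z.2)%:E}.

Lemma nnmeas_mu (F : MX X -> \bar R) : nnmeas F -> nnmeas (fun w => F (mu w)).
Proof. by move=> [F0 mF]; split => //; exact: measurableT_comp. Qed.

Lemma nnmeas_lin s : nneg_coefs s -> nnmeas (lin ev s).
Proof.
move=> hs; split; first by move=> m; apply: lin_ge0 => //; exact: nnmeas_ev.
by apply: measurable_lin; exact: nnmeas_ev.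
Qed.

Lemma lin_muE : {ae P, forall w, forall s, nneg_coefs s ->
  lin ev s (mu w) = \int[N w]_z (linf s z.1 * jump z)}.
Proof.
apply: filterS hmu => w hw s.
rewrite /lin /linf; elim: s => [|p s ih] h.
  rewrite big_nil; under eq_integral do rewrite big_nil mul0e.
  by rewrite integral0.
have hs : nneg_coefs s by move=> q qs; apply: h; right.
have p0 : (0 <= p.1)%R by apply: h; left.
rewrite big_cons ih//; under [RHS]eq_integral do rewrite big_cons.
have [l0 _] := nnmeas_linf hs.
have e z : (p.1%:E * (\1_(sval p.2) z.1)%:E + linf s z.1) * jump z =
    p.1%:E * ((\1_(sval p.2) z.1)%:E * jump z) + linf s z.1 * jump z.
  by rewrite ge0_muleDl ?muleA//; rewrite mule_ge0// lee_fin indicE.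
under [RHS]eq_integral do rewrite e.
have mp : measurable (sval p.2) by case: (p.2).
rewrite (ifunD (ifun_integral (N w))); last 2 first.
- apply: nnmeasM; first by apply: nnmeas_cst; rewrite lee_fin.
  exact: nnmeas_jumpB.
- exact: nnmeas_linf_jump.
rewrite (ifunZ (ifun_integral (N w)))//; last exact: nnmeas_jumpB.
by rewrite -jump_integral// /ev hw.
Qed.

(** By [lin_muE] this is the Laplace functional of the Poisson random measure. *)
Lemma crm_laplace_joint s (f : E -> \bar R) : nneg_coefs s -> nnmeas f ->
  \int[P]_w (enexp (lin ev s (mu w)) * enexp (\int[N w]_z f z)) =
  enexp (\int[nu]_z (1 - enexp (linf s z.1 * jump z + f z))).
Proof.
move=> hs nf; have nl := nnmeas_linf_jump hs.
rewrite -(prm_laplace hN); last exact: nnmeasD.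
have nNf := nnmeas_kernel_integral N nf.
have nL := nnmeas_mu (nnmeas_lin hs).
have n1 : nnmeas (fun w => enexp (lin ev s (mu w)) * enexp (\int[N w]_z f z)).
  by apply: nnmeasM; apply: nnmeas_enexp; [case: nL|case: nNf].
have n2 : nnmeas (fun w => enexp (\int[N w]_z (linf s z.1 * jump z + f z))).
  by apply: nnmeas_enexp; case: (nnmeas_kernel_integral N (nnmeasD nl nf)).
apply: ge0_ae_eq_integral => //; [by case: n1|by case: n2|by move=> w _; case: n1|by move=> w _; case: n2|].
apply: filterS lin_muE => w hw _; rewrite hw//.
rewrite -enexpD.
- by rewrite (ifunD (ifun_integral (N w))).
- exact: (ifun_ge0 (ifun_integral (N w))).
- exact: (ifun_ge0 (ifun_integral (N w))).
Qed.

Lemma crm_laplace s : nneg_coefs s ->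
  \int[P]_w enexp (lin ev s (mu w)) =
  enexp (\int[nu]_z (1 - enexp (linf s z.1 * jump z))).
Proof.
move=> hs; have := crm_laplace_joint hs (@nnmeas_cst _ E R 0 (lexx _)).
under eq_integral do rewrite integral0 enexp0 mule1.
by move=> ->; congr enexp; apply: eq_integral => z _; rewrite adde0.
Qed.

Definition setT_msets : msets := exist _ setT measurableT.

Definition total_coef (b : R) : seq (R * msets) := [:: (b, setT_msets)].

Lemma total_coef_nneg b : (0 <= b)%R -> nneg_coefs (total_coef b).
Proof. by move=> b0 p [<-|]. Qed.

Lemma lin_total b (m : MX X) : lin ev (total_coef b) m = b%:E * m setT.
Proof. by rewrite /lin big_seq1. Qed.

Lemma linf_total b x : linf (total_coef b) x = b%:E.
Proof. by rewrite /linf big_seq1 /= indicT mule1. Qed.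

(** The Laplace exponent of the total mass. *)
Definition exponent (b : R) : \bar R := \int[nu]_z (1 - enexp (b%:E * jump z)).

Lemma total_laplace b : (0 <= b)%R ->
  \int[P]_w enexp (b%:E * mu w setT) = enexp (exponent b).
Proof.
move=> b0; have := crm_laplace (total_coef_nneg b0).
under eq_integral do rewrite lin_total.
by move=> ->; congr enexp; apply: eq_integral => z _; rewrite linf_total.
Qed.

Lemma exponent_ge0 b : (0 <= b)%R -> 0 <= exponent b.
Proof.
move=> b0; apply: integral_ge0 => z _; apply: sube_enexp_ge0.
by apply: mule_ge0; [rewrite lee_fin|exact: jump_ge0].
Qed.

Hypothesis mu_fin : {ae P, forall w, mu w setT < +oo}.

(** Otherwise [exp (- b T)] would have mean [0], and [b T] would be infinite. *)
Lemma exponent_fin b : (0 <= b)%R -> exponent b < +oo.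
Proof.
move=> b0; rewrite ltNge leye_eq; apply/negP => /eqP e.
have nT : nnmeas (fun w => enexp (b%:E * mu w setT)).
  apply: nnmeas_enexp; apply: measurable_funeM.
  by have [] := nnmeas_mu (nnmeas_ev setT_msets).
have := total_laplace b0; rewrite e => h0.
have := @ae_eq_integral_abs _ Om R P setT measurableT
  (fun w => enexp (b%:E * mu w setT)) nT.2.
move=> [+ _]; under eq_integral do rewrite gee0_abs ?enexp_ge0//.
move=> /(_ h0) hae.
have : {ae P, forall w : Om, False}.
  apply: filterS2 mu_fin hae => w Tw /(_ I)/eqP.
  rewrite /enexp expeR_eq0 => /eqP en.
  have : b%:E * mu w setT < +oo by rewrite lte_mul_pinfty ?lee_fin.
  by rewrite -[X in X < _]oppeK en ltxx.
move=> [S [mS S0 hS]].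
have : P setT <= P S by apply: le_measure; [exact/mem_set|exact/mem_set|move=> w _; exact: hS].
by rewrite S0 (@probability_setT _ _ _ P) leNgt lte01.
Qed.

(** The Laplace functional of [N] under the tilted law is a quotient of
    Laplace functionals under [P], and [1 - exp (- (x+y)) = (1 - exp (- x)) +
    (1 - exp (- y)) exp (- x)] brings it to the form of [prm_of_laplace]. *)
Lemma tilted_poisson (b : R) (P' : probability Om R)
    (nuu : {measure set E -> \bar R}) : (0 <= b)%R ->
  (forall f, nnmeas f -> \int[P']_w f w =
    (expeR (exponent b)) * \int[P]_w (f w * enexp (b%:E * mu w setT))) ->
  (forall f, nnmeas f -> \int[nuu]_z f z = \int[nu]_z (f z * enexp (b%:E * jump z))) ->
  is_poisson_random_measure P' N nuu.
Proof.
move=> b0 hP' hnuu; apply: prm_of_laplace => f nf.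
have nNf := nnmeas_kernel_integral N nf.
have nb : nnmeas (fun z : E => b%:E * jump z).
  by apply: nnmeasM; [apply: nnmeas_cst; rewrite lee_fin|exact: nnmeas_jump].
have n1f := nnmeas_1enexp nf.
rewrite hP'; last by apply: nnmeas_enexp; case: nNf.
have := crm_laplace_joint (total_coef_nneg b0) nf.
under eq_integral do rewrite lin_total muleC.
move=> ->; rewrite hnuu//.
have e (x y : \bar R) : 0 <= x -> 0 <= y ->
    1 - enexp (x + y) = (1 - enexp x) + (1 - enexp y) * enexp x.
  move=> x0 y0; rewrite enexpD//.
  rewrite -(fineK (enexp_fin x0)) -(fineK (enexp_fin y0)).
  by rewrite -EFinM -!EFinB -EFinM -EFinD; congr EFin; ring.
have -> : \int[nu]_z (1 - enexp (linf (total_coef b) z.1 * jump z + f z)) =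
    exponent b + \int[nu]_z ((1 - enexp (f z)) * enexp (b%:E * jump z)).
  rewrite -(ifunD (ifun_integral nu)); last 2 first.
  - exact: nnmeas_1enexp.
  - by apply: nnmeasM => //; apply: nnmeas_enexp; case: nb.
  apply: eq_integral => z _; rewrite linf_total e//; first by case: nb.
  by case: nf.
have I0 : 0 <= \int[nu]_z ((1 - enexp (f z)) * enexp (b%:E * jump z)).
  apply: integral_ge0 => z _; rewrite mule_ge0 ?enexp_ge0//; by case: n1f.
have xf : exponent b \is a fin_num.
  by rewrite ge0_fin_numE ?exponent_fin// exponent_ge0.
rewrite enexpD ?exponent_ge0// muleA -(fineK xf) /enexp -EFinN /=.
by rewrite -EFinM -expRD subrr expR0 mul1e.
Qed.

End laplace.

End crm.

(** * Mecke's formula *)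

Section difference_quotient.
Context (R : realType).

(** The difference quotient at [0] of [t |-> 1 - exp (- t x)], along
    [t = 2 ^- n]: it increases to [x]. *)
Definition dquot (n : nat) (x : \bar R) : \bar R :=
  (2 ^+ n)%:E * (1 - enexp ((2 ^- n)%:E * x)).

Lemma dquot_ge0 n x : 0 <= x -> 0 <= dquot n x.
Proof.
move=> x0; rewrite mule_ge0// ?lee_fin ?exprn_ge0//; apply: sube_enexp_ge0.
by rewrite mule_ge0// lee_fin invr_ge0 exprn_ge0.
Qed.

Lemma dquot_le n x y : x <= y -> dquot n x <= dquot n y.
Proof.
move=> xy; apply: lee_wpmul2l; first by rewrite lee_fin exprn_ge0.
by apply: leeB => //; apply: enexp_le; exact: lee_wpmul2l.
Qed.

Lemma dquot_nd x : 0 <= x -> nondecreasing_seq (dquot ^~ x).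
Proof.
move=> x0; apply/nondecreasing_seqP => n; rewrite /dquot.
set y := (2 ^- n.+1)%:E * x.
have y0 : 0 <= y by rewrite mule_ge0// lee_fin invr_ge0 exprn_ge0.
have -> : (2 ^- n)%:E * x = y + y.
  rewrite /y -ge0_muleDl ?lee_fin ?invr_ge0 ?exprn_ge0//.
  rewrite -EFinD; congr (_%:E * _).
  by rewrite exprS invfM; field; rewrite expf_neq0.
rewrite enexpD// -(fineK (enexp_fin y0)); set a := fine _.
have a0 : (0 <= a)%R by apply: fine_ge0; exact: enexp_ge0.
have a1 : (a <= 1)%R by rewrite -lee_fin fineK ?enexp_fin// enexp_le1.
rewrite -EFinM -!EFinB -!EFinM lee_fin exprS -mulrA mulrCA.
by apply: ler_wpM2l; [rewrite exprn_ge0|nra].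
Qed.

Lemma dquot_fin_cvg (r : R) : (0 <= r)%R -> dquot n r%:E @[n --> \oo] --> r%:E.
Proof.
move=> r0.
have e n : dquot n r%:E = (2 ^+ n * (1 - expR (- (2 ^- n * r))))%:E.
  by [].
have -> : (fun n => dquot n r%:E) = (fun n => (2 ^+ n * (1 - expR (- (2 ^- n * r))))%:E).
  by apply/funext => n; rewrite e.
apply: cvg_EFin; first by apply: nearW.
have g0 n : (0 < 2 ^- n :> R)%R by rewrite invr_gt0 exprn_gt0.
have c0 : (r - r ^+ 2 * (2^-1) ^+ n)%R @[n --> \oo] --> r.
  rewrite -[X in _ --> X]subr0; apply: cvgB; first exact: cvg_cst.
  rewrite -(mulr0 (r ^+ 2)%R); apply: cvgM; first exact: cvg_cst.
  apply: cvg_expr; rewrite ger0_norm ?invr_ge0//.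
  by rewrite invf_lt1// ltr1n.
apply: (squeeze_cvgr _ c0 (cvg_cst r)).
apply: nearW => n /=.
set y := (2 ^- n * r)%R.
have y0 : (0 <= y)%R by rewrite mulr_ge0// ltW.
have r2 : r = (2 ^+ n * y)%R by rewrite /y mulrA mulfV ?mul1r// expf_neq0.
have r3 : (r ^+ 2 * (2^-1) ^+ n = 2 ^+ n * y ^+ 2)%R.
  by rewrite exprVn {1}r2; field; rewrite expf_neq0.
have p0 : (0 < 2 ^+ n :> R)%R by rewrite exprn_gt0.
have e1 : (1 - y <= expR (- y))%R by exact: expR_ge1Dx.
have e2 : (expR (- y) <= 1 - y + y ^+ 2)%R.
  have := expR_ge1Dx y; rewrite expRN => h.
  have ey : (0 < expR y)%R by exact: expR_gt0.
  rewrite -div1r ler_pdivrMr//; apply: (@le_trans _ _ ((1 - y + y ^+ 2) * (1 + y))%R).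
    by have := exprn_ge0 3 y0; rewrite !exprS expr0 => ?; nra.
  by apply: ler_wpM2l => //; nra.
rewrite r3 {1}r2 -mulrBr; apply/andP; split.
  by apply: ler_wpM2l; [exact: ltW|lra].
by rewrite [leRHS]r2; apply: ler_wpM2l; [exact: ltW|lra].
Qed.

Lemma dquot_lim x : 0 <= x -> limn (dquot ^~ x) = x.
Proof.
case: x => [r|_|//]; first by rewrite lee_fin => r0; apply/cvg_lim => //; exact: dquot_fin_cvg.
apply/cvg_lim => //.
have -> : (dquot ^~ +oo) = (fun n => (2 ^+ n)%:E).
  apply/funext => n; rewrite /dquot gt0_muley ?lte_fin ?invr_gt0 ?exprn_gt0//.
  by rewrite /enexp /= sube0 mule1.
apply: (@gee_cvgy _ _ _ _ (fun n => (n%:R : R)%:E)).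
  by apply: nearW => n; rewrite lee_fin -natrX ler_nat ltnW// ltn_expl.
by apply/cvgeryP; exact: cvgr_idn.
Qed.

Lemma dquot_le_id n x : 0 <= x -> dquot n x <= x.
Proof.
move=> x0; rewrite -{2}(dquot_lim x0).
have c := ereal_nondecreasing_cvgn (dquot_nd x0); rewrite (cvg_lim _ c)//.
by apply: ereal_sup_ubound; exists n.
Qed.

(** Since [dquot n x] increases both in [n] and in [x], the limits may be
    taken together. *)
Lemma dquot_diag (u : nat -> \bar R) : (forall n, 0 <= u n) ->
  nondecreasing_seq u -> limn (fun n => dquot n (u n)) = limn u.
Proof.
move=> u0 nd.
have nd2 : nondecreasing_seq (fun n => dquot n (u n)).
  move=> m n mn; apply: (@le_trans _ _ (dquot m (u n))).
    by apply: dquot_le; exact: nd.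
  exact: dquot_nd.
apply/eqP; rewrite eq_le; apply/andP; split.
  apply: lee_lim; do ?exact: ereal_nondecreasing_is_cvgn.
  by apply: nearW => n; exact: dquot_le_id.
apply: lime_le; first exact: ereal_nondecreasing_is_cvgn.
apply: nearW => k; rewrite -(dquot_lim (u0 k)).
apply: lee_lim; do ?exact: ereal_nondecreasing_is_cvgn.
  by apply: ereal_nondecreasing_is_cvgn; exact: dquot_nd.
near=> n; apply: dquot_le; apply: nd.
by near: n; exists k.
Unshelve. all: by end_near. Qed.

Lemma nnmeas_dquot d (T : measurableType d) n (f : T -> \bar R) :
  nnmeas f -> nnmeas (fun x => dquot n (f x)).
Proof.
move=> [f0 mf]; apply: nnmeasM; first by apply: nnmeas_cst; rewrite lee_fin exprn_ge0.
apply: nnmeas_1enexp; apply: nnmeasM; last by split.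
by apply: nnmeas_cst; rewrite lee_fin invr_ge0 exprn_ge0.
Qed.

End difference_quotient.

Section mecke.
Context (R : realType) (X : completeMetricType R).
Local Notation E := (borel X * R)%type.
Context d (Om : measurableType d) (P : probability Om R).
Variables (mu : Om -> MX X) (N : R.-ker Om ~> E) (nu : {measure set E -> \bar R}).
Hypothesis sepX : separable X.
Hypothesis mmu : measurable_fun setT mu.
Hypothesis hN : is_poisson_random_measure P N nu.
Hypothesis hmu : {ae P, forall w, forall A : set (borel X), measurable A ->
  mu w A = \int[N w]_(z in A `*` `]0%R, +oo[) (z.2)%:E}.

Let phi s := \int[nu]_z (1 - enexp (linf s z.1 * @jump R X z)).

(** The derivative of the Laplace functional in the direction of the indicator
    of [B], taken along the difference quotients [dquot] by monotone
    convergence. *)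
Lemma crm_laplace_mass s (B : set (borel X)) : nneg_coefs s -> measurable B ->
  \int[P]_w (enexp (lin (@ev R X) s (mu w)) * mu w B) =
  (\int[nu]_z (enexp (linf s z.1 * jump z) * ((\1_B z.1)%:E * jump z))) *
    enexp (phi s).
Proof.
move=> hs mB.
have nl := nnmeas_linf_jump hs; have nB := nnmeas_jumpB (R:=R) mB.
have nL : nnmeas (fun w => lin (@ev R X) s (mu w)) := nnmeas_mu mmu (nnmeas_lin hs).
have neL : nnmeas (fun w => enexp (lin (@ev R X) s (mu w))).
  by apply: nnmeas_enexp; case: nL.
have nel : nnmeas (fun z : E => enexp (linf s z.1 * jump z)).
  by apply: nnmeas_enexp; case: nl.
have nmB : nnmeas (fun w => mu w B).
  exact: (nnmeas_mu mmu (nnmeas_ev (exist _ B mB))).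
pose t n : R := (2 ^- n)%R.
have t0 n : (0 <= t n)%R by rewrite invr_ge0 exprn_ge0.
have ntB n : nnmeas (fun z : E => (t n)%:E * ((\1_B z.1)%:E * jump z)).
  by apply: nnmeasM => //; apply: nnmeas_cst; rewrite lee_fin.
have ntm n : nnmeas (fun w => (t n)%:E * mu w B).
  by apply: nnmeasM => //; apply: nnmeas_cst; rewrite lee_fin.
pose D n := \int[nu]_z (enexp (linf s z.1 * jump z) *
  (1 - enexp ((t n)%:E * ((\1_B z.1)%:E * jump z)))).
have n1 n : nnmeas (fun z => enexp (linf s z.1 * jump z) *
    (1 - enexp ((t n)%:E * ((\1_B z.1)%:E * jump z)))).
  by apply: nnmeasM => //; exact: nnmeas_1enexp.
have D0 n : 0 <= D n by apply: integral_ge0 => z _; case: (n1 n).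
have phi0 : 0 <= phi s.
  by apply: integral_ge0 => z _; apply: sube_enexp_ge0; case: nl.
have phiD n : phi (((t n), exist _ B mB : msets X) :: s) = phi s + D n.
  rewrite /phi /D -(ifunD (ifun_integral nu))//; last exact: nnmeas_1enexp.
  apply: eq_integral => z _.
  have -> : linf ((t n, exist _ B mB : msets X) :: s) z.1 =
      (t n)%:E * (\1_B z.1)%:E + linf s z.1 by rewrite /linf big_cons.
  have lz : 0 <= linf s z.1 by case: (nnmeas_linf hs).
  rewrite ge0_muleDl//; last by rewrite mule_ge0 ?lee_fin// indicE.
  have -> : (t n)%:E * (\1_B z.1)%:E * jump z = (t n)%:E * ((\1_B z.1)%:E * jump z).
    by rewrite muleA.
  rewrite enexpD; [|by case: (ntB n)|by case: nl].
  have xf : enexp (linf s z.1 * jump z) \is a fin_num by apply: enexp_fin; case: nl.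
  have yf : enexp ((t n)%:E * ((\1_B z.1)%:E * jump z)) \is a fin_num.
    by apply: enexp_fin; case: (ntB n).
  rewrite -(fineK xf) -(fineK yf); move: (fine _) (fine _) => a b; rewrite -EFinM -!EFinB -EFinM -EFinD.
  by congr EFin; ring.
have key n : \int[P]_w (enexp (lin (@ev R X) s (mu w)) *
    (1 - enexp ((t n)%:E * mu w B))) = (1 - enexp (D n)) * enexp (phi s).
  have nw1 : nnmeas (fun w => enexp (lin (@ev R X) s (mu w)) *
      (1 - enexp ((t n)%:E * mu w B))).
    by apply: nnmeasM => //; exact: nnmeas_1enexp.
  have nw2 : nnmeas (fun w => enexp (lin (@ev R X) s (mu w)) *
      enexp ((t n)%:E * mu w B)).
    by apply: nnmeasM => //; apply: nnmeas_enexp; case: (ntm n).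
  have h2 : \int[P]_w (enexp (lin (@ev R X) s (mu w)) *
      enexp ((t n)%:E * mu w B)) = enexp (phi s) * enexp (D n).
    rewrite -enexpD// -phiD -(crm_laplace mmu hN hmu); last first.
      by move=> p [<-|]; [exact: t0|exact: hs].
    apply: eq_integral => w _; rewrite /lin big_cons -/(lin _ s (mu w)) /=.
    by rewrite muleC -enexpD//; [exact: (ntm n).1|exact: nL.1].
  have h3 : \int[P]_w (enexp (lin (@ev R X) s (mu w)) *
      (1 - enexp ((t n)%:E * mu w B))) + enexp (phi s) * enexp (D n) =
      enexp (phi s).
    rewrite -h2 -(ifunD (ifun_integral P))// -[RHS](crm_laplace mmu hN hmu)//.
    apply: eq_integral => w _.
    have xf : enexp (lin (@ev R X) s (mu w)) \is a fin_num.
      by apply: enexp_fin; case: nL.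
    have yf : enexp ((t n)%:E * mu w B) \is a fin_num.
      by apply: enexp_fin; case: (ntm n).
    rewrite -(fineK xf) -(fineK yf); move: (fine _) (fine _) => a b; rewrite -EFinB -!EFinM -EFinD.
    by congr EFin; ring.
  have ef := enexp_fin phi0; have df := enexp_fin (D0 n).
  have -> : \int[P]_w (enexp (lin (@ev R X) s (mu w)) *
      (1 - enexp ((t n)%:E * mu w B))) =
      enexp (phi s) - enexp (phi s) * enexp (D n).
    by rewrite -[in X in _ = X - _]h3 addeK// fin_numM.
  rewrite -(fineK ef) -(fineK df); move: (fine _) (fine _) => a b.
  rewrite -EFinM -!EFinB -EFinM.
  by congr EFin; ring.
have lim1 : \int[P]_w (enexp (lin (@ev R X) s (mu w)) * mu w B) =
    limn (fun n => \int[P]_w (enexp (lin (@ev R X) s (mu w)) * dquot n (mu w B))).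
  rewrite -(ifun_lim (ifun_integral P)); last 2 first.
  - by move=> n; apply: nnmeasM => //; exact: nnmeas_dquot.
  - move=> w m n mn; apply: lee_wpmul2l; first exact: enexp_ge0.
    by apply: dquot_nd => //; case: nmB.
  apply: eq_integral => w _.
  rewrite ge0_nondecreasing_limeMl ?enexp_ge0//.
  - by rewrite dquot_lim//; case: nmB.
  - by move=> n; apply: dquot_ge0; case: nmB.
  - by apply: dquot_nd; case: nmB.
pose u n := (2 ^+ n)%:E * D n.
have u0 n : 0 <= u n by rewrite mule_ge0// lee_fin exprn_ge0.
have uE n : u n = \int[nu]_z (enexp (linf s z.1 * jump z) *
    dquot n ((\1_B z.1)%:E * jump z)).
  have c0 : (0 <= 2 ^+ n :> R)%R by rewrite exprn_ge0.
  rewrite /u /D -(ifunZ (ifun_integral nu) c0 (n1 n)).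
  by apply: eq_integral => z _; rewrite muleCA.
have lim2 : \int[nu]_z (enexp (linf s z.1 * jump z) * ((\1_B z.1)%:E * jump z)) =
    limn (fun n => (2 ^+ n)%:E * D n).
  transitivity (limn (fun n => \int[nu]_z (enexp (linf s z.1 * jump z) *
      dquot n ((\1_B z.1)%:E * jump z)))).
    rewrite -(ifun_lim (ifun_integral nu)); last 2 first.
    - by move=> n; apply: nnmeasM => //; exact: nnmeas_dquot.
    - move=> w m n mn; apply: lee_wpmul2l; first exact: enexp_ge0.
      by apply: dquot_nd => //; case: nB.
    apply: eq_integral => z _.
    rewrite ge0_nondecreasing_limeMl ?enexp_ge0//.
    - by rewrite dquot_lim//; case: nB.
    - by move=> n; apply: dquot_ge0; case: nB.
    - by apply: dquot_nd; case: nB.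
  by congr (limn _); apply/funext => n; rewrite -uE.
have und : nondecreasing_seq u.
  move=> m n mn; rewrite !uE; apply: (ifun_le (ifun_integral nu)).
  - by apply: nnmeasM => //; exact: nnmeas_dquot.
  - by apply: nnmeasM => //; exact: nnmeas_dquot.
  - move=> z; apply: lee_wpmul2l; first exact: enexp_ge0.
    by apply: dquot_nd => //; case: nB.
rewrite lim1 lim2 -/u -(dquot_diag u0 und) [RHS]muleC.
rewrite -ge0_nondecreasing_limeMl ?enexp_ge0//; last 2 first.
- by move=> n; exact: dquot_ge0.
- move=> m n mn; apply: (@le_trans _ _ (dquot m (u n))).
    by apply: dquot_le; exact: und.
  exact: dquot_nd.
congr (limn _); apply/funext => n.
transitivity ((2 ^+ n)%:E * \int[P]_w (enexp (lin (@ev R X) s (mu w)) *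
    (1 - enexp ((t n)%:E * mu w B)))).
  rewrite -(ifunZ (ifun_integral P)) ?exprn_ge0//; last first.
    by apply: nnmeasM => //; exact: nnmeas_1enexp.
  by apply: eq_integral => w _; rewrite muleCA.
have -> : dquot n (u n) = (2 ^+ n)%:E * (1 - enexp (D n)).
  by rewrite /dquot /u muleA -EFinM mulVf ?mul1e// expf_neq0.
by rewrite key muleA muleC.
Qed.

Hypothesis mu_fin : {ae P, forall w, mu w setT < +oo}.

Lemma nnmeas_add_atom d1 (T : measurableType d1) (F : T * MX X -> \bar R)
    (pt : T -> E) : nnmeas F -> measurable_fun setT pt ->
  nnmeas (fun p : T * MX X => F (p.1, add_atom p.2 (pt p.1).1 (pt p.1).2)).
Proof.
move=> [F0 mF] mpt; split=> //.
apply: (measurableT_comp mF); apply: measurable_fun_pair => //.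
have -> : (fun p : T * MX X => add_atom p.2 (pt p.1).1 (pt p.1).2) =
    (fun p : MX X * E => add_atom p.1 p.2.1 p.2.2) \o
    (fun p : T * MX X => (p.2, pt p.1)) by [].
apply: (measurableT_comp (measurable_add_atom sepX)).
apply: measurable_fun_pair; first exact: measurable_snd.
exact: measurableT_comp.
Qed.

Lemma nnmeas_mean d1 (T : measurableType d1) (F : T * MX X -> \bar R) :
  nnmeas F -> nnmeas (fun t => \int[P]_w F (t, mu w)).
Proof.
move=> [F0 mF]; split; first by move=> t; exact: integral_ge0.
have h := @measurable_fun_fubini_tonelli_F _ _ T Om R P
  (fun p => F (p.1, mu p.2)).
apply: h => //; apply: (measurableT_comp mF); apply: measurable_fun_pair => //.
exact: (measurableT_comp mmu measurable_snd).
Qed.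

(** Mecke's formula: to sample a point from [mu] is to add to [mu] an
    independent atom drawn from the intensity biased by the size of the jump.
    Both sides are finite measures in [Psi] once damped by [exp (- mu X)], and
    their Laplace transforms agree. *)
Lemma crm_mecke (Psi : MX X -> \bar R) (B : set (borel X)) :
  nnmeas Psi -> measurable B ->
  \int[P]_w (Psi (mu w) * mu w B) =
  \int[nu]_z ((\1_B z.1)%:E * jump z *
               \int[P]_w Psi (add_atom (mu w) z.1 z.2)).
Proof.
move=> nPsi mB.
have nB := nnmeas_jumpB (R:=R) mB.
have nadd (F : MX X -> \bar R) : nnmeas F ->
    nnmeas (fun z : E => \int[P]_w F (add_atom (mu w) z.1 z.2)).
  move=> nF; have nF2 : nnmeas (fun p : E * MX X => F p.2).
    by case: nF => F0 mF; split => //; exact: (measurableT_comp mF measurable_snd).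
  have := nnmeas_mean (nnmeas_add_atom nF2 (@measurable_id _ E setT)).
  by [].
pose wt (m : MX X) := enexp (m setT).
have nwt : nnmeas wt.
  by apply: nnmeas_enexp; exact: (measurable_eval measurableT).
have nmB : nnmeas (fun w => mu w B) := nnmeas_mu mmu (nnmeas_ev (exist _ B mB)).
have madd z : measurable_fun setT (fun w => add_atom (mu w) z.1 z.2).
  have -> : (fun w => add_atom (mu w) z.1 z.2) =
      (fun p : MX X * E => add_atom p.1 p.2.1 p.2.2) \o (fun w => (mu w, z)) by [].
  apply: (measurableT_comp (measurable_add_atom sepX)).
  by apply: measurable_fun_pair.
pose L1 (F : MX X -> \bar R) := \int[P]_w (F (mu w) * wt (mu w) * mu w B).
pose L2 (F : MX X -> \bar R) := \int[nu]_z ((\1_B z.1)%:E * jump z *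
  \int[P]_w (F (add_atom (mu w) z.1 z.2) * wt (add_atom (mu w) z.1 z.2))).
have hL1 : integral_functional L1.
  apply: (ifun_comp (L := fun f => \int[P]_w (f w * wt (mu w) * mu w B)) _ mmu).
  have -> : (fun f => \int[P]_w (f w * wt (mu w) * mu w B)) =
      (fun f => \int[P]_w (f w * (wt (mu w) * mu w B))).
    by apply/funext => f; apply: eq_integral => w _; rewrite muleA.
  apply: (ifun_density (ifun_integral P)).
  by apply: nnmeasM => //; exact: (nnmeas_mu mmu).
have hL2 : integral_functional L2.
  have -> : L2 = (fun F => \int[nu]_z ((\int[P]_w (F (add_atom (mu w) z.1 z.2) *
      wt (add_atom (mu w) z.1 z.2))) * ((\1_B z.1)%:E * jump z))).
    by apply/funext => F; apply: eq_integral => z _; rewrite muleC.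
  apply: (ifun_bind (ifun_density (ifun_integral nu) nB)
    (L2 := fun z F => \int[P]_w (F (add_atom (mu w) z.1 z.2) *
      wt (add_atom (mu w) z.1 z.2)))).
    move=> z.
    apply: (ifun_comp (L := fun f => \int[P]_w (f w *
      wt (add_atom (mu w) z.1 z.2))) _ (madd z)).
    apply: (ifun_density (ifun_integral P)).
    by case: nwt => w0 mw; split => //; exact: (measurableT_comp mw (madd z)).
  by move=> F nF; case: (nadd _ (nnmeasM nF nwt)).
have [m1 m1E] := ifun_measure hL1.
have [m2 m2E] := ifun_measure hL2.
have lwt (m : MX X) s : nneg_coefs s -> enexp (lin (@ev R X) s m) * wt m =
    enexp (lin (@ev R X) ((1%R, setT_msets X) :: s) m).
  move=> hs; rewrite /lin big_cons -/(lin _ s m) mul1e /wt addeC enexpD//.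
  by case: (nnmeas_lin hs).
have nns (s : seq (R * msets X)) : nneg_coefs s -> nneg_coefs ((1%R, setT_msets X) :: s).
  by move=> hs p [<-|]; [exact: ler01|exact: hs].
have nel s : nneg_coefs s -> nnmeas (fun m => enexp (lin (@ev R X) s m)).
  by move=> hs; apply: nnmeas_enexp; case: (nnmeas_lin hs).
have key s : nneg_coefs s ->
    \int[m1]_m enexp (lin (@ev R X) s m) = \int[m2]_m enexp (lin (@ev R X) s m).
  move=> hs; have hs' := nns s hs.
  rewrite m1E; last exact: nel.
  rewrite m2E; last exact: nel.
  rewrite /L1 /L2; under eq_integral do rewrite (lwt _ _ hs).
  rewrite crm_laplace_mass//.
  have nl' := nnmeas_linf_jump hs'.
  have phi0 : 0 <= phi ((1%R, setT_msets X) :: s).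
    by apply: integral_ge0 => z _; apply: sube_enexp_ge0; case: nl'.
  rewrite muleC -{1}(fineK (enexp_fin phi0)).
  rewrite -(ifunZ (ifun_integral nu)); last 2 first.
  - by apply: fine_ge0; exact: enexp_ge0.
  - by apply: nnmeasM => //; apply: nnmeas_enexp; case: nl'.
  rewrite fineK ?enexp_fin//.
  apply: eq_integral => z _.
  transitivity ((\1_B z.1)%:E * jump z *
    (enexp (linf ((1%R, setT_msets X) :: s) z.1 * jump z) *
      enexp (phi ((1%R, setT_msets X) :: s)))).
    by rewrite muleC [X in X * _]muleC -muleA.
  congr (_ * _).
  rewrite -(crm_laplace mmu hN hmu)//.
  have lf0 : 0 <= linf ((1%R, setT_msets X) :: s) z.1 * jump z by case: nl'.
  rewrite -{1}(fineK (enexp_fin lf0)) -(ifunZ (ifun_integral P)); last 2 first.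
  - by apply: fine_ge0; exact: enexp_ge0.
  - exact: (nnmeas_mu mmu (nel _ hs')).
  apply: eq_integral => w _; rewrite fineK ?enexp_fin//.
  rewrite (lwt (add_atom (mu w) z.1 z.2) s hs) lin_add_atom//.
  case: z lf0 => x t lf0.
  by rewrite muleC -enexpD//; case: (nnmeas_lin hs').
have xe1 (x : \bar R) : 0 <= x -> enexp x * x <= 1.
  case: x => [r||//] r0.
  - rewrite enexp_EFin -EFinM lee_fin expRN.
    rewrite -ler_pdivlMl ?invr_gt0 ?expR_gt0// invrK mulr1.
    by apply: le_trans (expR_ge1Dx r); rewrite lerDr ler01.
  - by rewrite /enexp /= mul0e lee_fin ler01.
have L1E A : measurable A -> m1 A = L1 (fun x => (\1_A x)%:E).
  by move=> mA; rewrite -m1E ?integral_indicT//; exact: nnmeas_indic.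
have L2E A : measurable A -> m2 A = L2 (fun x => (\1_A x)%:E).
  by move=> mA; rewrite -m2E ?integral_indicT//; exact: nnmeas_indic.
have m1oo : m1 setT < +oo.
  rewrite L1E// /L1; apply: (@le_lt_trans _ _ (\int[P]_w 1)); last first.
    by rewrite integral_prob_cst ltry.
  apply: (ifun_le (ifun_integral P)); [|exact: nnmeas_cst|].
    apply: nnmeasM => //.
    exact: (nnmeas_mu mmu (nnmeasM (nnmeas_indic _ measurableT) nwt)).
  move=> w; rewrite indicT mul1e; apply: le_trans (xe1 (mu w setT) _) => //.
  apply: lee_wpmul2l; first exact: enexp_ge0.
  by apply: le_measure => //; exact/mem_set.
have m12 : m1 setT = m2 setT.
  have := key [::] (fun _ => False_ind _); rewrite /lin.
  under eq_integral do rewrite big_nil enexp0.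
  under [in RHS]eq_integral do rewrite big_nil enexp0.
  by rewrite !integral_cst// !mul1e.
have m12E : forall A, measurable A -> m1 A = m2 A.
  by apply: (laplace_family_unique (@nnmeas_ev R X) (MX_evE sepX)) => //; rewrite -m12.
pose F (m : MX X) := Psi m * expeR (m setT).
have nF : nnmeas F.
  apply: nnmeasM => //; have -> : (fun m : MX X => expeR (m setT)) =
      (fun m => enexp (- (m setT))).
    by apply/funext => m; rewrite /enexp oppeK.
  apply: nnmeas_enexp; apply: measurableT_comp => //.
  exact: measurable_eval.
have eF (m : MX X) : m setT < +oo -> F m * wt m = Psi m.
  move=> moo; have mf : m setT \is a fin_num by rewrite ge0_fin_numE.
  rewrite /F /wt -muleA -(fineK mf) enexp_EFin /= -EFinM -expRD subrr expR0.
  by rewrite mule1.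
have := ge0_integral_unique m12E F; rewrite m1E// m2E// /L1 /L2 => h12.
transitivity (\int[P]_w (F (mu w) * wt (mu w) * mu w B)).
  apply: ge0_ae_eq_integral => //.
  - by case: (nnmeasM (nnmeas_mu mmu nPsi) nmB).
  - by case: (nnmeasM (nnmeas_mu mmu (nnmeasM nF nwt)) nmB).
  - by move=> w _; case: (nnmeasM (nnmeas_mu mmu nPsi) nmB).
  - by move=> w _; case: (nnmeasM (nnmeas_mu mmu (nnmeasM nF nwt)) nmB).
  - by apply: filterS mu_fin => w hw _; rewrite eF.
rewrite h12; apply: eq_integral => z _; congr (_ * _).
have n3 : nnmeas (fun w => F (add_atom (mu w) z.1 z.2) * wt (add_atom (mu w) z.1 z.2)).
  have [f0 mf] := nnmeasM nF nwt.
  by split => //; exact: (measurableT_comp mf (madd z)).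
have n4 : nnmeas (fun w => Psi (add_atom (mu w) z.1 z.2)).
  case: nPsi => f0 mf.
  by split => //; exact: (measurableT_comp mf (madd z)).
apply: ge0_ae_eq_integral => //.
- by case: n3.
- by case: n4.
- by move=> w _; case: n3.
- by move=> w _; case: n4.
- apply: filterS mu_fin => w hw _; rewrite eF// add_atomE indicT mul1e.
  by rewrite lte_add_pinfty// ltry.
Qed.

End mecke.

(** * Kernels, and the disintegration of the intensity *)

Section normalized_kernels.
Context (R : realType) d1 d2 (T1 : measurableType d1) (T2 : measurableType d2).
Variable L : T1 -> (T2 -> \bar R) -> \bar R.
Hypothesis hL : forall x, integral_functional (L x).
Hypothesis mL : forall B, measurable B ->
  measurable_fun setT (fun x => L x (fun y => (\1_B y)%:E)).

Definition functional_measure (x : T1) : {measure set T2 -> \bar R} :=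
  projT1 (cid (ifun_measure (hL x))).

Lemma functional_measureE x f : nnmeas f ->
  \int[functional_measure x]_y f y = L x f.
Proof. by move=> nf; rewrite /functional_measure; case: cid => m /= ->. Qed.

Fact functional_measure_measurable U : measurable U ->
  measurable_fun setT (functional_measure ^~ U).
Proof.
move=> mU; have -> : (fun x => functional_measure x U) =
  (fun x => L x (fun y => (\1_U y)%:E)); last exact: mL.
apply/funext => x; rewrite -functional_measureE; last exact: nnmeas_indic.
by rewrite integral_indicT.
Qed.

HB.instance Definition _ := isKernel.Build _ _ T1 T2 R functional_measure
  functional_measure_measurable.

Definition functional_kernel : R.-ker T1 ~> T2 := functional_measure.

(** The kernel is the normalised functional, and a Dirac measure where the
    mass is [0] or [+oo]. *)
Lemma normalized_kernel : exists k : R.-pker T1 ~> T2,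
  forall x, L x (fun=> 1) < +oo ->
  forall f, nnmeas f -> L x (fun=> 1) * \int[k x]_y f y = L x f.
Proof.
exists (knormalize functional_kernel (@dirac _ T2 point R)) => x moo f nf.
have mE : functional_kernel x setT = L x (fun=> 1).
  rewrite -functional_measureE; last exact: nnmeas_cst.
  by rewrite integral_cst// mul1e.
have [m0|mle] := ltP 0 (L x (fun=> 1)); last first.
  have m0 : L x (fun=> 1) = 0 by apply/eqP; rewrite eq_le mle -mE measure_ge0.
  rewrite m0 mul0e -functional_measureE//.
  rewrite (eq_measure_integral mzero) ?integral_measure_zero// => A mA _.
  transitivity (0 : \bar R) => //.
  apply/eqP; rewrite eq_le measure_ge0 andbT -m0 -mE.
  by apply: le_measure => //; exact/mem_set.
set c := L x _ in mE m0 moo *.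
have cf : c \is a fin_num by rewrite ge0_fin_numE// ltW.
have c0 : fine c != 0%R by rewrite fine_eq0// gt_eqF.
have kE U : measurable U -> c * knormalize functional_kernel (@dirac _ T2 point R) x U =
    functional_kernel x U.
  move=> mU; rewrite /knormalize/= /mnormalize mE gt_eqF//= lt_eqF//=.
  by rewrite muleCA -{1}(fineK cf) -EFinM mulfV// mule1.
rewrite -functional_measureE//.
apply: (ifun_unique (L1 := fun f => c * \int[_]_y f y) _ _ _ nf).
- by apply: ifunC; [exact: ifun_integral|exact: ltW].
- exact: ifun_integral.
- by move=> A mA; rewrite !integral_indicT//; exact: kE.
Qed.

End normalized_kernels.

Section joint_measurability.
Context (R : realType).

(** A kernel, seen as a family of functionals, integrates out its variable from
    functions that also depend on a parameter. *)
Definition jointly_measurable d1 d2 (T1 : measurableType d1) (T2 : measurableType d2)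
    (L : T1 -> (T2 -> \bar R) -> \bar R) : Prop :=
  forall d (S : measurableType d) (phi : S -> T1) (F : S * T2 -> \bar R),
    measurable_fun setT phi -> nnmeas F ->
    nnmeas (fun s => L (phi s) (fun y => F (s, y))).

Lemma ifun_integral_in d (T : measurableType d) (m : {measure set T -> \bar R})
    (A : set T) : measurable A -> integral_functional (fun f => \int[m]_(x in A) f x).
Proof.
move=> mA; have -> : (fun f : T -> \bar R => \int[m]_(x in A) f x) =
    (fun f => \int[m]_x (f x * (\1_A x)%:E)).
  apply/funext => f; rewrite -(integral_indicM _ _ mA).
  by apply: eq_integral => x _; rewrite muleC.
by apply: (ifun_density (ifun_integral m)); exact: nnmeas_indic.
Qed.

Lemma ifun_if d (T : measurableType d) (b : bool) (L : (T -> \bar R) -> \bar R) :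
  integral_functional L -> integral_functional (fun f => if b then L f else 0).
Proof.
case: b => // _; split => //.
- by move=> f g _ _; rewrite adde0.
- by move=> c f _ _; rewrite mule0.
- by move=> f_ _ _; rewrite lim_cst.
Qed.

(** Such a family is its mass times a probability kernel, whose partial
    integrals are measurable. *)
Lemma jointly_measurable_finite d1 d2 (T1 : measurableType d1)
    (T2 : measurableType d2) (L : T1 -> (T2 -> \bar R) -> \bar R) :
  (forall x, integral_functional (L x)) ->
  (forall B, measurable B -> measurable_fun setT (fun x => L x (fun y => (\1_B y)%:E))) ->
  (forall x, L x (fun=> 1) < +oo) ->
  jointly_measurable L.
Proof.
move=> hL mL oo d S phi F mphi [F0 mF].
have nF s : nnmeas (fun y => F (s, y)) by split => //; exact: measurableT_comp.
split; first by move=> s; apply: (ifun_ge0 (hL _)).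
have hLphi s : integral_functional (L (phi s)) by [].
have mLphi B : measurable B ->
    measurable_fun setT (fun s => L (phi s) (fun y => (\1_B y)%:E)).
  by move=> mB; exact: (measurableT_comp (mL B mB) mphi).
have [k kE] := normalized_kernel hLphi mLphi.
rewrite (_ : (fun s => _) =
    (fun s => L (phi s) (fun=> 1) * \int[k s]_y F (s, y))); last first.
  by apply/funext => s; rewrite kE.
apply: emeasurable_funM.
  have := mLphi setT measurableT; rewrite (_ : (fun y : T2 => _) = fun=> 1)//.
  by apply/funext => y; rewrite indicT.
exact: measurable_fun_integral_sfinite_kernel.
Qed.

End joint_measurability.

Section regular_version.
Context (R : realType) d (T : measurableType d) (rho : R.-ker T ~> R).

(** A bounded function, positive on the positive half-line only, whose
    integral against the intensity is the Laplace exponent of the total mass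
    at [1]. *)
Definition levy_weight (s : R) : R := (1 - expR (- Num.max s 0))%R.

Definition levy_mass (x : T) : \bar R := \int[rho x]_s (levy_weight s)%:E.

Lemma levy_weight_ge0 s : (0 <= levy_weight s)%R.
Proof. by rewrite subr_ge0 -expR0 ler_expR oppr_le0 le_max lexx orbT. Qed.

Lemma levy_weight_gt0 s : (0 < s)%R -> (0 < levy_weight s)%R.
Proof. by move=> s0; rewrite subr_gt0 -expR0 ltr_expR oppr_lt0 lt_max s0. Qed.

Lemma levy_weight_eq0 s : (s <= 0)%R -> levy_weight s = 0%R.
Proof. by move=> s0; rewrite /levy_weight max_r// oppr0 expR0 subrr. Qed.

Lemma nnmeas_levy_weight : nnmeas (fun s => (levy_weight s)%:E).
Proof.
split; first by move=> s; rewrite lee_fin levy_weight_ge0.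
apply/measurable_EFinP; apply: measurable_funB => //.
apply: measurableT_comp => //; apply: measurableT_comp => //.
exact: measurable_maxr.
Qed.

Lemma nnmeas_inv_levy_weight : nnmeas (fun s => ((levy_weight s)^-1)%:E).
Proof.
split; first by move=> s; rewrite lee_fin invr_ge0 levy_weight_ge0.
rewrite (_ : (fun s => _) = (fun s => if (s <= 0)%R then 0 else
  (((levy_weight s) `^ (-1))%R)%:E)).
  apply: measurable_fun_ifT => //; first exact: measurable_fun_ler.
  apply/measurable_EFinP; apply: (measurableT_comp (measurable_powR _)).
  by apply/measurable_EFinP; case: nnmeas_levy_weight.
apply/funext => s; case: leP => s0.
  by rewrite levy_weight_eq0// invr0.
by rewrite powRN powRr1// levy_weight_ge0.
Qed.

Lemma measurable_levy_mass : measurable_fun setT levy_mass.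
Proof.
have [w0 mw] := nnmeas_levy_weight.
apply: measurable_fun_integral_kernel => //; exact: measurable_kernel.
Qed.

Lemma levy_mass_ge0 x : 0 <= levy_mass x.
Proof. by apply: integral_ge0 => s _; rewrite lee_fin levy_weight_ge0. Qed.

(** Integration against [rho x] on the positive half-line, set to [0] where
    [levy_mass x] is infinite. Elsewhere [levy_weight] is a strictly positive
    integrable function of the size of the jump, so that functions jointly
    measurable in the size and in a parameter have measurable integrals. *)
Definition levy_int (x : T) (f : R -> \bar R) : \bar R :=
  if levy_mass x < +oo then \int[rho x]_(s in `]0%R, +oo[) f s else 0.

Lemma levy_intE x f : levy_mass x < +oo ->
  levy_int x f = \int[rho x]_(s in `]0%R, +oo[) f s.
Proof. by rewrite /levy_int => ->. Qed.

Lemma levy_int_singular x f : ~ levy_mass x < +oo -> levy_int x f = 0.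
Proof. by move=> h; rewrite /levy_int; case: ifP. Qed.

Lemma levy_int_ifun x : integral_functional (levy_int x).
Proof.
by apply: ifun_if; exact: ifun_integral_in.
Qed.

Let damped x (f : R -> \bar R) : \bar R :=
  if levy_mass x < +oo then \int[rho x]_s (f s * (levy_weight s)%:E) else 0.

(** The measure with density [levy_weight] is finite, and the density is
    divided out again in the integrand. *)
Lemma levy_int_joint : jointly_measurable levy_int.
Proof.
have [w0 mw] := nnmeas_levy_weight; have mm := measurable_levy_mass.
have jd : jointly_measurable damped.
  apply: jointly_measurable_finite.
  - move=> x; apply: ifun_if.
    by apply: (ifun_density (ifun_integral _)).
  - move=> B mB; apply: measurable_fun_ifT => //; first exact: measurable_fun_lte.
    have [h mh] := nnmeasM (nnmeas_indic R mB) nnmeas_levy_weight.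
    apply: measurable_fun_integral_kernel => //; exact: measurable_kernel.
  - move=> x; rewrite /damped; case: ifP => // xoo.
    by under eq_integral do rewrite mul1e.
move=> d' S phi F mphi nF.
have nFw : nnmeas (fun p => F p * ((levy_weight p.2)^-1)%:E).
  apply: nnmeasM => //; have [i0 mi] := nnmeas_inv_levy_weight.
  by split => //; exact: (measurableT_comp mi measurable_snd).
have := jd _ _ _ _ mphi nFw; congr nnmeas; apply/funext => s.
rewrite /damped /levy_int; case: ifP => // _.
rewrite [RHS]integral_mkcond; apply: eq_integral => t _.
rewrite patchE; case: ifPn => [/set_mem/=|].
  rewrite in_itv/= andbT => t0; rewrite -muleA -EFinM mulVf ?mule1//.
  by rewrite gt_eqF// levy_weight_gt0.
move=> tn; rewrite levy_weight_eq0 ?mule0// leNgt; apply: contra tn => t0.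
by apply/mem_set; rewrite /= in_itv/= t0.
Qed.

End regular_version.

Section disintegration.
Context (R : realType) (X : completeMetricType R).
Local Notation E := (borel X * R)%type.
Variables (eta : probability (borel X) R) (rho : R.-ker (borel X) ~> R)
  (nu : {measure set E -> \bar R}).
Hypothesis nuE : disintegrates nu eta (fun x => rho x).
Hypothesis nu_fin : exponent nu 1 < +oo.

Let rectangle (A : set (borel X)) (g : R -> \bar R) : measurable A -> nnmeas g ->
  \int[nu]_z ((\1_A z.1)%:E * g z.2) =
  \int[eta]_(x in A) \int[rho x]_s g s.
Proof.
move=> mA ng.
have nA : nnmeas (fun z : E => (\1_A z.1)%:E : \bar R).
  have [h mh] := nnmeas_indic R mA.
  by split => //; exact: (measurableT_comp mh measurable_fst).
apply: (ifun_unique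
  (L1 := fun g => \int[nu]_z ((\1_A z.1)%:E * g z.2))
  (L2 := fun g => \int[eta]_(x in A) \int[rho x]_s g s)) => //.
- apply: (ifun_comp (L := fun f : E -> \bar R => \int[nu]_z ((\1_A z.1)%:E * f z))
    _ measurable_snd).
  have -> : (fun f : E -> \bar R => \int[nu]_z ((\1_A z.1)%:E * f z)) =
      (fun f => \int[nu]_z (f z * (\1_A z.1)%:E)).
    by apply/funext => f; apply: eq_integral => z _; rewrite muleC.
  exact: (ifun_density (ifun_integral nu)).
- apply: (ifun_bind (L1 := fun f => \int[eta]_(x in A) f x)).
  + exact: ifun_integral_in.
  + by move=> x; exact: ifun_integral.
  + move=> f [f0 mf]; apply: measurable_fun_integral_kernel => //.
    exact: measurable_kernel.
- move=> B mB; transitivity (nu (A `*` B)).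
    rewrite -integral_indicT; last exact: measurableX.
    apply: eq_integral => -[x s] _; rewrite -EFinM; congr EFin.
    by rewrite !indicE in_setX -natrM mulnb.
  by rewrite nuE//; apply: eq_integral => x _; rewrite integral_indicT.
Qed.

(** The integral of [levy_mass] is the Laplace exponent at [1]. *)
Lemma levy_mass_fin : {ae eta, forall x, levy_mass rho x < +oo}.
Proof.
have h : \int[eta]_x levy_mass rho x < +oo.
  rewrite (_ : \int[eta]_x _ = exponent nu 1)//.
  have := rectangle measurableT (@nnmeas_levy_weight R).
  move=> <-; apply: eq_integral => z _.
  by rewrite indicT mul1e mul1e /jump enexp_EFin.
have int : eta.-integrable setT (levy_mass rho).
  apply/integrableP; split; first exact: measurable_levy_mass.
  by under eq_integral do rewrite gee0_abs ?levy_mass_ge0//.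
have := integrable_ae measurableT int.
apply: filterS => x /(_ I); rewrite ge0_fin_numE//; exact: levy_mass_ge0.
Qed.

(** The two sides are compared on rectangles, after multiplication by a weight
    that makes them finite. *)
Lemma levy_disintegration (F : E -> \bar R) : nnmeas F ->
  (forall z, (z.2 <= 0)%R -> F z = 0) ->
  \int[nu]_z F z = \int[eta]_x levy_int rho x (fun s => F (x, s)).
Proof.
move=> nF F0.
have nW : nnmeas (fun z : E => (levy_weight z.2)%:E).
  have [h mh] := @nnmeas_levy_weight R.
  by split => //; exact: (measurableT_comp mh measurable_snd).
have nV : nnmeas (fun z : E => ((levy_weight z.2)^-1)%:E).
  have [h mh] := @nnmeas_inv_levy_weight R.
  by split => //; exact: (measurableT_comp mh measurable_snd).
have nsec (G : E -> \bar R) x : nnmeas G -> nnmeas (fun s => G (x, s)).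
  by move=> [h mh]; split => //; exact: measurableT_comp.
have nint (G : E -> \bar R) : nnmeas G ->
    nnmeas (fun x => levy_int rho x (fun s => G (x, s))).
  by move=> nG; exact: (@levy_int_joint _ _ _ rho _ _ id G (@measurable_id _ _ _) nG).
pose L1 (F : E -> \bar R) := \int[nu]_z (F z * (levy_weight z.2)%:E).
pose L2 (F : E -> \bar R) :=
  \int[eta]_x levy_int rho x (fun s => F (x, s) * (levy_weight s)%:E).
have hL1 : integral_functional L1 by exact: (ifun_density (ifun_integral nu)).
have hL2 : integral_functional L2.
  apply: (ifun_bind (L2 := fun x F => levy_int rho x
    (fun s => F (x, s) * (levy_weight s)%:E)) (ifun_integral eta)).
    move=> x.
    apply: (ifun_comp (L := fun f => levy_int rho x
      (fun s => f s * (levy_weight s)%:E))).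
      by apply: (ifun_density (levy_int_ifun _ _)); exact: nnmeas_levy_weight.
    exact: measurable_pair1.
  by move=> G nG; case: (nint _ (nnmeasM nG nW)).
pose C := [set A `*` B | A in @measurable _ (borel X) & B in @measurable _ R].
have key : forall G, nnmeas G -> L1 G = L2 G.
  apply: (@ifun_unique_pi R _ _ C (fun=> setT) L1 L2) => //.
  - by rewrite measurable_prod_measurableType.
  - move=> _ _ [X1 mX1 [X2 mX2 <-]] [Y1 mY1 [Y2 mY2 <-]].
    exists (X1 `&` Y1); first exact: measurableI.
    by exists (X2 `&` Y2); [exact: measurableI|rewrite setXI].
  - by move=> _; exists setT => //; exists setT => //; rewrite setXTT.
  - by rewrite bigcup_const.
  - move=> _ [A mA [B mB <-]].
    have nBw := nnmeasM (nnmeas_indic R mB) (@nnmeas_levy_weight R).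
    have e (x : borel X) (s : R) : (\1_(A `*` B) (x, s))%:E * (levy_weight s)%:E =
        (\1_A x)%:E * ((\1_B s)%:E * (levy_weight s)%:E).
      rewrite -!EFinM; congr EFin; rewrite mulrA; congr (_ * _)%R.
      by rewrite !indicE in_setX -natrM mulnb.
    transitivity (\int[nu]_z ((\1_A z.1)%:E * ((\1_B z.2)%:E * (levy_weight z.2)%:E))).
      by apply: eq_integral => -[x s] _; rewrite e.
    rewrite (rectangle mA nBw) -(integral_indicM _ _ mA).
    apply: ge0_ae_eq_integral => //.
    + apply: (nnmeasM (nnmeas_indic R mA) _).2; split.
        by move=> x; apply: integral_ge0 => s _; case: nBw.
      case: nBw => h mh; apply: measurable_fun_integral_kernel => //.
      exact: measurable_kernel.
    + have mAB : measurable (A `*` B) by exact: measurableX.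
      by case: (nint _ (nnmeasM (nnmeas_indic R mAB) nW)).
    + move=> x _; apply: mule_ge0; first by rewrite lee_fin indicE.
      by apply: integral_ge0 => s _; case: nBw.
    + move=> x _; apply: (ifun_ge0 (levy_int_ifun _ _)).
      have mAB : measurable (A `*` B) by exact: measurableX.
      exact: (nsec _ x (nnmeasM (nnmeas_indic R mAB) nW)).
    apply: filterS levy_mass_fin => x xoo _.
    have -> : (fun s => (\1_(A `*` B) (x, s))%:E * (levy_weight s)%:E) =
        (fun s => (\1_A x)%:E * ((\1_B s)%:E * (levy_weight s)%:E)).
      by apply/funext => s; rewrite e.
    have i0 : (0 <= \1_A x :> R)%R by rewrite indicE.
    rewrite (ifunZ (levy_int_ifun rho x) i0 nBw).
    congr (_ * _); rewrite levy_intE// [RHS]integral_mkcond.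
    apply: eq_integral => s _; rewrite patchE; case: ifPn => // sn.
    rewrite levy_weight_eq0 ?mule0// leNgt; apply: contra sn => s0.
    by apply/mem_set; rewrite /= in_itv/= s0.
  - move=> k; rewrite /L1; under eq_integral do rewrite indicT mul1e.
    rewrite (_ : \int[nu]_z _ = exponent nu 1)//.
    by apply: eq_integral => z _; rewrite mul1e /jump enexp_EFin.
have e z : F z * ((levy_weight z.2)^-1)%:E * (levy_weight z.2)%:E = F z.
  have [z0|z0] := leP z.2 0%R; first by rewrite F0// !mul0e.
  by rewrite -muleA -EFinM mulVf ?mule1// gt_eqF// levy_weight_gt0.
have := key _ (nnmeasM nF nV); rewrite /L1 /L2.
under eq_integral do rewrite e.
move=> ->; apply: eq_integral => x _; congr (levy_int _ x _).
by apply/funext => s; rewrite (e (x, s)).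
Qed.

End disintegration.

(** * Sampling from a random measure *)

Section functional_fubini.
Context (R : realType) d1 d2 (T1 : measurableType d1) (T2 : measurableType d2).

Lemma ifunZr d (T : measurableType d) (L : (T -> \bar R) -> \bar R) (c : \bar R) f :
  integral_functional L -> 0 <= c -> nnmeas f ->
  L (fun x => f x * c) = L f * c.
Proof.
move=> hL c0 nf; have Lf0 := ifun_ge0 hL nf.
case: c c0 => [r|_|//].
  rewrite lee_fin => r0; rewrite muleC -(ifunZ hL)//.
  by congr L; apply/funext => x; rewrite muleC.
have nn : nondecreasing_seq (fun n => (n%:R : R)%:E).
  by move=> m n mn; rewrite lee_fin ler_nat.
have ny : limn (fun n => (n%:R : R)%:E) = +oo.
  by apply/cvg_lim => //; apply/cvgeryP; exact: cvgr_idn.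
have e (y : \bar R) : 0 <= y -> y * +oo = limn (fun n => (n%:R : R)%:E * y).
  move=> y0; rewrite -ny -ge0_nondecreasing_limeMl//.
  by congr (limn _); apply/funext => n; rewrite muleC.
rewrite e//; have -> : (fun x => f x * +oo) = (fun x => limn (fun n => (n%:R : R)%:E * f x)).
  by apply/funext => x; rewrite e//; case: nf.
have nnf n : nnmeas (fun x => (n%:R : R)%:E * f x).
  by apply: nnmeasM => //; apply: nnmeas_cst; rewrite lee_fin.
rewrite (ifun_lim hL)//; last first.
  move=> x m n mn; apply: lee_wpmul2r; first by case: nf.
  by rewrite lee_fin ler_nat.
by congr (limn _); apply/funext => n; rewrite (ifunZ hL).
Qed.

(** Tonelli's theorem, a functional taking the place of one of the measures;
    the weight witnesses that this functional is sigma-finite. *)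
Lemma ifun_fubini (L : (T1 -> \bar R) -> \bar R) (w : T1 -> R)
    (m : {sigma_finite_measure set T2 -> \bar R}) (G : T1 * T2 -> \bar R) :
  integral_functional L -> (forall x, (0 < w x)%R) -> measurable_fun setT w ->
  L (fun x => (w x)%:E) < +oo -> nnmeas G ->
  nnmeas (fun y => L (fun x => G (x, y))) /\
  L (fun x => \int[m]_y G (x, y)) = \int[m]_y L (fun x => G (x, y)).
Proof.
move=> hL w0 mw Lw nG.
have nw : nnmeas (fun x => (w x)%:E).
  by split; [move=> x; rewrite lee_fin ltW|exact/measurable_EFinP].
have nwi : nnmeas (fun x => ((w x)^-1)%:E).
  split; first by move=> x; rewrite lee_fin invr_ge0 ltW.
  rewrite (_ : (fun x => _) = (fun x => (((w x) `^ (-1))%R)%:E)).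
    by apply/measurable_EFinP; exact: (measurableT_comp (measurable_powR _)).
  by apply/funext => x; rewrite powRN powRr1// ltW.
have [m1 m1E] := ifun_measure (ifun_density hL nw).
have LE f : nnmeas f -> L f = \int[m1]_x (f x * ((w x)^-1)%:E).
  move=> nf; rewrite m1E; last exact: nnmeasM.
  congr L; apply/funext => x; rewrite -muleA -EFinM mulVf ?mule1//.
  by rewrite gt_eqF.
have m1oo : m1 setT < +oo.
  rewrite -integral_indicT// m1E; last exact: nnmeas_indic.
  rewrite (_ : (fun x => _) = fun x => (w x)%:E)//.
  by apply/funext => x; rewrite indicT mul1e.
have m1fin : fin_num_fun m1.
  by apply: lty_fin_num_fun.
pose H1 := isFinite.Build _ _ _ _ m1fin.
have m1sig : sigma_finite setT m1.
  by apply: fin_num_fun_sigma_finite => //; rewrite measure0.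
pose H2 := isSFinite.Build _ _ _ _ (sfinite_measure_sigma_finite m1sig).
pose H3 := isSigmaFinite.Build _ _ _ _ m1sig.
pose m1f := HB.pack_for (FiniteMeasure.type T1 R) (Measure.sort m1) H1 H2 H3.
have nsec1 (H : T1 * T2 -> \bar R) x : nnmeas H -> nnmeas (fun y => H (x, y)).
  by move=> [h mh]; split => //; exact: measurableT_comp.
have nsec2 (H : T1 * T2 -> \bar R) y : nnmeas H -> nnmeas (fun x => H (x, y)).
  by move=> [h mh]; split => //; exact: measurableT_comp.
have nH : nnmeas (fun p : T1 * T2 => G p * ((w p.1)^-1)%:E).
  apply: nnmeasM => //; case: nwi => h mh.
  by split => //; exact: (measurableT_comp mh measurable_fst).
have GE y : L (fun x => G (x, y)) = \int[m1f]_x (G (x, y) * ((w x)^-1)%:E).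
  by rewrite LE//; exact: nsec2.
have nI : nnmeas (fun x => \int[m]_y G (x, y)).
  split; first by move=> x; apply: integral_ge0 => y _; case: nG.
  by case: nG => g0 mg; exact: measurable_fun_fubini_tonelli_F.
split.
  split; first by move=> y; apply: (ifun_ge0 hL); exact: nsec2.
  rewrite (_ : (fun y => _) = fun y => \int[m1f]_x (G (x, y) * ((w x)^-1)%:E)).
    by case: nH => h mh; exact: (measurable_fun_fubini_tonelli_G (m1 := m1f) _ mh h).
  by apply/funext => y; rewrite GE.
rewrite LE//.
transitivity (\int[m1f]_x \int[m]_y (G (x, y) * ((w x)^-1)%:E)).
  apply: eq_integral => x _; rewrite ge0_integralZr//.
  - by case: (nsec1 _ x nG).
  - by move=> y _; case: nG.
  - by rewrite lee_fin invr_ge0 ltW.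
under [RHS]eq_integral do rewrite GE.
case: nH => h mh.
exact: (@fubini_tonelli _ _ _ _ _ m1f m (fun p => G p * ((w p.1)^-1)%:E) mh h).
Qed.

End functional_fubini.

Section atoms_measurability.
Context (R : realType) (X : completeMetricType R).
Hypothesis sepX : separable X.

(** Two distinct points are separated by a ball of rational radius around a
    point of the dense sequence. *)
Lemma measurable_diagonal : measurable [set p : borel X * borel X | p.1 = p.2].
Proof.
have [e he] := dense_sequence sepX.
pose B i k : set (borel X) := ball (e i) (k.+1%:R^-1)%R.
have mB i k : measurable (B i k) by exact: borel_open (ballX_open _ _).
rewrite -[X in measurable X]setCK; apply: measurableC.
rewrite (_ : ~` _ = \bigcup_i \bigcup_k (B i k `*` ~` B i k)).
  by do 2!(apply: bigcup_measurable => ? _); apply: measurableX => //; exact: measurableC.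
apply/seteqP; split => [[x y] /= xy|[x y] [i _ [k _ []]]]; last first.
  by move=> /= h1 h2 xy; apply: h2; rewrite -xy.
have d0 : (0 < mdist x y)%R.
  by rewrite mdist_gt0; apply/eqP.
have [k hk] : exists k, ((k.+1%:R^-1 : R) + k.+1%:R^-1 < mdist x y)%R.
  have d2 : (0 < mdist x y / 2)%R by rewrite divr_gt0.
  exists (Num.truncn (mdist x y / 2)^-1)%R.
  suff h : ((Num.truncn (mdist x y / 2)^-1).+1%:R^-1 < mdist x y / 2)%R.
    by rewrite [ltRHS]splitr ltrD.
  rewrite -[ltRHS]invrK ltf_pV2 ?posrE ?invr_gt0//.
  exact: truncnS_gt.
have [i hi] := he x (k.+1%:R^-1)%R (ltac:(by rewrite invr_gt0)).
exists i => //; exists k => //; split => //= hy.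
move: hi hy; rewrite /B !ballEmdist/= => hi hy.
have := metric_triangle x (e i) y; rewrite (metric_sym x (e i)) => tri.
by have := lt_trans hk (le_lt_trans tri (ltrD hi hy)); rewrite ltxx.
Qed.

Lemma measurable_point (x : borel X) : measurable [set x].
Proof.
have := measurable_xsection x measurable_diagonal.
rewrite (_ : xsection _ _ = [set x])//.
by apply/seteqP; split => y; rewrite /xsection/=; [move=> /set_mem|move=> ->; apply/mem_set].
Qed.

Lemma measurable_eqb d (S : measurableType d) (f g : S -> borel X) :
  measurable_fun setT f -> measurable_fun setT g ->
  measurable_fun setT (fun s => f s == g s).
Proof.
move=> mf mg; apply: (measurable_fun_bool true); rewrite setTI.
rewrite (_ : _ @^-1` _ = (fun s => (f s, g s)) @^-1` [set p | p.1 = p.2]).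
  rewrite -[X in measurable X]setTI.
  by apply: (measurable_fun_pair mf mg) => //; exact: measurable_diagonal.
by apply/seteqP; split => s /= /eqP.
Qed.

Lemma measurable_in n d (S : measurableType d) (f : S -> borel X)
    (g : S -> n.-tuple (borel X)) :
  measurable_fun setT f -> measurable_fun setT g ->
  measurable_fun setT (fun s => f s \in (g s : seq (borel X))).
Proof.
move=> mf; elim: n g => [g _|n ih g mg].
  rewrite (_ : (fun s => _) = fun=> false)//.
  by apply/funext => s; rewrite tuple0.
rewrite (_ : (fun s => _) = (fun s => (f s == thead (g s)) ||
    (f s \in ([tuple of behead (g s)] : seq (borel X))))).
  apply: measurable_or.
    by apply: measurable_eqb => //; exact: (measurableT_comp (measurable_tnth ord0) mg).
  by apply: ih; exact: (measurableT_comp (@measurable_behead _ _ _) mg).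
by apply/funext => s; rewrite {1}(tuple_eta (g s)) in_cons.
Qed.

Lemma nnmeas_if d (S : measurableType d) (b : S -> bool) (f g : S -> \bar R) :
  measurable_fun setT b -> nnmeas f -> nnmeas g ->
  nnmeas (fun s => if b s then f s else g s).
Proof.
move=> mb [f0 mf] [g0 mg]; split; first by move=> s; case: (b s).
exact: measurable_fun_ifT.
Qed.

(** The mass of the atom of [m] at [y] is measurable in both arguments: on each
    ball around the origin [m] is a finite kernel, to be integrated against the
    indicator of the diagonal. *)
Lemma nnmeas_atom_mass : nnmeas (fun p : borel X * MX X => p.2 [set p.1]).
Proof.
have mk k : measurable (origin_ball k : set (borel X)) by exact: origin_ball_measurable.
pose L k (m : MX X) (f : borel X -> \bar R) := \int[m]_(x in origin_ball k) f x.
have jL k : jointly_measurable (L k).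
  apply: jointly_measurable_finite.
  - by move=> m; exact: ifun_integral_in.
  - move=> B mB; have -> : (fun m => L k m (fun y => (\1_B y)%:E)) =
        (fun m : MX X => m (B `&` origin_ball k)).
      by apply/funext => m; rewrite /L integral_indic.
    by apply: measurable_eval; exact: measurableI.
  - move=> m; rewrite /L integral_cst// mul1e; apply: bf_finite => //.
    exact: origin_ball_bounded.
pose D := [set p : borel X * borel X | p.1 = p.2].
have nD : nnmeas (fun q : (borel X * MX X) * borel X => (\1_D (q.1.1, q.2))%:E : \bar R).
  have [h mh] := nnmeas_indic R measurable_diagonal; split => //.
  apply: (measurableT_comp mh); apply: measurable_fun_pair => //.
  by apply: measurableT_comp.
have n1 k : nnmeas (fun p : borel X * MX X => L k p.2 (fun x => (\1_D (p.1, x))%:E)).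
  exact: (jL k _ _ _ _ measurable_snd nD).
have mx := measurable_point.
have LE k (p : borel X * MX X) : L k p.2 (fun x => (\1_D (p.1, x))%:E) =
    p.2 ([set p.1] `&` origin_ball k).
  rewrite /L -integral_indic//.
  apply: eq_integral => x _; congr (_%:E); rewrite !indicE; congr (_%:R).
  by congr nat_of_bool; apply/idP/idP => /set_mem h; apply/mem_set.
have nd (p : borel X * MX X) : nondecreasing_seq (fun k => p.2 ([set p.1] `&` origin_ball k)).
  move=> i j ij; apply: le_measure; do ?by apply/mem_set; exact: measurableI.
  by apply: setIS; apply/subsetPset; exact: origin_ball_nd.
have -> : (fun p : borel X * MX X => p.2 [set p.1]) = (fun p => limn (fun k =>
    L k p.2 (fun x => (\1_D (p.1, x))%:E))).
  apply/funext => p; apply/esym/cvg_lim => //; under eq_fun do rewrite LE.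
  have e1 : [set p.1] = \bigcup_n ([set p.1] `&` origin_ball n).
    by rewrite -setI_bigcupr origin_ball_cover setIT.
  suff : p.2 ([set p.1] `&` origin_ball k) @[k --> \oo] -->
      p.2 (\bigcup_n ([set p.1] `&` origin_ball n)) by rewrite -e1.
    apply: nondecreasing_cvg_mu.
    - by move=> n; exact: measurableI.
    - by apply: bigcup_measurable => n _; exact: measurableI.
    - move=> i j ij; apply/subsetPset; apply: setIS; apply/subsetPset.
      exact: origin_ball_nd.
by apply: nnmeas_lim => // p i j ij; rewrite !LE; exact: nd.
Qed.

End atoms_measurability.

Section palm.
Context (R : realType) (X : completeMetricType R).
Hypothesis sepX : separable X.
Variable rho : R.-ker (borel X) ~> R.

(** The unnormalised posterior functional of [m] after the observations [x]: a
    value seen for the first time contributes a new atom whose size is drawn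
    from the size-biased Lévy measure at that point; a value seen again
    contributes the mass of the atom already there. *)
Fixpoint palm (x : seq (borel X)) (F : MX X -> \bar R) (m : MX X) : \bar R :=
  if x is y :: x' then
    if y \in x' then palm x' (fun m' => F m' * m' [set y]) m
    else levy_int rho y (fun t => jump (y, t) * palm x' F (add_atom m y t))
  else F m.

Lemma nnmeas_atom d (S : measurableType d) (y : S -> borel X) (m : S -> MX X) :
  measurable_fun setT y -> measurable_fun setT m ->
  nnmeas (fun s => m s [set y s]).
Proof.
move=> my mm; have [h mh] := nnmeas_atom_mass sepX; split => //.
exact: (measurableT_comp mh (measurable_fun_pair my mm)).
Qed.

Lemma measurable_fun_add_atom d (S : measurableType d) (m : S -> MX X)
    (y : S -> borel X) (t : S -> R) :
  measurable_fun setT m -> measurable_fun setT y -> measurable_fun setT t ->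
  measurable_fun setT (fun s => add_atom (m s) (y s) (t s)).
Proof.
move=> mm my mt.
exact: (measurableT_comp (measurable_add_atom sepX)
  (measurable_fun_pair mm (measurable_fun_pair my mt))).
Qed.

(** The sample [x] is a parameter here, so the test whether a value has been
    observed has to be measurable too. *)
Lemma palm_joint n d (S : measurableType d) (x : S -> n.-tuple (borel X))
    (m : S -> MX X) (F : S * MX X -> \bar R) :
  measurable_fun setT x -> measurable_fun setT m -> nnmeas F ->
  nnmeas (fun s => palm (x s) (fun m' => F (s, m')) (m s)).
Proof.
elim: n d S x m F => [|n ih] d S x m F mx mm nF.
  rewrite (_ : (fun s => _) = (fun s => F (s, m s))).
    case: nF => F0 mF; split => //.
    exact: (measurableT_comp mF (measurable_fun_pair (@measurable_id _ _ _) mm)).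
  by apply/funext => s; rewrite tuple0.
pose y s := thead (x s); pose x' s := [tuple of behead (x s)].
have my : measurable_fun setT y by exact: (measurableT_comp (measurable_tnth ord0) mx).
have mx' : measurable_fun setT x' by exact: (measurableT_comp (@measurable_behead _ _ _) mx).
rewrite (_ : (fun s => _) = (fun s =>
    if y s \in (x' s : seq _) then palm (x' s) (fun m' => F (s, m') * m' [set y s]) (m s)
    else levy_int rho (y s) (fun t => jump (y s, t) *
      palm (x' s) (fun m' => F (s, m')) (add_atom (m s) (y s) t)))); last first.
  by apply/funext => s; rewrite {1}(tuple_eta (x s)).
apply: nnmeas_if; first exact: measurable_in.
  apply: (ih _ _ x' m (fun p => F p * p.2 [set y p.1])) => //.
  apply: nnmeasM => //; apply: nnmeas_atom => //.
  exact: (measurableT_comp my measurable_fst).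
apply: (@levy_int_joint _ _ _ rho _ _ y (fun p => jump (y p.1, p.2) *
  palm (x' p.1) (fun m' => F (p.1, m')) (add_atom (m p.1) (y p.1) p.2))) => //.
have myf : measurable_fun setT (fun p : S * R => y p.1) by exact: (measurableT_comp my).
apply: nnmeasM.
  have [h mh] := @nnmeas_jump R X; split; first by move=> p; exact: jump_ge0.
  exact: (measurableT_comp mh (measurable_fun_pair myf measurable_snd)).
apply: (ih _ _ (fun p => x' p.1) (fun p => add_atom (m p.1) (y p.1) p.2)
  (fun q => F (q.1.1, q.2))).
- exact: (measurableT_comp mx').
- by apply: measurable_fun_add_atom => //; exact: (measurableT_comp mm).
- case: nF => F0 mF; split => //; apply: (measurableT_comp mF).
  by apply: measurable_fun_pair => //; exact: measurableT_comp.
Qed.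

Lemma nnmeas_palm_jump y (x : seq (borel X)) F m : nnmeas F ->
  nnmeas (fun t => jump (y, t) * palm x F (add_atom m y t)).
Proof.
move=> nF; apply: nnmeasM.
  have [h mh] := @nnmeas_jump R X; split; first by move=> p; exact: jump_ge0.
  exact: (measurableT_comp mh (measurable_pair1 _)).
apply: (@palm_joint _ _ _ (fun=> in_tuple x) (fun t => add_atom m y t) (fun p => F p.2)) => //.
  exact: measurable_fun_add_atom.
by case: nF => F0 mF; split => //; exact: measurableT_comp.
Qed.

Lemma palm_ifun x m : integral_functional (fun F => palm x F m).
Proof.
elim: x m => [|y x ih] m /=; first exact: ifun_eval.
have ny : nnmeas (fun m : MX X => m [set y]) by exact: nnmeas_atom.
have [yx|yx] := boolP (y \in x); first exact: (ifun_density (ih m) ny).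
have nj : nnmeas (fun t : R => @jump R X (y, t)).
  have [h mh] := @nnmeas_jump R X; split; first by move=> p; exact: jump_ge0.
  exact: (measurableT_comp mh (measurable_pair1 _)).
have -> : (fun F => levy_int rho y (fun t => jump (y, t) * palm x F (add_atom m y t))) =
    (fun F => levy_int rho y (fun t => palm x F (add_atom m y t) * jump (y, t))).
  by apply/funext => F; congr (levy_int _ y _); apply/funext => t; rewrite muleC.
apply: (ifun_bind (ifun_density (levy_int_ifun rho y) nj)
  (L2 := fun t F => palm x F (add_atom m y t))) => [t|F nF]; first exact: ih.
have := @palm_joint _ _ R (fun=> in_tuple x) (fun t => add_atom m y t) (fun p => F p.2).
case=> //; first exact: measurable_fun_add_atom.
by case: nF => F0 mF; split => //; exact: measurableT_comp.
Qed.

(** The factor [G] is a constant in each step of the recursion. *)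
Lemma palm_pullout x F G m : nnmeas F -> nnmeas G ->
  (forall m y t, y \in x -> G (add_atom m y t) = G m) ->
  palm x (fun m' => F m' * G m') m = palm x F m * G m.
Proof.
elim: x F m => [//|y x ih] F m nF nG GE /=.
have GEx m' z t : z \in x -> G (add_atom m' z t) = G m'.
  by move=> zx; apply: GE; rewrite in_cons zx orbT.
case: ifP => _.
  rewrite -ih//; last by apply: nnmeasM => //; exact: nnmeas_atom.
  by congr (palm x _ m); apply/funext => m'; rewrite muleAC.
rewrite -(ifunZr (levy_int_ifun _ _)); last 2 first.
- by case: nG.
- exact: nnmeas_palm_jump.
congr (levy_int _ y _); apply/funext => t.
by rewrite ih// GE ?mem_head// muleA.
Qed.

End palm.

Section iterated_mecke.
Context (R : realType) (X : completeMetricType R).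
Local Notation E := (borel X * R)%type.
Hypothesis sepX : separable X.

Lemma nnmeas_sum_undup n d (S : measurableType d) (x : S -> n.-tuple (borel X))
    (G : S * borel X -> \bar R) : measurable_fun setT x -> nnmeas G ->
  nnmeas (fun s => \sum_(y <- undup (x s)) G (s, y)).
Proof.
move=> + nG; elim: n x => [|n ih] x mx.
  rewrite (_ : (fun s => _) = fun=> 0); first exact: nnmeas_cst.
  by apply/funext => s; rewrite tuple0 big_nil.
have mx' : measurable_fun setT (fun s => [tuple of behead (x s)]).
  exact: (measurableT_comp (@measurable_behead _ _ _) mx).
have my : measurable_fun setT (fun s => thead (x s)).
  exact: (measurableT_comp (measurable_tnth ord0) mx).
rewrite (_ : (fun s => _) = (fun s =>
    (if thead (x s) \in ([tuple of behead (x s)] : seq _) then 0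
     else G (s, thead (x s))) +
    \sum_(y <- undup [tuple of behead (x s)]) G (s, y))).
  apply: nnmeasD; last exact: ih.
  apply: nnmeas_if; [exact: measurable_in|exact: nnmeas_cst|].
  case: nG => G0 mG; split => //.
  exact: (measurableT_comp mG (measurable_fun_pair (@measurable_id _ _ _) my)).
apply/funext => s; rewrite {1}(tuple_eta (x s)) /=.
by case: ifP => _; rewrite ?big_cons// add0e.
Qed.

Definition values (x : seq (borel X)) : set (borel X) := [set y | y \in x].

Lemma measurable_values x : measurable (values x).
Proof.
elim: x => [|y x ih]; first by rewrite (_ : values _ = set0)//; apply/seteqP; split.
rewrite (_ : values _ = [set y] `|` values x).
  by apply: measurableU => //; exact: measurable_point.
apply/seteqP; split => z; rewrite /values /= in_cons.
  by case/orP => [/eqP|]; [left|right].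
by move=> [->|->]; rewrite ?eqxx ?orbT.
Qed.

Lemma split_values (m : MX X) (B : set (borel X)) (x : seq (borel X)) :
  measurable B ->
  m B = m (B `\` values x) + \sum_(y <- undup x) (\1_B y)%:E * m [set y].
Proof.
move=> mB; elim: x => [|y x ih].
  rewrite big_nil adde0 (_ : values [::] = set0) ?setD0//.
  by apply/seteqP; split.
rewrite /=; case: ifPn => yx.
  rewrite ih; congr (m _ + _); congr (_ `\` _).
  apply/seteqP; split => z; rewrite /values/= in_cons.
    by move=> ->; rewrite orbT.
  by case/orP => [/eqP ->|].
rewrite big_cons addeA ih; congr (_ + _).
have mD : measurable (B `\` values x) by apply: measurableD => //; exact: measurable_values.
have mD2 : measurable (B `\` values (y :: x)).
  by apply: measurableD => //; exact: measurable_values.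
have mBy : measurable (B `&` [set y]).
  by apply: measurableI => //; exact: measurable_point.
transitivity (m (B `\` values (y :: x)) + m (B `&` [set y])).
  rewrite -measureU//.
    congr (m _); apply/seteqP; split => z; rewrite /values /setD /setU /setI/= in_cons.
      have [->|zy] := eqVneq z y; first by move=> [? _]; right.
      by move=> [? ?]; left; split.
    case => [[Bz h]|[Bz zy]]; last by rewrite zy in Bz *; split => // yx'; move: yx; rewrite yx'.
    by split => // zx; apply: h; rewrite zx orbT.
  apply/seteqP; split => // z [[_ h] [_ /= zy]]; apply: h.
  by rewrite /values/= in_cons zy eqxx.
congr (_ + _); rewrite indicE; have [/set_mem By|nBy] := boolP (y \in B).
  by rewrite mul1e; congr (m _); apply/seteqP; split => z /=; [case|move=> ->].
rewrite mul0e; rewrite (_ : B `&` [set y] = set0) ?measure0//.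
apply/seteqP; split => // z [Bz /= zy]; move/negP: nBy; apply.
by apply/mem_set; rewrite -zy.
Qed.

Context d (Om : measurableType d) (P : probability Om R).
Variables (mu : Om -> MX X) (N : R.-ker Om ~> E) (nu : {measure set E -> \bar R}).
Hypothesis mmu : measurable_fun setT mu.
Hypothesis hN : is_poisson_random_measure P N nu.
Hypothesis hmu : {ae P, forall w, forall A : set (borel X), measurable A ->
  mu w A = \int[N w]_(z in A `*` `]0%R, +oo[) (z.2)%:E}.
Hypothesis mu_fin : {ae P, forall w, mu w setT < +oo}.
Variables (eta : probability (borel X) R) (rho : R.-ker (borel X) ~> R).
Hypothesis nuE : disintegrates nu eta (fun x => rho x).

Definition palm_mean (x : seq (borel X)) (F : MX X -> \bar R) : \bar R :=
  \int[P]_w palm rho x F (mu w).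

Lemma palm_mean_joint n d1 (S : measurableType d1) (x : S -> n.-tuple (borel X))
    (F : S * MX X -> \bar R) : measurable_fun setT x -> nnmeas F ->
  nnmeas (fun s => palm_mean (x s) (fun m => F (s, m))).
Proof.
move=> mx nF.
have nG : nnmeas (fun q : S * MX X => palm rho (x q.1) (fun m => F (q.1, m)) q.2).
  apply: (@palm_joint _ _ sepX rho _ _ _ (fun q : S * MX X => x q.1) snd
    (fun r => F (r.1.1, r.2))) => //.
    exact: (measurableT_comp mx).
  case: nF => F0 mF; split => //; apply: (measurableT_comp mF).
  by apply: measurable_fun_pair => //; exact: measurableT_comp.
exact: (nnmeas_mean P mmu nG).
Qed.

Lemma palm_mean_ifun x : integral_functional (palm_mean x).
Proof.
apply: (ifun_bind (L2 := fun w F => palm rho x F (mu w)) (ifun_integral P)).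
  by move=> w; exact: palm_ifun.
move=> F nF; have := @palm_joint _ _ sepX rho _ _ Om (fun=> in_tuple x) mu (fun p => F p.2).
case=> //.
by case: nF => F0 mF; split => //; exact: measurableT_comp.
Qed.

(** The average over [mu] and the integral over the size of the new atom are
    exchanged by [ifun_fubini]. *)
Lemma palm_mean_new y (x : seq (borel X)) F : y \notin x -> nnmeas F ->
  palm_mean (y :: x) F = levy_int rho y (fun t => jump (y, t) *
    \int[P]_w palm rho x F (add_atom (mu w) y t)).
Proof.
move=> yx nF; rewrite /palm_mean /= (negbTE yx).
(* The weight is positive on the whole line, and agrees with [levy_weight] on
   the positive half-line. *)
pose wt (t : R) := (levy_weight t + (if (t <= 0)%R then 1 else 0))%R.
have wt0 t : (0 < wt t)%R.
  rewrite /wt; case: (leP t 0%R) => t0; first by rewrite levy_weight_eq0// add0r.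
  by rewrite addr0 levy_weight_gt0.
have mwt : measurable_fun setT wt.
  apply: measurable_funD; first by apply/measurable_EFinP; case: (@nnmeas_levy_weight R).
  by apply: measurable_fun_ifT => //; exact: measurable_fun_ler.
have wtoo : levy_int rho y (fun t => (wt t)%:E) < +oo.
  rewrite /levy_int; case: ifPn => [yoo|_]; last by rewrite ltry.
  apply: le_lt_trans yoo.
  rewrite (eq_integral (fun t => (levy_weight t)%:E)); last first.
    by move=> t /set_mem/=; rewrite in_itv/= andbT => t0; rewrite /wt leNgt t0 addr0.
  apply: ge0_subset_integral => //; last by move=> t _; rewrite lee_fin levy_weight_ge0.
  by case: (@nnmeas_levy_weight R).
pose G (q : R * Om) := jump (y, q.1) * palm rho x F (add_atom (mu q.2) y q.1).
have nj : nnmeas (fun t : R => @jump R X (y, t)).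
  have [h mh] := @nnmeas_jump R X; split; first by move=> p; exact: jump_ge0.
  exact: (measurableT_comp mh (measurable_pair1 _)).
have np : nnmeas (fun q : R * Om => palm rho x F (add_atom (mu q.2) y q.1)).
  apply: (@palm_joint _ _ sepX rho _ _ _ (fun=> in_tuple x)
    (fun q : R * Om => add_atom (mu q.2) y q.1) (fun p => F p.2)) => //.
    by apply: measurable_fun_add_atom => //; exact: (measurableT_comp mmu).
  by case: nF => F0 mF; split => //; exact: measurableT_comp.
have nG : nnmeas G.
  apply: nnmeasM => //; case: nj => h mh; split; first by move=> q; exact: jump_ge0.
  exact: (measurableT_comp mh measurable_fst).
have [_ <-] := @ifun_fubini R _ _ _ _ _ wt P G (levy_int_ifun rho y) wt0 mwt wtoo nG.
congr (levy_int _ y _); apply/funext => t; rewrite /G /=.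
have nt : nnmeas (fun w => palm rho x F (add_atom (mu w) y t)).
  case: np => h mh; split; first by move=> w; exact: (h (t, w)).
  have -> : (fun w => palm rho x F (add_atom (mu w) y t)) =
    (fun q : R * Om => palm rho x F (add_atom (mu q.2) y q.1)) \o (fun w => (t, w)) by [].
  exact: (measurableT_comp mh (measurable_pair1 _)).
by rewrite (ifunZ (ifun_integral P))// le_max lexx orbT.
Qed.

(** One more observation in [B]: it is either new, and then comes from
    Mecke's formula, or one of the values in [x]. *)
Lemma palm_mean_observe (x : seq (borel X)) (F : MX X -> \bar R)
    (B : set (borel X)) : nnmeas F -> measurable B ->
  palm_mean x (fun m => F m * m B) =
  \int[eta]_y (if y \in x then 0 else (\1_B y)%:E * palm_mean (y :: x) F) +
  \sum_(y <- undup x) (\1_B y)%:E * palm_mean (y :: x) F.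
Proof.
move=> nF mB; have hL := palm_mean_ifun x.
have mD : measurable (B `\` values x) by apply: measurableD => //; exact: measurable_values.
have nev (C : set (borel X)) : measurable C -> nnmeas (fun m : MX X => m C).
  by move=> mC; split => //; exact: measurable_eval.
have ny y : nnmeas (fun m : MX X => m [set y]) by apply: nev; exact: measurable_point.
have nBy y : nnmeas (fun m : MX X => (\1_B y)%:E * (F m * m [set y])).
  apply: nnmeasM; first by apply: nnmeas_cst; rewrite lee_fin indicE.
  exact: nnmeasM.
rewrite (_ : (fun m => _) = (fun m => F m * m (B `\` values x) +
    \sum_(y <- undup x) (\1_B y)%:E * (F m * m [set y]))); last first.
  apply/funext => m; rewrite (split_values m x mB) ge0_muleDr//; last first.
    by apply: sume_ge0 => y _; rewrite mule_ge0// lee_fin indicE.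
  congr (_ + _); rewrite ge0_sume_distrr; last first.
    by move=> y _; rewrite mule_ge0// lee_fin indicE.
  by apply: eq_bigr => y _; rewrite muleCA.
rewrite (ifunD hL); last 2 first.
- by apply: nnmeasM => //; exact: nev.
- exact: nnmeas_sum.
rewrite (ifun_sum hL)//; congr (_ + _); last first.
  apply: eq_big_seq => y; rewrite mem_undup => yx.
  by rewrite (ifunZ hL) ?indicE//; [rewrite /palm_mean /= yx|exact: nnmeasM].
have npx : nnmeas (fun m : MX X => palm rho x F m).
  apply: (@palm_joint _ _ sepX rho _ _ _ (fun=> in_tuple x) id (fun p => F p.2)) => //.
  by case: nF => F0 mF; split => //; exact: measurableT_comp.
transitivity (\int[P]_w (palm rho x F (mu w) * mu w (B `\` values x))).
  apply: eq_integral => w _.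
  apply: (palm_pullout sepX rho _ nF (nev _ mD)) => m y t yx.
  rewrite add_atomE indicE memNset ?mul0e ?adde0//.
  by move=> [_]; exact.
rewrite (crm_mecke sepX mmu hN hmu mu_fin npx mD).
have nu1 := exponent_fin mmu hN hmu mu_fin ler01.
have nI : nnmeas (fun z : E => \int[P]_w palm rho x F (add_atom (mu w) z.1 z.2)).
  have nF2 : nnmeas (fun p : E * MX X => palm rho x F p.2).
    by case: npx => h mh; split => //; exact: (measurableT_comp mh measurable_snd).
  by have := nnmeas_mean P mmu (nnmeas_add_atom sepX nF2 (@measurable_id _ E setT)).
rewrite (levy_disintegration nuE nu1); last 2 first.
- by apply: nnmeasM => //; exact: nnmeas_jumpB.
- by move=> z z0; rewrite /jump max_r// mule0 mul0e.
apply: eq_integral => y _ /=; case: ifPn => yx.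
  rewrite (_ : (fun s => _) = fun=> 0) ?(ifun0 (levy_int_ifun _ _))//.
  apply/funext => s; rewrite indicE memNset ?mul0e//.
  by move=> [_]; exact.
rewrite palm_mean_new// -(ifunZ (levy_int_ifun rho y)); last 2 first.
- by rewrite indicE.
- apply: nnmeasM.
    have [h mh] := @nnmeas_jump R X; split; first by move=> p; exact: jump_ge0.
    exact: (measurableT_comp mh (measurable_pair1 _)).
  case: nI => h mh; split; first by move=> t; exact: (h (y, t)).
  exact: (measurableT_comp mh (measurable_pair1 _)).
congr (levy_int _ y _); apply/funext => t; rewrite -muleA; congr (_%:E * _).
rewrite !indicE; congr (_%:R); congr nat_of_bool.
apply/idP/idP => /set_mem h; apply/mem_set; first by case: h.
by split => //; apply/negP.
Qed.

(** By induction on [n], using [palm_mean_observe]: biasing by the mass of [B]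
    adds one observation in [B], so the moments of [mu] are mixtures of the
    functionals [palm_mean x] over a finite measure on the samples. *)
Lemma iterated_mecke n : exists lam : {measure set (n.-tuple (borel X)) -> \bar R},
  lam setT < +oo /\
  forall (F : MX X -> \bar R) (B : 'I_n -> set (borel X)), nnmeas F ->
    (forall i, measurable (B i)) ->
  \int[P]_w (F (mu w) * \prod_(i < n) mu w (B i)) =
  \int[lam]_x ((\prod_(i < n) (\1_(B i) (tnth x i))%:E) * palm_mean x F).
Proof.
elim: n => [|n [lam [lamoo ih]]].
  exists (@dirac _ (0.-tuple (borel X)) [tuple] R); split.
    by rewrite /= diracE mem_set// ltry.
  move=> F B nF mB; rewrite integral_dirac//; last first.
    apply: emeasurable_funM => //.
      rewrite (_ : (fun x => _) = fun=> 1)//; apply/funext => x.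
      by rewrite big_ord0.
    by have [] := @palm_mean_joint 0 _ _ id (fun p : 0.-tuple (borel X) * MX X => F p.2)
      (@measurable_id _ _ _) _; first by
        case: nF => F0 mF; split => //; exact: measurableT_comp.
  rewrite /= diracE mem_set// mul1e big_ord0 mul1e; apply: eq_integral => w _.
  by rewrite big_ord0 mule1.
pose T := n.+1.-tuple (borel X).
(* Given the observations [x], the next one is either drawn from [eta] or
   repeats one of the values of [x]. *)
pose L (x : n.-tuple (borel X)) (f : T -> \bar R) :=
  \int[eta]_y (if y \in (x : seq _) then 0 else f [tuple of y :: x]) +
  \sum_(y <- undup x) f [tuple of y :: x].
have mcons d1 (S : measurableType d1) (y : S -> borel X) (x : S -> n.-tuple (borel X)) :
    measurable_fun setT y -> measurable_fun setT x ->
    measurable_fun setT (fun s => [tuple of y s :: x s] : T).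
  by move=> my mx; exact: (measurable_cons my mx).
have ncons d1 (S : measurableType d1) (y : S -> borel X) (x : S -> n.-tuple (borel X))
    (f : T -> \bar R) :
    measurable_fun setT y -> measurable_fun setT x -> nnmeas f ->
    nnmeas (fun s => f [tuple of y s :: x s]).
  by move=> my mx [f0 mf]; split => //; exact: (measurableT_comp mf (mcons _ _ _ _ my mx)).
have hL x : integral_functional (L x).
  apply: ifun_add.
    apply: (ifun_bind (L2 := fun y f => if y \in (x : seq _) then 0 else f [tuple of y :: x])
      (ifun_integral eta)).
      move=> y; have -> : (fun f : T -> \bar R => if y \in (x : seq _) then 0
          else f [tuple of y :: x]) =
          (fun f => if y \notin (x : seq _) then f [tuple of y :: x] else 0).
        by apply/funext => f; case: (y \in _).
      by apply: ifun_if; exact: ifun_eval.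
    move=> f nf; apply: (nnmeas_if _ _ _).2; [exact: measurable_in|exact: nnmeas_cst|].
    exact: ncons.
  elim: (undup x) => [|y s ihs].
    have -> : (fun f : T -> \bar R => \sum_(y <- [::]) f [tuple of y :: x]) = (fun=> 0).
      by apply/funext => f; rewrite big_nil.
    exact: (ifun_if false (@ifun_eval R _ T [tuple of nseq n.+1 (point : borel X)])).
  have -> : (fun f : T -> \bar R => \sum_(y0 <- y :: s) f [tuple of y0 :: x]) =
      (fun f => f [tuple of y :: x] + \sum_(y0 <- s) f [tuple of y0 :: x]).
    by apply/funext => f; rewrite big_cons.
  by apply: ifun_add => //; exact: ifun_eval.
have nL f : nnmeas f -> nnmeas (fun x => L x f).
  move=> nf; apply: nnmeasD; last first.
    apply: (@nnmeas_sum_undup n _ _ id (fun p => f [tuple of p.2 :: p.1])) => //.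
    exact: ncons.
  have nI : nnmeas (fun p : n.-tuple (borel X) * borel X =>
      if p.2 \in (p.1 : seq _) then 0 else f [tuple of p.2 :: p.1]).
    by apply: nnmeas_if; [exact: measurable_in|exact: nnmeas_cst|exact: ncons].
  case: nI => h mh; split; first by move=> x; apply: integral_ge0 => y _; exact: (h (x, y)).
  exact: (@measurable_fun_fubini_tonelli_F _ _ _ _ _ eta _ mh h).
have [lam' lam'E] := ifun_measure (ifun_bind (ifun_integral lam) hL
  (fun f nf => (nL f nf).2)).
exists lam'; split.
  rewrite -integral_indicT// lam'E; last exact: nnmeas_indic.
  apply: (@le_lt_trans _ _ (\int[lam]_x (n.+1%:R%:E))); last first.
    by rewrite integral_cst// lte_mul_pinfty// lee_fin.
  apply: (ifun_le (ifun_integral lam)).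
  - by apply: nL; exact: nnmeas_indic.
  - by apply: nnmeas_cst; rewrite lee_fin.
  move=> x; rewrite /L -natr1 addrC EFinD; apply: leeD.
    rewrite (eq_bigr (fun=> ((1%N)%:R : R)%:E)); last by move=> y _; rewrite indicT.
    rewrite sumEFin lee_fin -natr_sum ler_nat sum1_size.
    by apply: leq_trans (size_undup x) _; rewrite size_tuple.
  apply: (@le_trans _ _ (\int[eta]_y 1)); last by rewrite integral_prob_cst.
  apply: (ifun_le (ifun_integral eta)).
  - apply: nnmeas_if; [exact: measurable_in|exact: nnmeas_cst|].
    exact: (ncons _ _ _ _ _ _ _ (nnmeas_indic _ measurableT)).
  - exact: nnmeas_cst.
  - by move=> y; case: ifP => _; rewrite ?lee_fin ?ler01// indicT.
move=> F B nF mB.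
pose B' (i : 'I_n) := B (lift ord0 i).
have nB0 : nnmeas (fun m : MX X => m (B ord0)).
  by split => //; exact: measurable_eval.
transitivity (\int[P]_w ((F (mu w) * mu w (B ord0)) * \prod_(i < n) mu w (B' i))).
  by apply: eq_integral => w _; rewrite big_ord_recl muleA.
rewrite (ih _ B' (nnmeasM nF nB0)); last by move=> i; exact: mB.
have nf : nnmeas (fun z : T => (\prod_(i < n.+1) (\1_(B i) (tnth z i))%:E) * palm_mean z F).
  apply: nnmeasM.
    apply: nnmeas_prod => i; have [h mh] := nnmeas_indic R (mB i).
    by split => //; exact: (measurableT_comp mh (measurable_tnth i)).
  apply: (@palm_mean_joint n.+1 _ _ id (fun p : T * MX X => F p.2)) => //.
  by case: nF => F0 mF; split => //; exact: measurableT_comp.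
rewrite lam'E//; apply: eq_integral => x _; rewrite palm_mean_observe// /L.
pose c : R := (\prod_(i < n) \1_(B' i) (tnth x i))%R.
have c0 : (0 <= c)%R by apply: prodr_ge0 => i _; rewrite indicE.
have cE : \prod_(i < n) (\1_(B' i) (tnth x i))%:E = c%:E.
  by rewrite /c prodEFin.
have fE y : (\prod_(i < n.+1) (\1_(B i) (tnth [tuple of y :: x] i))%:E) *
    palm_mean (y :: x) F = c%:E * ((\1_(B ord0) y)%:E * palm_mean (y :: x) F).
  rewrite big_ord_recl tnth0 (eq_bigr (fun i => (\1_(B' i) (tnth x i))%:E)).
    by rewrite cE muleA [c%:E * _]muleC.
  by move=> i _; rewrite tnthS.
rewrite cE ge0_muleDr; last 2 first.
- apply: integral_ge0 => y _; case: ifP => // _.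
  by rewrite mule_ge0 ?lee_fin ?indicE//; apply: integral_ge0 => w _; exact: (ifun_ge0 (palm_ifun _ _ _ _)).
- apply: sume_ge0 => y _; rewrite mule_ge0 ?lee_fin ?indicE//.
  exact: (ifun_ge0 (palm_mean_ifun _)).
congr (_ + _).
  rewrite -(ifunZ (ifun_integral eta))//; last first.
    apply: nnmeas_if; [exact: measurable_in|exact: nnmeas_cst|].
    apply: nnmeasM; first exact: nnmeas_indic.
    apply: (@palm_mean_joint n.+1 _ _ (fun y => [tuple of y :: x] : T) (fun p => F p.2)).
      exact: (mcons _ _ _ (fun=> x)).
    by case: nF => F0 mF; split => //; exact: measurableT_comp.
  by apply: eq_integral => y _; case: ifP => _; rewrite ?mule0// -fE.
rewrite ge0_sume_distrr; last first.
  move=> y _; rewrite mule_ge0 ?lee_fin ?indicE//.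
  exact: (ifun_ge0 (palm_mean_ifun _)).
by apply: eq_bigr => y _; rewrite -fE.
Qed.

End iterated_mecke.

(** * Evaluation of the posterior functional *)

Section product_functionals.
Context (R : realType) (I : Type).

(** Integration against a measure for which functions of two variables have
    measurable partial integrals. *)
Definition tonelli_functional d (T : measurableType d) (L : (T -> \bar R) -> \bar R) :=
  integral_functional L /\
  forall d' (S : measurableType d') (F : S * T -> \bar R), nnmeas F ->
    nnmeas (fun s => L (fun t => F (s, t))).

Variable K : I -> (R -> \bar R) -> \bar R.

Fixpoint prod_fun (ys : seq I) : ((size ys).-tuple R -> \bar R) -> \bar R :=
  match ys return ((size ys).-tuple R -> \bar R) -> \bar R with
  | [::] => fun G => G [tuple]
  | y :: ys' => fun G => K y (fun t => @prod_fun ys' (fun s => G [tuple of t :: s]))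
  end.

Arguments prod_fun : clear implicits.

Hypothesis hK : forall y, tonelli_functional (K y).

Lemma measurable_cons_tuple n d (S : measurableType d) (t : S -> R) (s : S -> n.-tuple R) :
  measurable_fun setT t -> measurable_fun setT s ->
  measurable_fun setT (fun x => [tuple of t x :: s x]).
Proof. by move=> mt ms; exact: (measurable_cons mt ms). Qed.

Lemma prod_fun_tonelli ys : tonelli_functional (prod_fun ys).
Proof.
elim: ys => [|y ys [ih1 ih2]] /=.
  split; first exact: ifun_eval.
  move=> d' S F [F0 mF]; split => //.
  exact: (measurableT_comp mF (measurable_pair2 _)).
have [k1 k2] := hK y.
have mc (t : R) : measurable_fun setT (fun s : (size ys).-tuple R => [tuple of t :: s]).
  exact: (@measurable_cons_tuple _ _ _ (fun=> t)).
split.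
  apply: (ifun_bind (L2 := fun t (G : (size ys).+1.-tuple R -> \bar R) =>
    prod_fun ys (fun s => G [tuple of t :: s])) k1).
    by move=> t; exact: (ifun_comp ih1 (mc t)).
  move=> G [G0 mG].
  have [] // := ih2 _ R (fun p => G [tuple of p.1 :: p.2]).
  split => //; apply: (measurableT_comp mG).
  exact: (@measurable_cons_tuple _ _ (R * (size ys).-tuple R)%type fst snd).
move=> d' S F [F0 mF].
apply: (k2 _ S (fun p => prod_fun ys (fun s => F (p.1, [tuple of p.2 :: s])))).
apply: (ih2 _ (S * R)%type (fun q => F (q.1.1, [tuple of q.1.2 :: q.2]))).
split => //; apply: (measurableT_comp mF); apply: measurable_fun_pair.
  exact: (measurableT_comp measurable_fst measurable_fst).
apply: (@measurable_cons_tuple _ _ ((S * R) * (size ys).-tuple R)%type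
  (fun q => q.1.2) snd) => //.
exact: (measurableT_comp measurable_snd measurable_fst).
Qed.

Lemma prod_fun_prod ys (f : 'I_(size ys) -> R -> \bar R) :
  (forall k, nnmeas (f k)) ->
  prod_fun ys (fun s => \prod_(k < size ys) f k (tnth s k)) =
  \prod_(k < size ys) K (tnth (in_tuple ys) k) (f k).
Proof.
elim: ys f => [|y ys ih] f nf /=; first by rewrite !big_ord0.
have nfs : nnmeas (fun s : (size ys).-tuple R => \prod_(k < size ys) f (lift ord0 k) (tnth s k)).
  apply: nnmeas_prod => k; case: (nf (lift ord0 k)) => h mh; split => //.
  exact: (measurableT_comp mh (measurable_tnth k)).
have [k1 _] := hK y; have [p1 _] := prod_fun_tonelli ys.
rewrite big_ord_recl (tnth_nth y) /=.
under [X in _ = _ * X]eq_bigr do rewrite (tnth_nth y) /= -(tnth_nth y (in_tuple ys)).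
rewrite -(ih (fun k => f (lift ord0 k)))//.
rewrite -(ifunZr k1) //; last exact: (ifun_ge0 p1).
congr (K y _); apply/funext => t.
have -> : (fun s : (size ys).-tuple R =>
    \prod_(k < (size ys).+1) f k (tnth [tuple of t :: s] k)) =
    (fun s => (\prod_(k < size ys) f (lift ord0 k) (tnth s k)) * f ord0 t).
  apply/funext => s; rewrite big_ord_recl tnth0 muleC; congr (_ * _).
  by apply: eq_bigr => k _; rewrite tnthS.
by rewrite (ifunZr p1)// 1?muleC//; case: (nf ord0).
Qed.

End product_functionals.
Arguments prod_fun {R I} K ys G.

Section product_weights.
Context (R : realType) (I : Type).
Variables (K : I -> (R -> \bar R) -> \bar R).
Hypothesis hK : forall y, tonelli_functional (K y).

Definition weight_prod (w : I -> R -> \bar R) (ys : seq I) (s : seq R) : \bar R :=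
  \prod_(p <- zip ys s) w p.1 p.2.

Lemma nnmeas_weight_prod w ys : (forall y, nnmeas (w y)) ->
  nnmeas (fun s : (size ys).-tuple R => weight_prod w ys s).
Proof.
move=> nw; elim: ys => [|y ys ih].
  rewrite (_ : (fun s => _) = fun=> 1); first exact: nnmeas_cst.
  by apply/funext => s; rewrite /weight_prod tuple0 big_nil.
rewrite (_ : (fun s => _) = (fun s : (size ys).+1.-tuple R =>
    w y (thead s) * weight_prod w ys [tuple of behead s])).
  apply: nnmeasM.
    by case: (nw y) => h mh; split => //; exact: (measurableT_comp mh (measurable_tnth ord0)).
  case: ih => h mh; split => //.
  exact: (measurableT_comp mh (@measurable_behead _ _ _)).
by apply/funext => s; rewrite {1}(tuple_eta s) /weight_prod /= big_cons.
Qed.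

Lemma tonelli_weight (L : (R -> \bar R) -> \bar R) (w : R -> \bar R) :
  tonelli_functional L -> nnmeas w -> tonelli_functional (fun f => L (fun t => f t * w t)).
Proof.
move=> [h1 h2] nw; split; first exact: ifun_density.
move=> d S F nF; apply: (h2 _ S (fun p => F p * w p.2)).
apply: nnmeasM => //; case: nw => h mh; split => //.
exact: (measurableT_comp mh measurable_snd).
Qed.

Lemma tonelli_scale (L : (R -> \bar R) -> \bar R) (c : \bar R) :
  tonelli_functional L -> 0 <= c -> tonelli_functional (fun f => c * L f).
Proof.
move=> [h1 h2] c0; split; first exact: ifunC.
by move=> d S F nF; apply: nnmeasM; [exact: nnmeas_cst|exact: h2].
Qed.

Lemma prod_fun_weight w ys (G : (size ys).-tuple R -> \bar R) :
  (forall y, nnmeas (w y)) -> nnmeas G ->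
  prod_fun (fun y f => K y (fun t => f t * w y t)) ys G =
  prod_fun K ys (fun s => G s * weight_prod w ys s).
Proof.
move=> nw; elim: ys G => [|y ys ih] G nG /=.
  by rewrite /weight_prod big_nil mule1.
congr (K y _); apply/funext => t.
have nGt : nnmeas (fun s : (size ys).-tuple R => G [tuple of t :: s]).
  case: nG => h mh; split => //; apply: (measurableT_comp mh).
  exact: (@measurable_cons_tuple _ _ _ _ (fun=> t)).
rewrite ih// -(ifunZr (prod_fun_tonelli hK ys).1); last 2 first.
- by case: (nw y).
- by apply: nnmeasM => //; exact: nnmeas_weight_prod.
congr (prod_fun _ _ _); apply/funext => s.
by rewrite /weight_prod /= big_cons -muleA; congr (_ * _); rewrite muleC.
Qed.

Lemma prod_fun_scale (c : I -> \bar R) ys (G : (size ys).-tuple R -> \bar R) :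
  (forall y, 0 <= c y) -> nnmeas G ->
  prod_fun (fun y f => c y * K y f) ys G = (\prod_(y <- ys) c y) * prod_fun K ys G.
Proof.
move=> c0; elim: ys G => [|y ys ih] G nG /=; first by rewrite big_nil mul1e.
have nGt : nnmeas (fun p : R * (size ys).-tuple R => G [tuple of p.1 :: p.2]).
  case: nG => h mh; split => //; apply: (measurableT_comp mh).
  exact: (@measurable_cons_tuple _ _ _ (R * (size ys).-tuple R)%type fst snd).
have nsec t : nnmeas (fun s : (size ys).-tuple R => G [tuple of t :: s]).
  case: nGt => h mh; split; first by move=> s; exact: (h (t, s)).
  exact: (measurableT_comp mh (measurable_pair1 t)).
rewrite big_cons -muleA; congr (_ * _).
rewrite [RHS]muleC -(ifunZr (hK y).1).
- by congr (K y _); apply/funext => t; rewrite ih// muleC.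
- by apply: prode_ge0.
- exact: ((prod_fun_tonelli hK ys).2 _ R _ nGt).
Qed.

End product_weights.

Section palm_evaluation.
Context (R : realType) (X : completeMetricType R).
Hypothesis sepX : separable X.
Variable rho : R.-ker (borel X) ~> R.

Fixpoint add_atoms (m : MX X) (ys : seq (borel X)) (s : seq R) : MX X :=
  match ys, s with
  | y :: ys', t :: s' => add_atoms (add_atom m y t) ys' s'
  | _, _ => m
  end.

Lemma add_atomsE m ys s (A : set (borel X)) : size s = size ys ->
  add_atoms m ys s A = m A + \sum_(p <- zip ys s) (\1_A p.1)%:E * jump p.
Proof.
elim: ys s m => [|y ys ih] [|t s] //= m; first by rewrite big_nil adde0.
by move=> [ss]; rewrite ih// big_cons add_atomE addeA.
Qed.

Lemma measurable_add_atoms ys d (S : measurableType d) (m : S -> MX X)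
    (s : S -> (size ys).-tuple R) :
  measurable_fun setT m -> measurable_fun setT s ->
  measurable_fun setT (fun x => add_atoms (m x) ys (s x)).
Proof.
elim: ys m s => [//|y ys ih] m s mm ms.
rewrite (_ : (fun x => _) = (fun x => add_atoms (add_atom (m x) y (thead (s x))) ys
    [tuple of behead (s x)])).
  apply: ih; last exact: (measurableT_comp (@measurable_behead _ _ _) ms).
  apply: (measurable_fun_add_atom sepX) => //.
  exact: (measurableT_comp (measurable_tnth ord0) ms).
by apply/funext => x; rewrite {1}(tuple_eta (s x)).
Qed.

(** The weight of an atom of size [t] on a cell with [n] observations, after
    damping by [exp (- b t)]. *)
Definition cell_weight (b : R) (n : nat) (t : R) : \bar R :=
  (Num.max t 0 ^+ n * expR (- (b * Num.max t 0)))%:E.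

Lemma nnmeas_cell_weight b n : nnmeas (cell_weight b n).
Proof.
have mM : measurable_fun setT (fun t : R => Num.max t 0%R) by exact: measurable_maxr.
split.
  by move=> t; rewrite lee_fin mulr_ge0 ?expR_ge0// exprn_ge0// le_max lexx orbT.
apply/measurable_EFinP; apply: measurable_funM; first exact: measurable_funX.
apply: measurableT_comp => //; apply: measurableT_comp => //.
exact: measurable_funM.
Qed.

Lemma cell_weightS n t : cell_weight 0 n.+1 t = cell_weight 0 n t * (Num.max t 0)%:E.
Proof. by rewrite /cell_weight !mul0r oppr0 expR0 !mulr1 exprSr EFinM. Qed.

Let cw0 (c : borel X -> nat) y := cell_weight 0 (c y).

Lemma weight_prod_ext (c c' : borel X -> nat) ys s : {in ys, c =1 c'} ->
  weight_prod (cw0 c) ys s = weight_prod (cw0 c') ys s.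
Proof.
rewrite /weight_prod; elim: ys s => [|y ys ih] [|t s] h; rewrite /= ?big_nil//.
rewrite !big_cons ih; last by move=> z zy; apply: h; rewrite in_cons zy orbT.
by rewrite /cw0 /= h ?mem_head.
Qed.

(** The atom at [y] is the one added by [add_atoms], so multiplying by its
    mass raises the exponent of the cell of [y] by one. *)
Lemma weight_prod_atom (c c' : borel X -> nat) ys s (m : MX X) y :
  size s = size ys -> uniq ys -> y \in ys -> m [set y] = 0 ->
  c' y = (c y).+1 -> (forall z, z != y -> c' z = c z) ->
  weight_prod (cw0 c) ys s * add_atoms m ys s [set y] = weight_prod (cw0 c') ys s.
Proof.
move=> + + + + c'y c'z; elim: ys s m => [|z ys ih] [|t s] // m [ss] /= /andP[zys uys].
rewrite in_cons => + my; rewrite /weight_prod /= !big_cons.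
have [yz _|yz /= yys] := eqVneq y z.
  subst z; rewrite add_atomsE// add_atomE my add0e indicE mem_set// mul1e.
  have -> : \sum_(p <- zip ys s) (\1_[set y] p.1)%:E * @jump R X p = 0.
    rewrite big_seq big1// => p pz.
    have : p.1 \in ys.
      by rewrite -(unzip1_zip (s := ys) (t := s)) ?ss//; exact: map_f.
    move=> zin; rewrite indicE memNset ?mul0e//= => zy.
    by move: zys; rewrite -zy zin.
  rewrite adde0.
  have -> : cw0 c' (y, t).1 (y, t).2 = cw0 c y t * @jump R X (y, t).
    by rewrite /cw0 /= c'y cell_weightS.
  rewrite -!muleA; congr (_ * _).
  rewrite muleC; congr (_ * _).
  apply: (@weight_prod_ext c c') => u us; rewrite c'z//.
  by apply: contraNneq zys => <-.
rewrite -muleA /weight_prod in ih *; rewrite ih//.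
  by rewrite /cw0 /= c'z 1?eq_sym.
rewrite add_atomE my add0e indicE memNset ?mul0e//= => zy.
by move: yz; rewrite zy eqxx.
Qed.

(** The damping of the augmented measure is the product of the damping of [m]
    and of the damping of each added atom. *)
Lemma damped_weights (b : R) (c : borel X -> nat) ys s (M : \bar R) :
  (0 <= b)%R -> 0 <= M -> size s = size ys ->
  enexp (b%:E * (M + \sum_(p <- zip ys s) (\1_setT p.1)%:E * @jump R X p)) *
    weight_prod (cw0 c) ys s =
  enexp (b%:E * M) * weight_prod (fun y => cell_weight b (c y)) ys s.
Proof.
move=> b0 M0; have bM : 0 <= b%:E by rewrite lee_fin.
rewrite /weight_prod; elim: ys s => [|y ys ih] [|t s] //=.
  by rewrite !big_nil adde0.
move=> [ss]; rewrite !big_cons /=.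
have := ih s ss.
set S := \sum_(_ <- _) _; set W0 := \prod_(_ <- _) _; set Wb := \prod_(_ <- _) _ => h.
have S0 : 0 <= S by apply: sume_ge0 => p _; rewrite mule_ge0 ?jump_ge0// lee_fin indicE.
rewrite indicT mul1e addeCA ge0_muleDr ?jump_ge0 ?adde_ge0//.
rewrite enexpD ?mule_ge0 ?jump_ge0 ?adde_ge0//.
rewrite muleACA h muleCA; congr (_ * (_ * _)).
have -> : b%:E * @jump R X (y, t) = (b * Num.max t 0)%:E by [].
rewrite enexp_EFin /cw0 /cell_weight -EFinM; congr EFin.
by rewrite mul0r oppr0 expR0 mulr1 mulrC.
Qed.

Lemma levy_int_tonelli y : tonelli_functional (levy_int rho y).
Proof.
split; first exact: levy_int_ifun.
by move=> d S F nF; exact: (@levy_int_joint _ _ _ rho _ _ (fun=> y)).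
Qed.

Lemma nnmeas_add_atoms ys m (F : MX X -> \bar R) : nnmeas F ->
  nnmeas (fun s : (size ys).-tuple R => F (add_atoms m ys s)).
Proof.
move=> [F0 mF]; split => //; apply: (measurableT_comp mF).
exact: (@measurable_add_atoms ys _ _ (fun=> m)).
Qed.

(** Unfolding [palm], every value observed [c] times receives an atom of size
    [t] with weight [t^c]: one factor for its creation and one for every
    repetition. *)
Lemma palm_atoms (x : seq (borel X)) F (m : MX X) : nnmeas F ->
  (forall y, y \in x -> m [set y] = 0) ->
  palm rho x F m = prod_fun (levy_int rho) (undup x) (fun s =>
    F (add_atoms m (undup x) s) * weight_prod (cw0 (fun y => count_mem y x)) (undup x) s).
Proof.
elim: x F m => [|y x ih] F m nF m0; first by rewrite /= /weight_prod big_nil mule1.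
have nev : nnmeas (fun m : MX X => m [set y]) by exact: nnmeas_atom.
have m0x z : z \in x -> m [set z] = 0 by move=> zx; apply: m0; rewrite in_cons zx orbT.
rewrite /=; case: ifPn => yx.
  rewrite ih//; last exact: nnmeasM.
  congr (prod_fun _ _ _); apply/funext => s.
  rewrite -muleA; congr (_ * _); rewrite muleC.
  apply: weight_prod_atom; rewrite ?size_tuple ?undup_uniq ?mem_undup//.
  - by rewrite m0 ?mem_head.
  - by rewrite /= eqxx.
  - by move=> z zy; rewrite /= eq_sym (negbTE zy).
congr (levy_int _ y _); apply/funext => t.
have nw : nnmeas (fun s : (size (undup x)).-tuple R =>
    weight_prod (cw0 (fun z => count_mem z x)) (undup x) s).
  by apply: nnmeas_weight_prod => z; exact: nnmeas_cell_weight.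
rewrite ih//; last first.
  move=> z zx; rewrite add_atomE m0x// indicE memNset ?mul0e ?adde0//= => yz.
  by move: yx; rewrite yz zx.
rewrite muleC -(ifunZr (prod_fun_tonelli levy_int_tonelli _).1); last 2 first.
- exact: jump_ge0.
- by apply: nnmeasM => //; exact: nnmeas_add_atoms.
congr (prod_fun _ _ _); apply/funext => s; rewrite -muleA; congr (_ * _).
rewrite /weight_prod /= big_cons muleC; congr (_ * _).
  rewrite /cw0 /= eqxx (count_memPn yx) addn0 /jump /cell_weight /=.
  by rewrite mul0r oppr0 expR0 mulr1 expr1.
apply: weight_prod_ext => z; rewrite mem_undup => zx /=.
by case: eqVneq => // yz; move: yx; rewrite yz zx.
Qed.

(** The unnormalised law of a jump at a value observed [n] times. *)
Definition jump_int (b : R) (n : nat) (y : borel X) (f : R -> \bar R) : \bar R :=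
  levy_int rho y (fun t => f t * cell_weight b n t).

Lemma jump_int_tonelli b n y : tonelli_functional (jump_int b n y).
Proof.
by apply: tonelli_weight; [exact: levy_int_tonelli|exact: nnmeas_cell_weight].
Qed.

(** The damping factors over the added atoms and the part of [m] without fixed
    atoms, and turns the weights of [palm_atoms] into those of [jump_int]. *)
Lemma palm_eval (b : R) (x : seq (borel X)) F (m : MX X) : (0 <= b)%R -> nnmeas F ->
  (forall y, y \in x -> m [set y] = 0) ->
  palm rho x (fun m => F m * enexp (b%:E * m setT)) m =
  enexp (b%:E * m setT) *
  prod_fun (fun y => jump_int b (count_mem y x) y) (undup x)
    (fun s => F (add_atoms m (undup x) s)).
Proof.
move=> b0 nF m0.
have nd : nnmeas (fun m : MX X => enexp (b%:E * m setT)).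
  apply: nnmeas_enexp; apply: measurable_funeM; exact: measurable_eval.
rewrite palm_atoms//; last exact: nnmeasM.
rewrite [in RHS](_ : (fun y => _) = (fun y f => levy_int rho y (fun t =>
  f t * cell_weight b (count_mem y x) t)))//.
have nFa := nnmeas_add_atoms (undup x) m nF.
rewrite (prod_fun_weight levy_int_tonelli (w := fun y => cell_weight b (count_mem y x)))//; last first.
  by move=> y; exact: nnmeas_cell_weight.
rewrite muleC -(ifunZr (prod_fun_tonelli levy_int_tonelli _).1) ?enexp_ge0//; last first.
  by apply: nnmeasM => //; apply: nnmeas_weight_prod => y; exact: nnmeas_cell_weight.
congr (prod_fun _ _ _); apply/funext => s; rewrite -!muleA; congr (_ * _).
rewrite add_atomsE ?size_tuple// damped_weights ?size_tuple//.
by rewrite muleC.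
Qed.

End palm_evaluation.

(** * Bayes' rule *)

Section product_uniqueness.
Context (R : realType).

Lemma ifun_unique_prod d1 d2 (T1 : measurableType d1) (T2 : measurableType d2)
    (L1 L2 : (T1 * T2 -> \bar R) -> \bar R) :
  integral_functional L1 -> integral_functional L2 -> L1 (fun=> 1) < +oo ->
  (forall A B, measurable A -> measurable B ->
    L1 (fun p => (\1_A p.1)%:E * (\1_B p.2)%:E) =
    L2 (fun p => (\1_A p.1)%:E * (\1_B p.2)%:E)) ->
  forall f, nnmeas f -> L1 f = L2 f.
Proof.
move=> h1 h2 oo h12.
pose C := [set A `*` B | A in @measurable _ T1 & B in @measurable _ T2].
have e (A : set T1) (B : set T2) : (fun p : T1 * T2 => (\1_(A `*` B) p)%:E) =
    (fun p => (\1_A p.1)%:E * (\1_B p.2)%:E) :> (_ -> \bar R).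
  by apply/funext => -[x y]; rewrite -EFinM; congr EFin; rewrite !indicE in_setX -natrM mulnb.
apply: (@ifun_unique_pi R _ _ C (fun=> setT) L1 L2) => //.
- by rewrite measurable_prod_measurableType.
- move=> _ _ [X1 mX1 [X2 mX2 <-]] [Y1 mY1 [Y2 mY2 <-]].
  exists (X1 `&` Y1); first exact: measurableI.
  by exists (X2 `&` Y2); [exact: measurableI|rewrite setXI].
- by move=> _; exists setT => //; exists setT => //; rewrite setXTT.
- by rewrite bigcup_const.
- by move=> _ [A mA [B mB <-]]; rewrite e h12.
- move=> k; rewrite (_ : (fun x => _) = fun=> 1)//.
  by apply/funext => x; rewrite indicT.
Qed.

Definition box d (T : measurableType d) n (B : 'I_n -> set T) : set (n.-tuple T) :=
  [set x | forall i, B i (tnth x i)].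

Lemma measurable_box d (T : measurableType d) n (B : 'I_n -> set T) :
  (forall i, measurable (B i)) -> measurable (box B).
Proof.
move=> mB; rewrite (_ : box B = \bigcap_i ((fun x => tnth x i) @^-1` B i)).
  apply: fin_bigcap_measurable => // i _.
  by rewrite -[X in measurable X]setTI; exact: measurable_tnth.
by apply/seteqP; split => x /= h i; have := h i; [move=> + _|move=> /(_ I)].
Qed.

Lemma indic_box d (T : measurableType d) n (B : 'I_n -> set T) x :
  (\1_(box B) x)%:E = \prod_(i < n) (\1_(B i) (tnth x i))%:E :> \bar R.
Proof.
rewrite prodEFin; congr EFin; rewrite indicE.
have [/set_mem h|/negP h] := boolP (x \in box B).
  by rewrite big1// => i _; rewrite indicE mem_set//; exact: h.
have [i hi] : exists i, ~ B i (tnth x i).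
  by apply: contrapT => /forallNP k; apply: h; apply/mem_set => i; exact: contrapT (k i).
by rewrite (bigD1 i)//= indicE memNset// mul0r.
Qed.

Lemma ifun_unique_box d (T : measurableType d) n
    (L1 L2 : (n.-tuple T -> \bar R) -> \bar R) :
  integral_functional L1 -> integral_functional L2 -> L1 (fun=> 1) < +oo ->
  (forall B : 'I_n -> set T, (forall i, measurable (B i)) ->
    L1 (fun x => (\1_(box B) x)%:E) = L2 (fun x => (\1_(box B) x)%:E)) ->
  forall f, nnmeas f -> L1 f = L2 f.
Proof.
move=> h1 h2 oo h12.
pose C := [set box B | B in [set B : 'I_n -> set T | forall i, measurable (B i)]].
have boxT : box (fun=> setT : set T) = setT :> set (n.-tuple T) by apply/seteqP; split.
apply: (@ifun_unique_pi R _ _ C (fun=> setT) L1 L2) => //.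
- apply/seteqP; split; last first.
    apply: smallest_sub; first exact: sigma_algebra_measurable.
    by move=> _ [B mB <-]; exact: measurable_box.
  apply: smallest_sub; first exact: smallest_sigma_algebra.
  move=> A; rewrite -bigcup_seq => -[i _ [B mB <-]]; apply: sub_sigma_algebra.
  exists (fun j => if j == i then B else setT).
    by move=> j /=; case: ifP.
  rewrite setTI; apply/seteqP; split => x /= h.
    by have := h i; rewrite eqxx.
  by move=> j; case: eqP => // ->.
- move=> _ _ [B mB <-] [B' mB' <-]; exists (fun i => B i `&` B' i).
    by move=> i; exact: measurableI.
  apply/seteqP; split => x /=.
    by move=> h; split => i; case: (h i).
  by move=> [h h'] i; split.
- by move=> _; exists (fun=> setT).
- by rewrite bigcup_const.
- by move=> _ [B mB <-]; exact: h12.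
- move=> k; rewrite (_ : (fun x => _) = fun=> 1)//.
  by apply/funext => x; rewrite indicT.
Qed.

End product_uniqueness.

Section bayes.
Context (R : realType) d1 d2 (S : measurableType d1) (M : measurableType d2).
Context d (Om : measurableType d) (P : probability Om R).
Variables (Z : Om -> S) (V : Om -> M).
Hypotheses (mZ : measurable_fun setT Z) (mV : measurable_fun setT V).
Variables (Lam : (S -> \bar R) -> \bar R) (G : S -> (M -> \bar R) -> \bar R).
Hypothesis hLam : integral_functional Lam.
Hypothesis hG : forall z, integral_functional (G z).
Hypothesis mG : forall F : S * M -> \bar R, nnmeas F ->
  nnmeas (fun z => G z (fun v => F (z, v))).
Hypothesis joint : forall F : S * M -> \bar R, nnmeas F ->
  \int[P]_w F (Z w, V w) = Lam (fun z => G z (fun v => F (z, v))).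

Let D z := G z (fun=> 1).

Let nD : nnmeas D.
Proof. by apply: (mG (F := fun=> 1)); exact: nnmeas_cst. Qed.

Let law f : nnmeas f -> \int[P]_w f (Z w) = Lam (fun z => f z * D z).
Proof.
move=> nf; have nf2 : nnmeas (fun p : S * M => f p.1).
  by case: nf => h mh; split => //; exact: (measurableT_comp mh measurable_fst).
rewrite (joint nf2); congr Lam; apply/funext => z /=.
rewrite muleC -(ifunZr (hG z)); [|by case: nf|exact: nnmeas_cst].
by congr (G z _); apply/funext => v; rewrite mul1e.
Qed.

(** The normalising mass is almost surely positive and finite: the event that it
    vanishes has probability [Lam 0], and the probability of the event that it
    is infinite is unchanged by doubling. *)
Lemma normalising_mass : {ae P, forall w, 0 < D (Z w) < +oo}.
Proof.
have mD0 : measurable [set z | D z = 0].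
  by have := nD.2 measurableT _ (emeasurable_set1 0); rewrite setTI.
have mDoo : measurable [set z | D z = +oo].
  by have := nD.2 measurableT _ (emeasurable_set1 +oo); rewrite setTI.
pose A0 : set S := [set z | D z = 0].
pose Aoo : set S := [set z | D z = +oo].
have null (A : set S) : measurable A -> Lam (fun z => (\1_A z)%:E * D z) = 0 ->
    {ae P, forall w, ~ A (Z w)}.
  move=> mA h; exists (Z @^-1` A); split.
  - by rewrite -[X in measurable X]setTI; exact: mZ.
  - rewrite -h -law; last exact: nnmeas_indic.
    rewrite -integral_indicT//.
    by rewrite -[X in measurable X]setTI; exact: mZ.
  - by move=> w /= /contrapT.
have h0 : Lam (fun z => (\1_A0 z)%:E * D z) = 0.
  rewrite (_ : (fun z => _) = fun=> 0) ?(ifun0 hLam)//.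
  apply/funext => z; rewrite indicE; have [/set_mem/= ->|_] := boolP (z \in _).
    by rewrite mule0.
  by rewrite mul0e.
have hoo : Lam (fun z => (\1_Aoo z)%:E * D z) = 0.
  set f := (fun z => (\1_Aoo z)%:E * D z).
  have nf : nnmeas f by apply: nnmeasM => //; exact: nnmeas_indic.
  have f2 : Lam f = 2%:E * Lam f.
    rewrite -(ifunZ hLam)//; congr Lam; apply/funext => z; rewrite /f indicE.
    have [/set_mem/= ->|_] := boolP (z \in _).
      by rewrite mul1e gt0_muley// lte_fin.
    by rewrite mul0e mule0.
  have foo : Lam f \is a fin_num.
    rewrite ge0_fin_numE; last exact: (ifun_ge0 hLam).
    rewrite /f -law; last exact: nnmeas_indic.
    apply: (@le_lt_trans _ _ (\int[P]_w 1)); last by rewrite integral_prob_cst ltry.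
    apply: (ifun_le (ifun_integral P)); [|exact: nnmeas_cst|].
      have [h mh] := nnmeas_indic R mDoo.
      by split; [move=> x; exact: h|exact: (measurableT_comp mh mZ)].
    by move=> w; rewrite lee_fin indicE; case: (_ \in _).
  move: f2; rewrite -(fineK foo) -EFinM => -[]; set x := fine _ => f2.
  by congr EFin; lra.
apply: filterS2 (null _ mD0 h0) (null _ mDoo hoo) => w /= w0 woo.
rewrite lt_neqAle eq_sym (ltey_eq); have [D0 _] := nD.
rewrite D0 andbT; apply/andP; split; first exact/eqP.
by case: (D (Z w)) (D0 (Z w)) woo => // r _ _; rewrite fin_numE.
Qed.

(** The kernel normalises [G z]. On the event that the mass [D z] is finite,
    multiplying it back reproduces the joint law; the complement is negligible
    by [normalising_mass]. *)
Lemma bayes : exists K : R.-pker S ~> M,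
  is_cond_law P Z V K /\
  forall z, D z < +oo -> forall f, nnmeas f -> D z * \int[K z]_v f v = G z f.
Proof.
have mGi B : measurable B -> measurable_fun setT (fun z => G z (fun v => (\1_B v)%:E)).
  move=> mB; apply: (mG (F := fun p => (\1_B p.2)%:E) _).2.
  have [h mh] := nnmeas_indic R mB; split => //.
  exact: (measurableT_comp mh measurable_snd).
have [K KE] := normalized_kernel hG mGi; exists K; split => // A B mA mB.
have mZA : measurable (Z @^-1` A) by rewrite -[X in measurable X]setTI; exact: mZ.
have mVB : measurable (V @^-1` B) by rewrite -[X in measurable X]setTI; exact: mV.
pose fin := [set z | D z < +oo].
have mfin : measurable fin.
  have -> : fin = ~` [set z | D z = +oo].
    by apply/seteqP; split => z; rewrite /fin /= ltey => /eqP.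
  by apply: measurableC; have := nD.2 measurableT _ (emeasurable_set1 +oo); rewrite setTI.
have mA' : measurable (A `&` fin) by exact: measurableI.
have nA := nnmeas_indic R mA; have nA' := nnmeas_indic R mA'.
have nB := nnmeas_indic R mB.
have aefin : {ae P, forall w, (\1_A (Z w))%:E = (\1_(A `&` fin) (Z w))%:E :> \bar R}.
  apply: filterS normalising_mass => w /andP[_ Dw].
  rewrite !indicE; congr (_%:R)%:E; congr nat_of_bool.
  by apply/idP/idP => /set_mem h; apply/mem_set; [split|case: h].
have nZ (f : S -> \bar R) : nnmeas f -> nnmeas (fun w => f (Z w)).
  by move=> [h mh]; split => //; exact: measurableT_comp.
have nV (f : M -> \bar R) : nnmeas f -> nnmeas (fun w => f (V w)).
  by move=> [h mh]; split => //; exact: measurableT_comp.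
have nK : nnmeas (fun z => K z B).
  by split => //; exact: measurable_kernel.
have aeq (f : Om -> \bar R) : nnmeas f ->
    \int[P]_w ((\1_A (Z w))%:E * f w) = \int[P]_w ((\1_(A `&` fin) (Z w))%:E * f w).
  move=> nf; have n1 := nnmeasM (nZ _ nA) nf; have n2 := nnmeasM (nZ _ nA') nf.
  apply: ge0_ae_eq_integral => //; [by case: n1|by case: n2|by move=> w _; case: n1|by move=> w _; case: n2|].
  by apply: filterS aefin => w -> _.
rewrite -(integral_indicM _ _ mZA) -integral_indicT; last exact: measurableI.
transitivity (\int[P]_w ((\1_A (Z w))%:E * (\1_B (V w))%:E)).
  by apply: eq_integral => w _; rewrite indicI -EFinM !indicE.
transitivity (\int[P]_w ((\1_A (Z w))%:E * K (Z w) B)); last first.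
  by apply: eq_integral => w _; rewrite !indicE.
rewrite (aeq _ (nV _ nB)) (aeq _ (nZ _ nK)) (law (nnmeasM nA' nK)).
have nF : nnmeas (fun p : S * M => (\1_(A `&` fin) p.1)%:E * (\1_B p.2)%:E : \bar R).
  apply: nnmeasM.
    by case: nA' => h mh; split => //; exact: (measurableT_comp mh measurable_fst).
  by case: nB => h mh; split => //; exact: (measurableT_comp mh measurable_snd).
rewrite (joint nF); congr Lam; apply/funext => z /=.
have i0 : (0 <= \1_(A `&` fin) z :> R)%R by rewrite indicE.
rewrite (ifunZ (hG z) i0 nB).
rewrite -muleA indicE; have [/set_mem[_ Dz]|_] := boolP (z \in _); last by rewrite !mul0e.
by rewrite !mul1e muleC -(KE _ Dz _ nB) integral_indicT.
Qed.

End bayes.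

(** * Joint law of the latent variable, the sample and the tilted measure *)

Section lebesgue_real.
Context (R : realType).

Lemma lebesgue_ifun : integral_functional
  (fun f : R -> \bar R => \int[lebesgue_measure]_u f u).
Proof.
have [h0 hle hD hZ hlim] := ifun_integral (@lebesgue_measure R).
split; [exact: h0|exact: hle|exact: hD|exact: hZ|exact: hlim].
Qed.

Fact lebesgue_real_subproof : exists leb : {sigma_finite_measure set R -> \bar R},
  forall f : R -> \bar R, nnmeas f ->
    \int[leb]_u f u = \int[lebesgue_measure]_u f u.
Proof.
have [m mE] := ifun_measure lebesgue_ifun.
have mA (A : set R) : measurable A -> m A = lebesgue_measure A.
  move=> mA; rewrite -integral_indicT// mE; last exact: nnmeas_indic.
  by rewrite integral_indic ?setIT.
have msig : sigma_finite setT m.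
  have [F FT hF] := sigma_finiteT (@lebesgue_measure R); exists F => // i.
  have [mF Foo] := hF i; split; first exact: mF.
  by rewrite mA.
pose H2 := isSFinite.Build _ _ _ _ (sfinite_measure_sigma_finite msig).
pose H3 := isSigmaFinite.Build _ _ _ _ msig.
pose leb := HB.pack_for (SigmaFiniteMeasure.type R R) (Measure.sort m) H2 H3.
by exists leb.
Qed.

(** Lebesgue measure on the measurable structure of [R] over which the kernels
    and product measures below are formed. *)
Definition leb : {sigma_finite_measure set R -> \bar R} :=
  projT1 (cid lebesgue_real_subproof).

Lemma lebE (f : R -> \bar R) : nnmeas f ->
  \int[lebesgue_measure]_u f u = \int[leb]_u f u.
Proof. by move=> nf; rewrite /leb; case: cid => m /= ->. Qed.

End lebesgue_real.

Section joint_law.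
Context (R : realType) (X : completeMetricType R).
Local Notation E := (borel X * R)%type.
Hypothesis sepX : separable X.
Variables (eta : probability (borel X) R) (rho : R.-ker (borel X) ~> R)
  (nu : {measure set E -> \bar R}).
Hypothesis nuE : disintegrates nu eta (fun x => rho x).
Context d0 (Om0 : measurableType d0) (P0 : probability Om0 R).
Variables (mu : {RV P0 >-> MX X}) (N : R.-ker Om0 ~> E).
Hypothesis hN : is_poisson_random_measure P0 N nu.
Hypothesis hmu : {ae P0, forall w, forall A : set (borel X), measurable A ->
  mu w A = \int[N w]_(z in A `*` `]0%R, +oo[) (z.2)%:E}.
Hypothesis mu_total : {ae P0, forall w, 0 < mu w setT < +oo}.
Variables (q gamma : R) (n : nat).
Let h (x : R) : R := (expR (- (gamma * x)) * x `^ (- q))%R.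
Context d (Om : measurableType d) (P : probability Om R).
Variables (mut : {RV P >-> MX X}) (Xs : {RV P >-> n.-tuple (borel X)})
  (U : {RV P >-> R}).
Hypothesis mut_tilted : is_tilted mu h mut.
Hypothesis XsU : augmented_sample P mut Xs U (n%:R + q).
Local Notation S := (R * n.-tuple (borel X))%type.

Let mmu : measurable_fun setT mu. Proof. exact: measurable_funP. Qed.

Let mu_fin : {ae P0, forall w, mu w setT < +oo}.
Proof. by apply: filterS mu_total => w /andP[]. Qed.

Definition latent_power (u : R) : R :=
  (if 0 < u then u `^ (n%:R + q - 1) else 0)%R.

Lemma latent_power_ge0 u : (0 <= latent_power u)%R.
Proof. by rewrite /latent_power; case: ifP => // _; exact: powR_ge0. Qed.

Lemma nnmeas_latent_power : nnmeas (fun u => (latent_power u)%:E).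
Proof.
split; first by move=> u; rewrite lee_fin latent_power_ge0.
apply/measurable_EFinP; apply: measurable_fun_ifT => //.
exact: measurable_fun_ltr.
Qed.

(** The density of the joint law at the values [z] of the latent variable and
    of the sample, as a functional of the random measure. *)
Definition posterior (z : S) (F : MX X -> \bar R) : \bar R :=
  (latent_power z.1)%:E *
  palm_mean P0 mu rho z.2 (fun m => F m * enexp ((gamma + z.1)%:E * m setT)).

Let nnmeas_damp d1 (T : measurableType d1) (b : T -> R) (m : T -> MX X) :
  measurable_fun setT b -> measurable_fun setT m ->
  nnmeas (fun t => enexp ((b t)%:E * m t setT)).
Proof.
move=> mb mm; apply: nnmeas_enexp; apply: emeasurable_funM.
  exact/measurable_EFinP.
exact: (measurableT_comp (measurable_eval measurableT) mm).
Qed.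

Lemma posterior_ifun z : integral_functional (posterior z).
Proof.
apply: ifunC; last by rewrite lee_fin latent_power_ge0.
apply: (ifun_density (palm_mean_ifun sepX P0 mmu rho z.2)).
by apply: (nnmeas_damp (b := fun=> gamma + z.1)%R).
Qed.

Lemma posterior_joint (F : S * MX X -> \bar R) : nnmeas F ->
  nnmeas (fun z => posterior z (fun m => F (z, m))).
Proof.
move=> nF; apply: nnmeasM.
  have [h0 mh] := nnmeas_latent_power; split; first by move=> z; exact: h0.
  exact: (measurableT_comp mh measurable_fst).
apply: (palm_mean_joint sepX P0 mmu rho (x := snd)
  (F := fun p => F p * enexp ((gamma + p.1.1)%:E * p.2 setT))) => //.
apply: nnmeasM => //.
apply: (@nnmeas_damp _ _ (fun p : S * MX X => gamma + p.1.1)%R snd) => //.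
apply: measurable_funD => //; exact: (measurableT_comp measurable_fst measurable_fst).
Qed.

Lemma measurable_total_mass : measurable_fun setT (fun m : MX X => total_mass m).
Proof.
by apply: (measurableT_comp (@fine_measurable _ _ measurableT)); exact: measurable_eval.
Qed.

Let nnmeas_h : nnmeas (fun m : MX X => (h (total_mass m))%:E).
Proof.
split; first by move=> m; rewrite lee_fin mulr_ge0 ?expR_ge0 ?powR_ge0.
apply/measurable_EFinP; apply: measurable_funM.
  apply: measurableT_comp => //; apply: measurableT_comp => //.
  by apply: measurable_funM => //; exact: measurable_total_mass.
exact: (measurableT_comp (measurable_powR _) measurable_total_mass).
Qed.

Lemma tilted_integral : exists2 k : \bar R, 0 <= k & forall f, nnmeas f ->
  \int[P]_w f (mut w) = k * \int[P0]_w (f (mu w) * (h (total_mass (mu w)))%:E).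
Proof.
have [h0 mh] := nnmeas_h.
exists ('E_P0[fun w => h (total_mass (mu w))])^-1.
  by rewrite inve_ge0; apply: expectation_ge0 => w; have := h0 (mu w); rewrite lee_fin.
set k := _^-1 => f nf.
have k0 : 0 <= k.
  by rewrite inve_ge0; apply: expectation_ge0 => w; have := h0 (mu w); rewrite lee_fin.
have mmut : measurable_fun setT mut by exact: measurable_funP.
have [m' [m'I m'E]] := image_measure P mmut.
rewrite -m'I//.
have nkh : nnmeas (fun m : MX X => k * (h (total_mass m))%:E).
  by apply: nnmeasM => //; exact: nnmeas_cst.
have m'd A : measurable A -> m' A =
    \int[distribution P0 mu]_(m in A) (k * (h (total_mass m))%:E).
  move=> mA; rewrite m'E//; apply: (etrans (mut_tilted mA)).
  rewrite -!(integral_indicM _ _ mA) -/k muleC.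
  rewrite -(ifunZr (ifun_integral (distribution P0 mu)) k0); last first.
    by apply: nnmeasM => //; exact: nnmeas_indic.
  by apply: eq_integral => m _; rewrite [k * _]muleC muleA.
rewrite (integral_density nkh m'd nf).
rewrite ge0_integral_distribution; last 2 first.
- by case: (nnmeasM nf nkh).
- by move=> m; case: (nnmeasM nf nkh).
rewrite muleC -(ifunZr (ifun_integral P0) k0); last first.
  have [g0 mg] := nnmeasM nf nnmeas_h.
  by split; [move=> w; exact: (g0 (mu w))|exact: (measurableT_comp mg mmu)].
by apply: eq_integral => w _ /=; rewrite [k * _]muleC muleA.
Qed.

Lemma gamma_law_nnmeas (C : set R) : measurable C ->
  nnmeas (fun m : MX X => gamma_law (n%:R + q) (total_mass m) C).
Proof.
move=> mC; have mCI : measurable (C `&` `]0%R, +oo[) by exact: measurableI.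
pose F (p : MX X * R) : R := (p.2 `^ (n%:R + q - 1) * expR (- (p.2 * total_mass p.1)) *
  total_mass p.1 `^ (n%:R + q) / Gamma (n%:R + q))%R.
have G0 : (0 <= Gamma (n%:R + q))%R.
  apply: Rintegral_ge0 => t; rewrite /= in_itv/= andbT => t0.
  by rewrite mulr_ge0 ?expR_ge0 ?powR_ge0.
have mT : measurable_fun setT (fun p : MX X * R => total_mass p.1).
  exact: (measurableT_comp measurable_total_mass measurable_fst).
have mF : measurable_fun setT F.
  apply: measurable_funM => //; apply: measurable_funM.
    apply: measurable_funM.
      exact: (measurableT_comp (measurable_powR _) measurable_snd).
    apply: measurableT_comp => //; apply: measurableT_comp => //.
    exact: measurable_funM.
  exact: (measurableT_comp (measurable_powR _) mT).
have nF : nnmeas (fun p => (\1_(C `&` `]0%R, +oo[) p.2)%:E * (F p)%:E).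
  apply: nnmeasM.
    have [g0 mg] := nnmeas_indic R mCI; split => //.
    exact: (measurableT_comp mg measurable_snd).
  split; last exact/measurable_EFinP.
  by move=> p; rewrite lee_fin /F divr_ge0// !mulr_ge0 ?expR_ge0 ?powR_ge0.
have -> : (fun m : MX X => gamma_law (n%:R + q) (total_mass m) C) =
    (fun m => \int[leb R]_u ((\1_(C `&` `]0%R, +oo[) u)%:E * (F (m, u))%:E)).
  apply/funext => m; rewrite -lebE.
    exact: (esym (integral_indicM lebesgue_measure (fun u => (F (m, u))%:E) mCI)).
  case: nF => g0 mg; split; first by move=> u; exact: (g0 (m, u)).
  exact: (measurableT_comp mg (measurable_pair1 m)).
case: nF => g0 mg; split; first by move=> m; apply: integral_ge0 => u _; exact: (g0 (m, u)).
exact: (@measurable_fun_fubini_tonelli_F _ _ _ _ _ (leb R) _ mg g0).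
Qed.

Lemma normalizeE (m : MX X) (A : set (borel X)) :
  normalize m A = ((total_mass m)^-1)%:E * m A.
Proof. by []. Qed.

Lemma prode_scale k (c : R) (f : 'I_k -> \bar R) :
  \prod_(i < k) (c%:E * f i) = (c ^+ k)%:E * \prod_(i < k) f i.
Proof.
elim: k f => [|k ih] f; first by rewrite !big_ord0 mul1e.
by rewrite !big_ord_recl ih exprS EFinM muleACA.
Qed.

(** The powers of the total mass in the tilting, in the [n] normalised factors
    and in the gamma density cancel. *)
Lemma cancel_total_mass (m : MX X) (B : 'I_n -> set (borel X)) (C : set R) :
  measurable C -> 0 < m setT < +oo ->
  (\prod_(i < n) normalize m (B i)) * gamma_law (n%:R + q) (total_mass m) C *
    (h (total_mass m))%:E =
  ((Gamma (n%:R + q))^-1)%:E *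
  ((\prod_(i < n) m (B i)) * \int[leb R]_u ((\1_C u)%:E *
    ((latent_power u)%:E * enexp ((gamma + u)%:E * m setT)))).
Proof.
move=> mC /andP[T0 Too].
have Tf : m setT \is a fin_num by rewrite ge0_fin_numE// ltW.
set T := total_mass m; have TE : m setT = T%:E by rewrite fineK.
have TT0 : (0 < T)%R by rewrite -lte_fin -TE.
have mCI : measurable (C `&` `]0%R, +oo[) by exact: measurableI.
set G := Gamma _.
have G0 : (0 <= G^-1)%R.
  rewrite invr_ge0; apply: Rintegral_ge0 => t; rewrite /= in_itv/= andbT => t0.
  by rewrite mulr_ge0 ?expR_ge0 ?powR_ge0.
have K0 : 0 <= \prod_(i < n) m (B i) by apply: prode_ge0.
rewrite (eq_bigr (fun i => (T^-1)%:E * m (B i)))// prode_scale.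
set Kp := \prod_(i < n) m (B i) in K0 *.
have nC : nnmeas (fun u => (\1_C u)%:E * ((latent_power u)%:E *
    enexp ((gamma + u)%:E * m setT))).
  apply: nnmeasM; first exact: nnmeas_indic.
  apply: nnmeasM; first exact: nnmeas_latent_power.
  by apply: (@nnmeas_damp _ _ (fun u => gamma + u)%R (fun=> m)) => //; exact: measurable_funD.
have c0 : (0 <= (T^-1) ^+ n * h T)%R.
  apply: mulr_ge0; first by rewrite exprn_ge0// invr_ge0 ltW.
  by rewrite /h mulr_ge0 ?expR_ge0 ?powR_ge0.
suff e : gamma_law (n%:R + q) T C * ((T^-1) ^+ n * h T)%:E =
    (G^-1)%:E * \int[leb R]_u ((\1_C u)%:E *
    ((latent_power u)%:E * enexp ((gamma + u)%:E * m setT))).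
  by rewrite [RHS]muleCA -e EFinM -!muleA [LHS]muleCA; congr (_ * _); rewrite muleCA.
rewrite -(ifunZ (ifun_integral (leb R)) G0 nC) /gamma_law.
have mF : measurable_fun setT (fun u : R => (u `^ (n%:R + q - 1) * expR (- (u * T)) *
    T `^ (n%:R + q) / G)%R).
  apply: measurable_funM => //; apply: measurable_funM => //.
  apply: measurable_funM => //; apply: measurableT_comp => //.
  by apply: measurableT_comp => //; exact: measurable_funM.
have F0 u : (0 <= u `^ (n%:R + q - 1) * expR (- (u * T)) * T `^ (n%:R + q) / G)%R.
  by rewrite !mulr_ge0 ?expR_ge0 ?powR_ge0.
rewrite -(integral_indicM lebesgue_measure (fun u => (u `^ (n%:R + q - 1) *
  expR (- (u * T)) * T `^ (n%:R + q) / G)%:E) mCI).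
have nF : nnmeas (fun u => (\1_(C `&` `]0%R, +oo[) u)%:E * (u `^ (n%:R + q - 1) *
    expR (- (u * T)) * T `^ (n%:R + q) / G)%:E).
  apply: nnmeasM; first exact: nnmeas_indic.
  by split; [move=> u; rewrite lee_fin|exact/measurable_EFinP].
rewrite (lebE nF) -(ifunZr (ifun_integral (leb R)) _ nF); last by rewrite lee_fin.
apply: eq_integral => u _.
rewrite TE -EFinM enexp_EFin -!EFinM; congr EFin.
have iE : \1_(`]0%R, +oo[%classic : set R) u = (0 < u)%R%:R :> R.
  rewrite indicE; congr (_%:R); congr nat_of_bool; apply/idP/idP => [/set_mem/=|u0].
    by rewrite in_itv/= andbT.
  by apply/mem_set; rewrite /= in_itv/= u0.
rewrite indicI /= iE.
rewrite /latent_power; case: (ltP 0%R u) => u0; last by rewrite !(mul0r,mulr0).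
have -> : (T `^ (n%:R + q))%R = (T ^+ n * T `^ q)%R.
  rewrite powRD; first by rewrite powR_mulrn// ltW.
  by rewrite (gt_eqF TT0) implybT.
have -> : expR (- ((gamma + u) * T)) = (expR (- (gamma * T)) * expR (- (u * T)))%R.
  by rewrite -expRD; congr expR; ring.
have Tq : (T `^ q)%R != 0%R by rewrite gt_eqF// powR_gt0.
rewrite /h powRN exprVn; set a := expR _; set b := expR _; set c := (_ `^ (_ - 1))%R; set i := \1_C u.
have Tn : (T ^+ n)%R != 0%R by rewrite expf_neq0// gt_eqF.
move: Tq Tn; set tq := (_ `^ q)%R; set tn := (T ^+ n)%R; set g := (G^-1)%R => Tq Tn.
have -> : true%:R = 1%R :> R by [].
by field; rewrite Tq Tn.
Qed.

Let nnmeas_RV (F : MX X -> \bar R) : nnmeas F -> nnmeas (fun w => F (mu w)).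
Proof. by move=> [g0 mg]; split => //; exact: (measurableT_comp mg mmu). Qed.

(** On boxes, [cancel_total_mass] turns the law of the augmented sample into
    damped moments of [mu] on sets, to which [iterated_mecke] applies; boxes
    determine the law. *)
Lemma joint_law : exists (k : \bar R) (lam : {measure set (n.-tuple (borel X)) -> \bar R}),
  [/\ 0 <= k, lam setT < +oo & forall F : S * MX X -> \bar R, nnmeas F ->
  \int[P]_w F ((U w, Xs w), mut w) =
  k * \int[leb R]_u \int[lam]_x
    posterior (u, x) (fun m => F ((u, x), m))].
Proof.
have [k k0 tiltE] := tilted_integral.
have [lam [lamoo lamE]] := iterated_mecke sepX mmu hN hmu mu_fin nuE n.
set G := ((Gamma (n%:R + q))^-1)%R.
have G0 : (0 <= G)%R.
  rewrite invr_ge0; apply: Rintegral_ge0 => t; rewrite /= in_itv/= andbT => t0.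
  by rewrite mulr_ge0 ?expR_ge0 ?powR_ge0.
have kG0 : 0 <= k * G%:E by rewrite mule_ge0// lee_fin.
exists (k * G%:E), lam; split => //.
have mmut : measurable_fun setT mut by exact: measurable_funP.
have mXs : measurable_fun setT Xs by exact: measurable_funP.
have mU : measurable_fun setT U by exact: measurable_funP.
have mZ : measurable_fun setT (fun w => (U w, Xs w)) by exact: measurable_fun_pair.
pose L1 (F : S * MX X -> \bar R) := \int[P]_w F ((U w, Xs w), mut w).
pose L2 (F : S * MX X -> \bar R) := k * G%:E * \int[leb R]_u \int[lam]_x
    posterior (u, x) (fun m => F ((u, x), m)).
have hL1 : integral_functional L1.
  apply: (ifun_comp (phi := fun w => ((U w, Xs w), mut w)) (ifun_integral P)).
  exact: measurable_fun_pair.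
have lam_joint (f : S -> \bar R) : nnmeas f ->
    nnmeas (fun u => \int[lam]_x f (u, x)).
  move=> [f0 mf].
  have nG : nnmeas (fun p : n.-tuple (borel X) * R => f (p.2, p.1)).
    split => //; apply: (measurableT_comp mf); exact: measurable_fun_pair.
  have l1 : \int[lam]_x (1%R : R)%:E < +oo by rewrite integral_cst// mul1e.
  by have [] := @ifun_fubini R _ _ _ _ _ (fun=> 1%R) (leb R) _ (ifun_integral lam)
    (fun=> ltr01) (measurable_cst _) l1 nG.
have hL2 : integral_functional L2.
  apply: (ifunC _ kG0).
  apply: (@ifun_bind R _ _ _ (S * MX X)%type
    (fun f : R -> \bar R => \int[leb R]_u f u)
    (fun u F => \int[lam]_x posterior (u, x) (fun m => F ((u, x), m)))
    (ifun_integral (leb R))).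
    move=> u; apply: (@ifun_bind R _ _ _ (S * MX X)%type
      (fun f : n.-tuple (borel X) -> \bar R => \int[lam]_x f x)
      (fun x F => posterior (u, x) (fun m => F ((u, x), m))) (ifun_integral lam)).
      move=> x; apply: (ifun_comp (phi := fun m => ((u, x), m)) (posterior_ifun (u, x))).
      exact: measurable_pair1.
    move=> F nF; have [_ mp] := posterior_joint nF.
    exact: (measurableT_comp mp (measurable_pair1 u)).
  by move=> F nF; case: (lam_joint _ (posterior_joint nF)).
have L1oo F : nnmeas F -> (forall p, F p <= 1) -> L1 F < +oo.
  move=> nF F1; apply: (@le_lt_trans _ _ (L1 (fun=> 1))).
    by apply: (ifun_le hL1) => //; exact: nnmeas_cst.
  by rewrite /L1 integral_prob_cst ltry.
have ind1 d1 (T : measurableType d1) (A : set T) x : (\1_A x)%:E <= 1 :> \bar R.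
  by rewrite lee_fin indicE; case: (_ \in _).
have nind d1 d2 (T : measurableType d1) (T' : measurableType d2) (A : set T) (phi : T' -> T) :
    measurable A -> measurable_fun setT phi -> nnmeas (fun t => (\1_A (phi t))%:E : \bar R).
  move=> mA mphi; have [g0 mg] := nnmeas_indic R mA.
  by split => //; exact: (measurableT_comp mg mphi).
have mfst1 : measurable_fun setT (fun p : S * MX X => p.1.1).
  exact: (measurableT_comp measurable_fst measurable_fst).
have mfst2 : measurable_fun setT (fun p : S * MX X => p.1.2).
  exact: (measurableT_comp measurable_snd measurable_fst).
suff boxE (A : set (MX X)) (B : 'I_n -> set (borel X)) (C : set R) :
    measurable A -> (forall i, measurable (B i)) -> measurable C ->
    L1 (fun p => (\1_(box B) p.1.2)%:E * ((\1_C p.1.1)%:E * (\1_A p.2)%:E)) =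
    L2 (fun p => (\1_(box B) p.1.2)%:E * ((\1_C p.1.1)%:E * (\1_A p.2)%:E)).
  apply: (ifun_unique_prod hL1 hL2); first by apply: L1oo => //; exact: nnmeas_cst.
  move=> D A mD mA.
  have nA := nind _ _ _ _ A snd mA (@measurable_snd _ _ S (MX X)).
  have aux (L : (S * MX X -> \bar R) -> \bar R) : integral_functional L ->
      integral_functional (fun f : S -> \bar R => L (fun p => f p.1 * (\1_A p.2)%:E)).
    by move=> hL; exact: (ifun_comp (ifun_density hL nA) measurable_fst).
  apply: (ifun_unique_prod (aux _ hL1) (aux _ hL2) _ _ (nnmeas_indic R mD)).
    apply: L1oo; first by apply: nnmeasM => //; exact: nnmeas_cst.
    by move=> p; rewrite mul1e; exact: ind1.
  move=> C D' mC mD'.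
  have nC := nind _ _ _ _ C _ mC mfst1.
  have aux2 (L : (S * MX X -> \bar R) -> \bar R) : integral_functional L ->
      integral_functional (fun f : n.-tuple (borel X) -> \bar R =>
        L (fun p => f p.1.2 * ((\1_C p.1.1)%:E * (\1_A p.2)%:E))).
    by move=> hL; exact: (ifun_comp (ifun_density hL (nnmeasM nC nA)) mfst2).
  have := ifun_unique_box (aux2 _ hL1) (aux2 _ hL2) _ _ (nnmeas_indic R mD').
  have eD (L : (S * MX X -> \bar R) -> \bar R) :
      L (fun p => (\1_D' p.1.2)%:E * ((\1_C p.1.1)%:E * (\1_A p.2)%:E)) =
      L (fun p => (\1_C p.1.1)%:E * (\1_D' p.1.2)%:E * (\1_A p.2)%:E).
    by congr L; apply/funext => p; rewrite muleCA muleA.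
  rewrite !eD; apply.
    apply: L1oo; first by apply: nnmeasM; [exact: nnmeas_cst|exact: nnmeasM].
    move=> p; rewrite mul1e -[leRHS]mule1.
    by apply: lee_pmul; rewrite ?ind1// lee_fin indicE.
  by move=> B mB; exact: boxE.
move=> mA mB mC.
have mbox := measurable_box mB.
pose I (m : MX X) := \int[leb R]_u ((\1_C u)%:E *
    ((latent_power u)%:E * enexp ((gamma + u)%:E * m setT))).
have nprod : nnmeas (fun m : MX X => \prod_(i < n) m (B i)).
  by apply: nnmeas_prod => i; split => //; exact: measurable_eval.
have npn : nnmeas (fun m : MX X => \prod_(i < n) normalize m (B i)).
  apply: nnmeas_prod => i; split => //.
  have -> : (fun m : MX X => normalize m (B i)) =
    (fun m => ((total_mass m) `^ (-1))%:E * m (B i)).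
    by apply/funext => m; rewrite normalizeE powR_inv1// fine_ge0.
  apply: emeasurable_funM; last exact: measurable_eval.
  apply/measurable_EFinP.
  exact: (measurableT_comp (measurable_powR _) measurable_total_mass).
have nA := nnmeas_indic R mA.
have ngl := gamma_law_nnmeas mC.
transitivity (\int[P]_w ((\1_A (mut w))%:E * ((\prod_(i < n) normalize (mut w) (B i)) *
    gamma_law (n%:R + q) (total_mass (mut w)) C))).
  have mpreA : measurable (mut @^-1` A) by rewrite -[X in measurable X]setTI; exact: mmut.
  have mpreB : measurable (Xs @^-1` box B) by rewrite -[X in measurable X]setTI; exact: mXs.
  have mpreC : measurable (U @^-1` C) by rewrite -[X in measurable X]setTI; exact: mU.
  rewrite (integral_indicM P (fun w => (\prod_(i < n) normalize (mut w) (B i)) *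
    gamma_law (n%:R + q) (total_mass (mut w)) C) mpreA).
  rewrite -(XsU mA mB mC) -integral_indicT; last first.
    by apply: measurableI => //; exact: measurableI.
  apply: eq_integral => w _; rewrite -!EFinM; congr EFin.
  rewrite !indicI /= !indicE /=.
  rewrite -[w \in mut @^-1` A]/(mut w \in A) -[w \in U @^-1` C]/(U w \in C).
  rewrite -[w \in [set _ | _]]/(Xs w \in box B).
  by move: (Xs w \in box B) (U w \in C) (mut w \in A) => a b c; ring.
rewrite (tiltE (fun m => (\1_A m)%:E * ((\prod_(i < n) normalize m (B i)) *
    gamma_law (n%:R + q) (total_mass m) C))); last first.
  by apply: nnmeasM => //; exact: nnmeasM.
rewrite /L2 -muleA; congr (k * _).
have nI : nnmeas I.
  have nH : nnmeas (fun p : MX X * R => (\1_C p.2)%:E *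
      ((latent_power p.2)%:E * enexp ((gamma + p.2)%:E * p.1 setT))).
    apply: nnmeasM; first exact: nind.
    apply: nnmeasM.
      have [g0 mg] := nnmeas_latent_power; split; first by move=> p; exact: g0.
      exact: (measurableT_comp mg measurable_snd).
    apply: (@nnmeas_damp _ _ (fun p : MX X * R => gamma + p.2)%R fst) => //.
    exact: measurable_funD.
  case: nH => g0 mg; split; first by move=> m; apply: integral_ge0 => u _; exact: (g0 (m, u)).
  exact: (@measurable_fun_fubini_tonelli_F _ _ _ _ _ (leb R) _ mg g0).
transitivity (\int[P0]_w (G%:E * ((\1_A (mu w))%:E * ((\prod_(i < n) mu w (B i)) * I (mu w))))).
  have n1 : nnmeas (fun w => (\1_A (mu w))%:E * ((\prod_(i < n) normalize (mu w) (B i)) *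
      gamma_law (n%:R + q) (total_mass (mu w)) C) * (h (total_mass (mu w)))%:E).
    apply: (nnmeas_RV (F := fun m => (\1_A m)%:E * ((\prod_(i < n) normalize m (B i)) *
      gamma_law (n%:R + q) (total_mass m) C) * (h (total_mass m))%:E)).
    by apply: nnmeasM => //; apply: nnmeasM => //; exact: nnmeasM.
  have n2 : nnmeas (fun w => G%:E * ((\1_A (mu w))%:E *
      ((\prod_(i < n) mu w (B i)) * I (mu w)))).
    apply: (nnmeas_RV (F := fun m => G%:E * ((\1_A m)%:E *
      ((\prod_(i < n) m (B i)) * I m)))).
    apply: nnmeasM; first by apply: nnmeas_cst; rewrite lee_fin.
    by apply: nnmeasM => //; exact: nnmeasM.
  apply: ge0_ae_eq_integral => //; [by case: n1|by case: n2|by move=> w _; case: n1|by move=> w _; case: n2|].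
  apply: filterS mu_total => w hw _.
  by rewrite -muleA cancel_total_mass// muleCA.
rewrite (ifunZ (ifun_integral P0) G0); last first.
  apply: (nnmeas_RV (F := fun m => (\1_A m)%:E * ((\prod_(i < n) m (B i)) * I m))).
  by apply: nnmeasM => //; exact: nnmeasM.
congr (G%:E * _).
pose H (p : Om0 * R) := (\1_C p.2)%:E * ((latent_power p.2)%:E *
  (((\1_A (mu p.1))%:E * enexp ((gamma + p.2)%:E * mu p.1 setT)) *
    \prod_(i < n) mu p.1 (B i))).
have nH : nnmeas H.
  apply: nnmeasM; first exact: nind.
  apply: nnmeasM.
    have [g0 mg] := nnmeas_latent_power; split; first by move=> p; exact: g0.
    exact: (measurableT_comp mg measurable_snd).
  have mmu1 : measurable_fun setT (fun p : Om0 * R => mu p.1).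
    exact: (measurableT_comp mmu measurable_fst).
  apply: nnmeasM; first apply: nnmeasM.
  - exact: nind.
  - apply: (@nnmeas_damp _ _ (fun p : Om0 * R => gamma + p.2)%R (fun p => mu p.1)) => //.
    exact: measurable_funD.
  - case: nprod => g0 mg; split; first by move=> p; exact: (g0 (mu p.1)).
    have -> : (fun p : Om0 * R => \prod_(i < n) mu p.1 (B i)) =
      (fun m : MX X => \prod_(i < n) m (B i)) \o (fun p => mu p.1) by [].
    exact: (measurableT_comp mg mmu1).
transitivity (\int[P0]_w \int[leb R]_u H (w, u)).
  apply: eq_integral => w _; rewrite muleA /I muleC.
  rewrite -(ifunZr (ifun_integral (leb R))); last 2 first.
  - by rewrite mule_ge0 ?lee_fin ?indicE//; apply: prode_ge0.
  - apply: nnmeasM; first exact: nnmeas_indic.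
    apply: nnmeasM; first exact: nnmeas_latent_power.
    by apply: (@nnmeas_damp _ _ (fun u => gamma + u)%R (fun=> mu w)) => //; exact: measurable_funD.
  apply: eq_integral => u _; rewrite /H /= -!muleA; congr (_ * (_ * _)).
  by rewrite muleCA.
have [H0 mH] := nH.
transitivity (\int[leb R]_u \int[P0]_w H (w, u)).
  exact: (@fubini_tonelli _ _ _ _ _ P0 (leb R) H mH H0).
apply: eq_integral => u _.
have nAe : nnmeas (fun m : MX X => (\1_A m)%:E * enexp ((gamma + u)%:E * m setT)).
  by apply: nnmeasM => //; apply: (@nnmeas_damp _ _ (fun=> gamma + u)%R id).
have nAeB : nnmeas (fun w => ((\1_A (mu w))%:E * enexp ((gamma + u)%:E * mu w setT)) *
    \prod_(i < n) mu w (B i)).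
  exact: (nnmeas_RV (nnmeasM nAe nprod)).
have i0 : (0 <= \1_C u * latent_power u)%R.
  by rewrite mulr_ge0 ?latent_power_ge0// indicE.
transitivity ((\1_C u * latent_power u)%:E * \int[P0]_w (((\1_A (mu w))%:E *
    enexp ((gamma + u)%:E * mu w setT)) * \prod_(i < n) mu w (B i))).
  rewrite -(ifunZ (ifun_integral P0) i0 nAeB).
  by apply: eq_integral => w _; rewrite /H /= EFinM muleA.
rewrite (lamE _ B nAe mB).
have npm : nnmeas (fun x : n.-tuple (borel X) => palm_mean P0 mu rho x (fun m => (\1_A m)%:E *
    enexp ((gamma + u)%:E * m setT))).
  apply: (palm_mean_joint sepX P0 mmu rho (x := id) (F := fun p : n.-tuple (borel X) * MX X =>
    (\1_A p.2)%:E * enexp ((gamma + u)%:E * p.2 setT))) => //.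
  by case: nAe => g0 mg; split => //; exact: (measurableT_comp mg measurable_snd).
have nbp : nnmeas (fun x : n.-tuple (borel X) => (\prod_(i < n) (\1_(B i) (tnth x i))%:E) *
    palm_mean P0 mu rho x (fun m => (\1_A m)%:E * enexp ((gamma + u)%:E * m setT))).
  apply: nnmeasM => //; apply: nnmeas_prod => i.
  by apply: (nind _ _ _ _ (B i) (fun x : n.-tuple (borel X) => tnth x i)) => //; exact: measurable_tnth.
rewrite -(ifunZ (ifun_integral lam) i0 nbp); apply: eq_integral => x _.
rewrite /posterior -indic_box /=.
have e : (\1_(box B) x * \1_C u)%:E * palm_mean P0 mu rho x (fun m => (\1_A m)%:E *
    enexp ((gamma + u)%:E * m setT)) = palm_mean P0 mu rho x (fun m =>
    (\1_(box B) x)%:E * ((\1_C u)%:E * (\1_A m)%:E) * enexp ((gamma + u)%:E * m setT)).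
  have j0 : (0 <= \1_(box B) x * \1_C u :> R)%R by rewrite !indicE mulr_ge0.
  rewrite -(ifunZ (palm_mean_ifun sepX P0 mmu rho x) j0 nAe).
  by congr (palm_mean _ _ _ _ _); apply/funext => m; rewrite EFinM !muleA.
rewrite -e muleA [RHS]muleA -!EFinM; congr (_%:E * _).
by move: (\1_C u) (\1_(box B) x) (latent_power u) => a b c; ring.
Qed.

End joint_law.

(** * The posterior completely random measure *)

Section probability_tools.
Context (R : realType).

Lemma ifun_probability d (T : measurableType d) (L : (T -> \bar R) -> \bar R) :
  integral_functional L -> L (fun=> 1) = 1 ->
  exists P : probability T R, forall f, nnmeas f -> \int[P]_x f x = L f.
Proof.
move=> hL L1; have [m mE] := ifun_measure hL.
have m1 : m setT = 1.
  by rewrite -L1 -mE ?integral_cst ?mul1e//; exact: nnmeas_cst.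
exists (mnormalize m (@dirac _ T point R)) => f nf; rewrite -mE//.
apply: ge0_integral_unique => A mA.
by rewrite /= /mnormalize m1 eqe oner_eq0/= invr1 mule1.
Qed.

Lemma random_variable_of d d' (T : measurableType d) (T' : measurableType d')
    (P : probability T R) (f : T -> T') : measurable_fun setT f ->
  exists X : {RV P >-> T'}, X = f :> (T -> T').
Proof. by move=> mf; exists (mfun_Sub (mem_set mf)). Qed.

Lemma prode_pos_fin (I : eqType) (s : seq I) (f : I -> \bar R) :
  (forall i, 0 <= f i) -> 0 < \prod_(i <- s) f i < +oo ->
  forall i, i \in s -> 0 < f i < +oo.
Proof.
move=> f0; elim: s => [//|i s ih]; rewrite big_cons => /andP[h0 hoo].
have P0 : 0 <= \prod_(j <- s) f j by apply: prode_ge0.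
have fi0 : 0 < f i.
  by rewrite lt_neqAle f0 andbT; apply/eqP => e; move: h0; rewrite -e mul0e ltxx.
have Ps0 : 0 < \prod_(j <- s) f j.
  by rewrite lt_neqAle P0 andbT; apply/eqP => e; move: h0; rewrite -e mule0 ltxx.
have fioo : f i < +oo.
  by rewrite ltey; apply/eqP => e; move: hoo; rewrite e gt0_mulye// ltxx.
have Psoo : \prod_(j <- s) f j < +oo.
  by rewrite ltey; apply/eqP => e; move: hoo; rewrite e gt0_muley// ltxx.
move=> j; rewrite in_cons => /orP[/eqP ->|]; first by rewrite fi0.
by apply: ih; rewrite Ps0.
Qed.

Lemma sum_zip_tnth (I : Type) (ys : seq I) (s : (size ys).-tuple R)
    (f : I -> R -> \bar R) :
  \sum_(p <- zip ys s) f p.1 p.2 =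
  \sum_(k < size ys) f (tnth (in_tuple ys) k) (tnth s k).
Proof.
elim: ys s => [|y ys ih] s; first by rewrite tuple0 /= big_nil big_ord0.
rewrite {1}(tuple_eta s) /= big_cons big_ord_recl; congr (_ + _).
have := ih [tuple of behead s] => /= ->; apply: eq_bigr => k _.
by congr (f _ _); [rewrite !(tnth_nth y)|rewrite !(tnth_nth point) /= nth_behead].
Qed.

(** A point belongs to at most one of the disjoint sets. *)
Lemma disjoint_indic (T : Type) (k : nat) (C : 'I_k -> set T) x :
  trivIset setT C ->
  (forall i, \1_(C i) x = 0%R :> R) \/
  exists i, forall j, j != i -> \1_(C j) x = 0%R :> R.
Proof.
move=> tC; have [[i Ci]|nC] := pselect (exists i, C i x); last first.
  by left => i; rewrite indicE memNset// => Ci; apply: nC; exists i.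
right; exists i => j ji; rewrite indicE memNset// => Cj.
by move/negP : ji; apply; apply/eqP; apply: tC => //; exists x.
Qed.

End probability_tools.

Section posterior_mass.
Context (R : realType) (X : completeMetricType R).
Local Notation E := (borel X * R)%type.
Hypothesis sepX : separable X.
Variables (rho : R.-ker (borel X) ~> R) (nu : {measure set E -> \bar R}).
Hypothesis nu_diffuse : forall x : borel X, nu ([set x] `*` `]0%R, +oo[) = 0.
Context d0 (Om0 : measurableType d0) (P0 : probability Om0 R).
Variables (mu : {RV P0 >-> MX X}) (N : R.-ker Om0 ~> E).
Hypothesis hN : is_poisson_random_measure P0 N nu.
Hypothesis hmu : {ae P0, forall w, forall A : set (borel X), measurable A ->
  mu w A = \int[N w]_(z in A `*` `]0%R, +oo[) (z.2)%:E}.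
Hypothesis mu_fin : {ae P0, forall w, mu w setT < +oo}.
Variables (q gamma : R) (n : nat).
Hypothesis gamma_ge0 : (0 <= gamma)%R.

Let mmu : measurable_fun setT mu. Proof. exact: measurable_funP. Qed.

(** By Mecke's formula the mean mass of a point is the integral of the jumps
    over a set that [nu] does not charge. *)
Lemma no_fixed_atom (y : borel X) : {ae P0, forall w, mu w [set y] = 0}.
Proof.
have my := measurable_point sepX y.
have h := crm_mecke sepX mmu hN hmu mu_fin (nnmeas_cst (MX X) (@lee01 R)) my.
have h0 : \int[P0]_w mu w [set y] = 0.
  transitivity (\int[P0]_w (1 * mu w [set y])).
    by apply: eq_integral => w _; rewrite mul1e.
  rewrite h; under eq_integral do rewrite integral_prob_cst mule1.
  rewrite -jump_integral//; apply: null_set_integral => //.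
    exact: measurableX.
  apply/measurable_EFinP; apply: measurable_funTS; exact: measurable_snd.
have nm : nnmeas (fun w => mu w [set y]).
  exact: (nnmeas_mu mmu (nnmeas_ev (exist _ [set y] my))).
have := @ae_eq_integral_abs _ Om0 R P0 setT measurableT _ nm.2.
move=> [+ _]; under eq_integral do rewrite gee0_abs//.
by move=> /(_ h0); apply: filterS => w; apply.
Qed.

Lemma no_fixed_atoms (x : seq (borel X)) :
  {ae P0, forall w, forall y, y \in x -> mu w [set y] = 0}.
Proof.
elim: x => [|y x ih]; first exact: aeW.
apply: filterS2 (no_fixed_atom y) ih => w hy hx z.
by rewrite in_cons => /orP[/eqP ->//|]; exact: hx.
Qed.

Variables (u : R) (x : n.-tuple (borel X)).
Hypothesis u_gt0 : (0 < u)%R.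

Let b : R := (gamma + u)%R.
Let b_ge0 : (0 <= b)%R. Proof. by rewrite addr_ge0// ltW. Qed.
Let K (y : borel X) := jump_int rho b (count_mem y x) y.
Let hK y : tonelli_functional (K y). Proof. exact: jump_int_tonelli. Qed.

(** Almost surely [mu] has no atom at the observed values, which is the case
    treated by [palm_eval]. *)
Lemma posterior_eval F : nnmeas F ->
  posterior rho mu q gamma (u, x) F = (latent_power q n u)%:E *
  \int[P0]_w (enexp (b%:E * mu w setT) *
    prod_fun K (undup x) (fun s => F (add_atoms (mu w) (undup x) s))).
Proof.
move=> nF; rewrite /posterior /palm_mean /=; congr (_ * _).
have nd : nnmeas (fun m : MX X => enexp (b%:E * m setT)).
  apply: nnmeas_enexp; apply: measurable_funeM; exact: measurable_eval.
have n1 : nnmeas (fun w => palm rho x (fun m => F m * enexp (b%:E * m setT)) (mu w)).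
  apply: (@palm_joint _ _ sepX rho _ _ Om0 (fun=> x) mu
    (fun p => F p.2 * enexp (b%:E * p.2 setT))) => //.
  case: (nnmeasM nF nd) => h mh; split => //.
  exact: (measurableT_comp mh measurable_snd).
have n2 : nnmeas (fun w => enexp (b%:E * mu w setT) *
    prod_fun K (undup x) (fun s => F (add_atoms (mu w) (undup x) s))).
  apply: nnmeasM; first exact: (nnmeas_mu mmu nd).
  apply: ((prod_fun_tonelli hK (undup x)).2 _ _
    (fun p : Om0 * (size (undup x)).-tuple R => F (add_atoms (mu p.1) (undup x) p.2))).
  case: nF => h mh; split => //; apply: (measurableT_comp mh).
  apply: measurable_add_atoms => //; exact: (measurableT_comp mmu).
apply: ge0_ae_eq_integral => //; [by case: n1|by case: n2|by move=> w _; case: n1|by move=> w _; case: n2|].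
apply: filterS (no_fixed_atoms x) => w hw _.
exact: palm_eval.
Qed.

(** The normalising constant of the law of the jump at [y]. *)
Definition cell_mass (y : borel X) : \bar R := K y (fun=> 1).

Lemma cell_mass_ge0 y : 0 <= cell_mass y.
Proof. by apply: (ifun_ge0 (hK y).1); apply: nnmeas_cst. Qed.

Lemma prod_fun_one ys : prod_fun K ys (fun=> 1) = \prod_(y <- ys) cell_mass y.
Proof.
elim: ys => [|y ys ih] /=; first by rewrite big_nil.
rewrite big_cons; transitivity (K y (fun=> 1 * \prod_(y0 <- ys) cell_mass y0)).
  by congr (K y _); apply/funext => t; rewrite mul1e -ih.
rewrite (ifunZr (hK y).1)//.
by apply: prode_ge0 => z _; exact: cell_mass_ge0.
Qed.

Lemma posterior_mass : posterior rho mu q gamma (u, x) (fun=> 1) =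
  (latent_power q n u)%:E * (enexp (exponent nu b) * \prod_(y <- undup x) cell_mass y).
Proof.
rewrite posterior_eval; last exact: nnmeas_cst.
rewrite prod_fun_one (ifunZr (ifun_integral P0)).
- by rewrite (total_laplace mmu hN hmu).
- by apply: prode_ge0 => z _; exact: cell_mass_ge0.
- have nd : nnmeas (fun m : MX X => enexp (b%:E * m setT)).
    apply: nnmeas_enexp; apply: measurable_funeM; exact: measurable_eval.
  exact: (nnmeas_mu mmu nd).
Qed.

End posterior_mass.

Section fixed_atoms.
Context (R : realType) (X : completeMetricType R).
Local Notation E := (borel X * R)%type.
Context d (Om : measurableType d) (P : probability Om R).
Variables (mu : Om -> MX X) (N : R.-ker Om ~> E) (nu : {measure set E -> \bar R}).
Hypothesis mmu : measurable_fun setT mu.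
Hypothesis hN : is_poisson_random_measure P N nu.
Hypothesis hmu : {ae P, forall w, forall A : set (borel X), measurable A ->
  mu w A = \int[N w]_(z in A `*` `]0%R, +oo[) (z.2)%:E}.
Variables (K : borel X -> (R -> \bar R) -> \bar R) (ys : seq (borel X)).
Hypothesis hK : forall y, tonelli_functional (K y).
Hypothesis K1 : forall y, y \in ys -> K y (fun=> 1) = 1.
Local Notation J := ((size ys).-tuple R).

Let y_ (k : 'I_(size ys)) : borel X := tnth (in_tuple ys) k.

Let K1k k : K (y_ k) (fun=> 1) = 1.
Proof. by apply: K1; exact: (mem_tnth k (in_tuple ys)). Qed.

Lemma nnmeas_comp d1 d2 (T1 : measurableType d1) (T2 : measurableType d2)
    (f : T2 -> \bar R) (phi : T1 -> T2) :
  nnmeas f -> measurable_fun setT phi -> nnmeas (fun t => f (phi t)).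
Proof.
by move=> [f0 mf] mphi; split => //; exact: (measurableT_comp mf mphi).
Qed.

Let nprod (f : 'I_(size ys) -> R -> \bar R) : (forall k, nnmeas (f k)) ->
  nnmeas (fun s : J => \prod_(k < size ys) f k (tnth s k)).
Proof.
move=> nf; apply: nnmeas_prod => k.
by apply: nnmeas_comp => //; exact: measurable_tnth.
Qed.

Let hprod := prod_fun_tonelli hK ys.

Let prod1 : prod_fun K ys (fun=> 1) = 1.
Proof.
have := prod_fun_prod hK (ys := ys) (f := fun _ _ => 1) (fun=> nnmeas_cst _ (@lee01 R)).
under [X in _ = X -> _]eq_bigr do rewrite K1k.
by rewrite !big1_eq.
Qed.

(** The jumps at the points of [ys] are adjoined to the probability space as
    independent coordinates. *)
Lemma adjoin_jumps : exists P1 : probability (Om * J)%type R,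
  forall H, nnmeas H -> \int[P1]_p H p = \int[P]_w prod_fun K ys (fun s => H (w, s)).
Proof.
apply: (ifun_probability (L := fun H : Om * J -> \bar R =>
    \int[P]_w prod_fun K ys (fun s => H (w, s)))).
- apply: (@ifun_bind R _ _ Om (Om * J)%type (fun f => \int[P]_w f w)
    (fun w H => prod_fun K ys (fun s => H (w, s)))).
  + exact: ifun_integral.
  + by move=> w; apply: (ifun_comp hprod.1); exact: measurable_pair1.
  + by move=> H nH; case: (hprod.2 _ _ _ nH).
- by rewrite prod1 integral_prob_cst.
Qed.

Variable P1 : probability (Om * J)%type R.
Hypothesis P1E : forall H, nnmeas H ->
  \int[P1]_p H p = \int[P]_w prod_fun K ys (fun s => H (w, s)).

Lemma integral_jumps (g : Om -> \bar R) (f : 'I_(size ys) -> R -> \bar R) :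
  nnmeas g -> (forall k, nnmeas (f k)) ->
  \int[P1]_p (g p.1 * \prod_(k < size ys) f k (tnth p.2 k)) =
  (\int[P]_w g w) * \prod_(k < size ys) K (y_ k) (f k).
Proof.
move=> ng nf; have nP := nprod nf.
have c0 : 0 <= \prod_(k < size ys) K (y_ k) (f k).
  by apply: prode_ge0 => k _; apply: (ifun_ge0 (hK _).1).
rewrite P1E; last first.
  by apply: nnmeasM; [exact: (nnmeas_comp ng measurable_fst)|
    exact: (nnmeas_comp nP measurable_snd)].
rewrite -(ifunZr (ifun_integral P) c0 ng); apply: eq_integral => w _ /=.
under eq_fun do rewrite muleC.
rewrite (ifunZr hprod.1)//; first by rewrite muleC (prod_fun_prod hK nf).
by case: ng.
Qed.

Lemma integral_base (g : Om -> \bar R) : nnmeas g -> \int[P1]_p g p.1 = \int[P]_w g w.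
Proof.
move=> ng; have := integral_jumps ng (f := fun _ _ => 1) (fun=> nnmeas_cst _ (@lee01 R)).
under [X in _ = _ * X]eq_bigr do rewrite K1k.
rewrite big1// mule1 => <-.
by apply: eq_integral => p _; rewrite mule1.
Qed.

Lemma integral_jump k (f : R -> \bar R) : nnmeas f ->
  \int[P1]_p f (tnth p.2 k) = K (y_ k) f.
Proof.
move=> nf; pose fk j := if j == k then f else fun=> 1.
have nfk j : nnmeas (fk j) by rewrite /fk; case: ifP => _ //; exact: nnmeas_cst.
have := integral_jumps (nnmeas_cst Om (@lee01 R)) nfk.
rewrite integral_prob_cst mul1e (bigD1 k)//= [X in _ = _ * X]big1 ?mule1; last first.
  by move=> j jk; rewrite /fk (negbTE jk) K1k.
rewrite {2}/fk eqxx => <-; apply: eq_integral => p _.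
rewrite mul1e (bigD1 k)//= [X in _ * X]big1 ?mule1; last first.
  by move=> j jk; rewrite /fk (negbTE jk).
by rewrite /fk eqxx.
Qed.

Lemma ae_base (Q : Om -> Prop) : {ae P, forall w, Q w} -> {ae P1, forall p, Q p.1}.
Proof.
move=> [B [mB B0 QB]]; exists (B `*` setT); split.
- exact: measurableX.
- rewrite -integral_indicT; last exact: measurableX.
  rewrite -B0 -[RHS]integral_indicT// -(integral_base (nnmeas_indic R mB)).
  by apply: eq_integral => p _; rewrite !indicE in_setX [_ \in setT]mem_set ?andbT.
- by move=> p /= np; split => //; exact: QB.
Qed.

Lemma base_intensity (m : {RV P1 >-> MX X}) : m = (fun p => mu p.1) :> (_ -> _) ->
  is_CRM_with_intensity m nu.
Proof.
move=> mE.
have hL (p : Om * J) : integral_functional (fun f : E -> \bar R => \int[N p.1]_z f z).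
  exact: ifun_integral.
have mL (B : set E) : measurable B ->
    measurable_fun setT (fun p : Om * J => \int[N p.1]_z (\1_B z)%:E).
  move=> mB; have [_ mN] := nnmeas_kernel_integral N (nnmeas_indic R mB).
  exact: (measurableT_comp mN measurable_fst).
exists (functional_kernel hL mL).
have NE p f : \int[functional_kernel hL mL p]_z f z = \int[N p.1]_z f z.
  apply: ge0_integral_unique => A mA; rewrite /functional_kernel /=.
  rewrite -integral_indicT// functional_measureE ?integral_indicT//; exact: nnmeas_indic.
split.
  apply: prm_of_laplace => f nf.
  rewrite -(prm_laplace hN nf) -(integral_base (g := fun w => enexp (\int[N w]_z f z))).
    by apply: eq_integral => p _; rewrite NE.
  by apply: nnmeas_enexp; case: (nnmeas_kernel_integral N nf).
apply: filterS (ae_base hmu) => p h A mA; rewrite mE h//.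
rewrite !jump_integral//; exact: esym (NE _ _).
Qed.

Lemma jumps_independent (m : {RV P1 >-> MX X}) (Jk : 'I_(size ys) -> {RV P1 >-> R}) :
  m = (fun p => mu p.1) :> (_ -> _) ->
  (forall k, Jk k = (fun p => Num.max (tnth p.2 k) 0%R) :> (_ -> _)) ->
  mutually_independent P1 (fun i : option 'I_(size ys) =>
    if i is Some k then sigma_of (Jk k) else sigma_of m).
Proof.
move=> mE JE F hF.
have [A mA AE] := hF None; rewrite setTI in AE.
have /choice[B hB] : forall k, exists B : set R, measurable B /\ Jk k @^-1` B = F (Some k).
  by move=> k; have [B mB BE] := hF (Some k); exists B; split => //; rewrite -BE setTI.
have mB k : measurable (B k) by case: (hB k).
have mmax : measurable_fun setT (fun t : R => Num.max t 0%R) by exact: measurable_maxr.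
have mF i : measurable (F i).
  case: i => [k|]; last by rewrite -AE -[X in measurable X]setTI; exact: measurable_funP.
  by case: (hB k) => _ <-; rewrite -[X in measurable X]setTI; exact: measurable_funP.
pose f k (t : R) : \bar R := (\1_(B k) (Num.max t 0%R))%:E.
have nf k : nnmeas (f k) by exact: (nnmeas_comp (nnmeas_indic R (mB k)) mmax).
pose g (w : Om) : \bar R := (\1_A (mu w))%:E.
have ng : nnmeas g by exact: (nnmeas_comp (nnmeas_indic R mA) mmu).
have FN p : (\1_(F None) p)%:E = g p.1.
  by rewrite /g -AE !indicE -[p \in m @^-1` A]/(m p \in A) mE.
have FS k p : (\1_(F (Some k)) p)%:E = f k (tnth p.2 k).
  by rewrite /f; case: (hB k) => _ <-; rewrite !indicE -[p \in Jk k @^-1` B k]/(Jk k p \in B k) JE.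
have PN : P1 (F None) = \int[P]_w g w.
  by rewrite -integral_indicT// -integral_base//; apply: eq_integral => p _; rewrite FN.
have PS k : P1 (F (Some k)) = K (y_ k) (f k).
  by rewrite -integral_indicT// -integral_jump//; apply: eq_integral => p _; rewrite FS.
have bigopt (h : option 'I_(size ys) -> \bar R) :
    \prod_i h i = h None * \prod_(k < size ys) h (Some k).
  rewrite (bigD1 None)//=; congr (_ * _).
  rewrite (reindex_omap (fun k => Some k) id)/=; last by case.
  by apply: eq_bigl => k; rewrite eqxx.
rewrite bigopt PN; under [X in _ = _ * X]eq_bigr do rewrite PS.
rewrite -integral_jumps// -integral_indicT; last exact: fin_bigcap_measurable.
apply: eq_integral => p _; rewrite indic_bigcap bigopt FN; congr (_ * _).
by apply: eq_bigr => k _; rewrite FS.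
Qed.

Let nnmeas_enexpjump (a : R) k : (0 <= a)%R ->
  nnmeas (fun t : R => enexp (a%:E * @jump R X (y_ k, t))).
Proof.
move=> a0; apply: nnmeas_enexp; apply: measurable_funeM.
exact: (measurableT_comp (nnmeas_jump X).2 (measurable_pair1 (y_ k))).
Qed.

Let atoms_laplace (I : finType) (A : I -> set (borel X)) (t : I -> R) :
  (forall i, measurable (A i)) -> (forall i, (0 <= t i)%R) ->
  \int[P1]_p \prod_i enexp ((t i)%:E * add_atoms (mu p.1) ys p.2 (A i)) =
  (\int[P]_w \prod_i enexp ((t i)%:E * mu w (A i))) *
  \prod_(k < size ys)
    K (y_ k) (fun s => \prod_i enexp ((t i * \1_(A i) (y_ k))%:E * @jump R X (y_ k, s))).
Proof.
move=> mA t0.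
have ti0 i k : (0 <= t i * \1_(A i) (y_ k))%R by rewrite mulr_ge0// indicE.
rewrite -integral_jumps; last 2 first.
- apply: nnmeas_prod => i; apply: nnmeas_enexp; apply: measurable_funeM.
  exact: (measurableT_comp (measurable_eval (mA i)) mmu).
- by move=> k; apply: nnmeas_prod => i; exact: nnmeas_enexpjump.
apply: eq_integral => p _; rewrite exchange_big -big_split /=; apply: eq_bigr => i _.
rewrite add_atomsE ?size_tuple//.
rewrite (sum_zip_tnth p.2 (fun y s => (\1_(A i) y)%:E * @jump R X (y, s))).
rewrite ge0_muleDr//; last first.
  by apply: sume_ge0 => k _; rewrite mule_ge0 ?jump_ge0// lee_fin indicE.
have s0 k : 0 <= (\1_(A i) (y_ k))%:E * @jump R X (y_ k, tnth p.2 k).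
  by rewrite mule_ge0 ?jump_ge0// lee_fin indicE.
rewrite ge0_sume_distrr// enexpD; last 2 first.
- by rewrite mule_ge0// lee_fin.
- by apply: sume_ge0 => k _; rewrite mule_ge0// lee_fin.
congr (_ * _); rewrite enexp_sum; last by move=> k; rewrite mule_ge0// lee_fin.
by apply: eq_bigr => k _; rewrite EFinM muleA.
Qed.

(** Over disjoint sets the exponent of the Laplace functional is additive. *)
Let base_laplace k (A : 'I_k -> set (borel X)) (t : 'I_k -> R) :
  (forall i, measurable (A i)) -> trivIset setT A -> (forall i, (0 <= t i)%R) ->
  \int[P]_w \prod_(i < k) enexp ((t i)%:E * mu w (A i)) =
  \prod_(i < k) \int[P]_w enexp ((t i)%:E * mu w (A i)).
Proof.
move=> mA tA t0.
pose a i : msets X := exist _ (A i) (mA i).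
pose s := [seq (t i, a i) | i <- enum 'I_k].
have s0 : nneg_coefs s.
  move=> p; rewrite /s => /List.in_map_iff[i [<- _]]; exact: t0.
have s10 i : nneg_coefs [:: (t i, a i)] by move=> p /= [<-|[]]; exact: t0.
have linE (m : MX X) : lin (@ev R X) s m = \sum_(i < k) (t i)%:E * m (A i).
  by rewrite /lin big_map big_enum.
have nj : nnmeas (@jump R X) by exact: nnmeas_jump.
transitivity (\int[P]_w enexp (lin (@ev R X) s (mu w))).
  apply: eq_integral => w _; rewrite linE enexp_sum// => i.
  by rewrite mule_ge0// lee_fin.
have e1 i : \int[P]_w enexp ((t i)%:E * mu w (A i)) =
    enexp (\int[nu]_z (1 - enexp ((t i)%:E * (\1_(A i) z.1)%:E * @jump R X z))).
  transitivity (\int[P]_w enexp (lin (@ev R X) [:: (t i, a i)] (mu w))).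
    by apply: eq_integral => w _; rewrite /lin big_seq1.
  rewrite (crm_laplace mmu hN hmu (s10 i)); congr enexp.
  by apply: eq_integral => z _; rewrite /linf big_seq1.
under eq_bigr do rewrite e1.
rewrite (crm_laplace mmu hN hmu s0).
have nA i : nnmeas (fun z : E => 1 - enexp ((t i)%:E * (\1_(A i) z.1)%:E * @jump R X z)).
  apply: nnmeas_1enexp; apply: nnmeasM => //; apply: nnmeasM.
    by apply: nnmeas_cst; rewrite lee_fin.
  exact: (nnmeas_comp (nnmeas_indic R (mA i)) measurable_fst).
rewrite -enexp_sum; last by move=> i; apply: (ifun_ge0 (ifun_integral nu)).
rewrite -(ifun_sum (ifun_integral nu))//; congr enexp; apply: eq_integral => z _.
have lE : linf s z.1 = \sum_(i < k) (t i)%:E * (\1_(A i) z.1)%:E.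
  by rewrite /linf big_map big_enum.
rewrite lE; have [z0|[i zi]] := disjoint_indic R z.1 tA.
  have z0e i : (t i)%:E * (\1_(A i) z.1)%:E = 0 by rewrite z0 mule0.
  by rewrite !big1 ?mul0e ?enexp0 ?subee// => i _; rewrite z0e ?mul0e ?enexp0 ?subee.
have zie j : j != i -> (t j)%:E * (\1_(A j) z.1)%:E = 0.
  by move=> ji; rewrite zi// mule0.
rewrite (bigD1 i)// [X in (_ + X) * _]big1 ?adde0//.
by rewrite [RHS](bigD1 i)// [X in _ = _ + X]big1 ?adde0// => j ji; rewrite zie// mul0e enexp0 subee.
Qed.

(** Independence over disjoint sets is inherited from the part without fixed
    atoms, because every fixed atom lies in at most one of the sets. *)
Lemma atoms_CRM (m : {RV P1 >-> MX X}) :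
  m = (fun p => add_atoms (mu p.1) ys p.2) :> (_ -> _) -> is_CRM m.
Proof.
move=> mE k A mA _ tA.
have mm : measurable_fun setT m by exact: measurable_funP.
apply: indep_of_laplace.
  by move=> i; split => //; exact: (measurableT_comp (measurable_eval (mA i)) mm).
move=> t t0; rewrite mE (atoms_laplace mA t0) (base_laplace mA tA t0).
have e1 i : \int[P1]_p enexp ((t i)%:E * add_atoms (mu p.1) ys p.2 (A i)) =
    (\int[P]_w enexp ((t i)%:E * mu w (A i))) * \prod_(l < size ys)
      K (y_ l) (fun s => enexp ((t i * \1_(A i) (y_ l))%:E * @jump R X (y_ l, s))).
  have := atoms_laplace (I := 'I_1) (fun=> mA i) (fun=> t0 i).
  under [X in X = _ -> _]eq_integral do rewrite big_ord1.
  under [X in _ = X * _ -> _]eq_integral do rewrite big_ord1.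
  move=> ->; congr (_ * _); apply: eq_bigr => l _; congr (K _ _).
  by apply/funext => s; rewrite big_ord1.
under [RHS]eq_bigr do rewrite e1.
rewrite big_split /= [X in _ = _ * X]exchange_big /=; congr (_ * _).
apply: eq_bigr => l _.
have [z0|[i zi]] := disjoint_indic R (y_ l) tA.
  have z0e s i : enexp ((t i * \1_(A i) (y_ l))%:E * @jump R X (y_ l, s)) = 1.
    by rewrite z0 mulr0 mul0e enexp0.
  rewrite [RHS]big1; last by move=> i _; under eq_fun do rewrite z0e; exact: K1k.
  by rewrite -[RHS](K1k l); congr (K _ _); apply/funext => s; rewrite big1.
have zie j s : j != i -> enexp ((t j * \1_(A j) (y_ l))%:E * @jump R X (y_ l, s)) = 1.
  by move=> ji; rewrite zi// mulr0 mul0e enexp0.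
rewrite [RHS](bigD1 i)// [X in _ = _ * X]big1 ?mule1; last first.
  move=> j ji; rewrite -[RHS](K1k l); congr (K _ _).
  by apply/funext => s; rewrite zie.
congr (K _ _); apply/funext => s; rewrite (bigD1 i)//=.
by rewrite big1 ?mule1// => j ji; exact: zie.
Qed.

End fixed_atoms.

Section tilting.
Context (R : realType) (X : completeMetricType R).
Local Notation E := (borel X * R)%type.
Context d0 (Om0 : measurableType d0) (P0 : probability Om0 R).
Variables (mu : Om0 -> MX X) (N : R.-ker Om0 ~> E) (nu : {measure set E -> \bar R}).
Hypothesis mmu : measurable_fun setT mu.
Hypothesis hN : is_poisson_random_measure P0 N nu.
Hypothesis hmu : {ae P0, forall w, forall A : set (borel X), measurable A ->
  mu w A = \int[N w]_(z in A `*` `]0%R, +oo[) (z.2)%:E}.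
Hypothesis mu_fin : {ae P0, forall w, mu w setT < +oo}.

Lemma expeR_enexp (x : \bar R) : x \is a fin_num -> expeR x * enexp x = 1.
Proof.
move=> /fineK <-; rewrite enexp_EFin; set r := fine x.
by rewrite (_ : expeR r%:E = (expR r)%:E)// -EFinM -expRD subrr expR0.
Qed.

(** The law with density proportional to [exp (- b m(X))], under which [N] has
    intensity [exp (- b s) nu(dx, ds)] by [tilted_poisson]. *)
Lemma tilted_CRM (b : R) : (0 <= b)%R ->
  exists (P' : probability Om0 R) (nuu : {measure set E -> \bar R}),
  [/\ forall f, nnmeas f -> \int[P']_w f w = expeR (exponent nu b) *
        \int[P0]_w (f w * enexp (b%:E * mu w setT)),
      is_poisson_random_measure P' N nuu,
      {ae P', forall w, forall A : set (borel X), measurable A ->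
        mu w A = \int[N w]_(z in A `*` `]0%R, +oo[) (z.2)%:E} &
      forall f, nnmeas f ->
        \int[nuu]_z f z = \int[nu]_z (f z * enexp (b%:E * jump z))].
Proof.
move=> b0.
have ef : exponent nu b \is a fin_num.
  by rewrite ge0_fin_numE ?exponent_ge0//; exact: exponent_fin mmu hN hmu mu_fin _ b0.
have nd : nnmeas (fun m : MX X => enexp (b%:E * m setT)).
  apply: nnmeas_enexp; apply: measurable_funeM; exact: measurable_eval.
have ndw := nnmeas_mu mmu nd.
have nj : nnmeas (fun z : E => enexp (b%:E * jump z)).
  apply: nnmeas_enexp; apply: measurable_funeM; exact: (nnmeas_jump X).2.
have [nuu [nuuE _]] := density_measure nu nj.
pose L (f : Om0 -> \bar R) := expeR (exponent nu b) *
  \int[P0]_w (f w * enexp (b%:E * mu w setT)).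
have hL : integral_functional L.
  exact: (ifunC (ifun_density (ifun_integral P0) ndw) (expeR_ge0 _)).
have L1 : L (fun=> 1) = 1.
  rewrite /L; under eq_integral do rewrite mul1e.
  by rewrite (total_laplace mmu hN hmu b0) expeR_enexp.
have [P' P'E] := ifun_probability hL L1.
exists P', nuu; split => //; first exact: (tilted_poisson mmu hN hmu mu_fin b0).
have [B [mB B0 QB]] := hmu; exists B; split => //.
rewrite -integral_indicT// P'E; last exact: nnmeas_indic.
rewrite /L integral_indicM// null_set_integral ?mule0//.
by apply: measurable_funTS; case: ndw.
Qed.

End tilting.

Section damped_disintegration.
Context (R : realType) (X : completeMetricType R).
Local Notation E := (borel X * R)%type.
Variables (eta : probability (borel X) R) (rho : R.-ker (borel X) ~> R)
  (nu nuu : {measure set E -> \bar R}).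
Hypothesis nuE : disintegrates nu eta (fun x => rho x).
Hypothesis rho_pos : forall x : borel X, rho x `]-oo, 0%R]%classic = 0.
Hypothesis nu_fin : exponent nu 1 < +oo.
Variable b : R.
Hypothesis nuuE : forall f, nnmeas f ->
  \int[nuu]_z f z = \int[nu]_z (f z * enexp (b%:E * jump z)).

Let I0 : set R := `]0%R, +oo[.
Let mI0 : measurable I0. Proof. exact: measurable_itv. Qed.

Let I0P (s : R) : s \in I0 = (0 < s)%R.
Proof.
by apply/idP/idP => [/set_mem|h]; [|apply/mem_set]; rewrite /I0 /= in_itv/= andbT.
Qed.

Let ae_pos x : {ae rho x, forall s, (0 < s)%R}.
Proof.
exists `]-oo, 0%R]%classic; split.
- exact: measurable_itv.
- exact: rho_pos.
- by move=> s /= /negP; rewrite -leNgt in_itv.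
Qed.

Let ae_nu_pos : {ae nu, forall z, (0 < z.2)%R}.
Proof.
exists (setT `*` `]-oo, 0%R]%classic); split.
- exact: measurableX.
- by rewrite nuE//; under eq_integral do rewrite rho_pos; rewrite integral0.
- by move=> z /= /negP; rewrite -leNgt in_itv.
Qed.

(** The nonpositive sizes are null, and for almost every [x] the integrals
    against [rho x] and [levy_int rho x] agree on the positive ones; so the
    claim is [levy_disintegration] for the damped indicator of a rectangle. *)
Lemma damped_disintegration : disintegrates nuu eta (exp_tilt rho b).
Proof.
move=> A B mA mB.
have mAB : measurable (A `*` B) by exact: measurableX.
have nj : nnmeas (fun z : E => enexp (b%:E * jump z)).
  apply: nnmeas_enexp; apply: measurable_funeM; exact: (nnmeas_jump X).2.
have nAB := nnmeas_indic R mAB.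
have mBI : measurable (B `&` I0) by exact: measurableI.
have nABI := nnmeas_indic R (measurableX mA mBI).
pose F (z : E) := (\1_(A `*` (B `&` I0)) z)%:E * enexp (b%:E * jump z).
have nF : nnmeas F by exact: nnmeasM.
transitivity (\int[nu]_z F z).
  rewrite -integral_indicT// nuuE//.
  have n1 := nnmeasM nAB nj.
  apply: ge0_ae_eq_integral => //; [by case: n1|by case: nF|by move=> w _; case: n1|by move=> w _; case: nF|].
  apply: filterS ae_nu_pos => -[x s] /= s0 _; rewrite /F; congr (_%:E * _).
  by rewrite !indicE !in_setX in_setI I0P s0 andbT.
have F0 z : (z.2 <= 0)%R -> F z = 0.
  move=> z0; rewrite /F indicE in_setX in_setI I0P ltNge z0 !andbF.
  by rewrite mul0e.
rewrite (levy_disintegration nuE nu_fin nF F0).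
have ne : nnmeas (fun s : R => (expR (- (b * s)))%:E).
  split; first by move=> s; rewrite lee_fin expR_ge0.
  have mb : measurable_fun setT (fun s : R => (- (b * s))%R).
    by apply: measurable_funN; exact: measurable_funM.
  by apply/measurable_EFinP; apply: measurableT_comp.
have nB := nnmeas_indic R mB.
pose T x := \int[rho x]_s ((\1_B s)%:E * (expR (- (b * s)))%:E).
have nT : nnmeas T.
  have nBe := nnmeasM nB ne; split; first by move=> x; apply: integral_ge0 => s _; case: nBe.
  apply: measurable_fun_integral_kernel; [|by case: nBe|by case: nBe].
  by move=> U mU; exact: measurable_kernel.
rewrite -(integral_indicM eta (exp_tilt rho b ^~ B) mA).
have n2 := nnmeasM (nnmeas_indic R mA) nT.
have TE x : exp_tilt rho b x B = T x by rewrite /exp_tilt -integral_indicM.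
under [RHS]eq_integral do rewrite TE.
have n1 : nnmeas (fun x => levy_int rho x (fun s => F (x, s))).
  exact: (@levy_int_joint _ _ _ rho _ _ id).
apply: ge0_ae_eq_integral => //; [by case: n1|by case: n2|by move=> w _; case: n1|by move=> w _; case: n2|].
apply: filterS (levy_mass_fin nuE nu_fin) => x xfin _.
rewrite levy_intE// -(integral_indicM _ _ mI0).
have i0 : (0 <= \1_A x :> R)%R by rewrite indicE.
rewrite -(ifunZ (ifun_integral (rho x)) i0 (nnmeasM nB ne)).
have nl : nnmeas (fun s => (\1_I0 s)%:E * F (x, s)).
  apply: nnmeasM; first exact: nnmeas_indic.
  case: nF => h mh; split; first by move=> s; exact: h.
  exact: (measurableT_comp mh (measurable_pair1 x)).
have nr : nnmeas (fun s => (\1_A x)%:E * ((\1_B s)%:E * (expR (- (b * s)))%:E)).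
  by apply: nnmeasM; [apply: nnmeas_cst; rewrite lee_fin|exact: nnmeasM].
apply: ge0_ae_eq_integral; [exact: measurableT|by case: nl|by case: nr|
  by move=> w _; case: nl|by move=> w _; case: nr|].
apply: filterS (ae_pos x) => s s0 _.
have -> : F (x, s) = (\1_(A `*` (B `&` I0)) (x, s))%:E * (expR (- (b * s)))%:E.
  by rewrite /F /jump (max_idPl (ltW s0)) -[b%:E * _]EFinM enexp_EFin.
rewrite -!EFinM; congr EFin.
rewrite !indicE in_setX in_setI I0P s0 andbT /=.
by case: (x \in A); case: (s \in B); rewrite /= ?(mul0r,mul1r,mulr0).
Qed.

End damped_disintegration.

Section cells.
Context (R : realType) (X : completeMetricType R) (rho : R.-ker (borel X) ~> R).

Lemma count_tnth (T : eqType) n (x : n.-tuple T) y :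
  #|[set i | tnth x i == y]%SET| = count_mem y x.
Proof.
rewrite -[in RHS](map_tnth_enum x) count_map -size_filter cardE enumT.
by rewrite /enum_mem; congr size; apply: eq_filter => i; rewrite /= finset.in_set.
Qed.

Lemma cell_size_count n (x : n.-tuple (borel X)) (k : 'I_(ncells x)) :
  cell_size k = count_mem (cell_value k) x.
Proof. exact: count_tnth. Qed.

Lemma jump_intE (b : R) c y (f : R -> \bar R) : levy_mass rho y < +oo ->
  jump_int rho b c y f =
  \int[rho y]_(s in `]0%R, +oo[) (f s * (s ^+ c * expR (- (s * b)))%:E).
Proof.
move=> yfin; rewrite /jump_int (levy_intE _ yfin); apply: eq_integral => s sI.
have s0 : (0 < s)%R by move: (set_mem sI); rewrite /= in_itv/= andbT.
rewrite /cell_weight (max_idPl (ltW s0)).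
by rewrite [(b * s)%R]mulrC.
Qed.

Lemma cell_mass_pos_fin gamma u n (x : n.-tuple (borel X)) y :
  0 < cell_mass rho gamma u x y -> levy_mass rho y < +oo.
Proof.
rewrite /cell_mass /jump_int => h; apply: contrapT => nfin.
by move: h; rewrite levy_int_singular// ltxx.
Qed.

Lemma cell_mass_tau gamma u n (x : n.-tuple (borel X)) (k : 'I_(ncells x)) :
  levy_mass rho (cell_value k) < +oo ->
  cell_mass rho gamma u x (cell_value k) =
  tau rho (cell_size k) (cell_value k) (gamma + u).
Proof.
move=> kfin; rewrite /cell_mass jump_intE// /tau cell_size_count.
by apply: eq_integral => s _; rewrite mul1e.
Qed.

End cells.

Lemma mule_pos_fin_inj (R : realType) (D : \bar R) : 0 < D < +oo ->
  injective (fun z => D * z).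
Proof.
move=> /andP[D0 Doo]; have Df : D \is a fin_num by rewrite ge0_fin_numE// ltW.
apply: (can_inj (g := fun z => ((fine D)^-1)%:E * z)) => z.
rewrite muleA -[X in _ * X * _](fineK Df) -EFinM mulVf ?mul1e//.
by rewrite gt_eqF// fine_gt0// D0.
Qed.

Section posterior_CRM.
Context (R : realType) (X : completeMetricType R).
Local Notation E := (borel X * R)%type.
Hypothesis sepX : separable X.
Variables (eta : probability (borel X) R) (rho : R.-ker (borel X) ~> R)
  (nu : {measure set E -> \bar R}).
Hypothesis rho_pos : forall x : borel X, rho x `]-oo, 0%R]%classic = 0.
Hypothesis nuE : disintegrates nu eta (fun x => rho x).
Hypothesis nu_diffuse : forall x : borel X, nu ([set x] `*` `]0%R, +oo[) = 0.
Context d0 (Om0 : measurableType d0) (P0 : probability Om0 R).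
Variables (mu : {RV P0 >-> MX X}) (N : R.-ker Om0 ~> E).
Hypothesis hN : is_poisson_random_measure P0 N nu.
Hypothesis hmu : {ae P0, forall w, forall A : set (borel X), measurable A ->
  mu w A = \int[N w]_(z in A `*` `]0%R, +oo[) (z.2)%:E}.
Hypothesis mu_fin : {ae P0, forall w, mu w setT < +oo}.
Variables (q gamma : R) (n : nat).
Hypothesis gamma_ge0 : (0 <= gamma)%R.

Let mmu : measurable_fun setT mu. Proof. exact: measurable_funP. Qed.

Lemma measurable_normalize : measurable_fun setT (@normalize R X).
Proof.
apply: (measurable_to_MX sepX) => A mA.
have -> : (fun m : MX X => normalize m A) =
    (fun m => ((total_mass m) `^ (-1))%:E * m A).
  by apply/funext => m; rewrite normalizeE powR_inv1// fine_ge0.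
apply: emeasurable_funM; last exact: measurable_eval.
apply/measurable_EFinP.
exact: (measurableT_comp (measurable_powR _) (@measurable_total_mass R X)).
Qed.

Lemma nu_exponent_fin : exponent nu 1 < +oo.
Proof. exact: (exponent_fin mmu hN hmu mu_fin ler01). Qed.

(** The posterior mass is a product with the masses of the cells as factors. *)
Lemma cells_regular (u : R) (x : n.-tuple (borel X)) : (0 < u)%R ->
  0 < posterior rho mu q gamma (u, x) (fun=> 1) < +oo ->
  forall y, y \in undup x -> 0 < cell_mass rho gamma u x y < +oo.
Proof.
move=> u0 /andP[D0 Doo].
have b0 : (0 <= gamma + u)%R by rewrite addr_ge0// ltW.
have ef : exponent nu (gamma + u) \is a fin_num.
  by rewrite ge0_fin_numE ?exponent_ge0//; exact: exponent_fin mmu hN hmu mu_fin _ b0.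
have e0 : 0 < enexp (exponent nu (gamma + u)) by rewrite enexp_gt0// -ge0_fin_numE// exponent_ge0.
move: D0 Doo; rewrite (posterior_mass sepX rho nu_diffuse hN hmu mu_fin q gamma_ge0 x u0).
set M := \prod_(y <- _) _ => D0 Doo.
have M0 : 0 <= M by apply: prode_ge0 => y _; exact: cell_mass_ge0.
have lp0 : (0 < latent_power q n u)%R.
  rewrite lt_neqAle latent_power_ge0 andbT; apply/eqP => l0.
  by move: D0; rewrite -l0 mul0e ltxx.
apply: prode_pos_fin; first by move=> y; exact: cell_mass_ge0.
rewrite -/M !ltNge; apply/andP; split; apply/negP => h.
  have h0 : M = 0 by apply/eqP; rewrite eq_le h M0.
  by move: D0; rewrite h0 !mule0 ltxx.
have h0 : M = +oo by apply/eqP; rewrite -leye_eq.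
by move: Doo; rewrite h0 gt0_muley// gt0_muley ?ltxx// lte_fin.
Qed.

(** The random measure is the sum of a tilted copy of [mu] and of independent
    atoms at the observed values, the jump at [y] following the normalised
    [jump_int]. The normalising constants multiply to the posterior mass by
    [posterior_mass], so [posterior_eval] identifies the law of the normalised
    sum. *)
Lemma posterior_CRM (u : R) (x : n.-tuple (borel X)) (Q : set (MX X) -> \bar R) :
  (0 < u)%R -> 0 < posterior rho mu q gamma (u, x) (fun=> 1) < +oo ->
  (forall A, measurable A -> posterior rho mu q gamma (u, x) (fun=> 1) * Q A =
    posterior rho mu q gamma (u, x) (fun m => (\1_A (normalize m))%:E)) ->
  normalized_posterior_CRM eta rho gamma u x Q.
Proof.
move=> u0 /andP[D0 Doo] QE.
pose b := (gamma + u)%R; have b0 : (0 <= b)%R by rewrite addr_ge0// ltW.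
pose ys := undup x; pose cm y := cell_mass rho gamma u x y.
have ef : exponent nu b \is a fin_num.
  by rewrite ge0_fin_numE ?exponent_ge0//; exact: exponent_fin mmu hN hmu mu_fin _ b0.
have cmP y : y \in ys -> 0 < cm y < +oo by move=> yys; apply: (cells_regular u0 _ yys); rewrite D0.
have cm0 y : 0 <= cm y by exact: cell_mass_ge0.
have cmf y : y \in ys -> cm y \is a fin_num.
  by move=> yys; have /andP[h0 h] := cmP _ yys; rewrite ge0_fin_numE// ltW.
pose c (y : borel X) : R := (fine (cm y))^-1%R.
have c0 y : 0 <= (c y)%:E by rewrite lee_fin invr_ge0 fine_ge0.
have ccm y : y \in ys -> (c y)%:E * cm y = 1.
  move=> yys; rewrite -(fineK (cmf _ yys)) -EFinM mulVf// gt_eqF// fine_gt0//.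
  exact: cmP.
pose Kj (y : borel X) := jump_int rho b (count_mem y x) y.
have hKj y : tonelli_functional (Kj y) by exact: jump_int_tonelli.
pose K (y : borel X) (f : R -> \bar R) := (c y)%:E * Kj y f.
have hK y : tonelli_functional (K y) by exact: (tonelli_scale (hKj y) (c0 y)).
have K1 y : y \in ys -> K y (fun=> 1) = 1 by move=> yys; exact: ccm.
have prodK G : nnmeas G -> prod_fun K ys G = (\prod_(y <- ys) (c y)%:E) * prod_fun Kj ys G.
  by move=> nG; exact: (prod_fun_scale hKj (fun y => c0 y) nG).
have pccm : (\prod_(y <- ys) (c y)%:E) * \prod_(y <- ys) cm y = 1.
  rewrite -big_split /= big_seq big1// => y yys; exact: ccm.
have [P' [nuu [P'E hN' hmu' nuuE]]] := tilted_CRM mmu hN hmu mu_fin b0.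
have [P1 P1E] := adjoin_jumps P' hK K1.
have mfstmu : measurable_fun setT (fun p : Om0 * (size ys).-tuple R => mu p.1).
  exact: (measurableT_comp mmu measurable_fst).
have [muu muuE] := random_variable_of P1 mfstmu.
have mmus : measurable_fun setT
    (fun p : Om0 * (size ys).-tuple R => add_atoms (mu p.1) ys p.2).
  exact: (measurable_add_atoms sepX mfstmu measurable_snd).
have [mus musE] := random_variable_of P1 mmus.
have mmax : measurable_fun setT (fun t : R => Num.max t 0%R) by exact: measurable_maxr.
have mJ (k : 'I_(size ys)) : measurable_fun setT
    (fun p : Om0 * (size ys).-tuple R => Num.max (tnth p.2 k) 0%R).
  apply: (measurableT_comp mmax).
  exact: (measurableT_comp (measurable_tnth k) measurable_snd).
have /choice[J JE] := fun k => random_variable_of P1 (mJ k).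
exists _, _, P1, mus, mus, muu, J, nuu; split; [|split; [split|split]].
- move=> A mA; have nA : nnmeas (fun m : MX X => (\1_A (normalize m))%:E : \bar R).
    exact: (nnmeas_comp (nnmeas_indic R mA) measurable_normalize).
  pose F (m : MX X) : \bar R := (\1_A (normalize m))%:E.
  have mNA : measurable [set p | A (normalize (mus p))].
    have := measurableT_comp measurable_normalize mmus.
    by move=> /(_ measurableT _ mA); rewrite setTI musE.
  have P1A : P1 [set p | A (normalize (mus p))] =
      \int[P']_w prod_fun K ys (fun s => F (add_atoms (mu w) ys s)).
    rewrite -integral_indicT// -(P1E (fun p => F (add_atoms (mu p.1) ys p.2))); last first.
      exact: (nnmeas_comp nA mmus).
    by apply: eq_integral => p _; rewrite /F !indicE -[p \in _]/(normalize (mus p) \in A) musE.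
  have nG : nnmeas (fun p : Om0 * (size ys).-tuple R => F (add_atoms (mu p.1) ys p.2)).
    exact: (nnmeas_comp nA mmus).
  have nGw w : nnmeas (fun s : (size ys).-tuple R => F (add_atoms (mu w) ys s)).
    by case: nG => h mh; split; [move=> s; exact: (h (w, s))|exact: (measurableT_comp mh (measurable_pair1 w))].
  have nI := (prod_fun_tonelli hKj ys).2 _ Om0 _ nG.
  have nIK := (prod_fun_tonelli hK ys).2 _ Om0 _ nG.
  have nd : nnmeas (fun w => enexp (b%:E * mu w setT)).
    apply: (nnmeas_mu mmu (F := fun m : MX X => enexp (b%:E * m setT))).
    apply: nnmeas_enexp; apply: measurable_funeM; exact: measurable_eval.
  have pc0 : 0 <= \prod_(y <- ys) (c y)%:E by apply: prode_ge0.
  have PE : P1 [set p | A (normalize (mus p))] = expeR (exponent nu b) *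
      ((\prod_(y <- ys) (c y)%:E) * \int[P0]_w (enexp (b%:E * mu w setT) *
        prod_fun Kj ys (fun s => F (add_atoms (mu w) ys s)))).
    rewrite P1A P'E//; congr (_ * _); rewrite [RHS]muleC -(ifunZr (ifun_integral P0) pc0); last exact: nnmeasM.
    by apply: eq_integral => w _; rewrite prodK// [RHS]muleC -muleA; congr (_ * _); rewrite muleC.
  apply: (@mule_pos_fin_inj _ (posterior rho mu q gamma (u, x) (fun=> 1))); first by rewrite D0.
  rewrite QE// PE (posterior_eval sepX rho nu_diffuse hN hmu mu_fin q gamma_ge0 x u0 nA).
  rewrite (posterior_mass sepX rho nu_diffuse hN hmu mu_fin q gamma_ge0 x u0).
  rewrite -/b -/ys -/cm -/Kj -muleA; congr (_ * _).
  set I := \int[P0]_w _; rewrite muleACA [enexp _ * _]muleC expeR_enexp// mul1e.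
  by rewrite muleA [X in X * _]muleC pccm mul1e.
- exact: (atoms_CRM mmu hN' hmu' hK K1 P1E musE).
- by [].
- apply: aeW => p A mA; rewrite musE muuE add_atomsE ?size_tuple//.
  rewrite (sum_zip_tnth p.2 (fun y s => (\1_A y)%:E * @jump R X (y, s))).
  by congr (_ + _); apply: eq_bigr => k _; rewrite JE muleC diracE indicE.
- exact: (damped_disintegration nuE rho_pos nu_exponent_fin nuuE).
- exact: (base_intensity hN' hmu' hK K1 P1E muuE).
- move=> k B mB; have kys : cell_value k \in ys by exact: (mem_tnth k (in_tuple ys)).
  have [ck0 ckoo] := andP (cmP _ kys).
  have lfin := cell_mass_pos_fin ck0.
  pose f (t : R) : \bar R := (\1_B (Num.max t 0%R))%:E.
  have nf : nnmeas f by exact: (nnmeas_comp (nnmeas_indic R mB) mmax).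
  have -> : P1 (J k @^-1` B) = K (cell_value k) f.
    rewrite -(integral_jump hK K1 P1E k nf) -integral_indicT; last first.
      by rewrite -[X in measurable X]setTI; exact: measurable_funP.
    by apply: eq_integral => p _; rewrite /f !indicE -[p \in _]/(J k p \in B) JE.
  have dE : \int[rho (cell_value k)]_(s in `]0%R, +oo[)
     (s ^+ cell_size k * expR (- (s * (gamma + u))))%:E = cm (cell_value k).
    by rewrite /cm cell_mass_tau.
  rewrite /jump_law dE /K muleC; congr (_ * _); last first.
    by rewrite -[in RHS](fineK (cmf _ kys)) inver gt_eqF// fine_gt0// ck0 ckoo.
  rewrite /Kj (jump_intE _ _ _ lfin) cell_size_count.
  have mI0 : measurable (`]0%R, +oo[%classic : set R) by exact: measurable_itv.
  have mBI : measurable (B `&` `]0%R, +oo[) by exact: measurableI.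
  rewrite -(integral_indicM _ _ mI0) -(integral_indicM _ _ mBI); apply: eq_integral => s _.
  rewrite indicI /= EFinM muleA; congr (_ * _).
  rewrite /f -EFinM mulrC; congr EFin; case: (ltP 0%R s) => // s0.
  have -> : \1_(`]0%R, +oo[%classic : set R) s = 0%R :> R.
    by rewrite indicE memNset//= in_itv/= ltNge s0.
  by rewrite !mulr0.
- exact: (jumps_independent mmu hK K1 P1E muuE JE).
Qed.

End posterior_CRM.

(** * Conditional laws *)

Section latent_density.
Context (R : realType) (X : completeMetricType R).
Local Notation E := (borel X * R)%type.
Hypothesis sepX : separable X.
Variables (eta : probability (borel X) R) (rho : R.-ker (borel X) ~> R)
  (nu : {measure set E -> \bar R}).
Hypothesis rho_pos : forall x : borel X, rho x `]-oo, 0%R]%classic = 0.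
Hypothesis nuE : disintegrates nu eta (fun x => rho x).
Hypothesis nu_diffuse : forall x : borel X, nu ([set x] `*` `]0%R, +oo[) = 0.
Context d0 (Om0 : measurableType d0) (P0 : probability Om0 R).
Variables (mu : {RV P0 >-> MX X}) (N : R.-ker Om0 ~> E).
Hypothesis hN : is_poisson_random_measure P0 N nu.
Hypothesis hmu : {ae P0, forall w, forall A : set (borel X), measurable A ->
  mu w A = \int[N w]_(z in A `*` `]0%R, +oo[) (z.2)%:E}.
Hypothesis mu_total : {ae P0, forall w, 0 < mu w setT < +oo}.
Variables (q gamma : R) (n : nat).
Hypothesis gamma_ge0 : (0 <= gamma)%R.
Context d (Om : measurableType d) (P : probability Om R).
Variables (mut : {RV P >-> MX X}) (Xs : {RV P >-> n.-tuple (borel X)})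
  (U : {RV P >-> R}).
Hypothesis mut_tilted : is_tilted mu (fun x => expR (- (gamma * x)) * x `^ (- q))%R mut.
Hypothesis XsU : augmented_sample P mut Xs U (n%:R + q).
Hypothesis U_gt0 : {ae P, forall w, (0 < U w)%R}.
Local Notation S := (R * n.-tuple (borel X))%type.

Let mmu : measurable_fun setT mu. Proof. exact: measurable_funP. Qed.

Let mu_fin : {ae P0, forall w, mu w setT < +oo}.
Proof. by apply: filterS mu_total => w /andP[]. Qed.

Let nu_fin : exponent nu 1 < +oo.
Proof. exact: nu_exponent_fin hN hmu mu_fin. Qed.

(** Disintegration of the Laplace exponent. *)
Lemma exponent_psi (b : R) : (0 <= b)%R -> exponent nu b = psi eta rho 0 b.
Proof.
move=> b0; pose F (z : E) := 1 - enexp (b%:E * jump z).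
have nF : nnmeas F.
  apply: nnmeas_1enexp; apply: nnmeasM; last exact: nnmeas_jump.
  by apply: nnmeas_cst; rewrite lee_fin.
have F0 (z : E) : (z.2 <= 0)%R -> F z = 0.
  by move=> z0; rewrite /F /jump (max_idPr z0) mule0 enexp0 subee.
pose g (s : R) : \bar R := ((1 - expR (- (b * s))) * expR (- (0 * s)))%:E.
have mI0 : measurable (`]0%R, +oo[%classic : set R) by exact: measurable_itv.
have FE x (s : R) : (\1_(`]0%R, +oo[%classic : set R) s)%:E * F (x, s) =
    (\1_(`]0%R, +oo[%classic : set R) s)%:E * g s.
  have [s0|s0] := ltP 0%R s; last first.
    by rewrite indicE memNset ?mul0e//= in_itv/= ltNge s0.
  rewrite /F /g /jump (max_idPl (ltW s0)) -[b%:E * _]EFinM enexp_EFin.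
  by rewrite mul0r oppr0 expR0 mulr1.
have ng : nnmeas (fun s => (\1_(`]0%R, +oo[%classic : set R) s)%:E * g s).
  under eq_fun do rewrite -(FE point).
  apply: nnmeasM; first exact: nnmeas_indic.
  by apply: (nnmeas_comp nF); exact: measurable_pair1.
rewrite /exponent /psi -/F (levy_disintegration nuE nu_fin nF F0).
pose T x := \int[rho x]_(s in `]0%R, +oo[) g s.
have nT : nnmeas T.
  rewrite (_ : T = fun x => \int[rho x]_s ((\1_(`]0%R, +oo[%classic : set R) s)%:E * g s)).
    split; first by move=> x; apply: integral_ge0 => s _; case: ng.
    apply: measurable_fun_integral_kernel; [|by case: ng|by case: ng].
    by move=> V mV; exact: measurable_kernel.
  by apply/funext => x; rewrite integral_indicM.
have nl : nnmeas (fun x => levy_int rho x (fun s => F (x, s))).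
  exact: (@levy_int_joint _ _ _ rho _ _ id).
apply: (@ge0_ae_eq_integral _ _ _ eta setT _ T); [exact: measurableT|by case: nl|by case: nT|
  by move=> w _; case: nl|by move=> w _; case: nT|].
apply: filterS (levy_mass_fin nuE nu_fin) => x xfin _.
rewrite levy_intE// /T -!(integral_indicM _ _ mI0).
by apply: eq_integral => s _; exact: FE.
Qed.

Lemma posterior_latent (u : R) (x : n.-tuple (borel X)) : (0 < u)%R ->
  (forall k : 'I_(ncells x), levy_mass rho (cell_value k) < +oo) ->
  posterior rho mu q gamma (u, x) (fun=> 1) = latent_kernel eta rho gamma q x u.
Proof.
move=> u0 xfin.
rewrite (posterior_mass sepX rho nu_diffuse hN hmu mu_fin q gamma_ge0 x u0).
rewrite /latent_kernel muleC /latent_power u0; congr (_ * _ * _).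
  by rewrite exponent_psi// addr_ge0// ltW.
rewrite big_tnth; apply: eq_bigr => k _; exact: cell_mass_tau.
Qed.

Local Notation M := (MX X).

(** Bayes' rule is applied twice to [joint_law]: to the normalised measure
    given the latent variable and the sample and, once the measure is
    integrated out, to the latent variable given the sample. The set of sample
    values at which some jump has no proper law is negligible, because the
    posterior mass is almost surely positive and finite. *)
Lemma conditional_laws :
  (exists K : R.-pker S ~> M,
     is_cond_law P (fun w => (U w, Xs w)) (fun w => normalize (mut w)) K /\
     {ae P, forall w, normalized_posterior_CRM eta rho gamma (U w) (Xs w) (K (U w, Xs w))}) /\
  (exists kappa : R.-pker (n.-tuple (borel X)) ~> R,
     is_cond_law P Xs U kappa /\
     {ae P, forall w, forall B : set R, measurable B ->
        kappa (Xs w) B = \int[lebesgue_measure]_(u in B `&` `]0%R, +oo[)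
          latent_density eta rho gamma q (Xs w) u}).
Proof.
have [k [lam [k0 lamoo jointE]]] := joint_law sepX nuE hN hmu mu_total mut_tilted XsU.
have mmut : measurable_fun setT mut by exact: measurable_funP.
have mXs : measurable_fun setT Xs by exact: measurable_funP.
have mU : measurable_fun setT U by exact: measurable_funP.
have mZ : measurable_fun setT (fun w => (U w, Xs w)) by exact: measurable_fun_pair.
have mnorm := measurable_normalize sepX.
pose post := posterior rho mu q gamma (n := n).
have hpost z : integral_functional (post z) by exact: (posterior_ifun sepX).
have l1 : \int[lam]_x (1%R : R)%:E < +oo by rewrite integral_cst// mul1e.
have swap (f : S -> \bar R) : nnmeas f -> nnmeas (fun u => \int[lam]_x f (u, x)) /\
    \int[leb R]_u \int[lam]_x f (u, x) = \int[lam]_x \int[leb R]_u f (u, x).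
  move=> [f0 mf].
  have nG : nnmeas (fun p : n.-tuple (borel X) * R => f (p.2, p.1)).
    split => //; apply: (measurableT_comp mf); exact: measurable_fun_pair.
  have [h1 h2] := @ifun_fubini R _ _ _ _ _ (fun=> 1%R) (leb R) _ (ifun_integral lam)
    (fun=> ltr01) (measurable_cst _) l1 nG.
  by split.
pose Lam (f : S -> \bar R) := k * \int[leb R]_u \int[lam]_x f (u, x).
have hLam : integral_functional Lam.
  apply: (ifunC _ k0).
  apply: (@ifun_bind R _ _ _ S (fun f : R -> \bar R => \int[leb R]_u f u)
    (fun u F => \int[lam]_x F (u, x)) (ifun_integral (leb R))).
    by move=> u; apply: (ifun_comp (ifun_integral lam)); exact: measurable_pair1.
  by move=> F /swap[[]].
have npost (F : S * M -> \bar R) : nnmeas F ->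
    nnmeas (fun z : S => post z (fun m => F (z, normalize m))).
  move=> nF; apply: (posterior_joint sepX rho mu q gamma (F := fun p => F (p.1, normalize p.2))).
  apply: (nnmeas_comp nF); apply: measurable_fun_pair; first exact: measurable_fst.
  exact: (measurableT_comp mnorm measurable_snd).
have joint1 (F : S * M -> \bar R) : nnmeas F ->
    \int[P]_w F ((U w, Xs w), normalize (mut w)) =
    Lam (fun z => post z (fun m => F (z, normalize m))).
  move=> nF; apply: (jointE (fun p => F (p.1, normalize p.2))).
  apply: (nnmeas_comp nF); apply: measurable_fun_pair; first exact: measurable_fst.
  exact: (measurableT_comp mnorm measurable_snd).
pose G1 (z : S) (F : M -> \bar R) := post z (fun m => F (normalize m)).
have hG1 z : integral_functional (G1 z) by exact: (ifun_comp (hpost z) mnorm).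
have mnmut : measurable_fun setT (fun w => normalize (mut w)).
  exact: (measurableT_comp mnorm mmut).
have mass1 := normalising_mass mZ hLam hG1 npost joint1.
have regular : {ae P, forall w, forall y, y \in undup (Xs w) -> levy_mass rho y < +oo}.
  apply: filterS2 mass1 U_gt0 => w h u0 y yX.
  have /andP[c0 _] := cells_regular sepX nu_diffuse hN hmu mu_fin gamma_ge0 u0 h yX.
  exact: cell_mass_pos_fin c0.
split.
  have [K [Kcond KE]] := bayes mZ mnmut hLam hG1 npost joint1.
  exists K; split => //; apply: filterS2 mass1 U_gt0 => w h u0.
  apply: (posterior_CRM sepX rho_pos nuE nu_diffuse hN hmu mu_fin gamma_ge0 u0 h).
  move=> A mA; have /andP[_ hoo] := h.
  by have := KE _ hoo _ (nnmeas_indic R mA); rewrite integral_indicT.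
pose G2 (x : n.-tuple (borel X)) (f : R -> \bar R) :=
  \int[leb R]_u (f u * post (u, x) (fun=> 1)).
have nmass : nnmeas (fun z : S => post z (fun=> 1)).
  by apply: (npost (fun=> 1)); exact: nnmeas_cst.
have nmassx x : nnmeas (fun u => post (u, x) (fun=> 1)).
  by apply: (nnmeas_comp nmass); exact: measurable_pair2.
have hG2 x : integral_functional (G2 x).
  exact: (ifun_density (ifun_integral (leb R)) (nmassx x)).
pose Lam2 (f : n.-tuple (borel X) -> \bar R) := k * \int[lam]_x f x.
have hLam2 : integral_functional Lam2 by exact: (ifunC (ifun_integral lam) k0).
have nF2 (F : n.-tuple (borel X) * R -> \bar R) : nnmeas F ->
    nnmeas (fun z : S => F (z.2, z.1) * post z (fun=> 1)).
  move=> nF; apply: nnmeasM => //; apply: (nnmeas_comp nF).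
  exact: measurable_fun_pair.
have mG2 (F : n.-tuple (borel X) * R -> \bar R) : nnmeas F ->
    nnmeas (fun x => G2 x (fun u => F (x, u))).
  move=> /nF2[h mh]; split; first by move=> x; apply: integral_ge0 => u _; exact: (h (u, x)).
  have mh' : measurable_fun setT (fun p : n.-tuple (borel X) * R =>
      F (p.1, p.2) * post (p.2, p.1) (fun=> 1)).
    have ms : measurable_fun setT (fun p : n.-tuple (borel X) * R => (p.2, p.1)).
      exact: measurable_fun_pair.
    exact: (measurableT_comp mh ms).
  exact: (@measurable_fun_fubini_tonelli_F _ _ _ _ _ (leb R) _ mh' (fun p => h (p.2, p.1))).
have joint2 (F : n.-tuple (borel X) * R -> \bar R) : nnmeas F ->
    \int[P]_w F (Xs w, U w) = Lam2 (fun x => G2 x (fun u => F (x, u))).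
  move=> nF; have nF' : nnmeas (fun p : S * M => F (p.1.2, p.1.1)).
    apply: (nnmeas_comp nF); apply: measurable_fun_pair.
      exact: (measurableT_comp measurable_snd measurable_fst).
    exact: (measurableT_comp measurable_fst measurable_fst).
  rewrite (jointE _ nF') /Lam2 -(swap _ (nF2 _ nF)).2; congr (k * _).
  apply: eq_integral => u _; apply: eq_integral => x _ /=.
  rewrite [RHS]muleC -(ifunZr (hpost _)); [|by case: nF|exact: nnmeas_cst].
  by congr (posterior _ _ _ _ _ _); apply/funext => m; rewrite mul1e.
have [kappa [kcond kE]] := bayes mXs mU hLam2 hG2 mG2 joint2.
exists kappa; split => //.
have mass2 := normalising_mass mXs hLam2 hG2 mG2 joint2.
apply: filterS2 mass2 regular => w h reg B mB; have /andP[h0 hoo] := h.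
set x := Xs w in h h0 hoo reg *.
have mI0 : measurable (`]0%R, +oo[%classic : set R) by exact: measurable_itv.
pose LK := latent_kernel eta rho gamma q x.
have LKE u : (\1_(`]0%R, +oo[%classic : set R) u)%:E * LK u = post (u, x) (fun=> 1).
  have [u0|u0] := ltP 0%R u.
    rewrite indicE mem_set ?mul1e/=; last by rewrite in_itv/= u0.
    rewrite /LK /post posterior_latent// => c; apply: reg; exact: (mem_tnth c (in_tuple _)).
  rewrite indicE memNset/= ?mul0e; last by rewrite in_itv/= ltNge u0.
  by rewrite /post /posterior /latent_power ltNge u0 mul0e.
have nB := nnmeas_indic R mB.
have D2E : G2 x (fun=> 1) = \int[lebesgue_measure]_(v in `]0%R, +oo[) LK v.
  rewrite -(integral_indicM lebesgue_measure LK mI0).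
  under [RHS]eq_integral do rewrite LKE.
  by rewrite (lebE (nmassx x)); apply: eq_integral => u _; rewrite mul1e.
apply: (@mule_pos_fin_inj _ (G2 x (fun=> 1))) => //=.
rewrite -[kappa x B]integral_indicT// (kE _ hoo _ nB).
have mBI : measurable (B `&` `]0%R, +oo[) by exact: measurableI.
rewrite -(integral_indicM lebesgue_measure _ mBI) /latent_density -/LK -D2E.
set D := G2 x (fun=> 1).
have DE u : (\1_(B `&` `]0%R, +oo[) u)%:E * (LK u / D) =
    (\1_B u)%:E * post (u, x) (fun=> 1) * D^-1.
  by rewrite -LKE muleA !muleA -EFinM indicI.
under [in RHS]eq_integral do rewrite DE.
have nBm := nnmeasM nB (nmassx x).
have nBD : nnmeas (fun u => (\1_B u)%:E * post (u, x) (fun=> 1) * D^-1).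
  by apply: nnmeasM => //; apply: nnmeas_cst; rewrite inve_ge0 ltW.
rewrite (lebE nBD) (ifunZr (ifun_integral (leb R)) _ nBm); last by rewrite inve_ge0 ltW.
have Df : D \is a fin_num by rewrite ge0_fin_numE// ltW.
rewrite [RHS]muleCA muleA -(fineK Df) inver gt_eqF; last by rewrite fine_gt0// h0 hoo.
rewrite -muleA -EFinM divff ?mule1//.
by rewrite gt_eqF// fine_gt0// h0 hoo.
Qed.

End latent_density.

Theorem theorem3p2 (R : realType) (X : completeMetricType R)
  (sepX : separable X)
  (eta : probability (borel X) R)
  (eta_nonatomic : forall x : borel X, eta [set x] = 0)
  (rho : R.-sigmafker (borel X) ~> R)
  (rho_pos : forall x : borel X, rho x `]-oo, 0%R]%classic = 0)
  (nu : {measure set (borel X * R) -> \bar R})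
  (nuE : disintegrates nu eta (fun x => rho x))
  (nu_int : forall (A : set (borel X)) (s : R),
     measurable A -> metric_bounded A -> (0 < s)%R ->
     \int[nu]_(z in A `*` `]0%R, +oo[) (Num.min z.2 s)%:E < +oo)
  (nu_diffuse : forall x : borel X, nu ([set x] `*` `]0%R, +oo[) = 0)
  (d0 : measure_display) (Om0 : measurableType d0) (P0 : probability Om0 R)
  (mu : {RV P0 >-> MX X})
  (mu_crm : is_CRM_with_intensity mu nu)
  (mu_total : {ae P0, forall w, 0 < mu w setT < +oo})
  (q gamma : R) (q_ge0 : (0 <= q)%R) (gamma_ge0 : (0 <= gamma)%R)
  (h : R -> R)
  (hE : h = fun x => (expR (- (gamma * x)) * x `^ (- q))%R)
  (h_int : 'E_P0[fun w => h (total_mass (mu w))] < +oo)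
  (d : measure_display) (Om : measurableType d) (P : probability Om R)
  (mut : {RV P >-> MX X})
  (mut_tilted : is_tilted mu h mut)
  (n : nat) (n_gt0 : (0 < n)%N)
  (Xs : {RV P >-> n.-tuple (borel X)})
  (Xs_iid : cond_iid P (fun w => normalize (mut w))
              (fun w => normalize (mut w)) Xs)
  (U : {RV P >-> R})
  (U_gt0 : {ae P, forall w, (0 < U w)%R})
  (XsU : augmented_sample P mut Xs U (n%:R + q)) :
  (exists K : R.-pker (R * n.-tuple (borel X))%type ~> MX X,
     is_cond_law P (fun w => (U w, Xs w)) (fun w => normalize (mut w)) K /\
     {ae P, forall w,
        normalized_posterior_CRM eta rho gamma (U w) (Xs w)
          (K (U w, Xs w))}) /\
  (exists kappa : R.-pker (n.-tuple (borel X)) ~> R,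
     is_cond_law P Xs U kappa /\
     {ae P, forall w, forall B : set R, measurable B ->
        kappa (Xs w) B =
        \int[lebesgue_measure]_(u in B `&` `]0%R, +oo[)
          latent_density eta rho gamma q (Xs w) u}).
Proof.
have [N [hN hmu]] := mu_crm; subst h.
exact: (conditional_laws sepX rho_pos nuE nu_diffuse hN hmu mu_total gamma_ge0
  mut_tilted XsU U_gt0).
Qed.
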